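(* Let $\Gamma$ be a weighted plumbing graph with set of vertices $V$, arrowheads $H$, edges $E$, genus function $g$ and Euler number function $\varepsilon$, and let $(M,L)$ be the associated oriented graph manifold $M$ with link $L$ of $r=|H|\ge 0$ components. Fix a maximal tree $T$ of $\Gamma$ and the orders described in the context. Then $\pi_1(M\setminus L)$ has a presentation with generators (G1) $\gamma_v$ for $v\in V$; (G2) $\gamma_h$ for $h\in H$; (G3) $\gamma_e$ for $e\in E^*$; (G4) $\alpha_{j,v},\beta_{j,v}$ for $1\le j\le g(v)$ and $v\in V$; and relations (R1) $\displaystyle\Big(\prod_{\vec e\in E_v}\gamma_{\vec e}\cdot\gamma_{v_2(e)}\cdot\gamma_{\vec e}^{-1}\Big)\cdot\Big(\prod_{h\in H_v}\gamma_h\Big)\cdot\gamma_v^{\varepsilon(v)}=\prod_{j=1}^{g(v)}[\alpha_{j,v},\beta_{j,v}]$ for $v\in V$; (R2) $[\gamma_h,\gamma_{v_h}]=1$ for $h\in H$; (R3) $[\gamma_{v_1(e)},\gamma_{\vec e}\cdot\gamma_{v_2(e)}\cdot\gamma_{\vec e}^{-1}]=1$ for $e\in E^*$; (R4) $[\gamma_v,\alpha_{j,v}]=[\gamma_v,\beta_{j,v}]=1$ for $1\le j\le g(v)$ and $v\in V$. As a consequence, this group admits a presentation with as many generators as relations. If $r>0$, one of the relations in (R2) can be omitted.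
   Context: Plumbing graph: $\Gamma$ is a finite connected graph without loops (an edge never joins a vertex to itself; multiple edges are allowed). Its set of nodes is a disjoint union $V\sqcup H$ with $V\ne\emptyset$; elements of $V$ are called vertices, and elements of $H$, called arrowheads, have degree 1. The set of edges is a disjoint union $E\sqcup F$: elements of $E$ (edges) connect two vertices, elements of $F$ (arrows) connect an arrowhead with a vertex; so $r:=|H|=|F|\ge0$. For $h\in H$, $v_h\in V$ is the unique vertex connected with $h$. For $v\in V$, $H_v$ is the set of arrowheads connected with $v$. For $v\neq w$ in $V$, $E_{v,w}$ is the set of edges connecting $v$ and $w$. The vertices are weighted by two functions $g,\varepsilon:V\to\mathbb{Z}$, with $g(v)\ge0$ (genus) and $\varepsilon(v)$ (Euler number). Graph manifold: $\Gamma$ encodes $(M,L)$ by plumbing (W. Neumann). To each $v\in V$ one associates the oriented $\mathbb{S}^1$-bundle with Euler number $\varepsilon(v)$ over the closed oriented surface of genus $g(v)$; each edge joining $v$ and $w$ represents the gluing of the two corresponding bundles after removing from each of them a solid torus neighborhood of a fiber (trivialized as disk times circle), identifying the boundary tori by interchanging sections and fibers. The resulting closed oriented 3-manifold is $M$. Each arrowhead $h$ represents a fiber of the bundle of $v_h$ (distinct fibers for distinct arrowheads, away from the gluing regions), and $L$ is the union of these $r$ fibers. Choices: $T$ is a maximal tree of $\Gamma$, with a directed rooted tree structure directed away from the root, which is extended to a total order on $V$. Each $H_v$ is linearly ordered, and $H$ is ordered so that $h<h'$ if $h\in H_v$, $h'\in H_w$ and $v<w$. Each $E_{v,w}$ is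 linearly ordered so that its minimal element is the edge of $T$ in $E_{v,w}$ if there is one. $E_v$ is the set of edges of $E$ having $v$ as an endpoint, each oriented so as to start at $v$, ordered as follows: for $e\in E_{v,w}$ and $e'\in E_{v,w'}$, $e<e'$ iff $w<w'$, or $w=w'$ and $e<e'$ in $E_{v,w}$. $E^*$ is the set of edges of $E$ not in $T$. Products over $E_v$ and $H_v$ are taken respecting these orders. Notation: for an edge $e\in E$ with an orientation $\vec e$ starting at $v_1(e)$ and ending at $v_2(e)$, $\gamma_{\vec e}:=1$ if $e\in T$; $\gamma_{\vec e}:=\gamma_e$ if $e\notin T$ and $v_1(e)<v_2(e)$; $\gamma_{\vec e}:=\gamma_e^{-1}$ if $e\notin T$ and $v_2(e)<v_1(e)$. In (R4) the two commutator relations count separately. *)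

(* Defs.v *)
From HB Require Import structures.
From Stdlib Require Import Relation_Operators Operators_Properties.
From mathcomp Require Import all_boot all_order all_algebra.
From mathcomp Require Import all_classical all_reals all_analysis.
From mathcomp Require Import ring lra.
Import numFieldNormedType.Exports.
Import Order.TTheory GRing.Theory Num.Theory.

Set Implicit Arguments.
Unset Strict Implicit.
Unset Printing Implicit Defensive.

Local Open Scope classical_set_scope.
Local Open Scope ring_scope.
Local Open Scope quotient_scope.

Section FreeGroup.
Variable X : choiceType.

(* The letter (x, true) stands for x, and (x, false) for its inverse. *)
Local Notation word := (seq (X * bool)).

Definition inv_word (w : word) : word := rev [seq (a.1, ~~ a.2) | a <- w].

Inductive word_step : word -> word -> Prop :=
| WordCancel (u v : word) x b :
    word_step (u ++ (x, b) :: (x, ~~ b) :: v) (u ++ v).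

Definition word_equiv (u v : word) : bool :=
  `[< clos_refl_sym_trans _ word_step u v >].

Lemma word_equiv_refl : reflexive word_equiv.
Proof. by move=> u; apply/asboolP; exact: rst_refl. Qed.

Lemma word_equiv_sym : symmetric word_equiv.
Proof. by move=> u v; apply/asboolP/asboolP; exact: rst_sym. Qed.

Lemma word_equiv_trans : transitive word_equiv.
Proof.
by move=> v u w /asboolP uv /asboolP vw; apply/asboolP; exact: rst_trans vw.
Qed.

Canonical word_equivR :=
  EquivRel word_equiv word_equiv_refl word_equiv_sym word_equiv_trans.

Lemma word_equiv_map (f : word -> word) :
  (forall u v, word_step u v -> word_equiv (f u) (f v)) ->
  forall u v, word_equiv u v -> word_equiv (f u) (f v).
Proof.
move=> fP u v /asboolP; elim=> {u v}[u v /fP //|u|u v _|u v w _ uv _ vw].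
- exact: word_equiv_refl.
- by rewrite word_equiv_sym.
- exact: word_equiv_trans vw.
Qed.

Lemma word_step_equiv u v : word_step u v -> word_equiv u v.
Proof. by move=> uv; apply/asboolP; exact: rst_step. Qed.

Lemma word_equiv_cat u u' v v' :
  word_equiv u u' -> word_equiv v v' -> word_equiv (u ++ v) (u' ++ v').
Proof.
move=> uu' vv'; apply: (@word_equiv_trans (u' ++ v)).
  apply: (@word_equiv_map (fun w => w ++ v)) uu' => _ _ [w1 w2 x b].
  by rewrite -!catA; apply: word_step_equiv; constructor.
apply: (@word_equiv_map (fun w => u' ++ w)) vv' => _ _ [w1 w2 x b].
by rewrite !catA; apply: word_step_equiv; constructor.
Qed.

Lemma word_equiv_inv u v :
  word_equiv u v -> word_equiv (inv_word u) (inv_word v).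
Proof.
apply: word_equiv_map => _ _ [w1 w2 x b].
rewrite /inv_word !map_cat !rev_cat /= !rev_cons -!cats1 -!catA /= negbK.
by apply: word_step_equiv; constructor.
Qed.

Lemma inv_wordK : involutive inv_word.
Proof.
move=> w; rewrite /inv_word map_rev revK -map_comp map_id_in //.
by case=> x b _ /=; rewrite negbK.
Qed.

Lemma word_equivV u : word_equiv (inv_word u ++ u) [::].
Proof.
elim: u => [|[x b] u IHu]; first exact: word_equiv_refl.
apply: word_equiv_trans IHu.
rewrite {1}/inv_word /= rev_cons -/(inv_word u) cat_rcons.
by apply: word_step_equiv; rewrite -{2}(negbK b); constructor.
Qed.

Definition free_group : Type := {eq_quot word_equiv}.
HB.instance Definition _ := EqQuotient.on free_group.
HB.instance Definition _ := Choice.on free_group.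

Definition fg_gen (x : X) : free_group := \pi_free_group [:: (x, true)].
Definition fg_one : free_group := \pi_free_group [::].
Definition fg_mul (a b : free_group) : free_group :=
  \pi_free_group (repr a ++ repr b).
Definition fg_inv (a : free_group) : free_group :=
  \pi_free_group (inv_word (repr a)).

Lemma fg_mulE u v :
  fg_mul (\pi_free_group u) (\pi_free_group v) = \pi_free_group (u ++ v).
Proof.
apply/eqmodP; apply: word_equiv_cat; apply/eqmodP; exact: reprK.
Qed.

Lemma fg_invE u : fg_inv (\pi_free_group u) = \pi_free_group (inv_word u).
Proof. by apply/eqmodP; apply: word_equiv_inv; apply/eqmodP; exact: reprK. Qed.

Lemma fg_mulA : associative fg_mul.
Proof.
move=> a b c; rewrite -[a]reprK -[b]reprK -[c]reprK.
move: (repr a) (repr b) (repr c) => u v w.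
by rewrite (fg_mulE v w) (fg_mulE u v) !fg_mulE catA.
Qed.

Lemma fg_mul1g : left_id fg_one fg_mul.
Proof. by move=> a; rewrite -[a]reprK fg_mulE. Qed.

Lemma fg_mulg1 : right_id fg_one fg_mul.
Proof. by move=> a; rewrite -[a]reprK fg_mulE cats0. Qed.

Lemma fg_mulVg : left_inverse fg_one fg_inv fg_mul.
Proof.
by move=> a; rewrite -[a]reprK fg_invE fg_mulE; apply/eqmodP; exact: word_equivV.
Qed.

Lemma fg_mulgV : right_inverse fg_one fg_inv fg_mul.
Proof.
move=> a; rewrite -[a]reprK fg_invE fg_mulE; apply/eqmodP.
by rewrite -{1}(inv_wordK (repr a)); exact: word_equivV.
Qed.

HB.instance Definition _ := isGroup.Build free_group
  fg_mulA fg_mul1g fg_mulg1 fg_mulVg fg_mulgV.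

End FreeGroup.

Section Presentation.
Local Open Scope group_scope.

Definition normal_subgroup (F : groupType) (N : set F) : Prop :=
  [/\ N 1, forall x y, N x -> N y -> N (x * y), forall x, N x -> N x^-1
    & forall x y, N x -> N (x ^ y)].

Definition normal_closure (F : groupType) (A : set F) : set F :=
  \bigcap_(N in [set N | normal_subgroup N /\ A `<=` N]) N.

(* The pair (l, r) stands for the relation l = r, i.e. for the relator l / r. *)
Definition relation_of (X : choiceType) : Type :=
  (free_group X * free_group X)%type.

Definition has_presentation (G : groupType) (X : choiceType) (I : Type)
    (rel : I -> relation_of X) : Prop :=
  exists f : {multiplicative free_group X -> G},
    (forall y : G, exists x, f x = y) /\
    (forall x, f x = 1 <->
       normal_closure (range (fun i => (rel i).1 / (rel i).2)) x).

Definition expgz (G : groupType) (x : G) (m : int) : G :=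
  match m with Posz n => x ^+ n | Negz n => x ^- n.+1 end.

End Presentation.

Section Continuity.
Variables (R : realType) (Z : topologicalType).
Implicit Types f g : Z -> R.

Lemma ctsD f g :
  continuous f -> continuous g -> continuous (fun z => f z + g z).
Proof. by move=> cf cg z; apply: continuousD; [exact: cf|exact: cg]. Qed.

Lemma ctsB f g :
  continuous f -> continuous g -> continuous (fun z => f z - g z).
Proof. by move=> cf cg z; apply: continuousB; [exact: cf|exact: cg]. Qed.

Lemma ctsM f g :
  continuous f -> continuous g -> continuous (fun z => f z * g z).
Proof. by move=> cf cg z; apply: continuousM; [exact: cf|exact: cg]. Qed.

Lemma cts_min f g :
  continuous f -> continuous g -> continuous (fun z => Num.min (f z) (g z)).
Proof. by move=> cf cg z; apply: continuous_min; [exact: cf|exact: cg]. Qed.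

Lemma cts_max f g :
  continuous f -> continuous g -> continuous (fun z => Num.max (f z) (g z)).
Proof. by move=> cf cg z; apply: continuous_max; [exact: cf|exact: cg]. Qed.

Lemma cts_comp (X Y : topologicalType) (f : Z -> X) (g : X -> Y) :
  continuous f -> continuous g -> continuous (fun z => g (f z)).
Proof. by move=> cf cg z; apply: continuous_comp; [exact: cf|exact: cg]. Qed.

Lemma cts_cst (Y : topologicalType) (y : Y) : continuous (fun _ : Z => y).
Proof. by move=> z; exact: cvg_cst. Qed.

Lemma cts_pair (X Y : topologicalType) (f : Z -> X) (g : Z -> Y) :
  continuous f -> continuous g -> continuous (fun z => (f z, g z)).
Proof. by move=> cf cg z; apply: cvg_pair; [exact: cf|exact: cg]. Qed.

Lemma cts_paste (X : topologicalType) (a : Z -> R) (c : R) (f g : Z -> X) :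
  continuous a -> continuous f -> continuous g ->
  (forall z, a z = c -> f z = g z) ->
  continuous (fun z => if a z <= c then f z else g z).
Proof.
move=> ca cf cg fg z U /= nU; rewrite /nbhs /=.
case: (ltgtP (a z) c) nU => [az|az|az] nU.
- have na : \forall y \near z, a y < c by exact: (cvgr_lt _ (ca z)).
  have nf := cf z _ nU; rewrite /nbhs /= in nf.
  by apply: filterS2 na nf => y /ltW /= ->.
- have na : \forall y \near z, c < a y by exact: (cvgr_gt _ (ca z)).
  have ng := cg z _ nU; rewrite /nbhs /= in ng.
  by apply: filterS2 na ng => y /= yc; rewrite leNgt yc.
- have nf := cf z _ nU; rewrite /nbhs /= in nf.
  rewrite fg // in nU.
  have ng := cg z _ nU; rewrite /nbhs /= in ng.
  by apply: filterS2 nf ng => y /=; case: ifP.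
Qed.

Lemma cts_within (X Y : topologicalType) (A : set X) (f : X -> Y)
    (c : Z -> X) :
  {within A, continuous f} -> continuous c -> (forall z, A (c z)) ->
  continuous (fun z => f (c z)).
Proof.
move=> /subspace_continuousP cf cc Ac z U nU.
have := cf _ (Ac z) U nU; rewrite /nbhs /= /within /= => nf.
have := cc z _ nf; rewrite /nbhs /=; apply: filterS => y /=; exact.
Qed.

End Continuity.

Ltac cts_step :=
  lazymatch goal with
  | |- forall _, continuous_at _ ?f =>
    lazymatch eval cbv beta in f with
    | fun _ => _ - _ => apply: ctsB
    | fun _ => _ + _ => apply: ctsD
    | fun _ => _ * _ => apply: ctsM
    | fun _ => Num.min _ _ => apply: cts_min
    | fun _ => Num.max _ _ => apply: cts_max
    | fun z => z => (move=> ?; exact: cvg_id)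
    | idfun => (move=> ?; exact: cvg_id)
    | GRing.mul ?c => apply: (@ctsM _ _ (fun=> c) idfun)
    | fst => (move=> ?; exact: cvg_fst)
    | snd => (move=> ?; exact: cvg_snd)
    | fun z => z.1 => (move=> ?; exact: cvg_fst)
    | fun z => z.2 => (move=> ?; exact: cvg_snd)
    | fun _ => ?c => exact: cts_cst
    end
  end.

Ltac cts := repeat cts_step.

Section FundamentalGroup.
Variables (R : realType) (X : topologicalType) (x0 : X).

Record loop := Loop {
  loop_fun :> R -> X;
  loop_cts : {within `[0, 1], continuous loop_fun};
  loop_0 : loop_fun 0 = x0;
  loop_1 : loop_fun 1 = x0 }.

HB.instance Definition _ := gen_eqMixin loop.
HB.instance Definition _ := gen_choiceMixin loop.

Definition homotopic (f g : loop) : Prop :=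
  exists H : R * R -> X,
    [/\ {within `[0, 1] `*` `[0, 1], continuous H},
        forall t : R, 0 <= t <= 1 -> H (0, t) = f t,
        forall t : R, 0 <= t <= 1 -> H (1, t) = g t
      & forall s : R, 0 <= s <= 1 -> H (s, 0) = x0 /\ H (s, 1) = x0].

Definition clamp (t : R) : R := Num.max 0 (Num.min t 1).

Lemma clamp_cts : continuous clamp.
Proof. by rewrite /clamp; cts. Qed.

Lemma clamp_id t : 0 <= t <= 1 -> clamp t = t.
Proof. by rewrite /clamp; case/andP=> t0 t1; rewrite (min_l t1) (max_r t0). Qed.

Lemma clamp01 t : 0 <= clamp t <= 1.
Proof. by rewrite /clamp le_max lexx /= ge_max ler01 ge_min lexx orbT. Qed.

Lemma clamp_le0 t : t <= 0 -> clamp t = 0.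
Proof.
by move=> t0; rewrite /clamp max_l // ge_min t0.
Qed.

Lemma clamp_ge1 t : 1 <= t -> clamp t = 1.
Proof. by move=> t1; rewrite /clamp (min_r t1) max_r. Qed.

Definition ext (f : R -> X) (t : R) : X := f (clamp t).

Lemma ext_cts (f : loop) : continuous (ext f).
Proof.
apply: (cts_within (@loop_cts f)) clamp_cts _ => z.
by rewrite /= in_itv /= clamp01.
Qed.

Lemma ext_id f t : 0 <= t <= 1 -> ext f t = f t.
Proof. by move=> t01; rewrite /ext clamp_id. Qed.

Lemma ext_le0 (f : loop) t : t <= 0 -> ext f t = x0.
Proof. by move=> t0; rewrite /ext clamp_le0 // loop_0. Qed.

Lemma ext_ge1 (f : loop) t : 1 <= t -> ext f t = x0.
Proof. by move=> t1; rewrite /ext clamp_ge1 // loop_1. Qed.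

Lemma homotopic_cts (f g : loop) (H : R * R -> X) :
  continuous H ->
  (forall t : R, 0 <= t <= 1 -> H (0, t) = f t) ->
  (forall t : R, 0 <= t <= 1 -> H (1, t) = g t) ->
  (forall s : R, 0 <= s <= 1 -> H (s, 0) = x0 /\ H (s, 1) = x0) ->
  homotopic f g.
Proof. by move=> cH *; exists H; split=> //; exact: continuous_subspaceT. Qed.

Lemma homotopicP (f g : loop) : homotopic f g ->
  exists H : R * R -> X,
    [/\ continuous H,
        forall t : R, 0 <= t <= 1 -> H (0, t) = f t,
        forall t : R, 0 <= t <= 1 -> H (1, t) = g t
      & forall s t : R, t <= 0 \/ 1 <= t -> H (s, t) = x0].
Proof.
move=> [H [cH H0 H1 Hx]]; exists (fun z => H (clamp z.1, clamp z.2)); split.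
- apply: (cts_within (c := fun z => (clamp z.1, clamp z.2)) cH).
    by apply: cts_pair; [apply: (@cts_comp _ _ _ (fst : R * R -> R) clamp)
      |apply: (@cts_comp _ _ _ (snd : R * R -> R) clamp)];
      (exact: clamp_cts || cts).
  by move=> z; split; rewrite /= in_itv /= clamp01.
- by move=> t t01 /=; rewrite clamp_le0 // clamp_id ?H0.
- by move=> t t01 /=; rewrite clamp_ge1 // clamp_id ?H1.
- move=> s t /= [t0|t1].
    by rewrite (clamp_le0 t0); case: (Hx _ (clamp01 s)).
  by rewrite (clamp_ge1 t1); case: (Hx _ (clamp01 s)).
Qed.

Lemma homotopic_reparam (h f g : loop) (phi psi : R -> R) :
  continuous phi -> continuous psi ->
  (forall t : R, 0 <= t <= 1 -> f t = ext h (phi t)) ->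
  (forall t : R, 0 <= t <= 1 -> g t = ext h (psi t)) ->
  phi 0 = psi 0 -> phi 1 = psi 1 ->
  homotopic f g.
Proof.
move=> cphi cpsi fE gE e0 e1.
apply: (homotopic_cts (H := fun z => ext h ((1 - z.1) * phi z.2 + z.1 * psi z.2))).
- apply: (cts_comp _ (@ext_cts h)).
  cts.
  + by apply: (@cts_comp _ _ _ (snd : R * R -> R) phi) => //; cts.
  + by apply: (@cts_comp _ _ _ (snd : R * R -> R) psi) => //; cts.
- by move=> t t01 /=; rewrite fE // subr0 mul1r mul0r addr0.
- by move=> t t01 /=; rewrite gE // subrr mul1r mul0r add0r.
- move=> s _ /=; rewrite -e0 -e1 -!mulrDl subrK !mul1r -!fE ?lexx ?ler01 //.
  by rewrite loop_0 loop_1.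
Qed.

Lemma homotopic_refl f : homotopic f f.
Proof.
by apply: (@homotopic_reparam f _ _ idfun idfun) => //; (try by cts);
  move=> t t01 /=; rewrite ext_id.
Qed.

Lemma homotopic_sym f g : homotopic f g -> homotopic g f.
Proof.
move=> /homotopicP[H [cH H0 H1 Hx]].
apply: (homotopic_cts (H := fun z => H (1 - z.1, z.2))).
- by apply: (cts_comp _ cH); apply: cts_pair; cts.
- by move=> t t01 /=; rewrite subr0 H1.
- by move=> t t01 /=; rewrite subrr H0.
- by move=> s _ /=; rewrite !Hx; auto.
Qed.

Lemma homotopic_trans f g h : homotopic f g -> homotopic g h -> homotopic f h.
Proof.
move=> /homotopicP[H [cH H0 H1 Hx]] /homotopicP[K [cK K0 K1 Kx]].
apply: (homotopic_cts (H := fun z =>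
  if z.1 <= 2^-1 then H (2 * z.1, clamp z.2) else K (2 * z.1 - 1, clamp z.2))).
- apply: cts_paste; first by cts.
  + by apply: (cts_comp _ cH); apply: cts_pair; [|apply: (cts_comp _ clamp_cts)]; cts.
  + by apply: (cts_comp _ cK); apply: cts_pair; [|apply: (cts_comp _ clamp_cts)]; cts.
  + move=> z ->; rewrite divff ?pnatr_eq0 // subrr.
    by rewrite H1 ?K0 ?clamp01.
- by move=> t t01 /=; rewrite ifT ?invr_ge0 // mulr0 clamp_id ?H0.
- move=> t t01 /=; rewrite ifF; last by apply/negbTE; rewrite -ltNge invf_lt1 // ltr1n.
  by rewrite mulr1 (_ : 2 - 1 = 1) ?clamp_id ?K1 //; ring.
- move=> s _ /=; rewrite clamp_le0 // clamp_ge1 //.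
  by case: ifP => _; rewrite ?Hx ?Kx; auto.
Qed.

Definition homotopicb (f g : loop) : bool := `[< homotopic f g >].

Lemma homotopicb_refl : reflexive homotopicb.
Proof. by move=> f; apply/asboolP; exact: homotopic_refl. Qed.

Lemma homotopicb_sym : symmetric homotopicb.
Proof. by move=> f g; apply/asboolP/asboolP; exact: homotopic_sym. Qed.

Lemma homotopicb_trans : transitive homotopicb.
Proof.
by move=> g f h /asboolP fg /asboolP gh; apply/asboolP; exact: homotopic_trans gh.
Qed.

Canonical homotopicR :=
  EquivRel homotopicb homotopicb_refl homotopicb_sym homotopicb_trans.

Definition const_loop : loop :=
  @Loop (fun _ => x0) (continuous_subspaceT (@cts_cst R X x0)) erefl erefl.

Definition inv_fun (f : R -> X) (t : R) : X := f (1 - t).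

Lemma inv_fun_cts (f : loop) : {within `[0, 1], continuous (inv_fun f)}.
Proof.
refine (@subspace_eq_continuous _ _ _ (fun t : R => ext f (1 - t)) _ _ _).
  move=> t; rewrite inE /= in_itv /= => /andP[t0 t1].
  by rewrite ext_id // subr_ge0 t1 gerBl.
apply: continuous_subspaceT; apply: (cts_comp _ (@ext_cts f)); cts.
Qed.

Lemma inv_fun0 (f : loop) : inv_fun f 0 = x0.
Proof. by rewrite /inv_fun subr0 loop_1. Qed.

Lemma inv_fun1 (f : loop) : inv_fun f 1 = x0.
Proof. by rewrite /inv_fun subrr loop_0. Qed.

Definition inv_loop (f : loop) : loop :=
  Loop (@inv_fun_cts f) (inv_fun0 f) (inv_fun1 f).

Definition cat_fun (f g : R -> X) (t : R) : X :=
  if t <= 2^-1 then f (2 * t) else g (2 * t - 1).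

Lemma half_le1 : (2^-1 <= 1 :> R) /\ (1 <= 2^-1 :> R) = false.
Proof. by split; [lra|apply/negbTE; lra]. Qed.

Lemma cat_funE f g t : 0 <= t <= 1 ->
  cat_fun f g t = cat_fun (ext f) (ext g) t.
Proof.
move=> t01; rewrite /cat_fun.
by case: (leP t 2^-1) => th; rewrite ext_id //; lra.
Qed.

Lemma ext_cat_cts (f g : loop) : continuous (cat_fun (ext f) (ext g)).
Proof.
apply: cts_paste; first by cts.
- by apply: (cts_comp _ (@ext_cts f)); cts.
- by apply: (cts_comp _ (@ext_cts g)); cts.
- by move=> t ->; rewrite ext_ge1 ?ext_le0 //; lra.
Qed.

Lemma cat_fun_cts (f g : loop) : {within `[0, 1], continuous (cat_fun f g)}.
Proof.
refine (@subspace_eq_continuous _ _ _ (cat_fun (ext f) (ext g)) _ _ _).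
  by move=> t; rewrite inE /= in_itv /= => t01; rewrite -cat_funE.
exact: continuous_subspaceT (@ext_cat_cts f g).
Qed.

Lemma cat_fun0 (f g : loop) : cat_fun f g 0 = x0.
Proof. by rewrite /cat_fun ifT ?invr_ge0 // mulr0 loop_0. Qed.

Lemma cat_fun1 (f g : loop) : cat_fun f g 1 = x0.
Proof.
rewrite /cat_fun ifF ?(proj2 half_le1) // mulr1.
by rewrite (_ : 2 - 1 = 1) ?loop_1 //; ring.
Qed.

Definition cat_loop (f g : loop) : loop :=
  Loop (@cat_fun_cts f g) (cat_fun0 f g) (cat_fun1 f g).

Lemma cat_loop_homotopic f f' g g' :
  homotopic f f' -> homotopic g g' ->
  homotopic (cat_loop f g) (cat_loop f' g').
Proof.
move=> /homotopicP[H [cH H0 H1 Hx]] /homotopicP[K [cK K0 K1 Kx]].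
apply: (homotopic_cts (H := fun z =>
  if z.2 <= 2^-1 then H (z.1, 2 * z.2) else K (z.1, 2 * z.2 - 1))).
- apply: cts_paste; first by cts.
  + by apply: (cts_comp _ cH); apply: cts_pair; cts.
  + by apply: (cts_comp _ cK); apply: cts_pair; cts.
  + by move=> z ->; rewrite Hx ?Kx //; [left|right]; lra.
- move=> t t01 /=; rewrite /cat_fun.
  by case: (leP t 2^-1) => th; rewrite (H0, K0) //; lra.
- move=> t t01 /=; rewrite /cat_fun.
  by case: (leP t 2^-1) => th; rewrite (H1, K1) //; lra.
- move=> s _ /=; rewrite (proj2 half_le1) ifT ?invr_ge0 //.
  by rewrite Hx ?Kx //; [right|left]; lra.
Qed.

Lemma inv_loop_homotopic f g :
  homotopic f g -> homotopic (inv_loop f) (inv_loop g).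
Proof.
move=> /homotopicP[H [cH H0 H1 Hx]].
apply: (homotopic_cts (H := fun z => H (z.1, 1 - z.2))).
- by apply: (cts_comp _ cH); apply: cts_pair; cts.
- by move=> t t01 /=; rewrite H0 //; lra.
- by move=> t t01 /=; rewrite H1 //; lra.
- by move=> s _ /=; rewrite !Hx //; [left|right]; lra.
Qed.

(* Each group law compares two reparametrizations of one loop. *)
Lemma cat_loopA f g h :
  homotopic (cat_loop f (cat_loop g h)) (cat_loop (cat_loop f g) h).
Proof.
apply: (@homotopic_reparam (cat_loop f (cat_loop g h)) _ _ idfun
  (fun t => Num.min (2 * t) (Num.min (t + 4^-1) (2^-1 * t + 2^-1)))).
- by cts.
- by cts.
- by move=> t t01 /=; rewrite ext_id.
- move=> t /andP[t0 t1] /=; rewrite /cat_fun.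
  case: (leP t 2^-1) => th; first case: (leP (2 * t) 2^-1) => th'.
  + rewrite (@min_l _ _ (2 * t)); last by rewrite le_min; lra.
    by rewrite ext_id /cat_fun ?th' //; lra.
  + rewrite (@min_l _ _ (t + 4^-1)); last by lra.
    rewrite (@min_r _ _ (2 * t)); last by lra.
    rewrite ext_id; last by lra.
    rewrite /= /cat_fun ifF; last by lra.
    rewrite ifT; last by lra.
    by congr (g _); lra.
  + rewrite (@min_r _ _ (t + 4^-1)); last by lra.
    rewrite (@min_r _ _ (2 * t)); last by lra.
    rewrite ext_id; last by lra.
    rewrite /= /cat_fun ifF; last by lra.
    rewrite ifF; last by lra.
    by congr (h _); lra.
- by rewrite /= mulr0 min_l // le_min; lra.
- rewrite /= (@min_r _ _ (1 + 4^-1)); last by lra.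
  by rewrite min_r; lra.
Qed.

Lemma cat_loop1f f : homotopic (cat_loop const_loop f) f.
Proof.
apply: (@homotopic_reparam f _ _ (fun t => 2 * t - 1 + Num.max 0 (1 - 2 * t)) idfun).
- by cts.
- by cts.
- move=> t t01 /=; rewrite /cat_fun.
  case: (leP t 2^-1) => th.
    by rewrite (@max_r _ _ 0) ?ext_le0 //; lra.
  rewrite (@max_l _ _ 0); last by lra.
  by rewrite addr0 ext_id //; lra.
- by move=> t t01 /=; rewrite ext_id.
- by rewrite /= max_r; lra.
- by rewrite /= max_l; lra.
Qed.

Lemma cat_loopf1 f : homotopic (cat_loop f const_loop) f.
Proof.
apply: (@homotopic_reparam f _ _ (fun t => Num.min (2 * t) 1) idfun).
- by cts.
- by cts.
- move=> t t01 /=; rewrite /cat_fun.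
  case: (leP t 2^-1) => th.
    by rewrite min_l ?ext_id //; lra.
  by rewrite min_r ?ext_ge1 //; lra.
- by move=> t t01 /=; rewrite ext_id.
- by rewrite /= min_l; lra.
- by rewrite /= min_r; lra.
Qed.

Lemma cat_loopfV f : homotopic (cat_loop f (inv_loop f)) const_loop.
Proof.
apply: (@homotopic_reparam f _ _ (fun t => Num.min (2 * t) (2 - 2 * t)) (fun=> 0)).
- by cts.
- by cts.
- move=> t t01 /=; rewrite /cat_fun.
  case: (leP t 2^-1) => th.
    by rewrite min_l ?ext_id //; lra.
  rewrite min_r; last by lra.
  by rewrite ext_id /inv_fun; [congr (f _)|]; lra.
- by move=> t t01 /=; rewrite ext_le0.
- by rewrite /= min_l; lra.
- by rewrite /= min_r; lra.
Qed.

Lemma inv_loopK f : homotopic (inv_loop (inv_loop f)) f.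
Proof.
apply: (@homotopic_reparam f _ _ idfun idfun) => //; try by cts.
- move=> t t01 /=; rewrite /inv_fun /= /inv_fun ext_id //.
  by congr (f _); ring.
- by move=> t t01 /=; rewrite ext_id.
Qed.

Lemma cat_loopVf f : homotopic (cat_loop (inv_loop f) f) const_loop.
Proof.
apply: homotopic_trans (@cat_loopfV (inv_loop f)).
apply: cat_loop_homotopic; first exact: homotopic_refl.
exact: homotopic_sym (@inv_loopK f).
Qed.

Definition pi1 : Type := {eq_quot homotopicb}.
HB.instance Definition _ := EqQuotient.on pi1.
HB.instance Definition _ := Choice.on pi1.

Definition pi1_one : pi1 := \pi_pi1 const_loop.
Definition pi1_mul (a b : pi1) : pi1 := \pi_pi1 (cat_loop (repr a) (repr b)).
Definition pi1_inv (a : pi1) : pi1 := \pi_pi1 (inv_loop (repr a)).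

Lemma pi1_eqP f g : \pi_pi1 f = \pi_pi1 g <-> homotopic f g.
Proof. by split=> [/eqmodP/asboolP//|fg]; apply/eqmodP/asboolP. Qed.

Lemma pi1_mulE f g : pi1_mul (\pi_pi1 f) (\pi_pi1 g) = \pi_pi1 (cat_loop f g).
Proof.
by apply/pi1_eqP; apply: cat_loop_homotopic; apply/pi1_eqP; exact: reprK.
Qed.

Lemma pi1_invE f : pi1_inv (\pi_pi1 f) = \pi_pi1 (inv_loop f).
Proof.
by apply/pi1_eqP; apply: inv_loop_homotopic; apply/pi1_eqP; exact: reprK.
Qed.

Lemma pi1_mulA : associative pi1_mul.
Proof.
move=> a b c; rewrite -[a]reprK -[b]reprK -[c]reprK.
move: (repr a) (repr b) (repr c) => f g h.
rewrite (pi1_mulE g h) (pi1_mulE f g) !pi1_mulE.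
by apply/pi1_eqP; exact: cat_loopA.
Qed.

Lemma pi1_mul1g : left_id pi1_one pi1_mul.
Proof.
move=> a; rewrite -[a]reprK pi1_mulE; apply/pi1_eqP; exact: cat_loop1f.
Qed.

Lemma pi1_mulg1 : right_id pi1_one pi1_mul.
Proof.
move=> a; rewrite -[a]reprK pi1_mulE; apply/pi1_eqP; exact: cat_loopf1.
Qed.

Lemma pi1_mulVg : left_inverse pi1_one pi1_inv pi1_mul.
Proof.
move=> a; rewrite -[a]reprK pi1_invE pi1_mulE.
by apply/pi1_eqP; exact: cat_loopVf.
Qed.

Lemma pi1_mulgV : right_inverse pi1_one pi1_inv pi1_mul.
Proof.
move=> a; rewrite -[a]reprK pi1_invE pi1_mulE.
by apply/pi1_eqP; exact: cat_loopfV.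
Qed.

HB.instance Definition _ := isGroup.Build pi1
  pi1_mulA pi1_mul1g pi1_mulg1 pi1_mulVg pi1_mulgV.

End FundamentalGroup.

(* An arrow is the same thing as its arrowhead: arrowhead h is joined to
   [att h]. The edges in [edge] join vertices only; [src] and [tgt] list the
   two ends of an edge in an arbitrary, insignificant order. *)
Record plumbing_graph := PlumbingGraph {
  vertex : finType;
  arrowhead : finType;
  edge : finType;
  att : arrowhead -> vertex;
  src : edge -> vertex;
  tgt : edge -> vertex;
  genus : vertex -> nat;
  euler : vertex -> int;
  vertex_nonempty : (0 < #|vertex|)%N;
  edge_loopless : forall e, src e != tgt e;
  graph_connected : forall v w,
    connect (fun a b => [exists e, ((src e == a) && (tgt e == b)) ||
                                   ((src e == b) && (tgt e == a))]) v w
}.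

Section Darts.
Variable G : plumbing_graph.

(* An oriented edge: (e, true) runs from [src e] to [tgt e], and (e, false)
   backwards. *)
Definition dart : finType := (edge G * bool)%type.
Definition d_start (d : dart) : vertex G := if d.2 then src d.1 else tgt d.1.
Definition d_end (d : dart) : vertex G := if d.2 then tgt d.1 else src d.1.
Definition d_rev (d : dart) : dart := (d.1, ~~ d.2).

Definition joins (v w : vertex G) (e : edge G) : bool :=
  ((src e == v) && (tgt e == w)) || ((src e == w) && (tgt e == v)).

Definition tree_adj (T : {set edge G}) (v w : vertex G) : bool :=
  [exists e in T, joins v w e].

Definition acyclic (T : {set edge G}) : Prop :=
  forall c : seq dart, all (fun d => d.1 \in T) c ->
    cycle (fun d d' => d_end d == d_start d') c ->
    uniq (map d_start c) -> uniq (map fst c) -> c = [::].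

Definition maximal_tree (T : {set edge G}) : Prop :=
  (forall v w, connect (tree_adj T) v w) /\ acyclic T.

(* x lies on the path of T from the root to y *)
Definition tree_order (T : {set edge G}) (root x y : vertex G) : Prop :=
  exists p, [/\ path (tree_adj T) root p, uniq (root :: p), last root p = y
              & x \in root :: p].

End Darts.

Definition linear_on (A : eqType) (S : {pred A}) (le : rel A) : Prop :=
  [/\ {in S &, total le}, {in S &, antisymmetric le}
    & {in S & &, transitive le}].

Record plumbing_choices (G : plumbing_graph) := PlumbingChoices {
  tree : {set edge G};
  root : vertex G;
  leV : rel (vertex G);
  leH : rel (arrowhead G);
  leE : rel (edge G);
  tree_maximal : maximal_tree tree;
  leV_linear : linear_on predT leV;
  leV_tree : forall x y, tree_order tree root x y -> leV x y;
  leH_linear : linear_on predT leH;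
  leH_att : forall h h', leV (att h) (att h') -> att h != att h' -> leH h h';
  (* [leE] only compares parallel edges *)
  leE_linear : forall v w, linear_on (joins v w) leE;
  leE_tree : forall v w e e', joins v w e -> joins v w e' -> e \in tree ->
    leE e e'
}.

Section PlumbingPresentation.
Variables (G : plumbing_graph) (c : plumbing_choices G).

Definition cotree_edge : finType := {e : edge G | e \notin tree c}.

Definition handle : finType := {v : vertex G & 'I_(genus v)}.

Definition pgen : finType :=
  (vertex G + arrowhead G + cotree_edge + (handle + handle))%type.

Definition gamma_v (v : vertex G) : free_group pgen :=
  fg_gen (inl (inl (inl v)) : pgen).
Definition gamma_h (h : arrowhead G) : free_group pgen :=
  fg_gen (inl (inl (inr h)) : pgen).
Definition gamma_e (e : cotree_edge) : free_group pgen :=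
  fg_gen (inl (inr e) : pgen).
Definition alpha (v : vertex G) (j : 'I_(genus v)) : free_group pgen :=
  fg_gen (inr (inl (Tagged (fun v => 'I_(genus v)) j)) : pgen).
Definition beta (v : vertex G) (j : 'I_(genus v)) : free_group pgen :=
  fg_gen (inr (inr (Tagged (fun v => 'I_(genus v)) j)) : pgen).

Local Open Scope group_scope.

Definition gamma_d (d : dart G) : free_group pgen :=
  if insub d.1 is Some e then
    if leV c (d_start d) (d_end d) then gamma_e e else (gamma_e e)^-1
  else 1.

Definition le_dart (d d' : dart G) : bool :=
  if d_end d == d_end d' then leE c d.1 d'.1 else leV c (d_end d) (d_end d').

Definition edges_at (v : vertex G) : seq (dart G) :=
  sort le_dart [seq d <- enum (dart G) | d_start d == v].

Definition arrowheads_at (v : vertex G) : seq (arrowhead G) :=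
  sort (leH c) [seq h <- enum (arrowhead G) | att h == v].

Inductive prel_index : Type :=
| RelVertex of vertex G
| RelArrowhead of arrowhead G
| RelEdge of cotree_edge
| RelAlpha of handle
| RelBeta of handle.

(* The library's [~ x, y] is x^-1 y^-1 x y; replacing the alpha and beta by
   their inverses gives the relations for x y x^-1 y^-1. *)
Definition plumbing_rel (i : prel_index) : relation_of pgen :=
  match i with
  | RelVertex v =>
      ((\prod_(d <- edges_at v) (gamma_d d * gamma_v (d_end d) / gamma_d d)) *
         (\prod_(h <- arrowheads_at v) gamma_h h) * expgz (gamma_v v) (euler v),
       \prod_(j < genus v) [~ alpha j, beta j])
  | RelArrowhead h => ([~ gamma_h h, gamma_v (att h)], 1)
  | RelEdge e =>
      let d := (val e, true) in
      ([~ gamma_v (d_start d), gamma_d d * gamma_v (d_end d) / gamma_d d], 1)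
  | RelAlpha k => ([~ gamma_v (tag k), alpha (tagged k)], 1)
  | RelBeta k => ([~ gamma_v (tag k), beta (tagged k)], 1)
  end.

End PlumbingPresentation.

Section GraphManifold.
Variables (R : realType) (G : plumbing_graph).

Local Notation plane := (R * R)%type.

Definition cis (t : R) : plane := (cos t, sin t).
Definition sqnorm (z : plane) : R := z.1 ^+ 2 + z.2 ^+ 2.
Definition unit_circle : set plane := [set z | sqnorm z = 1].
Definition unit_disk : set plane := [set z | sqnorm z <= 1].

(* Inside the unit disk we place disjoint closed disks of radius
   [slot_radius], one for every port: one for each dart, one for each arrowhead,
   and a last one, [None], where the bundle is twisted. The surface of v only
   uses the disks of the darts and arrowheads at v, and of [None]. *)
Definition port : finType := option (dart G + arrowhead G).

Definition slot_radius : R := (2 * #|port|.+1%:R)^-1.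

Definition slot_center (p : port) : plane :=
  (-1 + 2 * (enum_rank p).+1%:R / #|port|.+1%:R, 0).

Definition slot_circle (p : port) (t : R) : plane :=
  ((slot_center p).1 + slot_radius * cos t,
   (slot_center p).2 + slot_radius * sin t).

Definition outside_slot (p : port) (z : plane) : Prop :=
  slot_radius ^+ 2 <= sqnorm (z.1 - (slot_center p).1, z.2 - (slot_center p).2).

Definition perforated_disk (v : vertex G) : set plane :=
  [set z | unit_disk z /\ outside_slot None z /\
           forall d : dart G, d_start d = v -> outside_slot (Some (inl d)) z].

(* The pieces to be glued: for each v, the product [inl v] of the perforated
   disk with the circle, and a solid torus [inr v]. In both, the first factor
   is the base and the second one the fibre. *)
Definition piece (i : vertex G + vertex G) : set (plane * plane) :=
  match i with
  | inl v => perforated_disk v `*` unit_circle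
  | inr _ => unit_disk `*` unit_circle
  end.

Definition pieces : topologicalType :=
  {i : (vertex G + vertex G)%type & piece i}.

Definition place : Type := ((vertex G + vertex G) * (plane * plane))%type.

Definition place_of (p : pieces) : place := (projT1 p, \val (projT2 p)).

(* The point at s in [0, 1] of the k-th side of the 4g-gon into which the
   boundary of the unit disk is subdivided *)
Definition side_point (g k : nat) (s : R) : plane :=
  cis (2 * pi * (k%:R + s) / (4 * g)%:R).

(* - [GluePolygon], [GlueSphere] close the unit disk up to the surface of genus
     g(v): the sides of the 4g-gon spell the product of the [a_i, b_i], and for
     g(v) = 0 the boundary circle is collapsed. The bundle over the complement
     of the disk [None] is the product with the circle.
   - [GlueEuler] fills the fibres over the disk [None]. The section s = 0 over
     the complement runs along the boundary of this disk as the loop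
     t |-> (cis t, cis (euler v * t)) of the solid torus, of degree [euler v]
     in the fibre: this is the obstruction to extending it, so the bundle has
     Euler number [euler v].
   - [GlueEdge] identifies the boundary tori of the two solid tori removed for
     an edge, interchanging base and fibre coordinates.
   With bases and fibres oriented as usual, all identifications are compatible
   with the product orientations of the pieces. *)
Inductive glue : place -> place -> Prop :=
| GluePolygon v (i : 'I_(genus v)) (b : bool) (s : R) z : 0 <= s <= 1 ->
    glue (inl v, (side_point (genus v) (4 * i + b) s, z))
         (inl v, (side_point (genus v) (4 * i + b + 2) (1 - s), z))
| GlueSphere v x y z : genus v = 0%N -> unit_circle x -> unit_circle y ->
    glue (inl v, (x, z)) (inl v, (y, z))
| GlueEuler v t s :
    glue (inl v, (slot_circle None t, cis s))
         (inr v, (cis t, cis (s + (euler v)%:~R * t)))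
| GlueEdge (d : dart G) t s :
    glue (inl (d_start d), (slot_circle (Some (inl d)) t, cis s))
         (inl (d_end d), (slot_circle (Some (inl (d_rev d))) s, cis t)).

Definition glued (p q : pieces) : bool :=
  `[< clos_refl_sym_trans _ (fun p q => glue (place_of p) (place_of q)) p q >].

Lemma glued_refl : reflexive glued.
Proof. by move=> u; apply/asboolP; exact: rst_refl. Qed.

Lemma glued_sym : symmetric glued.
Proof. by move=> u v; apply/asboolP/asboolP; exact: rst_sym. Qed.

Lemma glued_trans : transitive glued.
Proof.
by move=> v u w /asboolP uv /asboolP vw; apply/asboolP; exact: rst_trans vw.
Qed.

Canonical gluedR := EquivRel glued glued_refl glued_sym glued_trans.

Definition graph_manifold : topologicalType :=
  quotient_topology {eq_quot glued}.

(* The arrowhead h represents the fibre over the centre of its disk. *)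
Definition link : set graph_manifold :=
  [set x | exists p h t,
     place_of p = (inl (att h), (slot_center (Some (inr h)), cis t)) /\
     x = \pi_{eq_quot glued} p].

Definition link_complement : topologicalType := set_type (~` link).

End GraphManifold.

(* Main.v *)
(* The group presented by generators and relations and the fundamental group are
   compared through families of elements indexed by the vertices, arrowheads,
   oriented edges and handles ([pdata]). Such a family satisfying the relations
   is found in the fundamental groupoid by moving along the real axis of each
   perforated disk: [height v x] is the class of the loop that goes to the
   abscissa x in the lower half of the disk and comes back in the upper half, so
   that crossing the slot of a port multiplies [height] by the class of a loop
   around it, and [height v 1] is read on the polygon.
   Generation: every path is a product of short paths, each contained in a half
   of a perforated disk times the circle, or in a solid torus, and the frames of
   two places that are glued differ by an element of the subgroup.
   Universality: a family in a group Q defines a Q-valued cocycle on nearby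
   points (a flat Q-bundle), and the holonomy of this cocycle is the morphism
   to Q. No van Kampen theorem is needed.
   The order of the ports is then changed by conjugations, and contracting the
   maximal tree turns the family into the generators of the presentation. *)

From HB Require Import structures.
Require Import Defs.
From Stdlib Require Import Relation_Operators Operators_Properties.
From mathcomp Require Import all_boot all_order all_algebra.
From mathcomp Require Import all_classical all_reals all_analysis.
From mathcomp Require Import ring lra zify.
Import numFieldNormedType.Exports.
Import Order.TTheory GRing.Theory Num.Theory.

Set Implicit Arguments.
Unset Strict Implicit.
Unset Printing Implicit Defensive.

Local Open Scope classical_set_scope.
Local Open Scope ring_scope.
Local Open Scope quotient_scope.

(** * Transport along paths *)

(** The obstacle is that the manifold is known only as a quotient of the pieces: a path of it need
    not lift to the pieces, and the points near a given one have representatives of several kinds.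
    Explicit continuous functions that are constant on glued places settle this. They determine the
    glued classes in closed form ([coincide]) and, with the compactness of the pieces, let
    neighbourhoods be tested on representatives. Short paths are taken in polar coordinates around a
    pole adapted to the wall through their origin ([cone]), so that the paths obtained from
    different representatives agree in the quotient. Classes of loops and holonomies obey the same
    axioms ([path_functor]); comparing frames of one kind with frames of the other gives the values
    of the morphism on the generators. The presentation has no commutation relation for the tree
    edges, while the flat bundle needs one at every gluing torus. They are recovered from the leaves
    of the tree up to a chosen vertex. If this is the vertex of an arrowhead, the relation of this
    arrowhead is recovered as well, hence the relation of (R2) that can be omitted. *)

Lemma interval_glue (R : realType) (P : R -> R -> Prop) :
  (forall a b c, a <= b -> b <= c -> P a b -> P b c -> P a c) ->
  (forall t, exists2 e, 0 < e &
     forall a b, t - e < a -> a <= t -> t <= b -> b < t + e -> P a b) ->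
  forall a b, a <= b -> P a b.
Proof.
move=> Pcat Ploc a b ab.
(* Continuous induction: if the supremum of the points reached from [a] were below [b], a step of
   [e / 2] would pass it. *)
pose S := [set x | a <= x <= b /\ P a x].
have Sa : S a.
  split; first by rewrite lexx.
  by have [e e0] := Ploc a; apply=> //; lra.
have hS : has_sup S by split; [exists a | exists b => x [/andP[]]].
have aS : a <= sup S by apply: (ub_le_sup _ Sa); case: hS.
have Sb : sup S <= b by apply: ge_sup; [exists a | move=> x [/andP[]]].
have [e e0 He] := Ploc (sup S).
have [x [/andP[ax xb] Px] xS] := sup_adherent e0 hS.
have xS' : x <= sup S by apply: ub_le_sup; [case: hS | split=> //; rewrite ax].
pose y := Num.min (sup S + e / 2) b.
have [yb Sy ye] : [/\ y <= b, sup S <= y & y < sup S + e].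
  by rewrite /y; case: (leP (sup S + e / 2) b) => H; split; lra.
have Py : P a y by apply: (Pcat _ x) => //; [lra | apply: He].
have yS : y <= sup S.
  by apply: ub_le_sup; [case: hS | split=> //; rewrite yb andbT; lra].
have -> : b = y; last by [].
by move: yS; rewrite /y; case: (leP (sup S + e / 2) b) => H; lra.
Qed.

Section Transport.
Variables (R : realType) (X : topologicalType) (Q : groupType) (c : X -> X -> Q).
Local Open Scope group_scope.

(** [c x] acts as a flat frame around [x]. The neighbourhood in which [z] varies depends on [y], as
    nothing is uniform. *)
Definition germ_cocycle :=
  forall x, \forall y \near x, \forall z \near y, c x z = c x y * c y z.

(** The horizontal lifts of [K] over [A] in the flat bundle that [c] defines. *)
Definition lift_on (Z : topologicalType) (A : set Z) (K : Z -> X) (g : Z -> Q) :=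
  forall p, A p -> \forall q \near p, A q -> g q = g p * c (K p) (K q).

Hypothesis cC : germ_cocycle.

Lemma germ_cocycle1 x : c x x = 1.
Proof.
have /nbhs_singleton/nbhs_singleton := cC x.
by move=> h; apply: (mulgI (c x x)); rewrite -h mulg1.
Qed.

Lemma lift_local_ex (Z : topologicalType) (K : Z -> X) (p : Z) : continuous K ->
  exists2 U, nbhs p U & lift_on U K (fun q => c (K p) (K q)).
Proof.
move=> cK; exists [set q | \forall z \near K q, c (K p) z = c (K p) (K q) * c (K q) z].
  by have := cC (K p); move/(cK p).
by move=> q /= /(cK q); rewrite nbhs_simpl /=; apply: filterS => z /= ->.
Qed.

Lemma lift_sub (Z : topologicalType) (A B : set Z) (K : Z -> X) g :
  A `<=` B -> lift_on B K g -> lift_on A K g.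
Proof.
by move=> AB h p Ap; have := h p (AB _ Ap); apply: filterS => q H /AB.
Qed.

Lemma lift_mul (Z : topologicalType) (A : set Z) (K : Z -> X) g (a : Q) :
  lift_on A K g -> lift_on A K (fun z => a * g z).
Proof.
by move=> h p Ap; have := h p Ap; apply: filterS => q H /H ->; rewrite mulgA.
Qed.

Lemma lift_comp (Z W : topologicalType) (A : set Z) (B : set W) (K : Z -> X) g
    (f : W -> Z) :
  continuous f -> (forall w, B w -> A (f w)) -> lift_on A K g ->
  lift_on B (K \o f) (g \o f).
Proof.
move=> cf BA h p Bp; have /cf := h _ (BA _ Bp); rewrite nbhs_simpl /=.
by apply: filterS => q H /BA.
Qed.

(** The linking path is continuous on the whole line with all its values in [B], so that lifts are
    pulled back to it without subspace topologies. *)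
Definition path_linked (Z : topologicalType) (B : set Z) (o : Z) :=
  forall p, B p -> exists f : R -> Z,
    [/\ continuous f, f 0%R = o, f 1%R = p & forall t, B (f t)].

(** Around each time of the linking path both lifts are their value there times the same factor, so
    an equality spreads to earlier and later times. *)
Lemma lift_uniq (Z : topologicalType) (B : set Z) (K : Z -> X) o g1 g2 :
  path_linked B o -> lift_on B K g1 -> lift_on B K g2 -> g1 o = g2 o ->
  forall p, B p -> g1 p = g2 p.
Proof.
move=> lB h1 h2 e p /lB[f [cf f0 f1 fB]].
suff: g1 (f 0%R) = g2 (f 0%R) -> g1 (f 1%R) = g2 (f 1%R) by rewrite f0 f1; apply.
apply: (@interval_glue _ (fun a b => g1 (f a) = g2 (f a) -> g1 (f b) = g2 (f b)));
  last exact: ler01.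
  by move=> a b d _ _ H1 H2 /H1/H2.
move=> t.
have near_t g : lift_on B K g -> \forall x \near t, g (f x) = g (f t) * c (K (f t)) (K (f x)).
  move=> h; have /cf := h _ (fB t); rewrite nbhs_simpl /=.
  by apply: filterS => x; apply.
have /nbhs_ballP[e' /= e0 He] : \forall x \near t,
    g1 (f x) = g1 (f t) * c (K (f t)) (K (f x)) /\
    g2 (f x) = g2 (f t) * c (K (f t)) (K (f x)).
  by apply: filterS2 (near_t _ h1) (near_t _ h2) => x.
exists e' => // a b ta at' tb bt.
have [Ha1 Ha2] := He a ltac:(rewrite /ball /= ltr_norml; lra).
have [Hb1 Hb2] := He b ltac:(rewrite /ball /= ltr_norml; lra).
by rewrite Ha1 Ha2 Hb1 Hb2 => /mulIg ->.
Qed.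

(** A left translate of [g2] agrees with [g1] at [o], hence on the whole linked intersection.
    Closedness keeps a point of one set alone away from the other set. *)
Lemma lift_glue (Z : topologicalType) (A B : set Z) (K : Z -> X) o g1 g2 :
  closed A -> closed B -> A o -> B o -> path_linked (A `&` B) o ->
  lift_on A K g1 -> lift_on B K g2 -> exists g, lift_on (A `|` B) K g.
Proof.
move=> clA clB Ao Bo lAB h1 h2.
pose g3 z := g1 o * (g2 o)^-1 * g2 z.
have h3 : lift_on B K g3 by exact: lift_mul.
have e p : A p -> B p -> g1 p = g3 p.
  move=> Ap Bp; apply: (lift_uniq lAB _ _ _ (conj Ap Bp)).
  - by apply: (lift_sub _ h1) => ? [].
  - by apply: (lift_sub _ h3) => ? [].
  - by rewrite /g3 mulgVK.
exists (fun p => if `[< A p >] then g1 p else g3 p) => p.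
have gA q : A q -> (if `[< A q >] then g1 q else g3 q) = g1 q.
  by move=> Aq; rewrite asboolT.
have gB q : B q -> (if `[< A q >] then g1 q else g3 q) = g3 q.
  by case: asboolP => // Aq Bq; exact: e.
have notnear (D : set Z) : closed D -> ~ D p -> \forall q \near p, ~ D q.
  by move=> clD nDp; apply: open_nbhs_nbhs; split=> //; exact: closed_openC.
case: (pselect (A p)) => [Ap|nAp] ABp; case: (pselect (B p)) => [Bp|nBp].
- have n1 := h1 p Ap; have n3 := h3 p Bp.
  apply: filterS2 n1 n3 => q H1 H3 [Aq|Bq].
    by rewrite !gA // H1.
  by rewrite !gB // H3.
- have n1 := h1 p Ap; apply: filterS2 n1 (notnear _ clB nBp) => q H1 nB [Aq|//].
  by rewrite !gA // H1.
- have n3 := h3 p Bp; apply: filterS2 n3 (notnear _ clA nAp) => q H3 nA [//|Bq].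
  by rewrite !gB // H3.
- by case: ABp.
Qed.

Lemma path_linked_itv (a b o : R) : (a <= o <= b)%R -> path_linked `[a, b] o.
Proof.
move=> aob p /=; rewrite in_itv /= => apb.
exists (fun t => o + clamp t * (p - o))%R; split.
- cts; first exact: clamp_cts.
- by rewrite clamp_le0 // mul0r addr0.
- by rewrite clamp_ge1 // mul1r addrC subrK.
- move=> t /=; rewrite in_itv /=; have := clamp01 t; nra.
Qed.

Definition rect (a b d e : R) : set (R * R) := `[a, b] `*` `[d, e].

Lemma rect_closed a b d e : closed (rect a b d e).
Proof. have -> : rect a b d e = fst @^-1` `[a, b] `&` snd @^-1` `[d, e].
  by apply/seteqP; split.
by apply: closedI; apply: preimage_closed; try exact: interval_closed;
  move=> z _; [exact: cvg_fst|exact: cvg_snd]. Qed.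

Lemma path_linked_rect a b d e o1 o2 : (a <= o1 <= b)%R -> (d <= o2 <= e)%R ->
  path_linked (rect a b d e) (o1, o2).
Proof.
move=> h1 h2 [p1 p2] [/= H1 H2].
have [f [cf f0 f1 fB]] := path_linked_itv h1 H1.
have [g [cg g0 g1 gB]] := path_linked_itv h2 H2.
exists (fun t => (f t, g t)); split; rewrite ?f0 ?f1 ?g0 ?g1 //.
  by apply: cts_pair.
by move=> t; split; [exact: fB|exact: gB].
Qed.

Lemma lift_square (K : R * R -> X) : continuous K ->
  exists g, lift_on (rect 0 1 0 1) K g.
Proof.
move=> cK.
suff H a b : (a <= b)%R -> exists g, lift_on (rect a b 0 1) K g by exact: H ler01.
apply: (@interval_glue _ (fun a b => exists g, lift_on (rect a b 0 1) K g)).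
  move=> x y z xy yz [g1 h1] [g2 h2].
  have -> : rect x z 0 1 = rect x y 0 1 `|` rect y z 0 1.
    apply/seteqP; split=> -[s t] /=; rewrite /rect /= !in_itv /=.
      by case=> H1 H2; case: (leP s y) => h; [left|right]; split => //; lra.
    by case=> -[H1 H2]; split => //; lra.
  apply: (@lift_glue _ _ _ _ (y, 0%R) _ _ _ _ _ _ _ h1 h2); try exact: rect_closed.
  - by split; rewrite /= in_itv /=; lra.
  - by split; rewrite /= in_itv /=; lra.
  have -> : rect x y 0 1 `&` rect y z 0 1 = rect y y 0 1.
    apply/seteqP; split=> -[s t] /=; rewrite /rect /= !in_itv /=.
      by case=> -[H1 H2] [H3 H4]; split => //; lra.
    by case=> H1 H2; split; split=> //; lra.
  by apply: path_linked_rect; lra.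
move=> s.
(* A strip around [s] of unspecified width: gluing two height intervals takes the minimum of their
   widths, so the induction on the height needs no uniform bound. *)
pose P d e := exists2 u, (0 < u)%R & exists g, lift_on (rect (s - u) (s + u) d e) K g.
suff [u u0 [g hg]] : P 0%R 1%R.
  exists u => // a' b' h1 h2 h3 h4; exists g; apply: lift_sub hg => -[p q].
  by rewrite /rect /= !in_itv /= => -[H1 H2]; split => //; lra.
apply: (interval_glue _ _ ler01); rewrite {}/P.
  move=> x y z xy yz [u1 u10 [g1 h1]] [u2 u20 [g2 h2]].
  pose u := Num.min u1 u2.
  have [uu1 uu2 u0] : [/\ u <= u1, u <= u2 & 0 < u]%R.
    by rewrite /u; case: (leP u1 u2) => h; split => //; lra.
  exists u => //.
  have {h1} h1 : lift_on (rect (s - u) (s + u) x y) K g1.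
    apply: lift_sub h1 => -[p q]; rewrite /rect /= !in_itv /=.
    by case=> H1 H2; split => //; lra.
  have {h2} h2 : lift_on (rect (s - u) (s + u) y z) K g2.
    apply: lift_sub h2 => -[p q]; rewrite /rect /= !in_itv /=.
    by case=> H1 H2; split => //; lra.
  have -> : rect (s - u) (s + u) x z
      = rect (s - u) (s + u) x y `|` rect (s - u) (s + u) y z.
    apply/seteqP; split=> -[p t] /=; rewrite /rect /= !in_itv /=.
      by case=> H1 H2; case: (leP t y) => h; [left|right]; split => //; lra.
    by case=> -[H1 H2]; split => //; lra.
  apply: (@lift_glue _ _ _ _ (s, y) _ _ _ _ _ _ _ h1 h2); try exact: rect_closed.
  - by split; rewrite /= in_itv /=; lra.
  - by split; rewrite /= in_itv /=; lra.
  have -> : rect (s - u) (s + u) x y `&` rect (s - u) (s + u) y z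
      = rect (s - u) (s + u) y y.
    apply/seteqP; split=> -[p t] /=; rewrite /rect /= !in_itv /=.
      by case=> -[H1 H2] [H3 H4]; split => //; lra.
    by case=> H1 H2; split; split=> //; lra.
  by apply: path_linked_rect; lra.
move=> t; have [U /nbhs_ballP[e /= e0 eU] hU] := lift_local_ex (s, t) cK.
exists e => // a' b' ta at' tb bt; exists (e / 2)%R; first lra.
exists (fun q => c (K (s, t)) (K q)).
apply: lift_sub hU => -[p q]; rewrite /rect /= !in_itv /= => -[H1 H2].
by apply: eU; split; rewrite /ball /= ltr_norml; lra.
Qed.

Definition unit_itv : set R := `[0%R, 1%R]%classic.

(** The value 1 is a default for paths without a lift; any lift computes the transport, by
    uniqueness. *)
Definition transport (f : R -> X) : Q :=
  xget 1 [set q | exists g, [/\ lift_on unit_itv f g, g 0%R = 1 & g 1%R = q]].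

Lemma transportE (f : R -> X) g : lift_on unit_itv f g ->
  g 1%R = g 0%R * transport f.
Proof.
move=> hg; have hg' := lift_mul (g 0%R)^-1 hg.
rewrite /transport; case: xgetP => [q _ [k [hk k0 <-]]|/(_ ((g 0%R)^-1 * g 1%R))]; last first.
  by case; exists (fun z => (g 0%R)^-1 * g z); rewrite mulVg.
have l01 : path_linked unit_itv 0%R.
  by apply: path_linked_itv; rewrite lexx ler01.
have := lift_uniq l01 hg' hk; rewrite mulVg k0 => /(_ erefl 1%R).
by rewrite /unit_itv /= in_itv /= lexx ler01 => /(_ isT) <-; rewrite mulVKg.
Qed.

Lemma transport_ext f h : (forall t : R, 0 <= t <= 1 -> f t = h t)%R ->
  transport f = transport h.
Proof.
move=> fh; rewrite /transport; congr (xget _ _); apply/seteqP.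
have half (f1 f2 : R -> X) : (forall t : R, 0 <= t <= 1 -> f1 t = f2 t)%R ->
    forall g, lift_on unit_itv f1 g -> lift_on unit_itv f2 g.
  move=> e g hg p Ap; have := hg p Ap; apply: filterS => q H Aq.
  by rewrite H // !e //; move: Ap Aq; rewrite /unit_itv /= !in_itv.
split=> q [g [hg g0 g1]]; exists g; split=> //; apply: half hg => // t t01.
by rewrite fh.
Qed.

Lemma transport_const x : transport (fun=> x) = 1.
Proof.
have h : lift_on unit_itv (fun=> x : X) (fun=> 1 : Q).
  by move=> p _; apply: (@filterE _ (nbhs p)) => q _; rewrite germ_cocycle1 mulg1.
by have /= := transportE h; rewrite mul1g => <-.
Qed.

(** One lift over the whole square computes the transports along its four sides. This is homotopy
    invariance with moving endpoints. *)
Lemma transport_square (K : R * R -> X) : continuous K ->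
  transport (fun t => K (0%R, t)) * transport (fun s => K (s, 1%R)) =
  transport (fun s => K (s, 0%R)) * transport (fun t => K (1%R, t)).
Proof.
move=> cK; have [g hg] := lift_square cK.
have edge (f : R -> R * R) : continuous f ->
    (forall t, 0 <= t <= 1 -> 0 <= (f t).1 <= 1 /\ 0 <= (f t).2 <= 1)%R ->
    g (f 1%R) = g (f 0%R) * transport (K \o f).
  move=> cf fB; apply: (transportE (g := g \o f)).
  apply: (lift_comp cf _ hg) => t; rewrite /unit_itv /rect /= !in_itv /= => /fB.
  by [].
have e1 := @edge (fun t => (0%R, t)) ltac:(apply: cts_pair; cts)
  ltac:(by move=> t /= t01; split=> //; rewrite lexx ler01).
have e2 := @edge (fun t => (t, 1%R)) ltac:(apply: cts_pair; cts)
  ltac:(by move=> t /= t01; split=> //; rewrite lexx ler01).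
have e3 := @edge (fun t => (t, 0%R)) ltac:(apply: cts_pair; cts)
  ltac:(by move=> t /= t01; split=> //; rewrite lexx ler01).
have e4 := @edge (fun t => (1%R, t)) ltac:(apply: cts_pair; cts)
  ltac:(by move=> t /= t01; split=> //; rewrite lexx ler01).
apply: (mulgI (g (0%R, 0%R))); rewrite !mulgA.
move: e1 e2 e3 e4; rewrite /comp /= => <- <- <- <-.
by [].
Qed.

End Transport.

Definition gsimp (M : groupType) :=
  (@invgM M, @invgK M, @mulgA M, @mulgK M, @mulgVK M, @mulVg M, @mulgV M,
   @mul1g M, @mulg1 M, @invg1 M).

Ltac ctsx := repeat first
  [ cts_step | exact: clamp_cts | apply: cts_pair
  | apply: (cts_comp _ (@clamp_cts _))
  | match goal with H : continuous _ |- _ => first [exact: H | apply: (cts_comp _ H)] end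
  | match goal with H : forall _, continuous _ |- _ =>
      first [exact: H | apply: (cts_comp _ (H _))] end ].

Ltac slra := match goal with
  | |- is_true (_ <= _)%R => lra | |- is_true (_ < _)%R => lra
  | |- is_true (_ && _) => lra | |- @eq bool _ _ => lra | |- _ => idtac end.

(** * Functors on paths *)

Section PathFunctor.
Variables (R : realType) (X : topologicalType) (M : groupType).
Variable m : (R -> X) -> M.
Local Open Scope group_scope.

(** The common properties of path classes in a fundamental group and of holonomies. Products enter
    through squares only: inverses, subdivision and concatenation follow from squares with
    degenerate sides. *)
Record path_functor : Prop := PathFunctor {
  pf_ext : forall f g : R -> X, (forall t : R, 0 <= t <= 1 -> f t = g t)%R -> m f = m g;
  pf_const : forall x, m (fun=> x) = 1;
  pf_square : forall K : R * R -> X, continuous K ->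
    m (fun t => K (0%R, t)) * m (fun s => K (s, 1%R)) =
    m (fun s => K (s, 0%R)) * m (fun t => K (1%R, t)) }.

Hypothesis mP : path_functor.

Lemma pf_cone (K : R * R -> X) : continuous K ->
  (forall s, 0 <= s <= 1 -> K (s, 0) = K (0, 0))%R ->
  m (fun t => K (0%R, t)) * m (fun s => K (s, 1%R)) = m (fun t => K (1%R, t)).
Proof.
move=> cK K0; rewrite pf_square // (pf_ext mP (g := fun=> K (0%R, 0%R))).
  by rewrite pf_const // mul1g.
by move=> t /K0.
Qed.

Lemma pf_homotopy (K : R * R -> X) : continuous K ->
  (forall s, 0 <= s <= 1 -> K (s, 0) = K (0, 0))%R ->
  (forall s, 0 <= s <= 1 -> K (s, 1) = K (0, 1))%R ->
  m (fun t => K (0%R, t)) = m (fun t => K (1%R, t)).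
Proof.
move=> cK K0 K1; rewrite -pf_cone // [X in _ * X](pf_ext mP (g := fun=> K (0%R, 1%R))).
  by rewrite pf_const // mulg1.
by move=> t /K1.
Qed.

Lemma pf_rev (f : R -> X) : continuous f ->
  m (fun t => f (1 - t)%R) = (m f)^-1.
Proof.
move=> cf; apply: (mulgI (m f)); rewrite mulgV.
(* Two consecutive sides of this square are [f] and its reverse; the other two are constant. *)
have cK : continuous (fun z : R * R => f ((1 - z.1) * z.2)%R) by apply: (cts_comp _ cf); cts.
have := pf_square mP cK => /=.
rewrite (pf_ext mP (g := f)); last by move=> t _; rewrite subr0 mul1r.
rewrite (pf_ext mP (f := fun s => f ((1 - s) * 1)%R) (g := fun s => f (1 - s)%R));
  last by move=> t _; rewrite mulr1.
rewrite (pf_ext mP (f := fun s => f ((1 - s) * 0)%R) (g := fun s => f 0%R));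
  last by move=> t _; rewrite mulr0.
rewrite (pf_ext mP (f := fun s => f ((1 - 1) * s)%R) (g := fun s => f 0%R));
  last by move=> t _; rewrite subrr mul0r.
by rewrite !pf_const // mulg1.
Qed.

Lemma pf_between (f : R -> X) (a b d : R) : continuous f ->
  m (fun t => f (a + t * (b - a))%R) * m (fun t => f (b + t * (d - b))%R) =
  m (fun t => f (a + t * (d - a))%R).
Proof.
move=> cf.
(* A triangle with apex [f a], bounded by the images of the segments from [a] to [b], from [b] to
   [d] and from [a] to [d]. *)
have cK : continuous (fun z : R * R => f (a + z.2 * (b - a) + z.1 * z.2 * (d - b))%R).
  by apply: (cts_comp _ cf); cts.
have := pf_cone cK => /=.
rewrite (pf_ext mP (g := fun t => f (a + t * (b - a))%R)); last first.
  by move=> t _; rewrite !mul0r addr0.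
rewrite (pf_ext mP (f := fun s => f (a + 1 * (b - a) + s * 1 * (d - b))%R)
   (g := fun t => f (b + t * (d - b))%R)); last by move=> t _; congr f; ring.
rewrite (pf_ext mP (f := fun s => f (a + s * (b - a) + 1 * s * (d - b))%R)
   (g := fun t => f (a + t * (d - a))%R)); last by move=> t _; congr f; ring.
by apply=> s _; congr f; ring.
Qed.

Definition cat_path (f g : R -> X) (t : R) : X :=
  if (t <= 2^-1)%R then f (clamp (2 * t)%R) else g (clamp (2 * t - 1)%R).

Lemma cat_path_cts (f g : R -> X) : continuous f -> continuous g ->
  f 1%R = g 0%R -> continuous (cat_path f g).
Proof.
move=> cf cg e; apply: cts_paste; first by cts.
- by apply: (cts_comp _ cf); apply: (cts_comp _ (@clamp_cts R)); cts.
- by apply: (cts_comp _ cg); apply: (cts_comp _ (@clamp_cts R)); cts.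
- by move=> t ->; rewrite clamp_ge1 ?clamp_le0 //; lra.
Qed.

Lemma pf_cat (f g : R -> X) : continuous f -> continuous g -> f 1%R = g 0%R ->
  m (cat_path f g) = m f * m g.
Proof.
move=> cf cg e; have := pf_between 0%R (2^-1)%R 1%R (cat_path_cts cf cg e).
rewrite (pf_ext mP (g := f)); last first.
  move=> t t01; rewrite /cat_path ifT; last by lra.
  by rewrite clamp_id; [congr f|]; lra.
rewrite (pf_ext mP (f := fun t => cat_path f g (2^-1 + _)%R) (g := g)); last first.
  move=> t t01; rewrite /cat_path; case: leP => h.
    have -> : t = 0%R by lra.
    by rewrite clamp_ge1 //; lra.
  by rewrite clamp_id; [congr g|]; lra.
by move=> ->; apply: (pf_ext mP) => t _; congr cat_path; ring.
Qed.

End PathFunctor.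

Lemma transport_functor (R : realType) (X : topologicalType) (Q : groupType)
  (c : X -> X -> Q) : germ_cocycle c -> path_functor (@transport R X Q c).
Proof.
move=> cC; split; first exact: transport_ext.
- exact: transport_const.
- exact: transport_square.
Qed.

(** * Classes of paths in the fundamental group *)

Section PathClass.
Variables (R : realType) (X : topologicalType) (x0 : X) (om : X -> R -> X).
Hypotheses (om_cts : forall x, continuous (om x)) (om0 : forall x, om x 0 = x0)
  (om1 : forall x, om x 1 = x).
Local Notation clamp := (@clamp R).

(** The path [f] closed up by the chosen base paths of its two ends, with one unit of time for each
    of the three parts. *)
Definition based_fun (f : R -> X) (y : R) : X :=
  if y <= 1 then om (f 0) (clamp y) else
  if y <= 2 then f (clamp (y - 1)) else om (f 1) (clamp (3 - y)).

Lemma based_fun_cts (f : R -> X) : continuous f -> continuous (based_fun f).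
Proof.
move=> cf; apply: cts_paste; [by ctsx|by ctsx|apply: cts_paste; try by ctsx|].
- by move=> z ->; rewrite !clamp_ge1 ?om1 //; lra.
- move=> z ->; rewrite ifT; last by lra.
  by rewrite clamp_ge1 // clamp_le0 ?om1 //; lra.
Qed.

Definition based_loop (f : R -> X) (cf : continuous f) : loop R x0.
Proof.
apply: (@Loop R X x0 (fun t => based_fun f (3 * t))).
- apply: continuous_subspaceT; apply: (cts_comp _ (based_fun_cts cf)); cts.
- by rewrite /based_fun mulr0 ler01 clamp_le0.
- rewrite /based_fun mulr1 ifF; last by lra.
  rewrite ifF; last by lra.
  by rewrite subrr clamp_le0.
Defined.

Definition path_class (f : R -> X) : pi1 R x0 :=
  if pselect (continuous f) is left cf then \pi_(pi1 R x0) (based_loop cf) else 1%g.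

Lemma path_classE f (cf : continuous f) :
  path_class f = \pi_(pi1 R x0) (based_loop cf).
Proof.
rewrite /path_class; case: pselect => [cf'|//].
by rewrite (Prop_irrelevance cf cf').
Qed.

Lemma path_class_homotopy (K : R * R -> X) : continuous K ->
  (forall s, 0 <= s <= 1 -> K (s, 0) = K (0, 0)) ->
  (forall s, 0 <= s <= 1 -> K (s, 1) = K (0, 1)) ->
  path_class (fun t => K (0, t)) = path_class (fun t => K (1, t)).
Proof.
move=> cK K0 K1.
have c0 : continuous (fun t => K (0, t)) by apply: (cts_comp _ cK); apply: cts_pair; cts.
have c1 : continuous (fun t => K (1, t)) by apply: (cts_comp _ cK); apply: cts_pair; cts.
rewrite (path_classE c0) (path_classE c1); apply/pi1_eqP.
have z01 : 0 <= (0 : R) <= 1 by lra.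
have o01 : 0 <= (1 : R) <= 1 by lra.
apply: (homotopic_cts (H := fun z : R * R => if 3 * z.2 <= 1 then om (K (0, 0)) (clamp (3 * z.2))
  else if 3 * z.2 <= 2 then K (clamp z.1, clamp (3 * z.2 - 1))
  else om (K (0, 1)) (clamp (3 - 3 * z.2)))).
- apply: cts_paste; [by ctsx|by ctsx|apply: cts_paste; try by ctsx|].
  + move=> z ->; rewrite (@clamp_ge1 _ (2 - 1)) ?(@clamp_ge1 _ (3 - 2)); slra.
    by rewrite om1 K1 ?clamp01.
  + move=> z ->; rewrite ifT; last by lra.
    by rewrite clamp_ge1 // [clamp (1 - 1)]clamp_le0 ?om1 ?K0 ?clamp01 //; lra.
- by move=> t t01 /=; rewrite /based_fun (@clamp_le0 _ 0).
- by move=> t t01 /=; rewrite /based_fun (@clamp_ge1 _ 1) // (K0 1) ?(K1 1).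
- move=> s _ /=; rewrite mulr0 ler01 clamp_le0 // om0 mulr1 ifF; last by lra.
  rewrite ifF; last by lra.
  by rewrite clamp_le0 ?om0 //; lra.
Qed.

Lemma path_class_ext (f g : R -> X) : continuous f -> continuous g ->
  (forall t, 0 <= t <= 1 -> f t = g t) -> path_class f = path_class g.
Proof.
move=> cf cg fg; rewrite (path_classE cf) (path_classE cg); apply/pi1_eqP.
have e : forall t, based_fun f t = based_fun g t.
  move=> t; rewrite /based_fun !fg ?clamp01 // lexx ?ler01 //.
apply: (@homotopic_reparam _ _ _ (based_loop cf) _ _ idfun idfun) => //; try by cts.
  by move=> t t01 /=; rewrite ext_id.
by move=> t t01 /=; rewrite ext_id //= e.
Qed.

Lemma path_class_const x : path_class (fun=> x) = 1%g.
Proof.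
rewrite (path_classE (@cts_cst R X x)); apply/pi1_eqP.
pose b := based_loop (@cts_cst R X x).
have cm : continuous (fun t : R => Num.min (3 * t) (Num.min 1 (3 - 3 * t))) by cts.
have bt t : 0 <= t <= 1 -> b t = om x (Num.min (3 * t) (Num.min 1 (3 - 3 * t))).
  move=> t01 /=; rewrite /based_fun; case: leP => h1.
    rewrite clamp_id; last by lra.
    rewrite (min_l (x := 3 * t)) // le_min; lra.
  case: leP => h2.
    rewrite (min_l (x := 1)); last by lra.
    by rewrite min_r ?om1 //; lra.
  rewrite (min_r (x := 1)); last by lra.
  rewrite min_r; last by lra.
  by rewrite clamp_id //; lra.
apply: (homotopic_cts (H := fun z : R * R => om x ((1 - z.1) *
   Num.min (3 * z.2) (Num.min 1 (3 - 3 * z.2))))).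
- have ck : continuous (fun z : R * R => (1 - z.1) *
     Num.min (3 * z.2) (Num.min 1 (3 - 3 * z.2))) by cts.
  exact: (cts_comp ck (@om_cts x)).
- by move=> t t01; rewrite -[RHS]/(b t) bt //= subr0 mul1r.
- by move=> t t01 /=; rewrite subrr mul0r om0.
- move=> s _ /=; rewrite mulr0 subr0 mulr1 subrr !(min_l (x := 0)) ?le_min ?ler01 //; slra.
  by rewrite (min_r (x := 1)) // min_r // mulr0 om0.
Qed.

Lemma path_class_cat (f g : R -> X) : continuous f -> continuous g ->
  f 1 = g 0 -> path_class (cat_path f g) = (path_class f * path_class g)%g.
Proof.
move=> cf cg fg; have ch := cat_path_cts cf cg fg.
rewrite (path_classE cf) (path_classE cg) (path_classE ch).
rewrite [RHS]pi1_mulE; apply/pi1_eqP.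
have h0 : cat_path f g 0 = f 0 by rewrite /cat_path ifT ?clamp_le0 //; lra.
have h1 : cat_path f g 1 = g 1 by rewrite /cat_path ifF ?clamp_ge1 //; lra.
(* Both based loops in succession, in six units of time, with the detour from [f 1] along [om (f 1)]
   and back shortened by the factor [s]: a pause for [s = 0], the complete detour for [s = 1]. *)
pose L (s y : R) : X := if y <= 1 then om (f 0) (clamp y) else
  if y <= 2 then f (clamp (y - 1)) else
  if y <= 3 then om (f 1) (1 - clamp s * clamp (y - 2)) else
  if y <= 4 then om (f 1) (1 - clamp s * clamp (4 - y)) else
  if y <= 5 then g (clamp (y - 4)) else om (g 1) (clamp (6 - y)).
(* The based loop of the concatenation gives half a unit of time to each of [f] and [g]. This time
   change runs through it like [L 0]: half speed on both, and a pause between the times 2 and 4. *)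
pose th (y : R) := clamp y + clamp (y - 1) / 2 + clamp (y - 4) / 2 + clamp (y - 5).
have cth : continuous th.
  by rewrite /th; ctsx.
have thE (y : R) : based_fun (cat_path f g) (th y) = L 0 y.
  rewrite /L (@clamp_le0 _ 0) // !mul0r subr0 om1.
  rewrite /th; case: leP => y1.
    rewrite (@clamp_le0 _ (y - 1)) ?(@clamp_le0 _ (y - 4)) ?(@clamp_le0 _ (y - 5));
      slra.
    rewrite !mul0r !addr0 /based_fun ifT; last by have := clamp01 y; lra.
    by rewrite clamp_id ?clamp01 // h0.
  rewrite (@clamp_ge1 _ y); last by lra.
  case: leP => y2.
    rewrite (@clamp_id _ (y - 1)) ?(@clamp_le0 _ (y - 4)) ?(@clamp_le0 _ (y - 5)); slra.
    rewrite !mul0r !addr0 /based_fun ifF; last by lra.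
    rewrite ifT; last by lra.
    rewrite (@clamp_id _ (1 + _ - 1)); last by lra.
    rewrite /cat_path ifT; last by lra.
    by rewrite clamp_id; [congr f|]; lra.
  rewrite (@clamp_ge1 _ (y - 1)); last by lra.
  rewrite [if y <= 3 then _ else _](_ : _ = if y <= 4 then f 1 else if y <= 5 then g (clamp (y - 4))
     else om (g 1) (clamp (6 - y))); last first.
    by case: (leP y 3) => // h; rewrite ifT //; lra.
  case: leP => y4.
    rewrite (@clamp_le0 _ (y - 4)) ?(@clamp_le0 _ (y - 5)); slra.
    rewrite !mul0r !addr0 /based_fun ifF; last by lra.
    rewrite ifT; last by lra.
    rewrite (@clamp_id _ (1 + _ - 1)); last by lra.
    rewrite /cat_path ifT; last by lra.
    by rewrite clamp_ge1 //; lra.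
  case: leP => y5.
    rewrite (@clamp_id _ (y - 4)) ?(@clamp_le0 _ (y - 5)); slra.
    rewrite !addr0 /based_fun ifF; last by lra.
    rewrite ifT; last by lra.
    rewrite (@clamp_id _ (1 + _ + _ - 1)); last by lra.
    rewrite /cat_path ifF; last by lra.
    by rewrite clamp_id; [congr g|]; lra.
  rewrite (@clamp_ge1 _ (y - 4)); last by lra.
  have y6 : 0 < y - 5 by lra.
  rewrite /based_fun.
  rewrite ifF; last by have := clamp01 (y - 5); lra.
  case: (leP y 6) => y7.
    rewrite (@clamp_id _ (y - 5)); last by lra.
    rewrite ifF; last by lra.
    by rewrite h1; congr (om _ (clamp _)); lra.
  rewrite (@clamp_ge1 _ (y - 5)); last by lra.
  rewrite ifF; last by lra.
  by rewrite h1; congr (om _ _); rewrite !clamp_le0 //; lra.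
have cL : continuous (fun z : R * R => L z.1 (6 * z.2)).
  rewrite /L; apply: cts_paste; [by ctsx|by ctsx| |]; last first.
    move=> z ->; rewrite ifT; last by lra.
    by rewrite (@clamp_ge1 _ 1) // (@clamp_le0 _ (1 - 1)) ?om1 //; lra.
  apply: cts_paste; [by ctsx|by ctsx| |]; last first.
    move=> z ->; rewrite ifT; last by lra.
    by rewrite (@clamp_ge1 _ (2 - 1)) ?(@clamp_le0 _ (2 - 2)) ?mulr0 ?subr0 ?om1 //; lra.
  apply: cts_paste; [by ctsx|by ctsx| |]; last first.
    move=> z ->; rewrite ifT; last by lra.
    by congr (om _ (_ - _ * clamp _)); lra.
  apply: cts_paste; [by ctsx|by ctsx| |]; last first.
    move=> z ->; rewrite ifT; last by lra.
    by rewrite (@clamp_le0 _ (4 - 4)) ?mulr0 ?subr0 ?om1 ?fg //; lra.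
  apply: cts_paste; [by ctsx|by ctsx|by ctsx|].
  by move=> z ->; rewrite (@clamp_ge1 _ (5 - 4)) ?(@clamp_ge1 _ (6 - 5)) ?om1 //; lra.
have L00 s : L s (6 * 0) = x0 by rewrite /L mulr0 ler01 clamp_le0.
have L01 s : L s (6 * 1) = x0.
  rewrite /L !ifF; slra.
  by rewrite clamp_le0 //; lra.
have cL0 : continuous (fun t : R => L 0 (6 * t)).
  by apply: (cts_comp (f := fun t : R => (0, t)) _ cL); apply: cts_pair; cts.
apply: homotopic_sym.
apply: (@homotopic_trans _ _ _ _ (Loop (loop_fun := fun t => L 0 (6 * t))
  (continuous_subspaceT cL0) (L00 0) (L01 0))).
- apply: (homotopic_cts (H := fun z : R * R => L (1 - z.1) (6 * z.2))).
  + apply: (cts_comp (f := fun z : R * R => (1 - z.1, z.2)) _ cL).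
    by apply: cts_pair; cts.
  + move=> t t01 /=; rewrite subr0 /L (@clamp_ge1 _ 1) // !mul1r /cat_fun /=.
    rewrite /based_fun; case: (leP t 2^-1) => th2.
      rewrite (_ : 3 * (2 * t) = 6 * t); last by ring.
      case: ifP => // _; case: ifP => // h2.
      rewrite ifT; last by lra.
      by rewrite (@clamp_id _ (3 - _)) ?(@clamp_id _ (_ - 2)); [congr (om _ _)| |]; lra.
    rewrite ifF; last by lra.
    rewrite ifF; last by lra.
    rewrite ifF; last by lra.
    rewrite (_ : 3 * (2 * t - 1) = 6 * t - 3); last by ring.
    case: (leP (6 * t) 4) => h3.
      rewrite ifT; last by lra.
      rewrite (@clamp_id _ (4 - _)) ?(@clamp_id _ (_ - 3)); slra.
      by rewrite fg; congr (om _ _); lra.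
    rewrite [RHS]ifF; last by lra.
    case: (leP (6 * t) 5) => h4.
      rewrite ifT; last by lra.
      by congr (g (clamp _)); lra.
    rewrite ifF; last by lra.
    by congr (om _ (clamp _)); lra.
  + by move=> t t01 /=; rewrite subrr.
  + by move=> s _ /=; rewrite L00 L01.
- apply: (@homotopic_reparam _ _ _ (based_loop ch) _ _ (fun t => th (6 * t) / 3) idfun).
  + by apply: ctsM; [apply: (cts_comp _ cth); cts|cts].
  + by cts.
  + move=> t t01 /=; rewrite -thE ext_id /=; last first.
      by rewrite /th; have := clamp01 (6 * t); have := clamp01 (6 * t - 1);
        have := clamp01 (6 * t - 4); have := clamp01 (6 * t - 5); lra.
    by congr based_fun; lra.
  + by move=> t t01 /=; rewrite ext_id.
  + by rewrite /th mulr0 !clamp_le0 ?mul0r ?addr0 ?mul0r //; lra.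
  + by rewrite /th !clamp_ge1; lra.
Qed.

Lemma path_class_square (K : R * R -> X) : continuous K ->
  (path_class (fun t => K (0%R, t)) * path_class (fun s => K (s, 1%R)) =
   path_class (fun s => K (s, 0%R)) * path_class (fun t => K (1%R, t)))%g.
Proof.
move=> cK.
have ce (f : R -> R * R) : continuous f -> continuous (K \o f).
  by move=> cf; apply: (cts_comp cf cK).
have c1 := ce (fun t => (0, t)) ltac:(apply: cts_pair; cts).
have c2 := ce (fun t => (t, 1)) ltac:(apply: cts_pair; cts).
have c3 := ce (fun t => (t, 0)) ltac:(apply: cts_pair; cts).
have c4 := ce (fun t => (1, t)) ltac:(apply: cts_pair; cts).
rewrite -(path_class_cat c1 c2) // -(path_class_cat c3 c4) //.
pose a t := clamp (2 * t - 1); pose b t := clamp (2 * t).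
have ca : continuous a by rewrite /a; ctsx.
have cb : continuous b by rewrite /b; ctsx.
have e1 t : 0 <= t <= 1 -> cat_path (K \o (fun t => (0, t))) (K \o (fun t => (t, 1))) t = K (a t, b t).
  move=> t01; rewrite /cat_path /a /b; case: leP => h /=.
    by rewrite (@clamp_le0 _ (2 * t - 1)) //; lra.
  by rewrite (@clamp_ge1 _ (2 * t)) //; lra.
have e2 t : 0 <= t <= 1 -> cat_path (K \o (fun t => (t, 0))) (K \o (fun t => (1, t))) t = K (b t, a t).
  move=> t01; rewrite /cat_path /a /b; case: leP => h /=.
    by rewrite (@clamp_le0 _ (2 * t - 1)) //; lra.
  by rewrite (@clamp_ge1 _ (2 * t)) //; lra.
(* [K] on the segments between the two boundary paths of the square from one corner to the opposite
   one. *)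
pose J (z : R * R) := K ((1 - z.1) * a z.2 + z.1 * b z.2, (1 - z.1) * b z.2 + z.1 * a z.2).
have cJ : continuous J.
  have ca2 : continuous (fun z : R * R => a z.2) by apply: (cts_comp _ ca); cts.
  have cb2 : continuous (fun z : R * R => b z.2) by apply: (cts_comp _ cb); cts.
  by apply: (cts_comp _ cK); apply: cts_pair; apply: ctsD; apply: ctsM => //; cts.
have ej0 t : 0 <= t <= 1 -> K (a t, b t) = J (0, t).
  by move=> _; rewrite /J /=; congr (K (_, _)); ring.
have ej1 t : 0 <= t <= 1 -> K (b t, a t) = J (1, t).
  by move=> _; rewrite /J /=; congr (K (_, _)); ring.
have cJ0 : continuous (fun t => J (0, t)) by apply: (cts_comp _ cJ); apply: cts_pair; cts.
have cJ1 : continuous (fun t => J (1, t)) by apply: (cts_comp _ cJ); apply: cts_pair; cts.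
rewrite (path_class_ext (cat_path_cts c1 c2 erefl) cJ0); last first.
  by move=> t t01; rewrite e1 // ej0.
rewrite (path_class_ext (cat_path_cts c3 c4 erefl) cJ1); last first.
  by move=> t t01; rewrite e2 // ej1.
have a0 : a 0 = 0 by rewrite /a clamp_le0 //; lra.
have b0 : b 0 = 0 by rewrite /b clamp_le0 //; lra.
have a1 : a 1 = 1 by rewrite /a clamp_ge1 //; lra.
have b1 : b 1 = 1 by rewrite /b clamp_ge1 //; lra.
apply: path_class_homotopy => // s _; rewrite /J /= ?a0 ?b0 ?a1 ?b1;
  by congr (K (_, _)); ring.
Qed.

(** Composing with [clamp] makes the class depend on the unit interval only, whatever the function
    does elsewhere; [path_class] alone is 1 on discontinuous functions. *)
Definition pi1_class (f : R -> X) : pi1 R x0 := path_class (f \o clamp).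

Lemma pi1_classE f : continuous f -> pi1_class f = path_class f.
Proof.
move=> cf; apply: path_class_ext => // [|t t01]; last by rewrite /= clamp_id.
by apply: (cts_comp _ cf); exact: clamp_cts.
Qed.

Lemma pi1_class_functor : path_functor pi1_class.
Proof.
split=> [f g fg|x|K cK].
- rewrite /pi1_class (_ : f \o clamp = g \o clamp) //.
  by apply/funext => t /=; rewrite fg ?clamp01.
- exact: path_class_const.
- have ce (f : R -> R * R) : continuous f -> continuous (K \o f).
    by move=> cf; apply: (cts_comp cf cK).
  rewrite !pi1_classE; first exact: path_class_square.
  + by apply: (ce (fun t => (1, t))); apply: cts_pair; cts.
  + by apply: (ce (fun t => (t, 0))); apply: cts_pair; cts.
  + by apply: (ce (fun t => (t, 1))); apply: cts_pair; cts.
  + by apply: (ce (fun t => (0, t))); apply: cts_pair; cts.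
Qed.

(** With a constant base path at [x0], the based loop is the loop itself with a pause at both
    ends. *)
Lemma pi1_class_loop (l : loop R x0) : (forall t, om x0 t = x0) ->
  pi1_class (ext l) = \pi_(pi1 R x0) l.
Proof.
move=> omx; rewrite pi1_classE; last exact: ext_cts.
rewrite (path_classE (@ext_cts R X x0 l)); apply/pi1_eqP.
apply: (@homotopic_reparam _ _ _ l _ _ (fun t => clamp (3 * t - 1)) idfun).
- by ctsx.
- by cts.
- move=> t t01 /=; rewrite /based_fun (@ext_le0 _ _ _ l 0) // (@ext_ge1 _ _ _ l 1) // !omx.
  rewrite /ext; case: leP => h1; first by rewrite (@clamp_le0 _ (3 * t - 1)) ?(@clamp_le0 _ 0) ?loop_0 //; lra.
  case: leP => h2; first by [].
  by rewrite (@clamp_ge1 _ (3 * t - 1)) ?(@clamp_ge1 _ 1) ?loop_1 //; lra.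
- by move=> t t01 /=; rewrite ext_id.
- by rewrite /= clamp_le0 //; lra.
- by rewrite /= clamp_ge1 //; lra.
Qed.

End PathClass.

(** * Presentations *)

Section FreeGroupEval.
Variables (X : choiceType) (Q : groupType) (q : X -> Q).
Local Open Scope group_scope.

Definition letter_eval (a : X * bool) : Q := if a.2 then q a.1 else (q a.1)^-1.

Definition word_eval (w : seq (X * bool)) : Q := \prod_(a <- w) letter_eval a.

Lemma word_eval_equiv u v : word_equiv u v -> word_eval u = word_eval v.
Proof.
move=> /asboolP; elim=> {u v} [_ _ [u v x b]|//|u v _ -> //|u v w _ -> _ -> //].
rewrite /word_eval !big_cat /= !big_cons /letter_eval /=.
by case: b; rewrite ?mulVKg ?mulKg.
Qed.

Definition fg_eval (a : free_group X) : Q := word_eval (repr a).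

Lemma fg_evalE w : fg_eval (\pi_(free_group X) w) = word_eval w.
Proof. by apply: word_eval_equiv; apply/eqmodP; rewrite reprK. Qed.

Lemma fg_evalM : {morph fg_eval : a b / a * b}.
Proof.
move=> a b; rewrite -[a]reprK -[b]reprK [_ * _]fg_mulE !fg_evalE.
by rewrite /word_eval big_cat.
Qed.

HB.instance Definition _ := isMultiplicative.Build _ _ fg_eval fg_evalM.

Lemma fg_eval1 : fg_eval 1 = 1.
Proof.
have -> : 1 = \pi_(free_group X) [::] :> free_group X by [].
by rewrite fg_evalE /word_eval big_nil.
Qed.

Lemma fg_evalV : {morph fg_eval : a / a^-1}.
Proof. by move=> a; apply: (mulgI (fg_eval a)); rewrite -fg_evalM !mulgV fg_eval1. Qed.

Lemma fg_eval_gen x : fg_eval (fg_gen x) = q x.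
Proof. by rewrite fg_evalE /word_eval big_seq1. Qed.

Lemma fg_eval_prod (I : Type) (s : seq I) F :
  fg_eval (\prod_(i <- s) F i) = \prod_(i <- s) fg_eval (F i).
Proof. by elim/big_ind2: _ => [|a b a' b' <- <-|//]; rewrite ?fg_evalM ?fg_eval1. Qed.

Lemma fg_eval_expgz a m : fg_eval (expgz a m) = expgz (fg_eval a) m.
Proof.
have e n : fg_eval (a ^+ n) = fg_eval a ^+ n.
  by elim: n => [|n IH]; rewrite ?expg0 ?fg_eval1 // !expgS fg_evalM IH.
by case: m => n /=; rewrite ?fg_evalV e.
Qed.

Lemma fg_evalR a b : fg_eval [~ a, b] = [~ fg_eval a, fg_eval b].
Proof. by rewrite /commg /conjg !(fg_evalM, fg_evalV). Qed.

Lemma fg_eval_unique (f : free_group X -> Q) : {morph f : a b / a * b} ->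
  (forall x, f (fg_gen x) = q x) -> f =1 fg_eval.
Proof.
move=> fM fx a.
have f1 : f 1 = 1 by apply: (mulgI (f 1)); rewrite -fM !mulg1.
have fV b : f b^-1 = (f b)^-1 by apply: (mulgI (f b)); rewrite -fM !mulgV.
rewrite -[a]reprK fg_evalE; elim: (repr a) => [|[x b] w IH].
  by rewrite /word_eval big_nil -[\pi _]/(1 : free_group X).
rewrite -cat1s -[\pi_(_) _]fg_mulE fM IH /word_eval big_cons; congr (_ * _).
case: b; first exact: fx.
have -> : \pi_(free_group X) [:: (x, false)] = (fg_gen x)^-1.
  by rewrite [RHS]fg_invE.
by rewrite fV fx.
Qed.

End FreeGroupEval.

Section QuotientGroup.
Variables (F : groupType) (N : set F).
Hypothesis nN : normal_subgroup N.
Local Open Scope group_scope.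

Definition coset_rel (x y : F) : bool := `[< N (x / y) >].

Lemma coset_rel_refl : reflexive coset_rel.
Proof. by move=> x; apply/asboolP; rewrite mulgV; case: nN. Qed.

Lemma coset_rel_sym : symmetric coset_rel.
Proof.
by move=> x y; apply/asboolP/asboolP; case: nN => _ _ NV _ /NV; rewrite invgF.
Qed.

Lemma coset_rel_trans : transitive coset_rel.
Proof.
move=> y x z /asboolP xy /asboolP yz; apply/asboolP; case: nN => _ NM _ _.
by rewrite -(divgKA y); apply: NM => //; rewrite invgK mulgA in yz *.
Qed.

Canonical coset_equiv := EquivRel coset_rel coset_rel_refl coset_rel_sym coset_rel_trans.

Definition quot_group : Type := {eq_quot coset_rel}.
HB.instance Definition _ := EqQuotient.on quot_group.
HB.instance Definition _ := Choice.on quot_group.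

Definition quot_class (x : F) : quot_group := \pi_quot_group x.
Definition quot_mul (a b : quot_group) := quot_class (repr a * repr b).
Definition quot_inv (a : quot_group) := quot_class (repr a)^-1.

Lemma quot_classP x y : quot_class x = quot_class y <-> N (x / y).
Proof. by split=> [/eqmodP/asboolP|h] //; apply/eqmodP/asboolP. Qed.

Lemma quot_classM x y : quot_mul (quot_class x) (quot_class y) = quot_class (x * y).
Proof.
have [_ NM _ NJ] := nN.
have /quot_classP hx := reprK (quot_class x).
have /quot_classP hy := reprK (quot_class y).
apply/quot_classP; set a := repr _ in hx *; set b := repr _ in hy *.
have -> : a * b / (x * y) = (a / x) * ((b / y) ^ x^-1).
  by rewrite /conjg !invgM !invgK !mulgA mulgVK.
by apply: NM => //; exact: NJ.
Qed.

Lemma quot_classV x : quot_inv (quot_class x) = quot_class x^-1.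
Proof.
have [_ _ NV NJ] := nN.
have /quot_classP hx := reprK (quot_class x).
apply/quot_classP; set a := repr _ in hx *.
have -> : a^-1 / x^-1 = ((a / x)^-1) ^ a.
  by rewrite /conjg !invgM !invgK !mulgA mulgVK.
by apply: NJ; exact: NV.
Qed.

Lemma quot_mulA : associative quot_mul.
Proof.
move=> a b c; rewrite -[a]reprK -[b]reprK -[c]reprK -!/(quot_class _).
move: (repr a) (repr b) (repr c) => x y z.
by rewrite (quot_classM y z) (quot_classM x y) !quot_classM mulgA.
Qed.

Lemma quot_mul1g : left_id (quot_class 1) quot_mul.
Proof. by move=> a; rewrite -[a]reprK -/(quot_class _) quot_classM mul1g. Qed.
Lemma quot_mulg1 : right_id (quot_class 1) quot_mul.
Proof. by move=> a; rewrite -[a]reprK -/(quot_class _) quot_classM mulg1. Qed.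
Lemma quot_mulVg : left_inverse (quot_class 1) quot_inv quot_mul.
Proof. by move=> a; rewrite -[a]reprK -/(quot_class _) quot_classV quot_classM mulVg. Qed.
Lemma quot_mulgV : right_inverse (quot_class 1) quot_inv quot_mul.
Proof. by move=> a; rewrite -[a]reprK -/(quot_class _) quot_classV quot_classM mulgV. Qed.

HB.instance Definition _ := isGroup.Build quot_group
  quot_mulA quot_mul1g quot_mulg1 quot_mulVg quot_mulgV.

End QuotientGroup.

Section UniversalProperty.
Local Open Scope group_scope.

Definition subgroup_set (G : groupType) (N : set G) :=
  [/\ N 1, forall x y, N x -> N y -> N (x * y) & forall x, N x -> N x^-1].

Definition satisfies (X : choiceType) (I : Type) (rel : I -> relation_of X)
    (Q : groupType) (q : X -> Q) :=
  forall i, fg_eval q (rel i).1 = fg_eval q (rel i).2.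

Lemma normal_closure_normal (F : groupType) (A : set F) :
  normal_subgroup (normal_closure A).
Proof.
split.
- by move=> N [[]].
- by move=> x y hx hy N /= HN; have [[_ NM _ _] _] := HN; apply: NM; [apply: hx|apply: hy].
- by move=> x hx N /= HN; have [[_ _ NV _] _] := HN; apply: NV; exact: hx.
- by move=> x y hx N /= HN; have [[_ _ _ NJ] _] := HN; apply: NJ; exact: hx.
Qed.

(** Universality is applied to the free group modulo the normal closure of the relators. The
    morphism obtained, composed with the evaluation at [g], is the projection, so the kernel of the
    evaluation lies in the normal closure. *)
Lemma has_presentationI (G : groupType) (X : choiceType) (I : Type)
    (rel : I -> relation_of X) (g : X -> G) :
  satisfies rel g ->
  (forall N : set G, subgroup_set N -> (forall x, N (g x)) -> forall y, N y) ->
  (forall (Q : groupType) (q : X -> Q), satisfies rel q ->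
     exists2 h : G -> Q, {morph h : x y / x * y} & forall x, h (g x) = q x) ->
  has_presentation G rel.
Proof.
move=> relg gen univ; exists (fg_eval g); split.
  apply: gen; last by move=> x; exists (fg_gen x); exact: fg_eval_gen.
  split; first by exists 1; exact: fg_eval1.
    by move=> _ _ [a <-] [b <-]; exists (a * b); exact: fg_evalM.
  by move=> _ [a <-]; exists a^-1; exact: fg_evalV.
pose A := range (fun i => (rel i).1 / (rel i).2).
have nA := @normal_closure_normal _ A.
move=> w; rewrite -/A; split=> [w1|Aw]; last first.
  apply: (Aw [set x | fg_eval g x = 1]); split=> /=.
    split=> /= [|x y hx hy|x hx|x y hx]; first exact: fg_eval1.
    - by rewrite fg_evalM hx hy mulg1.
    - by rewrite fg_evalV hx invg1.
    - by rewrite /conjg !fg_evalM fg_evalV hx mul1g mulVg.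
  by move=> _ [i _ <-] /=; rewrite fg_evalM fg_evalV relg mulgV.
pose q x : quot_group nA := quot_class nA (fg_gen x).
have cM : {morph quot_class nA : x y / x * y}.
  by move=> x y; rewrite [RHS]quot_classM.
have cE : quot_class nA =1 fg_eval q by exact: fg_eval_unique.
have [i|h hM hg] := univ _ q.
  rewrite -!cE; apply/quot_classP => N /= [_]; apply; by exists i.
have hE : h \o fg_eval g =1 fg_eval q.
  apply: fg_eval_unique => [x y|x] /=; first by rewrite fg_evalM hM.
  by rewrite fg_eval_gen hg.
have := hE w; rewrite /= w1 -cE.
have -> : h 1 = quot_class nA 1.
  by apply: (@mulgI _ (h 1) _ (1 : quot_group nA)); rewrite -hM !mulg1.
by move/esym/quot_classP; rewrite invg1 mulg1.
Qed.

End UniversalProperty.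

(** * Families of generators and the order of the ports *)

Section PlumbingData.
Variable G : plumbing_graph.
Local Open Scope group_scope.

(* A family of elements of a group Q playing the roles of the generators, with
   one element for every oriented edge, those of the tree included. *)
Record pdata (Q : groupType) := Pdata {
  pd_v : vertex G -> Q;
  pd_h : arrowhead G -> Q;
  pd_d : dart G -> Q;
  pd_a : handle G -> Q;
  pd_b : handle G -> Q }.

Section Data.
Variables (Q : groupType) (D : pdata Q).

Definition dart_val (d : dart G) : Q := pd_d D d * pd_v D (d_end d) / pd_d D d.

(** A port that does not belong to [v] has value 1, so that one list of all ports serves at every
    vertex. [None] carries the Euler number. *)
Definition port_val (v : vertex G) (p : port G) : Q :=
  match p with
  | None => expgz (pd_v D v) (euler v)
  | Some (inl d) => if d_start d == v then dart_val d else 1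
  | Some (inr h) => if att h == v then pd_h D h else 1
  end.

Definition handles_val (v : vertex G) : Q :=
  \prod_(j < genus v) [~ pd_a D (Tagged (fun v => 'I_(genus v)) j),
                         pd_b D (Tagged (fun v => 'I_(genus v)) j)].

(** [L v] is the order in which the ports are read at [v]. The commutation [ok_dart] concerns all
    edges, those of the tree included. *)
Record pdata_ok (L : vertex G -> seq (port G)) : Prop := PdataOk {
  ok_rev : forall d, pd_d D (d_rev d) = (pd_d D d)^-1;
  ok_dart : forall d, commute (pd_v D (d_start d)) (dart_val d);
  ok_h : forall h, commute (pd_v D (att h)) (pd_h D h);
  ok_a : forall k, commute (pd_v D (tag k)) (pd_a D k);
  ok_b : forall k, commute (pd_v D (tag k)) (pd_b D k);
  ok_prod : forall v, \prod_(p <- L v) port_val v p = handles_val v }.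

(** The same family after the base path of each vertex [v] has been changed by [g v]. *)
Definition pgauge (g : vertex G -> Q) : pdata Q := {|
  pd_v := fun v => g v * pd_v D v / g v;
  pd_h := fun h => g (att h) * pd_h D h / g (att h);
  pd_d := fun d => g (d_start d) * pd_d D d / g (d_end d);
  pd_a := fun k => g (tag k) * pd_a D k / g (tag k);
  pd_b := fun k => g (tag k) * pd_b D k / g (tag k) |}.

Definition pdata_in (N : set Q) : Prop :=
  [/\ forall v, N (pd_v D v), forall h, N (pd_h D h), forall d, N (pd_d D d),
      forall k, N (pd_a D k) & forall k, N (pd_b D k)].

End Data.

Definition pdata_map (Q M : groupType) (f : M -> Q) (D : pdata M) (E : pdata Q) :=
  [/\ forall v, f (pd_v D v) = pd_v E v, forall h, f (pd_h D h) = pd_h E h,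
      forall d, f (pd_d D d) = pd_d E d, forall k, f (pd_a D k) = pd_a E k
    & forall k, f (pd_b D k) = pd_b E k].

(* Generation and universality are stated up to a change of the vertex base
   paths: the data describe the fundamental groupoid on one point per vertex. *)
Definition pgenerates (M : groupType) (D : pdata M) :=
  forall (g : vertex G -> M) (N : set M), subgroup_set N ->
    pdata_in (pgauge D g) N -> forall y, N y.

Definition puniversal (L : vertex G -> seq (port G)) (M : groupType) (D : pdata M) :=
  forall (Q : groupType) (E : pdata Q), pdata_ok E L ->
    exists (f : M -> Q) (g : vertex G -> Q), {morph f : x y / x * y} /\
      pdata_map f D (pgauge E g).

Definition groupoid_presentation (L : vertex G -> seq (port G)) (M : groupType) :=
  exists D : pdata M, [/\ pdata_ok D L, pgenerates D & puniversal L D].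

Lemma morph1 (M Q : groupType) (f : M -> Q) : {morph f : x y / x * y} -> f 1 = 1.
Proof. by move=> fM; apply: (mulgI (f 1)); rewrite -fM !mulg1. Qed.

Lemma morphV (M Q : groupType) (f : M -> Q) : {morph f : x y / x * y} ->
  {morph f : x / x^-1}.
Proof. by move=> fM x; apply: (mulgI (f x)); rewrite -fM !mulgV morph1. Qed.

Lemma morph_expgz (M Q : groupType) (f : M -> Q) : {morph f : x y / x * y} ->
  forall x n, f (expgz x n) = expgz (f x) n.
Proof.
move=> fM x; have e n : f (x ^+ n) = f x ^+ n.
  by elim: n => [|n IH]; rewrite ?expg0 ?morph1 // !expgS fM IH.
by case=> n /=; rewrite ?(morphV fM) e.
Qed.

Lemma commute_expgz (M : groupType) (x y : M) n : commute x y -> commute x (expgz y n).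
Proof. by move=> xy; case: n => n /=; [|apply: commuteV]; exact: commuteX. Qed.

Lemma conj_expgz (M : groupType) (g x : M) n : expgz (g * x / g) n = g * expgz x n / g.
Proof.
have fM : {morph (fun y : M => g * y / g) : y z / y * z}.
  by move=> y z /=; rewrite !mulgA mulgVK.
by rewrite -(morph_expgz fM).
Qed.

Lemma subgroup_expgz (M : groupType) (N : set M) x n : subgroup_set N -> N x ->
  N (expgz x n).
Proof.
move=> [N1 NM NV] Nx.
have Nn k : N (x ^+ k) by elim: k => [|k IH]; rewrite ?expg0 // expgS; exact: NM.
by case: n => n //=; exact: NV.
Qed.

Lemma pdata_map_port (M Q : groupType) (f : M -> Q) g D E v p :
  {morph f : x y / x * y} -> pdata_map f D (pgauge E g) ->
  f (port_val D v p) = g v * port_val E v p / g v.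
Proof.
move=> fM [fv fh fd _ _]; have f1 := morph1 fM; have fV := morphV fM.
case: p => [[d|h]|] /=.
- case: eqP => [<-|_]; last by rewrite f1 mulg1 mulgV.
  by rewrite /dart_val !fM fV fd fv /= !gsimp.
- by case: eqP => [<-|_]; rewrite ?fh // f1 mulg1 mulgV.
- by rewrite morph_expgz // fv conj_expgz.
Qed.

Section Twist.
Variables (Q : groupType) (v0 : vertex G) (a : port G) (u : Q).

(** Conjugating the value of the port [a] at [v0] by [u] compensates for an exchange of [a] with a
    neighbour of value [u], as [a * b = b * (b^-1 * a * b)]. For an edge, the factor is put at its
    end in [v0], hence on both of its orientations. *)
Definition ptwist (D : pdata Q) : pdata Q := {|
  pd_v := pd_v D;
  pd_h := fun h => if (a == Some (inr h)) && (att h == v0) then u^-1 * pd_h D h * u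
                   else pd_h D h;
  pd_d := fun d =>
    (if (a == Some (inl d)) && (d_start d == v0) then u^-1 else 1) * pd_d D d *
    (if (a == Some (inl (d_rev d))) && (d_end d == v0) then u else 1);
  pd_a := pd_a D;
  pd_b := pd_b D |}.

End Twist.

Lemma d_revK : involutive (@d_rev G).
Proof. by case=> e b; rewrite /d_rev negbK. Qed.

Lemma d_start_rev d : @d_start G (d_rev d) = d_end d.
Proof. by case: d => e [] . Qed.

Lemma d_end_rev d : @d_end G (d_rev d) = d_start d.
Proof. by case: d => e [] . Qed.

Lemma d_start_neq_end (d : dart G) : d_start d != d_end d.
Proof. by case: d => e []; rewrite /d_start /d_end /= ?edge_loopless // eq_sym edge_loopless. Qed.

(** Seen from the other end of the edge, [u] stands next to the fibre of [v0], with which it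
    commutes, and cancels. *)
Lemma ptwist_dart_val (Q : groupType) v0 a (u : Q) D d : commute (pd_v D v0) u ->
  dart_val (ptwist v0 a u D) d =
  if (a == Some (inl d)) && (d_start d == v0) then u^-1 * dart_val D d * u else dart_val D d.
Proof.
move=> cu; rewrite /dart_val /=.
set x := if _ && (d_end d == v0) then _ else _.
have xE : x * pd_v D (d_end d) / x = pd_v D (d_end d).
  rewrite /x; case: andP => [[_ /eqP ->]|_]; last by rewrite mul1g invg1 mulg1.
  by rewrite -cu mulgK.
move: xE; move: x => x xE; rewrite !invgM.
have xE' : x * pd_v D (d_end d) = pd_v D (d_end d) * x by rewrite -{2}xE mulgVK.
rewrite !mulgA -(mulgA _ x (pd_v _ _)) xE' !mulgA mulgK.
by case: ifP => _; rewrite !gsimp.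
Qed.

Lemma ptwist_port_val (Q : groupType) v0 a (u : Q) D v p : commute (pd_v D v0) u ->
  port_val (ptwist v0 a u D) v p =
  if (a == p) && (v == v0) then u^-1 * port_val D v p * u else port_val D v p.
Proof.
move=> cu; case: p => [[d|h]|] /=.
- rewrite ptwist_dart_val //; case: (eqVneq (d_start d) v) => [->|_] //.
  by case: ifP => // _; rewrite mulg1 mulVg.
- case: (eqVneq (att h) v) => [->|_] //.
  by case: ifP => // _; rewrite mulg1 mulVg.
- case: andP => // -[_ /eqP ->].
  have : commute u (expgz (pd_v D v0) (euler v0)) by apply: commute_expgz; apply/commute_sym.
  by move=> c; rewrite -mulgA -c mulKg.
Qed.

Lemma ptwist_ok (Q : groupType) (D : pdata Q) v0 a u L L' :
  pdata_ok D L -> commute (pd_v D v0) u ->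
  (forall v, \prod_(p <- L' v) port_val (ptwist v0 a u D) v p =
             \prod_(p <- L v) port_val D v p) ->
  pdata_ok (ptwist v0 a u D) L'.
Proof.
move=> [Drev Dd Dh Da Db Dp] cu e; split=> //=.
- move=> d; rewrite Drev d_revK d_start_rev d_end_rev !invgM mulgA.
  case: ifP => _; case: ifP => _; by rewrite ?invg1 ?invgK ?mulg1 ?mul1g.
- move=> d; rewrite ptwist_dart_val //; case: andP => // -[_ /eqP dv].
  have Dd' := Dd d; rewrite dv in Dd' *.
  by apply: commuteM => //; apply: commuteM => //; exact: commuteV.
- move=> h; case: andP => // -[_ /eqP hv].
  have Dh' := Dh h; rewrite hv in Dh' *.
  by apply: commuteM => //; apply: commuteM => //; exact: commuteV.
- by move=> v; rewrite e Dp.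
Qed.

Lemma port_val_commute (Q : groupType) (D : pdata Q) L v p : pdata_ok D L ->
  commute (pd_v D v) (port_val D v p).
Proof.
move=> ok; case: p => [[d|h]|] /=.
- by case: eqP => [<-|_]; [exact: ok_dart ok _|exact: commute1].
- by case: eqP => [<-|_]; [exact: ok_h ok _|exact: commute1].
- by apply: commute_expgz.
Qed.

Lemma swap_prod (Q : groupType) (D : pdata Q) (a b : port G) s1 s2 v0 u :
  a != b -> a \notin s1 ++ s2 -> u = port_val D v0 b -> commute (pd_v D v0) u ->
  \prod_(p <- s1 ++ b :: a :: s2) port_val (ptwist v0 a u D) v0 p =
  \prod_(p <- s1 ++ a :: b :: s2) port_val D v0 p.
Proof.
move=> ab as12 ub cu.
have e s : a \notin s -> \prod_(p <- s) port_val (ptwist v0 a u D) v0 p =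
   \prod_(p <- s) port_val D v0 p.
  move=> asN; apply: eq_big_seq => p ps; rewrite ptwist_port_val //.
  by case: eqP => //= ap; rewrite -ap (negbTE asN) in ps.
move: as12; rewrite mem_cat negb_or => /andP[as1 as2].
rewrite !big_cat /= !big_cons !e //; congr (_ * _).
rewrite !ptwist_port_val // eqxx /= (negbTE ab) /= eqxx -ub !mulgA.
by rewrite mulgV mul1g.
Qed.

Lemma pgauge_ok (Q : groupType) (D : pdata Q) g L : pdata_ok D L -> pdata_ok (pgauge D g) L.
Proof.
have cj v (x y : Q) : commute x y -> commute (g v * x / g v) (g v * y / g v).
  by move=> c; rewrite /commute !mulgA !mulgVK -(mulgA (g v) x) c mulgA.
have dv d : dart_val (pgauge D g) d = g (d_start d) * dart_val D d / g (d_start d).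
  by rewrite /dart_val /= !gsimp.
have pv v p : port_val (pgauge D g) v p = g v * port_val D v p / g v.
  case: p => [[d|h]|] /=; last exact: conj_expgz.
    by case: eqP => [<-|_]; rewrite ?dv // mulg1 mulgV.
  by case: eqP => [<-|_]; rewrite // mulg1 mulgV.
have gp v (I : Type) (s : seq I) F :
    \prod_(i <- s) (g v * F i / g v) = g v * (\prod_(i <- s) F i) / g v.
  by elim/big_rec2: _ => [|i y x _ ->]; rewrite !gsimp.
move=> [Drev Dd Dh Da Db Dp]; split=> //=.
- by move=> d; rewrite d_start_rev d_end_rev Drev !gsimp.
- by move=> d; rewrite dv; exact: cj.
- by move=> h; apply: cj.
- by move=> h; apply: cj.
- by move=> h; apply: cj.
- move=> v; under eq_bigr do rewrite pv; rewrite gp Dp -gp.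
  by apply: eq_bigr => j _; rewrite /commg /conjg /= !gsimp.
Qed.

(** The twist can be undone inside the new family, because the value of [b] is the same in both:
    hence the generation, and every family for the new order is the twist of a family for the old
    one. *)
Lemma groupoid_presentation_swap M L L' v0 a b s1 s2 :
  a != b -> a \notin s1 ++ s2 ->
  L v0 = s1 ++ a :: b :: s2 -> L' v0 = s1 ++ b :: a :: s2 ->
  (forall v, v != v0 -> L' v = L v) ->
  groupoid_presentation L M -> groupoid_presentation L' M.
Proof.
move=> ab as12 Lv Lv' LL [D [ok gen univ]].
pose u := port_val D v0 b; have cu : commute (pd_v D v0) u by exact: port_val_commute ok.
exists (ptwist v0 a u D); split.
- apply: (ptwist_ok ok cu) => v; case: (eqVneq v v0) => [->|vv].
    by rewrite Lv Lv'; exact: swap_prod.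
  rewrite LL //; apply: eq_bigr => p _; rewrite ptwist_port_val //.
  by rewrite (negbTE vv) andbF.
- move=> g N sN [Nv Nh Nd Na Nb].
  have [N1 NM NV] := sN.
  have conjM v x y : N (g v * x / g v) -> N (g v * y / g v) -> N (g v * (x * y) / g v).
    by move=> hx hy; have := NM _ _ hx hy; rewrite !gsimp.
  have conjV v x : N (g v * x / g v) -> N (g v * x^-1 / g v).
    by move=> hx; have := NV _ hx; rewrite !gsimp.
  have pv : N (g v0 * u / g v0).
    rewrite /u; have -> : port_val D v0 b = port_val (ptwist v0 a u D) v0 b.
      by rewrite ptwist_port_val // (negbTE ab).
    move: (ptwist v0 a u D) Nv Nh Nd {Na Nb} => D' Nv Nh Nd.
    case: (b) => [[d|h]|] /=.
    + case: eqP => [<-|_]; last by rewrite mulg1 mulgV.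
      have := NM _ _ (NM _ _ (Nd d) (Nv (d_end d))) (NV _ (Nd d)).
      by rewrite /dart_val /= !gsimp.
    + case: eqP => [<-|_]; last by rewrite mulg1 mulgV.
      exact: Nh.
    + by rewrite -conj_expgz; apply: subgroup_expgz => //; exact: (Nv v0).
  apply: (gen g N sN); split=> //=.
  + move=> h; have := Nh h; rewrite /=; case: andP => // -[_ /eqP hv]; rewrite hv => hN.
    have := conjM _ _ _ (conjM _ _ _ pv hN) (conjV _ _ pv).
    by rewrite !gsimp.
  + move=> d; have /= := Nd d; set x := if _ then _ else _; set y := if _ then _ else _.
    have Nx : N (g (d_start d) * x / g (d_start d)).
      rewrite /x; case: andP => [[_ /eqP ->]|_]; first exact: conjV.
      by rewrite mulg1 mulgV.
    have Ny : N (g (d_end d) * y / g (d_end d)).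
      rewrite /y; case: andP => [[_ /eqP ->]|_]; first by [].
      by rewrite mulg1 mulgV.
    move=> h; have := NM _ _ (NM _ _ (conjV _ _ Nx) h) (conjV _ _ Ny).
    by rewrite !gsimp.
- move=> Q E' okE'.
  pose w := port_val E' v0 b.
  have cw : commute (pd_v E' v0) w by exact: port_val_commute okE'.
  have cwV : commute (pd_v E' v0) w^-1 by exact: commuteV.
  pose E := ptwist v0 a w^-1 E'.
  have EE : ptwist v0 a w E = pgauge E' (fun=> 1).
    rewrite /E /ptwist /pgauge /=; congr Pdata; apply/funext => k;
      rewrite ?mul1g ?invg1 ?mulg1 //.
      by case: (_ && _); rewrite ?gsimp.
    by case: (_ && _); case: (_ && _); rewrite ?gsimp.
  have pb : port_val E v0 b = w by rewrite ptwist_port_val // (negbTE ab).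
  have okE : pdata_ok E L.
    apply: (ptwist_ok okE' cwV) => v; case: (eqVneq v v0) => [->|vv]; last first.
      rewrite -LL //; apply: eq_bigr => p _; rewrite ptwist_port_val //.
      by rewrite (negbTE vv) andbF.
    rewrite Lv Lv' -(swap_prod (D := E) (u := w)) //.
    rewrite EE; apply: eq_bigr => p _; case: p => [[d|h]|] //=.
    + by rewrite /dart_val /= !gsimp.
    + by rewrite !gsimp.
    + by rewrite !gsimp.
  have [f [g [fM [fv fh fd fa fb]]]] := univ Q E okE.
  have f1 := morph1 fM; have fV := morphV fM.
  have fu : f u = g v0 * w / g v0 by rewrite /u -pb; apply: pdata_map_port.
  exists f, g; split=> //; split=> //= [h|d].
  + case: andP => [[ah /eqP hv]|nh]; last by rewrite fh /E /=; case: andP nh.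
    by rewrite !fM fV fu fh /E /= ah hv eqxx /= !gsimp.
  + rewrite !fM fd /= -/w.
    set x := if _ && (d_start d == v0) then _ else _.
    set y := if _ && (d_end d == v0) then _ else _.
    set x' := if _ && (d_start d == v0) then _ else _.
    set y' := if _ && (d_end d == v0) then _ else _.
    have -> : f x = g (d_start d) * x'^-1 / g (d_start d).
      rewrite /x /x'; case: andP => [[_ /eqP ->]|_]; last by rewrite f1 !gsimp.
      by rewrite fV fu !gsimp.
    have -> : f y' = g (d_end d) * y^-1 / g (d_end d).
      rewrite /y /y'; case: andP => [[_ /eqP ->]|_]; last by rewrite f1 !gsimp.
      by rewrite fu !gsimp.
    by rewrite !gsimp.
Qed.

Lemma groupoid_presentation_perm M L L' :
  (forall v, uniq (L v)) -> (forall v, perm_eq (L v) (L' v)) ->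
  groupoid_presentation L M -> groupoid_presentation L' M.
Proof.
move=> uL LL'.
(* At one vertex, the entries of [t] are brought to their places one at a time by exchanges of
   neighbours; [r] is the part already in order. *)
have one v0 K s t : uniq s -> perm_eq s t -> forall r, uniq (r ++ s) ->
    groupoid_presentation (fun v => if v == v0 then r ++ s else K v) M ->
    groupoid_presentation (fun v => if v == v0 then r ++ t else K v) M.
  elim: t s => [|x t IH] s us st r urs H.
    by move/perm_nilP: st H => ->.
  have xs : x \in s by rewrite (perm_mem st) mem_head.
  have [s1 [s2 sE]] : exists s1 s2, s = s1 ++ x :: s2.
    by case/splitPr: xs => s1 s2; exists s1, s2.
  subst s.
  have st' : perm_eq (s1 ++ s2) t by move: st; rewrite perm_catC /= perm_cons perm_catC.
  have H' : groupoid_presentation (fun v => if v == v0 then r ++ x :: s1 ++ s2 else K v) M.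
    move: H urs {us st st' IH xs}.
    elim/last_ind: s1 s2 => [|s1 y IH] s2 //= H urs.
    have pm : perm_eq (r ++ s1 ++ x :: y :: s2) (r ++ rcons s1 y ++ x :: s2).
      by rewrite cat_rcons !perm_cat2l (perm_catCA [:: x] [:: y]).
    have urs' : uniq (r ++ s1 ++ x :: y :: s2) by rewrite (perm_uniq pm).
    have urs2 : uniq (y :: x :: r ++ s1 ++ s2).
      rewrite (perm_uniq (s2 := r ++ rcons s1 y ++ x :: s2)) // perm_sym.
      rewrite cat_rcons -[y :: x :: r ++ _]/([:: y; x] ++ r ++ _) perm_sym perm_catCA.
      by rewrite perm_cat2l -[y :: x :: s2]/([:: y; x] ++ s2) perm_catCA.
    have := IH (y :: s2) _ urs'; rewrite cat_rcons; apply.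
    apply: (@groupoid_presentation_swap M _ _ v0 y x (r ++ s1) s2 _ _ _ _ _ H).
    - by move: urs2; rewrite /= inE negb_or => /andP[/andP[]].
    - by move: urs2; rewrite /= inE negb_or catA => /andP[/andP[]].
    - by rewrite eqxx cat_rcons -catA.
    - by rewrite eqxx -catA.
    - by move=> v /negbTE ->.
  have urxs : uniq (rcons r x ++ s1 ++ s2).
    rewrite cat_rcons (perm_uniq (s2 := r ++ s1 ++ x :: s2)) //.
    by rewrite perm_cat2l (perm_catCA [:: x]).
  have us12 : uniq (s1 ++ s2) by move: urxs; rewrite cat_uniq => /and3P[].
  have := IH _ us12 st' (rcons r x) urxs; rewrite !cat_rcons; exact.
have many (s : seq (vertex G)) : groupoid_presentation L M ->
    groupoid_presentation (fun v => if v \in s then L' v else L v) M.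
  elim: s => [|v0 s IH] H; first by [].
  have {}H := IH H.
  have e1 : (fun v => if v \in s then L' v else L v) =
     (fun v => if v == v0 then if v0 \in s then L' v0 else L v0
               else if v \in s then L' v else L v).
    by apply/funext => v; case: eqP => // ->.
  rewrite e1 in H.
  have e2 : (fun v => if v \in v0 :: s then L' v else L v) =
     (fun v => if v == v0 then L' v0 else if v \in s then L' v else L v).
    by apply/funext => v; rewrite inE; case: eqP => // ->.
  rewrite e2.
  have uL' v : uniq (L' v) by rewrite -(perm_uniq (LL' v)).
  have us : uniq (if v0 \in s then L' v0 else L v0) by case: ifP.
  have pm : perm_eq (if v0 \in s then L' v0 else L v0) (L' v0) by case: ifP.
  exact: (one v0 (fun v => if v \in s then L' v else L v) _ _ us pm [::] us H).
move=> /(many (enum (vertex G))).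
by have -> : (fun v => if v \in enum (vertex G) then L' v else L v) = L'
  by apply/funext => v; rewrite mem_enum.
Qed.

End PlumbingData.

(** * Forests, potentials and commutation along a tree *)

Section SpanningTree.
Variable G : plumbing_graph.

Lemma joins_sym v w (e : edge G) : joins v w e = joins w v e.
Proof. by rewrite /joins orbC. Qed.

Lemma tree_adjP (T : {set edge G}) v w :
  reflect (exists d : dart G, [/\ d.1 \in T, d_start d = v & d_end d = w]) (tree_adj T v w).
Proof.
apply: (iffP existsP) => [[e /andP[eT /orP[]/andP[/eqP <- /eqP <-]]]|[[e b] [/= eT <- <-]]].
- by exists (e, true).
- by exists (e, false).
- exists e; rewrite eT /joins /d_start /d_end /=.
  by case: b; rewrite !eqxx ?orbT.
Qed.

Lemma tree_adj_connect_sym (T : {set edge G}) : connect_sym (tree_adj T).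
Proof.
apply: sym_connect_sym => v w; apply: eq_existsb => e.
by rewrite joins_sym.
Qed.

Lemma tree_path_darts (S : {set edge G}) v p : path (tree_adj S) v p ->
  exists c : seq (dart G),
  [/\ all (fun d => d.1 \in S) c, map (@d_start G) c = belast v p, map (@d_end G) c = p,
      forall d0, d_end d0 = v -> path (fun d d' : dart G => d_end d == d_start d') d0 c
    & uniq (v :: p) -> uniq (map fst c)].
Proof.
elim: p v => [|w p IH] v /=; first by exists [::].
move=> /andP[/tree_adjP[d [dS dv dw]] /IH[c [cS cs ce cp cu]]].
exists (d :: c); split=> /=; rewrite ?dS ?dv ?dw ?cs ?ce //.
  by move=> d0 ->; rewrite eqxx cp.
move=> /andP[vN wN]; rewrite cu // andbT.
apply: contra vN => /mapP[d' d'c dd'].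
have h1 : d_start d' \in w :: p.
  by apply: mem_belast; rewrite -cs; exact: map_f.
have h2 : d_end d' \in w :: p by rewrite inE -ce map_f ?orbT.
move: dv h1 h2; rewrite /d_start /d_end -dd'.
by case: (d.2) => <-; case: (d'.2).
Qed.

(** A simple path between the ends that avoids this edge would close up with it into a cycle. *)
Lemma acyclic_bridge (T : {set edge G}) (d : dart G) : acyclic T -> d.1 \in T ->
  ~~ connect (tree_adj (T :\ d.1)) (d_start d) (d_end d).
Proof.
move=> acT dT; apply/negP => /connectP[p0 pth0 lst0].
case/shortenP: pth0 lst0 => p pth up _ lst.
have [c [cS cs ce cp cu]] := tree_path_darts pth.
have rd : d_end (d_rev d) = d_start d by rewrite d_end_rev.
have : d_rev d :: c = [::]; last by [].
apply: acT.
- by rewrite /= dT; apply: sub_all cS => d'; rewrite !inE => /andP[].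
- rewrite /= rcons_path cp //= d_start_rev.
  have -> : d_end (last (d_rev d) c) = last (d_start d) p; last by rewrite lst.
  by rewrite -rd -ce; elim: (c) (d_rev d) => //= a s IH b; rewrite IH.
- by rewrite /= cs d_start_rev lst; move: up; rewrite lastI rcons_uniq.
- rewrite /= cu // andbT; apply/mapP => -[d' d'c dd'].
  by move/allP: cS => /(_ _ d'c); rewrite -dd' !inE eqxx.
Qed.

Lemma acyclic_sub (S T : {set edge G}) : S \subset T -> acyclic T -> acyclic S.
Proof.
move=> /fintype.subsetP ST acT c cS; apply: acT.
by apply: sub_all cS => d /ST.
Qed.

Local Open Scope group_scope.

(** Induction on the number of edges: the removed edge is a bridge, so multiplying the potential by
    a constant on one side of it adjusts this edge and disturbs no other. *)
Lemma tree_potential (M : groupType) (x : dart G -> M) (T : {set edge G}) :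
  (forall d, x (d_rev d) = (x d)^-1) -> acyclic T ->
  exists g : vertex G -> M, forall d, d.1 \in T -> g (d_start d) * x d / g (d_end d) = 1.
Proof.
move=> xr; move: {2}#|T|.+1 (ltnSn #|T|) => n.
elim: n T => // n IH T Tn acT.
case: (set_0Vmem T) => [->|[e eT]]; first by exists (fun=> 1) => d; rewrite inE.
have [|g gP] := IH (T :\ e) _ (acyclic_sub (subD1set _ _) acT).
  by move: Tn; rewrite (cardsD1 e T) eT.
pose d : dart G := (e, true).
pose C := connect (tree_adj (T :\ e)) (d_end d).
pose k := g (d_start d) * x d / g (d_end d).
have nC : ~~ C (d_start d).
  by rewrite /C tree_adj_connect_sym; apply: (acyclic_bridge (d := d) acT).
have Cb : C (d_end d) by exact: connect0.
exists (fun v => if C v then k * g v else g v) => d' d'T.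
case: (eqVneq d'.1 e) => [de|de]; last first.
  have d'T' : d'.1 \in T :\ e by rewrite !inE de.
  have adj : tree_adj (T :\ e) (d_start d') (d_end d') by apply/tree_adjP; exists d'.
  have -> : C (d_start d') = C (d_end d').
    by rewrite /C; apply: (same_connect_r (@tree_adj_connect_sym _)); exact: connect1.
  have := gP _ d'T'; case: (C _) => // h.
  by rewrite invgM !mulgA -(mulgA k) -(mulgA k) h mulg1 mulgV.
have hd : (if C (d_start d) then k * g (d_start d) else g (d_start d)) * x d /
   (if C (d_end d) then k * g (d_end d) else g (d_end d)) = 1.
  by rewrite (negbTE nC) Cb /k !gsimp.
case: d' de {d'T} => e' [] /= ->; first exact: hd.
rewrite -[(e, false)]/(d_rev d) d_start_rev d_end_rev xr.
by apply: invg_inj; rewrite invg1 -hd !gsimp.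
Qed.

Lemma commute_prod_seq (M : groupType) (I : eqType) (x : M) (s : seq I) F :
  (forall j, j \in s -> commute x (F j)) -> commute x (\prod_(j <- s) F j).
Proof. by move=> cF; rewrite big_seq; apply: commute_prod. Qed.

(** The remaining factor is the whole product divided on both sides by products that commute with
    [x]. *)
Lemma commute_prod_rest (M : groupType) (I : eqType) (x : M) (s : seq I) F i :
  uniq s -> i \in s -> commute x (\prod_(j <- s) F j) ->
  (forall j, j \in s -> j != i -> commute x (F j)) -> commute x (F i).
Proof.
move=> us si; case/splitPr: si us => s1 s2; rewrite cat_uniq /= negb_or.
move=> /and3P[_ /andP[is1 _] /andP[is2 _]] + cF.
have c1 : commute x (\prod_(j <- s1) F j).
  apply: commute_prod_seq => j js; apply: cF; first by rewrite mem_cat js.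
  by apply: contraNneq is1 => <-.
have c2 : commute x (\prod_(j <- s2) F j).
  apply: commute_prod_seq => j js; apply: cF; first by rewrite mem_cat inE js !orbT.
  by apply: contraNneq is2 => <-.
rewrite big_cat big_cons /=; move: c1 c2; set A := \prod_(j <- s1) _; set B := \prod_(j <- s2) _.
move=> c1 c2 cT; have -> : F i = A^-1 * (A * (F i * B)) / B by rewrite !gsimp.
by apply: commuteM; [apply: commuteM => //|]; exact: commuteV.
Qed.

Lemma commute_dart_rev (Q : groupType) (E : pdata G Q) d :
  pd_d E (d_rev d) = (pd_d E d)^-1 ->
  commute (pd_v E (d_start d)) (dart_val E d) ->
  commute (pd_v E (d_end d)) (dart_val E (d_rev d)).
Proof.
move=> dr; rewrite /dart_val dr d_end_rev.
set a := pd_v E (d_start d); set b := pd_v E (d_end d); set x := pd_d E d => h.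
apply: (mulgI x); apply: (@mulIg _ x^-1).
by move: h; rewrite /commute !gsimp => ->.
Qed.

(* Going from the leaves of the tree to the vertex r, the relation at each
   vertex forces its fibre to commute with the only conjugate not yet known to. *)
Lemma tree_darts_commute (Q : groupType) (E : pdata G Q) (T : {set edge G}) r L :
  maximal_tree T -> (forall v, uniq (L v)) -> (forall v p, p \in L v) ->
  (forall d, pd_d E (d_rev d) = (pd_d E d)^-1) ->
  (forall d, d.1 \notin T -> commute (pd_v E (d_start d)) (dart_val E d)) ->
  (forall h, att h != r -> commute (pd_v E (att h)) (pd_h E h)) ->
  (forall k, commute (pd_v E (tag k)) (pd_a E k)) ->
  (forall k, commute (pd_v E (tag k)) (pd_b E k)) ->
  (forall v, \prod_(p <- L v) port_val E v p = handles_val E v) ->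
  forall d, commute (pd_v E (d_start d)) (dart_val E d).
Proof.
move=> [_ acT] uL aL Er Ed Eh Ea Eb Ep.
(* The side of the edge to which [d] leads once this edge is removed; the induction is on its
   size. *)
pose C (d : dart G) : {set vertex G} := finset (connect (tree_adj (T :\ d.1)) (d_end d)).
have csym S := @tree_adj_connect_sym S.
have handles v : commute (pd_v E v) (handles_val E v).
  apply: commute_prod => j _; rewrite /commg /conjg.
  have ca := Ea (Tagged (fun v => 'I_(genus v)) j); have cb := Eb (Tagged (fun v => 'I_(genus v)) j).
  by do ![apply: commuteM => //]; apply: commuteV.
have main n d : d.1 \in T -> (#|C d| < n)%N -> r \notin C d ->
    commute (pd_v E (d_end d)) (dart_val E (d_rev d)).
  elim: n d => // n IH d dT dn rd.
  have br : d_end d != r by apply: contraNneq rd => <-; rewrite inE connect0.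
  have -> : dart_val E (d_rev d) = port_val E (d_end d) (Some (inl (d_rev d))).
    by rewrite /= d_start_rev eqxx.
  apply: (commute_prod_rest (uL (d_end d))); rewrite ?Ep //.
  move=> [[d'|h]|] _ /=; last by move=> _; apply: commute_expgz.
    case: (eqVneq (d_start d') (d_end d)) => [d'd|_ _]; last exact: commute1.
    move=> d'N; rewrite -d'd.
    case: (boolP (d'.1 \in T)) => [d'T|]; last exact: Ed.
    have dd' : d'.1 != d.1.
      apply: contraNneq d'N => e; apply/eqP; congr (Some (inl _)).
      have := d_start_neq_end d; rewrite -d'd.
      case: d e {dT dn rd br d'd} => e b; case: d' d'T => e' b' _ /= ->.
      by rewrite /d_start /d_end /d_rev /=; case: b; case: b' => //; rewrite eqxx.
    rewrite -[d' in dart_val _ d']d_revK; rewrite -[d' in d_start d']d_revK d_start_rev.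
    apply: commute_dart_rev; first exact: Er.
    rewrite d_start_rev.
    have disj : ~~ connect (tree_adj (T :\ d'.1)) (d_end d') (d_end d).
      by rewrite csym -d'd; exact: acyclic_bridge.
    (* What lies beyond [d'] lies beyond [d], and [d_end d] is left out, so the induction hypothesis
       applies to [d']. *)
    have sub v : connect (tree_adj (T :\ d'.1)) (d_end d') v -> 
        connect (tree_adj (T :\ d.1)) (d_end d) v.
      move=> /connectP[p pth ->].
      have hd : connect (tree_adj (T :\ d.1)) (d_end d) (d_end d').
        apply: connect1; apply/tree_adjP; exists d'; split=> //.
        by rewrite !inE dd'.
      apply: (connect_trans hd); apply/connectP; exists p => //.
      have : forall w, connect (tree_adj (T :\ d'.1)) (d_end d') w -> path (tree_adj (T :\ d'.1)) w p ->
         path (tree_adj (T :\ d.1)) w p.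
        elim: (p) => // w q IHq u cu /= /andP[uw wq].
        have cw : connect (tree_adj (T :\ d'.1)) (d_end d') w.
          by apply: (connect_trans cu); exact: connect1.
        rewrite (IHq _ cw wq) andbT.
        move/tree_adjP: uw => [f [fT fu fw]].
        apply/tree_adjP; exists f; split=> //.
        move: fT; rewrite !inE => /andP[_ ->]; rewrite andbT.
        apply/eqP => fd; case/negP: disj.
        have [->|->] // : d_end d = u \/ d_end d = w.
        by rewrite -fu -fw /d_start /d_end fd; case: (f.2); case: (d.2); auto.
      by apply=> //; exact: connect0.
    apply: IH => //; last first.
      by apply: contra rd; rewrite !inE; exact: sub.
    rewrite -ltnS; apply: leq_trans dn; apply: proper_card.
    apply/properP; split; first by apply/fintype.subsetP => v; rewrite !inE; exact: sub.
    by exists (d_end d); rewrite inE ?connect0 ?(negbTE disj).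
  case: (eqVneq (att h) (d_end d)) => [hd|_ _]; last exact: commute1.
  by move=> _; rewrite -hd; apply: Eh; rewrite hd.
move=> d; case: (boolP (d.1 \in T)) => [dT|]; last exact: Ed.
have main' d' : d'.1 \in T -> r \notin C d' ->
    commute (pd_v E (d_end d')) (dart_val E (d_rev d')).
  by move=> d'T rd'; exact: (main #|C d'|.+1).
(* The vertex [r] is on one side of the edge only, so [main'] applies to [d] or to its reverse. *)
case: (boolP (r \in C d)) => rd.
  rewrite -[d in dart_val _ d]d_revK -(d_end_rev d); apply: main' => //.
  apply/negP => rd'; have := acyclic_bridge acT dT; case/negP.
  move: rd rd'; rewrite !inE d_end_rev /= => h1 h2.
  by apply: (connect_trans h2); rewrite csym.
rewrite -[d]d_revK d_start_rev; apply: commute_dart_rev; first exact: Er.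
by rewrite d_start_rev; exact: main'.
Qed.

End SpanningTree.

(** * From families to the presentation *)

Section PlumbingPresentationProof.
Variables (G : plumbing_graph) (c : plumbing_choices G).
Local Open Scope group_scope.

Definition port_at (v : vertex G) (p : port G) : bool :=
  match p with
  | None => true
  | Some (inl d) => d_start d == v
  | Some (inr h) => att h == v
  end.

(** The order of the factors in (R1): edges, arrowheads, Euler term. The ports of the other vertices
    come last, with value 1. *)
Definition port_order (v : vertex G) : seq (port G) :=
  [seq Some (inl d) | d <- edges_at c v] ++
  [seq Some (inr h) | h <- arrowheads_at c v] ++
  None :: [seq p <- enum (port G) | ~~ port_at v p].

Lemma mem_edges_at v d : (d \in edges_at c v) = (d_start d == v).
Proof. by rewrite mem_sort mem_filter mem_enum andbT. Qed.

Lemma mem_arrowheads_at v h : (h \in arrowheads_at c v) = (att h == v).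
Proof. by rewrite mem_sort mem_filter mem_enum andbT. Qed.

Lemma port_order_mem v p : p \in port_order v.
Proof.
rewrite !mem_cat inE mem_filter mem_enum andbT.
case: p => [[d|h]|] /=; last by rewrite ?orbT.
- case: (boolP (d_start d == v)) => [dv|_]; last by rewrite !orbT.
  by apply/orP; left; apply/mapP; exists d; rewrite ?mem_edges_at.
- case: (boolP (att h == v)) => [dv|_]; last by rewrite !orbT.
  by apply/orP; right; apply/orP; left; apply/mapP; exists h; rewrite ?mem_arrowheads_at.
Qed.

Lemma port_order_uniq v : uniq (port_order v).
Proof.
have ud : uniq [seq Some (inl d) : port G | d <- edges_at c v].
  rewrite map_inj_uniq; last by move=> x y [].
  by rewrite sort_uniq; apply: filter_uniq; exact: enum_uniq.
have uh : uniq [seq Some (inr h) : port G | h <- arrowheads_at c v].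
  rewrite map_inj_uniq; last by move=> x y [].
  by rewrite sort_uniq; apply: filter_uniq; exact: enum_uniq.
have ur : uniq [seq p <- enum (port G) | ~~ port_at v p].
  by apply: filter_uniq; exact: enum_uniq.
rewrite /port_order !cat_uniq ud uh /= ur mem_filter /= !andbT.
rewrite negb_or; apply/and3P; split.
- apply/hasPn => p /=; rewrite !(mem_cat, inE) mem_filter.
  case/or3P=> [/mapP[h _ ->]|/eqP ->|/andP[np _]]; apply/mapP => -[d dv] // e.
  by move: np dv; rewrite e /= mem_edges_at => /negbTE ->.
- by apply/mapP => -[].
- apply/hasPn => p /=; rewrite mem_filter => /andP[np _].
  apply/mapP => -[h hv] e.
  by move: np hv; rewrite e /= mem_arrowheads_at => /negbTE ->.
Qed.

Lemma port_order_perm v : perm_eq (enum (port G)) (port_order v).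
Proof.
apply: uniq_perm; rewrite ?enum_uniq ?port_order_uniq // => p.
by rewrite port_order_mem mem_enum.
Qed.

Section Eval.
Variables (Q : groupType) (q : pgen c -> Q).

Definition eval_data : pdata G Q := {|
  pd_v := fun v => q (inl (inl (inl v)));
  pd_h := fun h => q (inl (inl (inr h)));
  pd_d := fun d => fg_eval q (gamma_d c d);
  pd_a := fun k => q (inr (inl k));
  pd_b := fun k => q (inr (inr k)) |}.

Lemma gamma_d_tree d : d.1 \in tree c -> gamma_d c d = 1.
Proof. by move=> dT; rewrite /gamma_d insubF // dT. Qed.

Lemma leV_flip (d : dart G) :
  leV c (d_start (d_rev d)) (d_end (d_rev d)) = ~~ leV c (d_start d) (d_end d).
Proof.
have [tot anti _] := leV_linear c; rewrite d_start_rev d_end_rev.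
have := tot (d_start d) (d_end d) isT isT.
case: (boolP (leV c (d_start d) (d_end d))) => [h1 _|_ /= ->] //.
apply/negbTE/negP => h2; have := anti (d_start d) (d_end d) isT isT.
by rewrite h1 h2 => /(_ isT); apply/eqP; exact: d_start_neq_end.
Qed.

Lemma gamma_d_rev d : gamma_d c (d_rev d) = (gamma_d c d)^-1.
Proof.
rewrite /gamma_d leV_flip /=; case: insubP => [e _ _|_]; last by rewrite invg1.
by case: (leV _ _ _); rewrite ?invgK.
Qed.

Lemma port_order_prod v :
  \prod_(p <- port_order v) port_val eval_data v p =
  fg_eval q (plumbing_rel (RelVertex c v)).1.
Proof.
rewrite /= !fg_evalM !fg_eval_prod fg_eval_expgz fg_eval_gen.
rewrite /port_order !big_cat !big_map big_cons /= mulgA.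
congr (_ * _).
  rewrite (eq_big_seq (fun d => fg_eval q (gamma_d c d * gamma_v c (d_end d) / gamma_d c d)));
    last by move=> d; rewrite mem_edges_at => ->; rewrite !fg_evalM fg_evalV fg_eval_gen.
  rewrite [X in _ * X](eq_big_seq (fun h => fg_eval q (gamma_h c h))) //.
  by move=> h; rewrite mem_arrowheads_at fg_eval_gen => ->.
rewrite [X in _ * X](_ : _ = 1) ?mulg1 // big_filter big1 // => -[[d|h]|] //= /negbTE ->.
all: by [].
Qed.

Lemma handles_val_eval v : handles_val eval_data v = fg_eval q (plumbing_rel (RelVertex c v)).2.
Proof.
by rewrite /= fg_eval_prod; apply: eq_bigr => j _; rewrite fg_evalR !fg_eval_gen.
Qed.

Lemma commute_commg (M : groupType) (x y : M) : [~ x, y] = 1 <-> commute x y.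
Proof. by split=> [/eqP/commgP|/commgP/eqP]. Qed.

Lemma eval_data_rel i :
  fg_eval q (plumbing_rel i).1 = fg_eval q (plumbing_rel i).2 <->
  match i with
  | RelVertex v => \prod_(p <- port_order v) port_val eval_data v p = handles_val eval_data v
  | RelArrowhead h => commute (pd_v eval_data (att h)) (pd_h eval_data h)
  | RelEdge e => commute (pd_v eval_data (d_start (val e, true)))
                   (dart_val eval_data (val e, true))
  | RelAlpha k => commute (pd_v eval_data (tag k)) (pd_a eval_data k)
  | RelBeta k => commute (pd_v eval_data (tag k)) (pd_b eval_data k)
  end.
Proof.
case: i => [v|h|e|k|k] /=.
- by rewrite port_order_prod handles_val_eval.
- rewrite fg_evalR fg_eval1 !fg_eval_gen commute_commg.
  by split=> /commute_sym.
- rewrite fg_evalR fg_eval1 !fg_evalM fg_evalV !fg_eval_gen; exact: commute_commg.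
- rewrite fg_evalR fg_eval1 !fg_eval_gen; case: k => v j; exact: commute_commg.
- rewrite fg_evalR fg_eval1 !fg_eval_gen; case: k => v j; exact: commute_commg.
Qed.

(** [h0] is the arrowhead whose relation is not assumed. With its vertex as the vertex [r] of
    [tree_darts_commute], all edges commute with the fibres at their ends; then the product relation
    at this vertex has [h0] as the only factor not yet known to commute with the fibre. *)
Lemma eval_data_ok (h0 : option (arrowhead G)) :
  (forall i, (forall h, h0 = Some h -> i <> RelArrowhead c h) ->
     fg_eval q (plumbing_rel i).1 = fg_eval q (plumbing_rel i).2) ->
  pdata_ok eval_data port_order.
Proof.
move=> H.
have rev d : pd_d eval_data (d_rev d) = (pd_d eval_data d)^-1.
  by rewrite /= gamma_d_rev fg_evalV.
have prd v : \prod_(p <- port_order v) port_val eval_data v p = handles_val eval_data v.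
  by have /eval_data_rel := H (RelVertex c v) ltac:(by []).
have cot d : d.1 \notin tree c -> commute (pd_v eval_data (d_start d)) (dart_val eval_data d).
  case: d => e b /= eT.
  have := H (RelEdge (exist _ e eT : cotree_edge c)) ltac:(by []) => /eval_data_rel /= h.
  by case: b; [exact: h | exact: (commute_dart_rev (rev (e, true)) h)].
have ca k : commute (pd_v eval_data (tag k)) (pd_a eval_data k).
  by have /eval_data_rel := H (RelAlpha c k) ltac:(by []).
have cb k : commute (pd_v eval_data (tag k)) (pd_b eval_data k).
  by have /eval_data_rel := H (RelBeta c k) ltac:(by []).
have ch h : h0 <> Some h -> commute (pd_v eval_data (att h)) (pd_h eval_data h).
  move=> hh; have : forall k, h0 = Some k -> RelArrowhead c h <> RelArrowhead c k.
    by move=> k e [] hk; apply: hh; rewrite e hk.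
  by move/H/eval_data_rel.
pose r := if h0 is Some h then att h else Defs.root c.
have dv := @tree_darts_commute G Q eval_data (tree c) r port_order (tree_maximal c)
  port_order_uniq port_order_mem rev cot.
have {}dv d : commute (pd_v eval_data (d_start d)) (dart_val eval_data d).
  apply: dv => // h hr; apply: ch => e; move: hr; rewrite /r e.
  by rewrite eqxx.
split=> // h; case: (pselect (h0 = Some h)) => [e|]; last exact: ch.
have -> : pd_h eval_data h = port_val eval_data (att h) (Some (inr h)) by rewrite /= eqxx.
apply: (commute_prod_rest (port_order_uniq (att h))); rewrite ?port_order_mem //.
  rewrite prd; apply: commute_prod => j _; rewrite /commg /conjg.
  have cja := ca (Tagged (fun v => 'I_(genus v)) j); have cjb := cb (Tagged (fun v => 'I_(genus v)) j).
  by do ![apply: commuteM => //]; apply: commuteV.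
move=> [[d|h']|] _ /= ne.
- by case: eqP => [<-|_]; [exact: dv|exact: commute1].
- case: eqP => [<-|_]; last exact: commute1.
  by apply: ch; rewrite e => -[] hh; rewrite hh eqxx in ne.
- by apply: commute_expgz.
Qed.

End Eval.

Lemma groupoid_to_plumbing (M : groupType) : groupoid_presentation port_order M ->
  exists g : pgen c -> M, [/\ satisfies (@plumbing_rel G c) g,
    forall N : set M, subgroup_set N -> (forall x, N (g x)) -> forall y, N y
  & forall (Q : groupType) (q : pgen c -> Q), pdata_ok (eval_data q) port_order ->
     exists2 h : M -> Q, {morph h : x y / x * y} & forall x, h (g x) = q x].
Proof.
move=> [D0 [ok0 gen0 univ0]].
have [conT acT] := tree_maximal c.
(* In the gauge of this potential the tree edges have value 1, as in the presentation. *)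
have [g0 g0T] := tree_potential (ok_rev ok0) acT.
pose D := pgauge D0 g0.
have okD : pdata_ok D port_order by exact: pgauge_ok.
have DT d : d.1 \in tree c -> pd_d D d = 1 by exact: g0T.
pose g (x : pgen c) : M := match x with
  | inl (inl (inl v)) => pd_v D v
  | inl (inl (inr h)) => pd_h D h
  | inl (inr e) => let d := (val e, true) in
      if leV c (d_start d) (d_end d) then pd_d D d else (pd_d D d)^-1
  | inr (inl k) => pd_a D k
  | inr (inr k) => pd_b D k end.
have gd d : fg_eval g (gamma_d c d) = pd_d D d.
  case: (boolP (d.1 \in tree c)) => [dT|dT]; first by rewrite gamma_d_tree // fg_eval1 DT.
  have main e (eT : e \notin tree c) : fg_eval g (gamma_d c (e, true)) = pd_d D (e, true).
    rewrite /gamma_d insubT /=; case: (boolP (leV _ _ _)) => h;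
      rewrite ?fg_evalV fg_eval_gen /= ?h // (negbTE h) invgK //.
  case: d dT => e [] dT; first exact: main.
  by rewrite -[(e, false)]/(d_rev (e, true)) gamma_d_rev fg_evalV main // (ok_rev okD).
have evg : eval_data g = D.
  have -> : D = Pdata (pd_v D) (pd_h D) (pd_d D) (pd_a D) (pd_b D) by [].
  by rewrite /eval_data; congr Pdata; apply/funext.
exists g; split.
- move=> i; apply/eval_data_rel; rewrite evg; case: okD => [Dr Dd Dh Da Db Dp].
  by case: i => //= [e]; exact: (Dd (val e, true)).
- move=> N sN gN.
  have Nd d : N (pd_d D d).
    case: (boolP (d.1 \in tree c)) => [dT|dT]; first by rewrite DT //; case: sN.
    have N1 e (eT : e \notin tree c) : N (pd_d D (e, true)).
      have := gN (inl (inr (exist _ e eT))); rewrite /g /=; case: ifP => // _.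
      by case: sN => _ _ NV /NV; rewrite invgK.
    case: d dT => e [] dT; first exact: N1.
    rewrite -[(e, false)]/(d_rev (e, true)) (ok_rev okD); case: sN => _ _; apply.
    exact: N1.
  apply: (gen0 g0 N sN); split=> [v|h|//|k|k].
  + exact: (gN (inl (inl (inl v)))).
  + exact: (gN (inl (inl (inr h)))).
  + exact: (gN (inr (inl k))).
  + exact: (gN (inr (inr k))).
- move=> Q q okE.
  have [f [u [fM [fv fh fd fa fb]]]] := univ0 Q (eval_data q) okE.
  have fV := morphV fM; have f1 := morph1 fM.
  (* The change of gauge between [eval_data q] and the image of [D]. Both are 1 on the tree edges,
     so [k] is constant, and conjugating [f] by its value gives the required morphism. *)
  pose k v := f (g0 v) * u v.
  have kd d : f (pd_d D d) = k (d_start d) * pd_d (eval_data q) d / k (d_end d).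
    by rewrite /D /= !fM fV fd /k /= !gsimp.
  have kc v w : k v = k w.
    move/connectP: (conT v w) => [p pth ->]; elim: p v pth => //= x p IH v.
    move=> /andP[/tree_adjP[d [dT <- dx]] pth]; rewrite -(IH _ pth) -dx.
    have := kd d; rewrite DT // f1 /= gamma_d_tree // fg_eval1 mulg1.
    by move/esym/divg1_eq.
  have [w _] : exists w : vertex G, True.
    by have /card_gt0P[w _] := vertex_nonempty G; exists w.
  exists (fun y => (k w)^-1 * f y * k w); first by move=> x y; rewrite fM !gsimp.
  have kv v : k v = k w by exact: kc.
  have kk v : f (g0 v) = k w / u v by rewrite -(kv v) /k mulgK.
  move=> [[[v|h]|e]|[j|j]]; rewrite /g /=.
  + by rewrite !fM fV fv kk /= !gsimp.
  + by rewrite !fM fV fh kk /= !gsimp.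
  + have e1 := kd (val e, true); rewrite !kv in e1.
    have e2 : pd_d (eval_data q) (val e, true) =
        if leV c (d_start (val e, true)) (d_end (val e, true)) then q (inl (inr e)) else (q (inl (inr e)))^-1.
      rewrite /= /gamma_d valK; case: ifP => _; by rewrite ?fg_evalV fg_eval_gen.
    case: ifP e2 => _ e2; rewrite ?fV e1 e2 !gsimp //.
  + by rewrite !fM fV fa kk /= !gsimp.
  + by rewrite !fM fV fb kk /= !gsimp.
Qed.

Lemma has_presentation_reindex (M : groupType) (X : choiceType) (I J : Type)
    (rel : I -> relation_of X) (f : J -> I) (g : I -> J) : cancel g f ->
  has_presentation M rel -> has_presentation M (fun j => rel (f j)).
Proof.
move=> gK [h [hs hk]]; exists h; split=> // x; rewrite hk.
have -> // : range (fun i => (rel i).1 / (rel i).2) =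
   range (fun j => (rel (f j)).1 / (rel (f j)).2).
by apply/seteqP; split=> _ [i _ <-]; [exists (g i) => //; rewrite gK|exists (f i)].
Qed.

Lemma plumbing_presentations (M : groupType) :
  groupoid_presentation (fun=> enum (port G)) M ->
  [/\ has_presentation M (@plumbing_rel G c),
      exists (X I : finType) (rel : I -> relation_of X),
        #|X| = #|I| /\ has_presentation M rel
    & (0 < #|arrowhead G|)%N ->
      exists h : arrowhead G, has_presentation M
          (fun i : {i : prel_index c | i <> RelArrowhead c h} => plumbing_rel (proj1_sig i))].
Proof.
move=> /(groupoid_presentation_perm (fun=> enum_uniq _) port_order_perm).
move=> /groupoid_to_plumbing[g [gs ggen guniv]].
have P1 : has_presentation M (@plumbing_rel G c).
  apply: (has_presentationI gs ggen) => Q q qs; apply: guniv.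
  by apply: (eval_data_ok (h0 := None)) => i _; exact: qs.
split=> //.
(* The kinds of relations match the kinds of generators: (R1) the vertices, (R2) the arrowheads,
   (R3) the edges off the tree, and (R4) the handles, twice. *)
- pose I : finType := (vertex G + arrowhead G + cotree_edge c + (handle G + handle G))%type.
  pose f (i : I) : prel_index c := match i with
    | inl (inl (inl v)) => RelVertex c v | inl (inl (inr h)) => RelArrowhead c h
    | inl (inr e) => RelEdge e | inr (inl k) => RelAlpha c k | inr (inr k) => RelBeta c k end.
  pose f' (i : prel_index c) : I := match i with
    | RelVertex v => inl (inl (inl v)) | RelArrowhead h => inl (inl (inr h))
    | RelEdge e => inl (inr e) | RelAlpha k => inr (inl k) | RelBeta k => inr (inr k) end.
  exists (pgen c), I, (fun i => plumbing_rel (f i)); split=> //.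
  by apply: (@has_presentation_reindex _ _ _ _ _ f f') P1; case.
- move=> /card_gt0P[h _]; exists h; apply: (has_presentationI (g := g)) => //.
  move=> Q q qs; apply: guniv; apply: (eval_data_ok (h0 := Some h)) => i hi.
  exact: (qs (exist _ i (hi h erefl))).
Qed.

End PlumbingPresentationProof.

(** * Geometry of the pieces *)

Ltac ctsg := repeat first
  [ cts_step | solve [move=> ?; exact: cvg_id]
  | match goal with |- forall _, continuous_at _ (+%R ?x) => apply: (@ctsD _ _ (fun=> x) idfun) end | exact: clamp_cts | apply: cts_pair
  | exact: continuous_cos | exact: continuous_sin
  | apply: (cts_comp _ (@clamp_cts _))
  | apply: (cts_comp _ (@continuous_cos _)) | apply: (cts_comp _ (@continuous_sin _))
  | match goal with H : continuous _ |- _ => first [exact: H | apply: (cts_comp _ H)] end ].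

(** * Complex numbers, arguments and turns *)

Section Plane.
Variable R : realType.
Local Notation plane := (R * R)%type.
Implicit Types (z w a : plane) (s t : R).

Definition cm (z w : plane) : plane := (z.1 * w.1 - z.2 * w.2, z.1 * w.2 + z.2 * w.1).
Definition cj (z : plane) : plane := (z.1, - z.2).

Lemma cmA : associative cm.
Proof. by move=> x y z; rewrite /cm /=; congr pair; ring. Qed.
Lemma cmC : commutative cm.
Proof. by move=> x y; rewrite /cm /=; congr pair; ring. Qed.
Lemma cm1 z : cm z (1, 0) = z.
Proof. by case: z => x y; rewrite /cm /=; congr pair; ring. Qed.
Lemma cjM z w : cj (cm z w) = cm (cj z) (cj w).
Proof. by rewrite /cm /cj /=; congr pair; ring. Qed.
Lemma cjK : involutive cj.
Proof. by case=> x y; rewrite /cj /= opprK. Qed.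
Lemma sqnormM z w : sqnorm (cm z w) = sqnorm z * sqnorm w.
Proof. by rewrite /sqnorm /cm /=; ring. Qed.
Lemma sqnorm_cj z : sqnorm (cj z) = sqnorm z.
Proof. by rewrite /sqnorm /cj /=; ring. Qed.
Lemma cm_cj z : sqnorm z = 1 -> cm z (cj z) = (1, 0).
Proof. by rewrite /sqnorm => h; rewrite /cm /cj /=; congr pair; rewrite -?h; ring. Qed.
Lemma cmK z w : sqnorm w = 1 -> cm (cm z w) (cj w) = z.
Proof. by move=> h; rewrite -cmA cm_cj // cm1. Qed.
Lemma cmVK z w : sqnorm w = 1 -> cm (cm z (cj w)) w = z.
Proof. by move=> h; rewrite -{2}(cjK w) cmK // sqnorm_cj. Qed.
Lemma cisD s t : cis (s + t) = cm (cis s) (cis t).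
Proof. by rewrite /cis /cm /= cosD sinD [sin s * _ + _]addrC. Qed.
Lemma cisN s : cis (- s) = cj (cis s).
Proof. by rewrite /cis /cj /= cosN sinN. Qed.
Lemma cis0 : cis 0 = (1, 0) :> plane.
Proof. by rewrite /cis cos0 sin0. Qed.
Lemma sqnorm_cis t : sqnorm (cis t) = 1.
Proof. by rewrite /sqnorm /= cos2Dsin2. Qed.
Lemma cis_pi : cis (pi : R) = (-1, 0).
Proof. by rewrite /cis cospi sinpi. Qed.

Lemma cis_cts : continuous (@cis R).
Proof. by apply: cts_pair; [exact: continuous_cos|exact: continuous_sin]. Qed.

Lemma cis_int t (n : int) : cis (t + n%:~R * (2 * pi)) = cis t.
Proof.
have c2 (k : nat) (u : R) : cis (u + k%:R * (2 * pi)) = cis u.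
  have e : k%:R * (2 * pi) = (pi *+ 2) *+ k :> R by rewrite -[RHS]mulr_natl -[pi *+ 2]mulr_natl.
  by rewrite /cis e (periodicn (@cosD2pi R)) (periodicn (@sinD2pi R)).
case: n => k; first exact: c2.
rewrite -(c2 k.+1) NegzE; congr cis; rewrite rmorphN /= -pmulrn; ring.
Qed.

Lemma pi_pos : 0 < (pi : R). Proof. exact: pi_gt0. Qed.

Lemma cis_inj s t : `|s - t| < 2 * pi -> cis s = cis t -> s = t.
Proof.
move=> st e; apply/eqP; rewrite -subr_eq0; apply/negPn/negP => ne.
have p0 := pi_pos.
have c1 : cos (s - t) = 1.
  by have := cisD s (- t); rewrite cisN e cm_cj ?sqnorm_cis // => -[].
pose x := `|s - t| / 2.
have x0 : 0 < x < pi by rewrite /x divr_gt0 ?normr_gt0 //=; lra.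
have : 0 < sin x by exact: sin_gt0_pi.
have : cos (x + x) = 1.
  have -> : x + x = `|s - t| by rewrite /x; field.
  by case: (ger0P (s - t)) => _; rewrite ?cosN.
by rewrite cosD; have := cos2Dsin2 x; nra.
Qed.

Lemma cis_surj z : sqnorm z = 1 -> exists2 t, 0 <= t < 2 * pi & cis t = z.
Proof.
case: z => x y; rewrite /sqnorm /= => h; have p0 := pi_pos.
have x1 : -1 <= x <= 1 by nra.
have ca : cos (acos x) = x by rewrite acosK // in_itv.
have a0 : 0 <= acos x <= pi by rewrite acos_ge0 //= acos_lepi.
have sa : sin (acos x) = `|y|.
  by rewrite sin_acos // -(sqrtr_sqr y); congr Num.sqrt; lra.
case: (leP 0 y) => hy.
  exists (acos x); first lra.
  by rewrite /cis ca sa ger0_norm.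
exists (2 * pi - acos x).
  suff : 0 < acos x by lra.
  by apply: acos_gt0; nra.
have e : cis (2 * pi - acos x) = cis (- acos x).
  by rewrite -[RHS](cis_int _ 1) mul1r addrC.
by rewrite e /cis cosN sinN ca sa ltr0_norm // opprK.
Qed.

Definition arg (z : plane) : R := xget 0 [set t | 0 <= t < 2 * pi /\ cis t = z].

Lemma argP z : sqnorm z = 1 -> 0 <= arg z < 2 * pi /\ cis (arg z) = z.
Proof.
move=> /cis_surj[t t0 tz]; rewrite /arg.
by case: xgetP => [//|/(_ t)]; case.
Qed.

Lemma cis_arg z : sqnorm z = 1 -> cis (arg z) = z. Proof. by move/argP => []. Qed.

(** The number of full turns in the angle [s], which is [arg (cis s)] plus [fl s] turns. *)
Definition fl (s : R) : int := Num.floor (s / (2 * pi)).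

Lemma flE s (n : int) : n%:~R * (2 * pi) <= s -> s < (n + 1)%:~R * (2 * pi) -> fl s = n.
Proof.
have p0 : 0 < 2 * pi :> R by rewrite mulr_gt0 ?pi_pos.
move=> h1 h2; rewrite /fl; apply/eqP; rewrite floor_eq.
by rewrite ler_pdivlMr // h1 ltr_pdivrMr.
Qed.

Lemma flP s : (fl s)%:~R * (2 * pi) <= s /\ s < (fl s + 1)%:~R * (2 * pi).
Proof.
have p0 : 0 < 2 * pi :> R by rewrite mulr_gt0 ?pi_pos.
by rewrite -ler_pdivlMr // -ltr_pdivrMr //; apply/andP; exact: floor_itv.
Qed.

Lemma flD s (n : int) : fl (s + n%:~R * (2 * pi)) = fl s + n.
Proof.
have [h1 h2] := flP s; apply: flE; rewrite !intrD in h2 *; lra.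
Qed.

Lemma fl_arg z : sqnorm z = 1 -> fl (arg z) = 0.
Proof. by move=> /argP[h _]; apply: flE => /=; rewrite ?mul0r ?mul1r; lra. Qed.

Lemma cis_eq s t : cis s = cis t -> exists n : int, s = t + n%:~R * (2 * pi).
Proof.
move=> e; exists (fl s - fl t).
have [h1 h2] := flP s; have [h3 h4] := flP t.
apply: cis_inj; last by rewrite cis_int.
rewrite !(intrD, intrN, mulrDl) in h1 h2 h3 h4 *; rewrite ltr_norml; lra.
Qed.

Lemma arg_lift s : arg (cis s) = s - (fl s)%:~R * (2 * pi).
Proof.
have [h e] := argP (sqnorm_cis s); have [n an] := cis_eq e.
rewrite an; suff -> : fl s = - n by rewrite intrN; ring.
have := fl_arg (sqnorm_cis s); rewrite an flD => /eqP.
by rewrite addr_eq0 => /eqP.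
Qed.

(* Equal to the argument in ]-pi/3, pi/3[, and continuous on the whole plane. *)
Definition ang (z : plane) : R := atan (z.2 / Num.max z.1 2^-1).

Lemma ang_cts : continuous ang.
Proof.
move=> z; apply: continuous_comp; last exact: continuous_atan.
apply: cvgM; first exact: cvg_snd.
apply: cvgV; first by apply: lt0r_neq0; rewrite lt_max; apply/orP; right; lra.
by apply: (@cts_max R); cts.
Qed.

Lemma ang_bound z : - (pi / 2) < ang z < pi / 2.
Proof. by rewrite /ang atan_gtNpi2 atan_ltpi2. Qed.

Lemma cis_ang z : sqnorm z = 1 -> 2^-1 < z.1 -> cis (ang z) = z.
Proof.
case: z => x y; rewrite /sqnorm /= => h x0; rewrite /cis /ang /= max_l ?(ltW x0) //.
have ca : cos (atan (y / x)) = x.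
  rewrite cos_atan.
  have -> : 1 + (y / x) ^+ 2 = x ^- 2.
    have xx : x != 0 by lra.
    have y2 : y ^+ 2 = 1 - x ^+ 2 by rewrite -h addrC addKr.
    by rewrite expr_div_n y2; field.
  by rewrite -exprVn sqrtr_sqr normfV invrK gtr0_norm //; lra.
have ta := atanK (y / x); rewrite /tan ca in ta.
have xx : x != 0 by lra.
by congr pair => //; move/(congr1 (fun u => u * x)): ta; rewrite !divfK.
Qed.

Lemma ang_cis t : - (pi / 2) < t < pi / 2 -> 2^-1 < cos t -> ang (cis t) = t.
Proof.
move=> t0 ct; rewrite /ang /cis /= max_l ?(ltW ct) //.
by rewrite -[sin t / _]/(tan t) tanK // in_itv.
Qed.

Lemma ang1 : ang (1, 0) = 0. Proof. by rewrite /ang /= mul0r atan0. Qed.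

Lemma cos_near0 : exists2 e : R, 0 < e & e < pi / 2 /\ forall t, `|t| < e -> 2^-1 < cos t.
Proof.
have : \forall t \near (0 : R), 2^-1 < cos t.
  by apply: (cvgr_gt _ (@continuous_cos R 0)); rewrite cos0; lra.
move=> /nbhs_ballP[e /= e0 He]; have p0 := pi_pos.
exists (Num.min e (pi / 4)); first by rewrite lt_min e0; lra.
split; first by rewrite gt_min; apply/orP; right; lra.
move=> t; rewrite lt_min => /andP[te _]; apply: He.
by rewrite /ball /= sub0r normrN.
Qed.

Definition rel_dir (a0 a : plane) := cm a (cj a0).
(** For unit vectors, the short arc from [a0] towards [a] at constant speed. The formula is total
    and continuous in all its arguments; it ends at [a] as soon as the real part of [rel_dir a0 a]
    exceeds one half. *)
Definition lerp (a0 a : plane) (l : R) : plane := cm a0 (cis (l * ang (rel_dir a0 a))).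

Lemma sqnorm_lerp a0 a l : sqnorm a0 = 1 -> sqnorm (lerp a0 a l) = 1.
Proof. by move=> h; rewrite sqnormM h sqnorm_cis mulr1. Qed.

Lemma lerp0 a0 a : lerp a0 a 0 = a0.
Proof. by rewrite /lerp mul0r cis0 cm1. Qed.

Lemma sqnorm_rel a0 a : sqnorm a0 = 1 -> sqnorm a = 1 -> sqnorm (rel_dir a0 a) = 1.
Proof. by move=> h k; rewrite sqnormM sqnorm_cj h k mulr1. Qed.

Lemma cis_ang_rel a0 a : sqnorm a0 = 1 -> sqnorm a = 1 -> 2^-1 < (rel_dir a0 a).1 ->
  cm a0 (cis (ang (rel_dir a0 a))) = a.
Proof.
move=> h k h2; rewrite cis_ang ?sqnorm_rel // /rel_dir cmC cmVK //.
Qed.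

Lemma lerp1 a0 a : sqnorm a0 = 1 -> sqnorm a = 1 -> 2^-1 < (rel_dir a0 a).1 ->
  lerp a0 a 1 = a.
Proof. by move=> *; rewrite /lerp mul1r cis_ang_rel. Qed.

Lemma rel_dirr a : sqnorm a = 1 -> rel_dir a a = (1, 0).
Proof. exact: cm_cj. Qed.

Lemma lerpp a l : sqnorm a = 1 -> lerp a a l = a.
Proof. by move=> h; rewrite /lerp rel_dirr // ang1 mulr0 cis0 cm1. Qed.

Lemma rel_dir_cis s t : rel_dir (cis s) (cis t) = cis (t - s).
Proof. by rewrite /rel_dir -cisN cisD. Qed.

Lemma lift_near a0 t0 a : cis t0 = a0 -> sqnorm a = 1 -> 2^-1 < (rel_dir a0 a).1 ->
  a = cis (t0 + ang (rel_dir a0 a)).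
Proof. by move=> h k h2; rewrite cisD h cis_ang_rel // -h sqnorm_cis. Qed.

Lemma rel_dir_near a0 : sqnorm a0 = 1 -> \forall a \near a0, 2^-1 < (rel_dir a0 a).1.
Proof.
move=> h; have c : continuous (fun a => (rel_dir a0 a).1) by rewrite /rel_dir /cm /=; cts.
by apply: (cvgr_gt _ (c a0)); rewrite rel_dirr //=; lra.
Qed.

Lemma ang_rel_near a0 e : sqnorm a0 = 1 -> 0 < e ->
  \forall a \near a0, `|ang (rel_dir a0 a)| < e.
Proof.
move=> h e0; have c : continuous (fun a => `|ang (rel_dir a0 a)|).
  have ca : continuous (fun a => ang (rel_dir a0 a)).
    apply: (cts_comp _ ang_cts); rewrite /rel_dir /cm /=.
    by apply: cts_pair; cts.
  by move=> a; apply: cvg_norm; exact: ca.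
by apply: (cvgr_lt _ (c a0)); rewrite rel_dirr // ang1 normr0.
Qed.

(* The number of positive crossings of the ray of argument 0 on the way from w
   to a nearby w'. *)
Definition ncross (w w' : plane) : int := fl (arg w + ang (rel_dir w w')).

Lemma ncrossE s s' : - (pi / 2) < s' - s < pi / 2 -> 2^-1 < cos (s' - s) ->
  ncross (cis s) (cis s') = fl s' - fl s.
Proof.
move=> h1 h2; rewrite /ncross arg_lift rel_dir_cis ang_cis //.
have -> : s - (fl s)%:~R * (2 * pi) + (s' - s) = s' + (- fl s)%:~R * (2 * pi).
  by rewrite intrN; ring.
by rewrite flD.
Qed.

(** On lifts to the line, [ncross] is a difference of values of [fl], and these differences
    telescope; [w'] is taken so close to [w] that the three angles add up. *)
Lemma ncross_add w0 w : sqnorm w0 = 1 -> sqnorm w = 1 -> 2^-1 < (rel_dir w0 w).1 ->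
  \forall w' \near w, sqnorm w' = 1 -> ncross w0 w' = ncross w0 w + ncross w w'.
Proof.
move=> h0 h1 h2; have [e e0 [ep ec]] := cos_near0.
have c : continuous (fun a => (rel_dir w0 a).1) by rewrite /rel_dir /cm /=; cts.
have n1 : \forall a \near w, 2^-1 < (rel_dir w0 a).1 by apply: (cvgr_gt _ (c w)).
have n2 := rel_dir_near h1.
have n3 := ang_rel_near h1 e0.
have a0 := argP h0; set s0 := arg w0 in a0; set x := ang (rel_dir w0 w).
have xb := ang_bound (rel_dir w0 w); rewrite -/x in xb.
have cx : 2^-1 < cos x.
  by have := cis_ang (sqnorm_rel h0 h1) h2; rewrite -/x => /(congr1 fst) /= ->.
have we : w = cis (s0 + x) by apply: lift_near => //; case: a0.
(* The room left to the angle [x] between [- (pi / 2)] and [pi / 2]. *)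
pose mrg := Num.min (pi / 2 - x) (pi / 2 + x).
have m0 : 0 < mrg by rewrite lt_min; lra.
have cc : \forall u \near (0 : R), 2^-1 < cos (x + u).
  have cu : continuous (fun u : R => cos (x + u)).
    by ctsg.
  by apply: (cvgr_gt _ (cu 0)); rewrite addr0.
have [d d0 Hd] : exists2 d, 0 < d & forall u, `|u| < d -> 2^-1 < cos (x + u).
  have /nbhs_ballP[d /= d0 Hd] := cc; exists d => // u ud; apply: Hd.
  by rewrite /ball /= sub0r normrN.
have n4 := ang_rel_near h1 m0; have n5 := ang_rel_near h1 d0.
near=> w' => hw'.
have k2 : 2^-1 < (rel_dir w w').1 by near: w'.
have k3 : `|ang (rel_dir w w')| < e by near: w'.
have k4 : `|ang (rel_dir w w')| < mrg by near: w'.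
have k5 : `|ang (rel_dir w w')| < d by near: w'.
have we' := lift_near (esym we) hw' k2.
set u := ang (rel_dir w w') in we' k3 k4 k5.
move: k4; rewrite lt_min !ltr_norml => k4.
rewrite -(cis_arg h0) -/s0 we' we !ncrossE //; first ring.
- by rewrite [_ - _](_ : _ = u); [rewrite ltr_norml in k3; lra|ring].
- by rewrite [_ - _](_ : _ = u); [exact: ec|ring].
- by rewrite [_ - _](_ : _ = x); [|ring].
- by rewrite [_ - _](_ : _ = x); [|ring].
- by rewrite [_ - _](_ : _ = x + u); [lra|ring].
- by rewrite [_ - _](_ : _ = x + u); [exact: Hd|ring].
Unshelve. all: by end_near. Qed.

(** Arguments start at 0 on the ray itself, so that only leaving the ray downwards changes the
    number of turns. *)
Lemma ncross_level a : sqnorm a = 1 -> \forall a' \near a, sqnorm a' = 1 ->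
  ncross a a' = if (0 < a.1) && (a.2 == 0) && (a'.2 < 0) then -1 else 0.
Proof.
move=> h; have p0 := pi_pos; have [t0 t0b] := argP h; set t := arg a in t0 t0b *.
have [e e0 [ep ec]] := cos_near0.
(* Off the ray, the distance of the argument to both ends of its interval. *)
pose m := if t == 0 then e else Num.min t (2 * pi - t).
have m0 : 0 < m by rewrite /m; case: eqP => // tz; rewrite lt_min; lra.
have [k1 k2] := (ang_rel_near h e0, ang_rel_near h m0).
near=> a' => h'.
have k3 : 2^-1 < (rel_dir a a').1 by near: a'; exact: rel_dir_near.
have k4 : `|ang (rel_dir a a')| < e by near: a'.
have k5 : `|ang (rel_dir a a')| < m by near: a'.
have ea := lift_near t0b h' k3; rewrite /ncross -/t.
set u := ang (rel_dir a a') in k4 k5 ea *; rewrite ltr_norml in k4.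
have [tz|tnz] := eqVneq t 0.
  have [a1 a2] : a.1 = 1 /\ a.2 = 0 by rewrite -t0b tz cis0.
  rewrite a1 a2 ltr01 eqxx /= tz add0r ea tz add0r /=.
  case: (ltP u 0) => hu.
    have -> : sin u < 0.
      by rewrite -oppr_gt0 -sinN; apply: sin_gt0_pi; lra.
    by apply: flE => /=; rewrite ?mulN1r ?mul0r; lra.
  have -> : (sin u < 0) = false.
    by apply/negbTE; rewrite -leNgt; apply: sin_ge0_pi; lra.
  by apply: flE => /=; rewrite ?mul1r ?mul0r; lra.
have -> : (0 < a.1) && (a.2 == 0) = false.
  apply/negbTE/negP => /andP[a1 /eqP a2].
  have e1 : a = cis 0.
    rewrite cis0 [a]surjective_pairing a2; congr pair.
    by have := h; rewrite /sqnorm a2; nra.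
  case/eqP: tnz; apply: cis_inj; last by rewrite t0b.
  by rewrite subr0 ltr_norml; lra.
move: k5; rewrite /m (negbTE tnz) lt_min !ltr_norml => k5.
by apply: flE => /=; rewrite ?mul1r ?mul0r; lra.
Unshelve. all: by end_near. Qed.

(* Points close to a0 are joined to it without crossing the real axis. *)
Lemma lerp_level a0 : sqnorm a0 = 1 -> \forall a \near a0, sqnorm a = 1 ->
  forall l, 0 <= l <= 1 -> (0 <= a.2 -> 0 <= (lerp a0 a l).2) /\ (a.2 <= 0 -> (lerp a0 a l).2 <= 0).
Proof.
move=> h; have p0 := pi_pos; have [t0 t0b] := argP h; set t := arg a0 in t0 t0b *.
have sgn (x l : R) : - (pi / 2) < x < pi / 2 -> 0 <= l <= 1 ->
    (0 <= sin x -> 0 <= sin (l * x)) /\ (sin x <= 0 -> sin (l * x) <= 0).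
  move=> xb l01; case: (ltgtP x 0) => hx.
  - have s1 : sin x < 0 by rewrite -oppr_gt0 -sinN; apply: sin_gt0_pi; lra.
    split; first by rewrite leNgt s1.
    by move=> _; rewrite -oppr_ge0 -sinN; apply: sin_ge0_pi; nra.
  - have s1 : 0 < sin x by apply: sin_gt0_pi; lra.
    split; last by rewrite leNgt s1.
    by move=> _; apply: sin_ge0_pi; nra.
  - by rewrite hx mulr0 sin0.
have [z0|z0] := eqVneq a0.2 0.
  near=> a => ha l l01.
  have k3 : 2^-1 < (rel_dir a0 a).1 by near: a; exact: rel_dir_near.
  have ea := lift_near t0b ha k3.
  have xb := ang_bound (rel_dir a0 a); rewrite /lerp; set x := ang _ in ea xb *.
  have -> : a.2 = a0.1 * sin x.
    by rewrite ea cisD t0b /cm /= z0; ring.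
  have -> : (cm a0 (cis (l * x))).2 = a0.1 * sin (l * x) by rewrite /cm /= z0; ring.
  have [s1 s2] := sgn x l xb l01.
  case: (lerP 0 a0.1) => ha0.
    have {}ha0 : 0 < a0.1 by rewrite lt_neqAle ha0 andbT; apply/eqP => e;
      have := h; rewrite /sqnorm -e z0; lra.
    by rewrite !pmulr_rge0 // !pmulr_rle0.
  by rewrite !nmulr_rge0 // !nmulr_rle0.
have csin : continuous (fun u : R => sin (t + u) * a0.2).
  by ctsg.
have [d d0 Hd] : exists2 d, 0 < d & forall u, `|u| < d -> 0 < sin (t + u) * a0.2.
  have : \forall u \near (0 : R), 0 < sin (t + u) * a0.2.
    apply: (cvgr_gt _ (csin 0)); rewrite addr0.
    have -> : sin t = a0.2 by rewrite -t0b.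
    by rewrite -expr2 exprn_even_gt0.
  move=> /nbhs_ballP[d /= d0 Hd]; exists d => // u ud; apply: Hd.
  by rewrite /ball /= sub0r normrN.
near=> a => ha l l01.
have k3 : 2^-1 < (rel_dir a0 a).1 by near: a; exact: rel_dir_near.
have k4 : `|ang (rel_dir a0 a)| < d by near: a; exact: ang_rel_near.
have ea := lift_near t0b ha k3; rewrite /lerp; set x := ang _ in ea k4 *.
have h1 : 0 < a.2 * a0.2 by rewrite ea; exact: Hd.
have h2 : 0 < (cm a0 (cis (l * x))).2 * a0.2.
  rewrite -{1}t0b -cisD; apply: Hd; apply: le_lt_trans k4.
  by rewrite normrM ger0_norm ?ler_piMl //; lra.
by split; nra.
Unshelve. all: by end_near. Qed.

End Plane.

(** * The disks of the ports *)

Section Slots.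
Variables (R : realType) (G : plumbing_graph).
Local Notation plane := (R * R)%type.
Local Notation r := (slot_radius R G).
Implicit Types (p q : port G) (z a w : plane).

Definition sc p : R := (slot_center R p).1.
Definition off (c : R) (z : plane) : R := sqnorm (z.1 - c, z.2).
Definition pol (c rho : R) (a : plane) : plane := (c + rho * a.1, rho * a.2).

Lemma slot_centerE p : slot_center R p = (sc p, 0). Proof. by []. Qed.

Lemma outside_slotE p z : outside_slot p z <-> r ^+ 2 <= off (sc p) z.
Proof. by rewrite /outside_slot /off /= subr0. Qed.

Lemma slot_circleE p t : slot_circle p t = pol (sc p) r (cis t).
Proof. by rewrite /slot_circle /pol /= add0r. Qed.

Lemma card_port_gt0 : (0 < #|port G|)%N.
Proof. by apply/card_gt0P; exists None. Qed.

Lemma slot_radius_bounds : 0 < r <= 4^-1.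
Proof.
have := card_port_gt0; rewrite /slot_radius; case: #|_| => // n _.
have h : (2 : R) <= n.+2%:R by rewrite ler_nat.
rewrite invr_gt0 lef_pV2 ?posrE; lra.
Qed.

Lemma slot_spacing : 2 / (#|port G|.+1%:R) = 4 * r :> R.
Proof.
have : (#|port G|.+1%:R : R) != 0 by rewrite pnatr_eq0.
by rewrite /slot_radius; move: (_.+1%:R) => x nz; field.
Qed.

Lemma scE p : sc p = -1 + 4 * r * (enum_rank p).+1%:R.
Proof. by rewrite /sc /= -slot_spacing; ring. Qed.

Lemma slot_total : 4 * r * #|port G|.+1%:R = 2.
Proof. by rewrite -slot_spacing mulfVK // pnatr_eq0. Qed.

Lemma sc_bounds p : -1 + 4 * r <= sc p <= 1 - 4 * r.
Proof.
have [r0 _] := andP slot_radius_bounds; rewrite scE.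
have h1 : (1 : R) <= (enum_rank p).+1%:R by rewrite ler1n.
have h2 : ((enum_rank p).+1%:R : R) + 1 <= #|port G|.+1%:R.
  by rewrite natr1 ler_nat ltnS.
by have := slot_total; nra.
Qed.

Lemma sc_lt p q : (enum_rank p < enum_rank q)%N -> sc p + 4 * r <= sc q.
Proof.
have [r0 _] := andP slot_radius_bounds; move=> pq; rewrite !scE.
have h : ((enum_rank p).+1%:R : R) + 1 <= (enum_rank q).+1%:R by rewrite natr1 ler_nat.
nra.
Qed.

Lemma sc_sep p q : p != q -> 4 * r <= `|sc p - sc q|.
Proof.
have [r0 _] := andP slot_radius_bounds => pq.
have : enum_rank p != enum_rank q :> nat by apply: contra pq => /eqP/val_inj/enum_rank_inj ->.
rewrite neq_ltn => /orP[]/sc_lt h; last by rewrite ger0_norm; lra.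
by rewrite ler0_norm; lra.
Qed.

Lemma off_pol c rho a : sqnorm a = 1 -> off c (pol c rho a) = rho ^+ 2.
Proof. by rewrite /off /pol /sqnorm /= => h; rewrite -[RHS]mulr1 -h; ring. Qed.

(** Centres are at least [4 * r] apart, so the disks of radius [2 * r] around them do not
    overlap. *)
Lemma off_other p q z : p != q -> off (sc p) z <= (2 * r) ^+ 2 -> (2 * r) ^+ 2 <= off (sc q) z.
Proof.
move=> /sc_sep; have [r0 _] := andP slot_radius_bounds.
rewrite /off /sqnorm /= ler_normr; move: (sc p) (sc q) => c c' h1 h2.
have [h3 h4] : z.1 - c <= 2 * r /\ - (2 * r) <= z.1 - c by split; nra.
by case/orP: h1 => h1; nra.
Qed.

Lemma off_unit p z : off (sc p) z < (4 * r) ^+ 2 -> sqnorm z < 1.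
Proof.
have := sc_bounds p; have [r0 r1] := andP slot_radius_bounds.
rewrite /off /sqnorm /=; move: (sc p) => c cb h.
have zc : `|z.1 - c| < 4 * r by rewrite ltr_norml; apply/andP; split; nra.
have e : z.1 ^+ 2 + z.2 ^+ 2 = (z.1 - c) ^+ 2 + z.2 ^+ 2 + 2 * c * (z.1 - c) + c ^+ 2 by ring.
have hc : c * (z.1 - c) <= (1 - 4 * r) * (4 * r).
  move: zc; rewrite ltr_norml => /andP[z1 z2].
  case: (lerP 0 c) => c0; nra.
have c2 : c ^+ 2 <= (1 - 4 * r) ^+ 2 by nra.
rewrite e; nra.
Qed.

(** Centres are at distance at most [1 - 4 * r] from the origin, which leaves [3 * r] up to the ring
    of width [r] along the unit circle. *)
Lemma off_outer p z : (1 - r) ^+ 2 <= sqnorm z -> (3 * r) ^+ 2 <= off (sc p) z.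
Proof.
have := sc_bounds p; have [r0 r1] := andP slot_radius_bounds.
rewrite /off /sqnorm /=; move: (sc p) => c cb h.
pose s := Num.sqrt (z.1 ^+ 2 + z.2 ^+ 2).
have s2 : s ^+ 2 = z.1 ^+ 2 + z.2 ^+ 2 by rewrite sqr_sqrtr // addr_ge0 ?sqr_ge0.
have s0 : 0 <= s by exact: sqrtr_ge0.
have s1 : 1 - r <= s by rewrite -s2 in h; nra.
have sz : `|z.1| <= s by rewrite -sqrtr_sqr ler_sqrt ?addr_ge0 ?sqr_ge0 // lerDl sqr_ge0.
have cc : z.1 * c <= s * (1 - 4 * r).
  move: sz; rewrite ler_norml => /andP[z1 z2].
  by case: (lerP 0 c) => c0; nra.
case: (lerP 0 c) => c0; rewrite ler_norml in sz.
  have -> : (z.1 - c) ^+ 2 + z.2 ^+ 2 = s ^+ 2 - 2 * (z.1 * c) + c ^+ 2 by rewrite s2; ring.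
  have : z.1 * c <= s * c by nra.
  by nra.
have -> : (z.1 - c) ^+ 2 + z.2 ^+ 2 = s ^+ 2 - 2 * (z.1 * c) + c ^+ 2 by rewrite s2; ring.
have : z.1 * c <= s * - c by nra.
by nra.
Qed.

(** Takes the value 1 exactly on the circle of the slot, which can thus be recognized, and vanishes
    before the other slots and the unit circle are reached. *)
Definition bump p z : R := Num.max 0 (2 - off (sc p) z / r ^+ 2).

Lemma bump1 p a : sqnorm a = 1 -> bump p (pol (sc p) r a) = 1.
Proof.
have [r0 _] := andP slot_radius_bounds.
by move=> h; rewrite /bump off_pol // divff ?expf_neq0 ?lt0r_neq0 // max_r; lra.
Qed.

Lemma bump_eq1 p z : bump p z = 1 -> off (sc p) z = r ^+ 2.
Proof.
have [r0 _] := andP slot_radius_bounds.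
have rr : r ^+ 2 != 0 by rewrite expf_neq0 ?lt0r_neq0.
rewrite /bump; case: (leP 0 (2 - _)) => [h e|_ e]; last by exfalso; move: e; lra.
have {}e : off (sc p) z / r ^+ 2 = 1 by lra.
by rewrite -[LHS](divfK rr) e mul1r.
Qed.

Lemma bump0 p z : (2 * r) ^+ 2 <= off (sc p) z -> bump p z = 0.
Proof.
have [r0 _] := andP slot_radius_bounds => h.
rewrite /bump max_l // subr_le0 ler_pdivlMr ?exprn_gt0 //; nra.
Qed.

Lemma bump_other p q a : p != q -> sqnorm a = 1 -> bump q (pol (sc p) r a) = 0.
Proof.
move=> pq h; apply: bump0; apply: (off_other pq); rewrite off_pol //.
have [r0 _] := andP slot_radius_bounds; nra.
Qed.

Lemma bump_unit p z : sqnorm z = 1 -> bump p z = 0.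
Proof.
have [r0 r1] := andP slot_radius_bounds => h.
by apply: bump0; have := @off_outer p z; rewrite h => /(_ ltac:(nra)); nra.
Qed.

Definition bout z : R := Num.max 0 (1 - (1 - sqnorm z) / r).

Lemma bout1 z : sqnorm z = 1 -> bout z = 1.
Proof. by move=> h; rewrite /bout h subrr mul0r subr0 max_r // ler01. Qed.

Lemma bout_eq1 z : bout z = 1 -> sqnorm z = 1.
Proof.
have [r0 _] := andP slot_radius_bounds.
rewrite /bout; case: (leP 0 (1 - _)) => [h e|_ e]; last by exfalso; move: e; lra.
have {}e : (1 - sqnorm z) / r = 0 by lra.
by apply/eqP; move/eqP: e; rewrite mulf_eq0 invr_eq0 (gt_eqF r0) orbF subr_eq0 eq_sym.
Qed.

Lemma bout_slot p a : sqnorm a = 1 -> bout (pol (sc p) r a) = 0.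
Proof.
have [r0 r1] := andP slot_radius_bounds => h.
rewrite /bout max_l // subr_le0 ler_pdivlMr // mul1r.
case: (lerP ((1 - r) ^+ 2) (sqnorm (pol (sc p) r a))) => k; last by nra.
have := off_outer p k; rewrite off_pol //; nra.
Qed.

Lemma off_cts c : continuous (off c).
Proof. by rewrite /off /sqnorm /= => z; apply: ctsD; apply: ctsM; cts. Qed.
Lemma sqnorm_cts : continuous (@sqnorm R).
Proof. by rewrite /sqnorm => z; apply: ctsD; apply: ctsM; cts. Qed.
Lemma bump_cts p : continuous (bump p).
Proof.
rewrite /bump; apply: cts_max; first by cts.
by apply: ctsB; [cts|apply: ctsM; [exact: off_cts|cts]].
Qed.
Lemma bout_cts : continuous bout.
Proof.
rewrite /bout; apply: cts_max; first by cts.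
apply: ctsB; first by cts.
by apply: ctsM; [apply: ctsB; [cts|exact: sqnorm_cts]|cts].
Qed.

(** Integer powers of a unit complex number. The conjugate in place of the inverse keeps the map
    continuous on the whole plane. *)
Definition cpow (a : plane) (n : int) : plane :=
  match n with Posz k => iter k (cm a) (1, 0) | Negz k => iter k.+1 (cm (cj a)) (1, 0) end.

Lemma cpow_cis t n : cpow (cis t) n = cis (n%:~R * t).
Proof.
have c (k : nat) (s : R) : iter k (cm (cis s)) (1, 0) = cis (k%:R * s).
  elim: k => [|k IH] /=; first by rewrite mul0r cis0.
  by rewrite IH -cisD; congr cis; rewrite -natr1; ring.
case: n => k; first exact: c.
rewrite /cpow -cisN c NegzE; congr cis.
by rewrite rmorphN /= -pmulrn; ring.
Qed.

Lemma sqnorm_cpow a n : sqnorm a = 1 -> sqnorm (cpow a n) = 1.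
Proof. by move=> /cis_surj[t _ <-]; rewrite cpow_cis sqnorm_cis. Qed.

Lemma cm_cts (Z : topologicalType) (f g : Z -> plane) : continuous f -> continuous g ->
  continuous (fun u => cm (f u) (g u)).
Proof.
move=> cf cg.
have c1 (h : Z -> plane) : continuous h -> continuous (fun u => (h u).1).
  by move=> ch; apply: (cts_comp (g := fst) ch); cts.
have c2 (h : Z -> plane) : continuous h -> continuous (fun u => (h u).2).
  by move=> ch; apply: (cts_comp (g := snd) ch); cts.
by apply: cts_pair; [apply: ctsB|apply: ctsD]; apply: ctsM; auto.
Qed.

Lemma cj_cts : continuous (@cj R).
Proof.
have : continuous (fun z : plane => (z.1, 0 - z.2)) by apply: cts_pair; cts.
by rewrite (_ : (fun z : plane => (z.1, 0 - z.2)) = @cj R) //; apply/funext => z; rewrite sub0r.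
Qed.

Lemma cpow_cts n : continuous (cpow^~ n).
Proof.
have c (k : nat) (f : plane -> plane) : continuous f -> continuous (fun z => iter k (cm (f z)) (1, 0)).
  by move=> cf; elim: k => [|k IH] /=; [exact: cts_cst|exact: cm_cts].
case: n => k; last exact: (c k.+1 (@cj R) cj_cts).
by apply: (c k id) => z; exact: cvg_id.
Qed.

End Slots.

(** * The sides of the polygon and their identification *)

Section Polygon.
Variables (R : realType) (g : nat).
Local Notation plane := (R * R)%type.
Hypothesis g0 : (0 < g)%N.
Implicit Types (k : nat) (a : plane).

(** Half of the angle of a side seen from the origin; [nvec k] is the middle of the side [k] and
    [vvec k] its first end. *)
Definition pang : R := pi / (4 * g)%:R.
Definition nvec k : plane := cis ((2 * k%:R + 1) * pang).
Definition vvec k : plane := cis (2 * k%:R * pang).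

Lemma g4_gt0 : (0 : R) < (4 * g)%:R. Proof. by rewrite ltr0n muln_gt0. Qed.

Lemma pang_bounds : 0 < pang <= pi / 4.
Proof.
have p0 := @pi_pos R; rewrite /pang divr_gt0 ?g4_gt0 //=.
by rewrite ler_pM2l // lef_pV2 ?posrE ?g4_gt0 // ler_nat leq_pmulr.
Qed.

Lemma pang_total : pang * (4 * g)%:R = pi.
Proof. by rewrite /pang divfK // gt_eqF // g4_gt0. Qed.

(** A side extends at most [pi / 4] on either side of its middle, so [ang] measures positions on it
    exactly. *)
Lemma cos_pang : 2^-1 < cos pang.
Proof.
have [h1 h2] := andP pang_bounds; have p0 := @pi_pos R.
have c4 : 2^-1 < cos (pi / 4 : R).
  have := cosD (pi / 4 : R) (pi / 4).
  have -> : pi / 4 + pi / 4 = pi / 2 :> R by field.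
  rewrite cos_pihalf; have := cos2Dsin2 (pi / 4 : R).
  have : 0 < cos (pi / 4 : R) by apply: cos_gt0_pihalf; lra.
  by move: (cos _) (sin _) => c s; nra.
apply: (lt_le_trans c4); by rewrite leNgt ltr_cos ?in_itv /= -?leNgt; lra.
Qed.

Lemma side_pointE k (s : R) : side_point g k s = cm (nvec k) (cis ((2 * s - 1) * pang)).
Proof.
rewrite /side_point -cisD; congr cis; rewrite /pang.
have : ((4 * g)%:R : R) != 0 by rewrite gt_eqF // g4_gt0.
by move: (_%:R) (k%:R) => x y nz; field.
Qed.

Lemma side_point0 k : side_point g k (0 : R) = vvec k.
Proof. by rewrite side_pointE -cisD; congr cis; ring. Qed.

Lemma side_point1 k : side_point g k (1 : R) = vvec k.+1.
Proof. by rewrite side_pointE -cisD -natr1; congr cis; ring. Qed.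

(** In every block of four sides, the sides 0 and 2 are identified, and so are the sides 1 and 3. *)
Definition mate k : nat := if (k %% 4 < 2)%N then k.+2 else (k - 2)%N.

Lemma mate_lt k : (k < 4 * g)%N -> (mate k < 4 * g)%N.
Proof.
rewrite /mate; have := divn_eq k 4; have : (k %% 4 < 4)%N by exact: ltn_pmod.
by move: (k %/ 4)%N (k %% 4)%N => x y; case: (ltnP y 2) => h1 h2 h3 h4; lia.
Qed.

Lemma mateK k : (k < 4 * g)%N -> mate (mate k) = k.
Proof.
move=> _; rewrite /mate; have e := divn_eq k 4; have h4 : (k %% 4 < 4)%N by exact: ltn_pmod.
move: e h4; set x := (k %/ 4)%N; set y := (k %% 4)%N => e h4.
case: (ltnP y 2) => h.
  have -> : (k.+2 %% 4 = y + 2)%N.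
    by rewrite e -addn2 -addnA modnMDl modn_small //; lia.
  by rewrite ltnNge leq_addl /=; lia.
have -> : ((k - 2) %% 4 = y - 2)%N.
  have -> : (k - 2 = x * 4 + (y - 2))%N by lia.
  by rewrite modnMDl modn_small //; lia.
by case: ltnP => h'; lia.
Qed.

Lemma mate_neq k : mate k != k.
Proof.
rewrite /mate; have := divn_eq k 4.
by move: (k %/ 4)%N (k %% 4)%N => x y; case: ltnP => h1 h2; lia.
Qed.

(** The reflection of the circle that exchanges the middles of the side [k] and of its mate: it
    identifies the two sides with opposite directions. *)
Definition fold_side k a : plane := cm (cm (nvec k) (nvec (mate k))) (cj a).

Lemma fold_cis k phi : fold_side k (cm (nvec k) (cis phi)) = cm (nvec (mate k)) (cis (- phi)).
Proof.
by rewrite /fold_side cjM -cisN cmA (cmC (nvec k)) cmK ?sqnorm_cis // cisN.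
Qed.

Definition in_side k a := cos pang < (rel_dir (nvec k) a).1.

Lemma in_sideP k a : sqnorm a = 1 -> in_side k a ->
  exists2 phi, - pang < phi < pang & a = cm (nvec k) (cis phi).
Proof.
move=> h; rewrite /in_side => k2; have [p1 p2] := andP pang_bounds; have p0 := @pi_pos R.
have hr := sqnorm_rel (sqnorm_cis ((2 * k%:R + 1) * pang)) h.
have k3 : 2^-1 < (rel_dir (nvec k) a).1 by apply: lt_trans k2; exact: cos_pang.
exists (ang (rel_dir (nvec k) a)); last by rewrite cis_ang_rel ?sqnorm_cis.
have b := ang_bound (rel_dir (nvec k) a).
have e := cis_ang hr k3; set x := ang _ in b e *.
have : cos pang < cos `|x|.
  have -> : cos `|x| = cos x by case: (ger0P x) => _; rewrite ?cosN.
  by move: k2; rewrite /nvec -e.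
have i1 : pang \in `[0, pi] by rewrite in_itv /=; lra.
have i2 : `|x| \in `[0, pi] by rewrite in_itv /= normr_ge0 ler_norml; lra.
by rewrite ltr_cos // ltr_norml.
Qed.

Lemma in_side_cis k phi : - pang < phi < pang -> in_side k (cm (nvec k) (cis phi)).
Proof.
move=> h; have [p1 p2] := andP pang_bounds; have p0 := @pi_pos R.
rewrite /in_side /nvec -cisD rel_dir_cis /=.
have -> : cos ((2 * k%:R + 1) * pang + phi - (2 * k%:R + 1) * pang) = cos `|phi|.
  rewrite [X in cos X](_ : _ = phi); last by ring.
  by case: (ger0P phi) => _; rewrite ?cosN.
have i1 : pang \in `[0, pi] by rewrite in_itv /=; lra.
have i2 : `|phi| \in `[0, pi] by rewrite in_itv /= normr_ge0 ler_norml; lra.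
by rewrite ltr_cos // ltr_norml.
Qed.

Lemma circle_sides a : sqnorm a = 1 ->
  (exists2 k, (k < 4 * g)%N & in_side k a) \/ (exists2 k, (k < 4 * g)%N & a = vvec k).
Proof.
move=> /argP[t0 <-]; have [p1 p2] := andP pang_bounds; move: (arg a) t0 => t t0.
pose x := t / (2 * pang).
have x0 : 0 <= x by rewrite /x divr_ge0 //; lra.
have pt := pang_total.
have xt : t = x * (2 * pang) by rewrite /x divfK //; lra.
have [k kx xk] : exists2 k : nat, k%:R <= x & x < k.+1%:R.
  exists (Num.truncn x); first by rewrite truncn_le.
  exact: truncnS_gt.
have kg : (k < 4 * g)%N.
  rewrite -(ltr_nat R); apply: (le_lt_trans kx); rewrite -(ltr_pM2r (x := 2 * pang)); last by lra.
  by rewrite -xt; lra.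
have [kxe|kxn] := eqVneq (k%:R : R) x.
  by right; exists k => //; rewrite /vvec kxe xt; congr cis; ring.
left; exists k => //.
have -> : cis t = cm (nvec k) (cis (t - (2 * k%:R + 1) * pang)) by rewrite -cisD; congr cis; ring.
have kx' : k%:R < x by rewrite lt_neqAle kxn.
by apply: in_side_cis; rewrite xt; rewrite -natr1 in xk; nra.
Qed.

Lemma in_side_inj k l a : (k < 4 * g)%N -> (l < 4 * g)%N -> sqnorm a = 1 ->
  in_side k a -> in_side l a -> k = l.
Proof.
move=> kg lg h /(in_sideP h)[x xb ->] /in_sideP[|y yb]; first by rewrite sqnormM !sqnorm_cis mulr1.
have [p1 p2] := andP pang_bounds; have pt := pang_total.
have hk : (k%:R : R) + 1 <= (4 * g)%:R by rewrite natr1 ler_nat.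
have hl : (l%:R : R) + 1 <= (4 * g)%:R by rewrite natr1 ler_nat.
have k0 := ler0n R k; have l0 := ler0n R l.
rewrite -!cisD => /cis_inj; rewrite ltr_norml => e.
have {}e := e ltac:(nra).
case: (ltngtP k l) => // kl; exfalso.
  have : (k%:R : R) + 1 <= l%:R by rewrite natr1 ler_nat.
  nra.
have : (l%:R : R) + 1 <= k%:R by rewrite natr1 ler_nat.
nra.
Qed.

Lemma vvec_not_side k l : (k < 4 * g)%N -> (l < 4 * g)%N -> ~ in_side l (vvec k).
Proof.
move=> kg lg /in_sideP[|y yb]; first exact: sqnorm_cis.
have [p1 p2] := andP pang_bounds; have pt := pang_total.
have hk : (k%:R : R) + 1 <= (4 * g)%:R by rewrite natr1 ler_nat.
have hl : (l%:R : R) + 1 <= (4 * g)%:R by rewrite natr1 ler_nat.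
have k0 := ler0n R k; have l0 := ler0n R l.
rewrite -cisD => /cis_inj; rewrite ltr_norml => e.
have {}e := e ltac:(nra).
case: (leqP k l) => kl.
  have : (k%:R : R) <= l%:R by rewrite ler_nat.
  nra.
have : (l%:R : R) + 1 <= k%:R by rewrite natr1 ler_nat.
nra.
Qed.

End Polygon.

(** * Functions that separate the points of the quotient *)

Section Invariants.
Variables (R : realType) (G : plumbing_graph).
Local Notation plane := (R * R)%type.
Local Notation r := (slot_radius R G).
Local Notation sc := (@sc R G).
Local Notation bump := (@bump R G).
Local Notation bout := (@bout R G).
Local Notation glue := (@Defs.glue R G).

(** Such functions descend to continuous functions on the glued space. Enough of them determine the
    generated equivalence without following chains of gluings, and separate the points. *)
Definition wall_invariant (f : place R G -> R) : Prop :=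
  (forall p q, glue p q -> f p = f q) /\ forall i, continuous (fun q => f (i, q)).

Definition hole (v : vertex G) (p : port G) : bool :=
  match p with None => true | Some (inl d) => d_start d == v | _ => false end.

(** Within a perforated disk it vanishes exactly on the walls, so that its product with any function
    of the cell extends by 0 to an invariant. *)
Definition wall_prod v (z : plane) : R :=
  (1 - sqnorm z) * \prod_(p | hole v p) (off (sc p) z - r ^+ 2).

Lemma wall_prod_slot v p a : hole v p -> sqnorm a = 1 -> wall_prod v (pol (sc p) r a) = 0.
Proof. by move=> hp ha; rewrite /wall_prod (bigD1 p) //= off_pol // subrr mul0r mulr0. Qed.

Lemma wall_prod_unit v z : sqnorm z = 1 -> wall_prod v z = 0.
Proof. by move=> h; rewrite /wall_prod h subrr mul0r. Qed.

Lemma continuous_prod (Z : topologicalType) (I : Type) (s : seq I) (P : pred I) (F : I -> Z -> R) :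
  (forall i, continuous (F i)) -> continuous (fun z => \prod_(i <- s | P i) F i z).
Proof.
move=> cF; elim: s => [|i s IH].
  by under eq_fun do rewrite big_nil; exact: cts_cst.
under eq_fun do rewrite big_cons.
by case: (P i) => //; exact: ctsM.
Qed.

Lemma wall_prod_cts v : continuous (wall_prod v).
Proof.
apply: ctsM; first by apply: ctsB; [cts|exact: sqnorm_cts].
by apply: continuous_prod => p; apply: ctsB; [exact: off_cts|cts].
Qed.

Lemma fst_comp_cts (X Y Z : topologicalType) (f : X -> Z) : continuous f ->
  continuous (fun q : X * Y => f q.1).
Proof. by move=> cf; apply: (cts_comp (f := fst) _ cf); cts. Qed.
Lemma snd_comp_cts (X Y Z : topologicalType) (f : Y -> Z) : continuous f ->
  continuous (fun q : X * Y => f q.2).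
Proof. by move=> cf; apply: (cts_comp (f := snd) _ cf); cts. Qed.

Definition inner_fun v (chi : plane * plane -> R) (p : place R G) : R :=
  if p.1 == inl v then wall_prod v p.2.1 * chi p.2 else 0.

Lemma inner_fun_invariant v chi : continuous chi -> wall_invariant (inner_fun v chi).
Proof.
move=> cc; split; last first.
  move=> i; rewrite /inner_fun /=; case: (i == inl v); last exact: cts_cst.
  by apply: ctsM => //; apply: fst_comp_cts; exact: wall_prod_cts.
have z0 w z y : wall_prod v z = 0 -> inner_fun v chi (w, (z, y)) = 0.
  by move=> h; rewrite /inner_fun /= h mul0r if_same.
have zs w p y t : (w == inl v -> hole v p) -> inner_fun v chi (w, (slot_circle p t, y)) = 0.
  rewrite /inner_fun /= slot_circleE; case: eqP => // _ h.
  by rewrite wall_prod_slot ?mul0r ?h ?sqnorm_cis.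
move=> _ _ [w i b s z _|w x y z _ hx hy|w t s|d t s].
- by rewrite !z0 ?wall_prod_unit ?sqnorm_cis.
- by rewrite !z0 ?wall_prod_unit.
- by rewrite zs // /inner_fun.
- rewrite (zs _ (Some (inl d))); last by move=> /eqP[<-] /=.
  by rewrite zs // => /eqP[<-]; rewrite /hole d_start_rev.
Qed.

(** A function of the two angles of the gluing torus of [d], read at either end with base and fibre
    exchanged, and damped away from the torus. *)
Definition dart_fun (d : dart G) (chi : plane * plane -> R) (p : place R G) : R :=
  let: (i, (z, w)) := p in
  let c x := ((z.1 - x) / r, z.2 / r) in
  if i == inl (d_start d) then bump (Some (inl d)) z * chi (c (sc (Some (inl d))), w)
  else if i == inl (d_end d) then bump (Some (inl (d_rev d))) z * chi (w, c (sc (Some (inl (d_rev d)))))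
  else 0.

Lemma slot_coord p (a : plane) :
  (((pol (sc p) r a).1 - sc p) / r, (pol (sc p) r a).2 / r) = a.
Proof.
have [r0 _] := andP (slot_radius_bounds R G).
have rr : r != 0 by exact: lt0r_neq0.
by case: a => x y; rewrite /pol /=; congr pair; field.
Qed.

Lemma slot_coord_cts p : continuous (fun z : plane => ((z.1 - sc p) / r, z.2 / r)).
Proof. by apply: cts_pair; cts. Qed.

Lemma dart_fun_invariant d chi : continuous chi -> wall_invariant (dart_fun d chi).
Proof.
move=> cc; split; last first.
  move=> i; rewrite /dart_fun /=.
  rewrite (_ : (fun q => _) = fun q : plane * plane =>
    if i == inl (d_start d) then bump (Some (inl d)) q.1 * chi (((q.1.1 - sc (Some (inl d))) / r, q.1.2 / r), q.2)
    else if i == inl (d_end d) then bump (Some (inl (d_rev d))) q.1 *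
      chi (q.2, ((q.1.1 - sc (Some (inl (d_rev d)))) / r, q.1.2 / r)) else 0); last by apply/funext => -[].
  case: (i == _); last case: (i == _); last exact: cts_cst.
  - apply: ctsM; first by apply: fst_comp_cts; exact: bump_cts.
    apply: (cts_comp _ cc); apply: cts_pair; last by cts.
    exact: (fst_comp_cts (@slot_coord_cts _)).
  - apply: ctsM; first by apply: fst_comp_cts; exact: bump_cts.
    apply: (cts_comp _ cc); apply: cts_pair; first by cts.
    exact: (fst_comp_cts (@slot_coord_cts _)).
have un i z w : sqnorm z = 1 -> dart_fun d chi (i, (z, w)) = 0.
  by move=> h; rewrite /dart_fun !bump_unit // !mul0r !if_same.
have ot i p t w : p != Some (inl d) -> p != Some (inl (d_rev d)) ->
    dart_fun d chi (i, (slot_circle p t, w)) = 0.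
  move=> h1 h2; rewrite /dart_fun slot_circleE !bump_other ?sqnorm_cis // !mul0r !if_same //.
have se : (inl (d_end d) == inl (d_start d) :> vertex G + vertex G) = false.
  by apply/negbTE; apply: contra (d_start_neq_end d) => /eqP[->].
have v1 t s : dart_fun d chi (inl (d_start d), (slot_circle (Some (inl d)) t, cis s)) = chi (cis t, cis s).
  by rewrite /dart_fun eqxx slot_circleE bump1 ?sqnorm_cis // mul1r slot_coord.
have v2 t s : dart_fun d chi (inl (d_end d), (slot_circle (Some (inl (d_rev d))) s, cis t)) = chi (cis t, cis s).
  by rewrite /dart_fun se eqxx slot_circleE bump1 ?sqnorm_cis // mul1r slot_coord.
move=> _ _ [w i b s z _|w x y z _ hx hy|w t s|d' t s].
- by rewrite !un // sqnorm_cis.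
- by rewrite !un.
- by rewrite ot.
- have [->|n1] := eqVneq d' d; first by rewrite v1 v2.
  have [->|n2] := eqVneq d' (d_rev d).
    by rewrite d_start_rev d_end_rev d_revK v1 v2.
  rewrite !ot //.
  + by apply: contra n2 => /eqP[<-]; rewrite d_revK.
  + by apply: contra n1 => /eqP[e1 /negb_inj e2]; apply/eqP; case: (d) (d') e1 e2 => ? ? [? ?] /= -> ->.
Qed.

(** A function on the solid torus, continued through the gluing map to a collar of the twisted slot
    and damped there. *)
Definition euler_fun (v : vertex G) (chi : plane * plane -> R) (p : place R G) : R :=
  let: (i, (z, w)) := p in
  let a := ((z.1 - sc None) / r, z.2 / r) in
  if i == inr v then chi (z, w)
  else if i == inl v then bump None z * chi (a, cm w (cpow a (euler v))) else 0.

Lemma euler_fun_invariant v chi : continuous chi -> wall_invariant (euler_fun v chi).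
Proof.
move=> cc; split; last first.
  move=> i; rewrite /euler_fun /=.
  rewrite (_ : (fun q => _) = fun q : plane * plane =>
    if i == inr v then chi q
    else if i == inl v then bump None q.1 *
      chi (((q.1.1 - sc None) / r, q.1.2 / r), cm q.2 (cpow ((q.1.1 - sc None) / r, q.1.2 / r) (euler v)))
    else 0); last by apply/funext => -[].
  case: (i == _); first by [].
  case: (i == _); last exact: cts_cst.
  apply: ctsM; first by apply: fst_comp_cts; exact: bump_cts.
  apply: (cts_comp _ cc); apply: cts_pair; first exact: (fst_comp_cts (@slot_coord_cts _)).
  apply: cm_cts; first by cts.
  apply: (fst_comp_cts (f := fun z : plane => cpow ((z.1 - sc None) / r, z.2 / r) (euler v))).
  exact: (cts_comp (@slot_coord_cts _) (@cpow_cts R _)).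
have un w z y : sqnorm z = 1 -> euler_fun v chi (inl w, (z, y)) = 0.
  by move=> h; rewrite /euler_fun /= bump_unit // !mul0r !if_same.
have ot w (p : port G) t y : p != None -> euler_fun v chi (inl w, (slot_circle p t, y)) = 0.
  by move=> h1; rewrite /euler_fun /= slot_circleE bump_other ?sqnorm_cis // mul0r if_same.
move=> _ _ [w i b s z _|w x y z _ hx hy|w t s|d' t s].
- by rewrite !un // sqnorm_cis.
- by rewrite !un.
- rewrite slot_circleE /euler_fun -[inl w == inr v]/false -[inl w == inl v]/(w == v).
  rewrite -[inr w == inl v]/false -[inr w == inr v]/(w == v).
  case: eqP => [->|//]; rewrite bump1 ?sqnorm_cis // mul1r slot_coord.
  by rewrite cpow_cis -cisD.
- by rewrite !ot.
Qed.

Definition outer_fun (v : vertex G) (psi : plane -> R) (chi : plane -> R) (p : place R G) : R :=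
  if p.1 == inl v then bout p.2.1 * psi p.2.1 * chi p.2.2 else 0.

Lemma outer_fun_invariant v psi chi : continuous psi -> continuous chi ->
  (genus v = 0%N -> forall x y, sqnorm x = 1 -> sqnorm y = 1 -> psi x = psi y) ->
  (forall (i : 'I_(genus v)) (b : bool) (s : R), 0 <= s <= 1 ->
     psi (side_point (genus v) (4 * i + b) s) = psi (side_point (genus v) (4 * i + b + 2) (1 - s))) ->
  wall_invariant (outer_fun v psi chi).
Proof.
move=> cp cc p0 pg; split; last first.
  move=> i; rewrite /outer_fun /=; case: (i == _); last exact: cts_cst.
  apply: ctsM; last exact: snd_comp_cts.
  by apply: (fst_comp_cts (f := fun z => bout z * psi z)); apply: ctsM => //; exact: bout_cts.
have ot i (p : port G) t y : outer_fun v psi chi (i, (slot_circle p t, y)) = 0.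
  by rewrite /outer_fun /= slot_circleE bout_slot ?sqnorm_cis // !mul0r if_same.
move=> _ _ [w i b s z s01|w x y z gw hx hy|w t s|d' t s]; last by rewrite !ot.
- rewrite /outer_fun /= -[inl w == inl v]/(w == v); case: eqP => [e|//].
  by subst w; rewrite !bout1 ?sqnorm_cis // !mul1r pg.
- rewrite /outer_fun /= -[inl w == inl v]/(w == v); case: eqP => [e|//].
  by subst w; rewrite !bout1 // !mul1r (p0 gw x y).
- by rewrite ot.
Qed.

Section SideFunctions.
Variable g : nat.
Hypothesis g0 : (0 < g)%N.
Local Notation pang := (@pang R g).
Local Notation nvec := (@nvec R g).

Definition side_height k (z : plane) : R := Num.max 0 ((rel_dir (nvec k) z).1 - cos pang).
(** Folding exchanges the heights of a side and of its mate and changes the sign of the second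
    coordinate, so [side_psi1] and [side_psi2] are invariant; together they recover a point of an
    open side up to folding. *)
Definition side_psi1 k (z : plane) : R := side_height k z + side_height (mate k) z.
Definition side_psi2 k (z : plane) : R :=
  side_height k z * (rel_dir (nvec k) z).2 - side_height (mate k) z * (rel_dir (nvec (mate k)) z).2.

Lemma side_height_cts k : continuous (side_height k).
Proof. by rewrite /side_height /rel_dir /cm /=; cts. Qed.

Lemma rel_dir2_cts k : continuous (fun z => (rel_dir (nvec k) z).2).
Proof. by rewrite /rel_dir /cm /=; cts. Qed.

Lemma side_psi_cts k : continuous (side_psi1 k) /\ continuous (side_psi2 k).
Proof.
split; first by apply: ctsD; exact: side_height_cts.
by apply: ctsB; apply: ctsM; [exact: side_height_cts|exact: rel_dir2_cts
  |exact: side_height_cts|exact: rel_dir2_cts].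
Qed.

Lemma side_height_gt0 k z : (0 < side_height k z) = (cos pang < (rel_dir (nvec k) z).1).
Proof. by rewrite /side_height lt_max ltxx /= subr_gt0. Qed.

Lemma side_height0 k z : ~ in_side g k z -> side_height k z = 0.
Proof. by move=> /negP; rewrite /side_height -leNgt => h; rewrite max_l // subr_le0. Qed.

Lemma side_height_in k z : in_side g k z -> side_height k z = (rel_dir (nvec k) z).1 - cos pang.
Proof. by rewrite /in_side /side_height => h; rewrite max_r // subr_ge0 ltW. Qed.

Lemma vvec_total : vvec R g (4 * g) = vvec R g 0.
Proof.
rewrite /vvec (_ : 2 * (4 * g)%:R * pang = 2 * 0%:R * pang + 1%:~R * (2 * pi)); last first.
  by rewrite -mulrA (mulrC _ pang) pang_total // mulr0 mul0r add0r mul1r.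
by rewrite cis_int.
Qed.

Lemma side_height_point j k (s : R) : (j < 4 * g)%N -> (k < 4 * g)%N -> 0 <= s <= 1 ->
  side_height k (side_point g j s) =
  if k == j then Num.max 0 (cos ((2 * s - 1) * pang) - cos pang) else 0.
Proof.
move=> jg kg s01; have [p1 p2] := andP (pang_bounds R g0).
have nz : sqnorm (side_point g j s) = 1 by exact: sqnorm_cis.
case: eqVneq => [->|kj].
  rewrite side_pointE // /side_height /nvec -cisD rel_dir_cis /=.
  by rewrite [X in cos X - _](_ : _ = (2 * s - 1) * pang) //; ring.
apply: side_height0 => hk.
case: (eqVneq s 0) => [s0|s0].
  by move: hk; rewrite s0 side_point0 //; exact: vvec_not_side.
case: (eqVneq s 1) => [s1|s1].
  have [jg'|] := ltnP j.+1 (4 * g).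
    by move: hk; rewrite s1 side_point1 //; exact: vvec_not_side.
  move=> jg'; have je : j.+1 = (4 * g)%N by apply/eqP; rewrite eqn_leq jg jg'.
  have z0 : (0 < 4 * g)%N by rewrite muln_gt0.
  by move: hk; rewrite s1 side_point1 // je vvec_total; exact: vvec_not_side.
have hj : in_side g j (side_point g j s).
  have h1 : 0 < s by rewrite lt_neqAle eq_sym s0; lra.
  have h2 : s < 1 by rewrite lt_neqAle s1; lra.
  rewrite side_pointE //; apply: in_side_cis => //; nra.
by move/eqP: kj; apply; exact: (in_side_inj g0 kg jg nz hk hj).
Qed.

Lemma mate_side (i : 'I_g) (b : bool) : mate (4 * i + b) = (4 * i + b + 2)%N.
Proof.
rewrite /mate (_ : (4 * i + b) %% 4 = b)%N; first by case: b; rewrite addn2.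
by rewrite mulnC modnMDl modn_small //; case: b.
Qed.

Lemma side_lt (i : 'I_g) (b : bool) : (4 * i + b < 4 * g)%N.
Proof. by have := ltn_ord i; case: b => /=; lia. Qed.

Lemma side_point_mate k (s : R) : side_point g (mate k) (1 - s) = fold_side g k (side_point g k s).
Proof.
rewrite !side_pointE // fold_cis; congr (cm _ (cis _)); ring.
Qed.

Lemma eq_mate j k : (j < 4 * g)%N -> (k < 4 * g)%N -> (mate k == j) = (k == mate j).
Proof. by move=> jg kg; apply/eqP/eqP => [<-|->]; rewrite ?(mateK g0 kg) ?(mateK g0 jg). Qed.

Lemma side_psi_invariant k (i : 'I_g) (b : bool) (s : R) : (k < 4 * g)%N -> 0 <= s <= 1 ->
  side_psi1 k (side_point g (4 * i + b) s) = side_psi1 k (side_point g (4 * i + b + 2) (1 - s)) /\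
  side_psi2 k (side_point g (4 * i + b) s) = side_psi2 k (side_point g (4 * i + b + 2) (1 - s)).
Proof.
move=> kg s01; have jg := side_lt i b; rewrite -mate_side.
set j := (4 * i + b)%N in jg *; have mg := mate_lt g0 jg; have mkg := mate_lt g0 kg.
have s01' : 0 <= 1 - s <= 1 by lra.
have T l (u : R) : (rel_dir (nvec l) (side_point g l u)).2 = sin ((2 * u - 1) * pang).
  rewrite side_pointE // /nvec -cisD rel_dir_cis /=; congr sin; ring.
have ce : cos ((2 * (1 - s) - 1) * pang) = cos ((2 * s - 1) * pang).
  by rewrite -cosN; congr cos; ring.
have sn : sin ((2 * (1 - s) - 1) * pang) = - sin ((2 * s - 1) * pang).
  by rewrite -sinN; congr sin; ring.
rewrite /side_psi1 /side_psi2 !side_height_point // ce.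
rewrite [mate k == mate j](inj_in_eq (D := [pred x | (x < 4 * g)%N])) ?inE //; last first.
  by move=> x y; rewrite !inE => xg yg e; rewrite -(mateK g0 xg) e (mateK g0 yg).
rewrite eq_mate //; split; first by rewrite addrC.
case: (eqVneq k j) => [->|kj].
  by rewrite [j == mate j]eq_sym (negbTE (mate_neq g0 j)) !mul0r subr0 !T sn; ring.
case: (eqVneq k (mate j)) => [e|_]; last by rewrite !mul0r.
by rewrite e (mateK g0 jg) !mul0r !sub0r !T sn; ring.
Qed.

Lemma rel_dir_inj (n z z' : plane) : sqnorm n = 1 -> rel_dir n z = rel_dir n z' -> z = z'.
Proof. by move=> hn e; rewrite -(cmVK z hn) -(cmVK z' hn) -!/(rel_dir _ _) e. Qed.

Lemma rel_dir_fold k z :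
  rel_dir (nvec (mate k)) (fold_side g k z) = cj (rel_dir (nvec k) z).
Proof.
rewrite /rel_dir /fold_side cjM cjK [in RHS]cmC (cmC (nvec k)) -cmA cmC.
by rewrite cmA cmVK ?sqnorm_cis // cmC.
Qed.

(** All these functions vanish at the vertices, whence the third case: they see the vertices as one
    point, which is what the gluing makes of them. *)
Lemma side_separate z z' : sqnorm z = 1 -> sqnorm z' = 1 ->
  (forall k, (k < 4 * g)%N -> side_psi1 k z = side_psi1 k z' /\ side_psi2 k z = side_psi2 k z') ->
  [\/ z = z', exists k, [/\ (k < 4 * g)%N, in_side g k z & z' = fold_side g k z]
    | exists k l, [/\ (k < 4 * g)%N, (l < 4 * g)%N, z = vvec R g k & z' = vvec R g l]].
Proof.
move=> hz hz' e.
have dis k y : (k < 4 * g)%N -> sqnorm y = 1 -> in_side g k y -> side_height (mate k) y = 0.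
  move=> kg hy ky; apply: side_height0 => my.
  by have := mate_neq g0 k; rewrite -(in_side_inj g0 kg (mate_lt g0 kg) hy ky my) eqxx.
case: (circle_sides g0 hz) => [[k kg kz]|[k kg zk]].
  have [e1 e2] := e k kg.
  have hpos : 0 < side_height k z by rewrite side_height_gt0.
  have mg := mate_lt g0 kg.
  rewrite /side_psi1 /side_psi2 (dis _ _ kg hz kz) addr0 mul0r subr0 in e1 e2.
  case: (pselect (in_side g k z')) => kz'.
    apply: Or31; apply: (rel_dir_inj (sqnorm_cis ((2 * k%:R + 1) * pang))).
    rewrite (dis _ _ kg hz' kz') addr0 mul0r subr0 in e1 e2.
    rewrite [LHS]surjective_pairing [RHS]surjective_pairing; congr pair.
      by move: e1; rewrite !side_height_in // => /addIr.
    by rewrite e1 in hpos e2; move/(mulfI (lt0r_neq0 hpos)): e2.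
  rewrite (side_height0 kz') add0r mul0r sub0r in e1 e2.
  have mz' : in_side g (mate k) z' by rewrite /in_side -side_height_gt0 -e1.
  apply: Or32; exists k; split=> //.
  apply: (rel_dir_inj (sqnorm_cis ((2 * (mate k)%:R + 1) * pang))).
  rewrite -/(nvec (mate k)) rel_dir_fold.
  rewrite [LHS]surjective_pairing /cj; congr pair.
    by move: e1; rewrite !side_height_in // => /addIr.
  by rewrite e1 -mulrN in hpos e2; move/(mulfI (lt0r_neq0 hpos)): e2 => ->; rewrite opprK.
case: (circle_sides g0 hz') => [[l lg lz]|[l lg zl]]; last by apply: Or33; exists k, l.
exfalso; have [e1 _] := e l lg.
have hpos : 0 < side_height l z' by rewrite side_height_gt0.
have : side_psi1 l z = 0.
  by rewrite /side_psi1 zk !side_height0 ?addr0 //; apply: vvec_not_side => //; exact: mate_lt.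
rewrite e1 /side_psi1 (dis _ _ lg hz' lz) addr0 => h; by rewrite h ltxx in hpos.
Qed.

End SideFunctions.

(** The equivalence generated by the gluing in closed form: the walls are disjoint, so one step
    suffices. The vertices of a polygon form a single class over each point of the fibre, and
    [CoSide] concerns the open sides. *)
Inductive coincide : place R G -> place R G -> Prop :=
| CoRefl p : coincide p p
| CoEdge d a w : sqnorm a = 1 -> sqnorm w = 1 ->
    coincide (inl (d_start d), (pol (sc (Some (inl d))) r a, w))
             (inl (d_end d), (pol (sc (Some (inl (d_rev d)))) r w, a))
| CoEuler v a w : sqnorm a = 1 -> sqnorm w = 1 ->
    coincide (inl v, (pol (sc None) r a, w)) (inr v, (a, cm w (cpow a (euler v))))
| CoEulerV v a w : sqnorm a = 1 -> sqnorm w = 1 ->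
    coincide (inr v, (a, cm w (cpow a (euler v)))) (inl v, (pol (sc None) r a, w))
| CoSphere v a b w : genus v = 0%N -> sqnorm a = 1 -> sqnorm b = 1 -> sqnorm w = 1 ->
    coincide (inl v, (a, w)) (inl v, (b, w))
| CoSide v k a w : (k < 4 * genus v)%N -> sqnorm a = 1 -> sqnorm w = 1 ->
    in_side (genus v) k a -> coincide (inl v, (a, w)) (inl v, (fold_side (genus v) k a, w))
| CoVertex v k l w : (k < 4 * genus v)%N -> (l < 4 * genus v)%N -> sqnorm w = 1 ->
    coincide (inl v, (vvec R (genus v) k, w)) (inl v, (vvec R (genus v) l, w)).

Lemma pair_ext (X Y : Type) (p q : X * Y) : p.1 = q.1 -> p.2 = q.2 -> p = q.
Proof. by case: p q => ? ? [? ?] /= -> ->. Qed.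

Definition coords : seq (plane * plane -> R) :=
  [:: fun q => q.1.1; fun q => q.1.2; fun q => q.2.1; fun q => q.2.2].

Lemma coords_cts (chi : plane * plane -> R) : List.In chi coords -> continuous chi.
Proof.
move=> [<-|[<-|[<-|[<-|[]]]]];
  by [apply: (fst_comp_cts (f := fst)); cts|apply: (fst_comp_cts (f := snd)); cts
     |apply: (snd_comp_cts (f := fst)); cts|apply: (snd_comp_cts (f := snd)); cts].
Qed.

Lemma coords_ext (q q' : plane * plane) :
  (forall chi, List.In chi coords -> chi q = chi q') -> q = q'.
Proof.
move=> h; apply: pair_ext; apply: pair_ext.
- by apply: (h (fun q => q.1.1)); left.
- by apply: (h (fun q => q.1.2)); right; left.
- by apply: (h (fun q => q.2.1)); do 2 right; left.
- by apply: (h (fun q => q.2.2)); do 3 right; left.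
Qed.

Lemma slot_polar p z : off (sc p) z = r ^+ 2 ->
  exists2 a, sqnorm a = 1 & z = pol (sc p) r a.
Proof.
have [r0 _] := andP (slot_radius_bounds R G); have rr := lt0r_neq0 r0.
move=> h; exists ((z.1 - sc p) / r, z.2 / r).
  move: h; rewrite /off /sqnorm /= => h.
  by rewrite !expr_div_n -mulrDl h divff // expf_neq0.
by apply: pair_ext; rewrite /pol /= mulrC divfK // addrC subrK.
Qed.

(** With the constant function 1 for [chi], the invariants locate the cell and the wall of [q]; with
    the coordinate functions, they give its position there. *)
Lemma coincideP (p q : place R G) : piece p.1 p.2 -> piece q.1 q.2 ->
  (forall f, wall_invariant f -> f p = f q) -> coincide p q.
Proof.
case: p => i [z w]; case: q => j [z' w'] /= pp pq H.
have Hi v chi : continuous chi -> inner_fun v chi (i, (z, w)) = inner_fun v chi (j, (z', w')).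
  by move=> cc; apply: H; exact: inner_fun_invariant.
have Hd d chi : continuous chi -> dart_fun d chi (i, (z, w)) = dart_fun d chi (j, (z', w')).
  by move=> cc; apply: H; exact: dart_fun_invariant.
have He v chi : continuous chi -> euler_fun v chi (i, (z, w)) = euler_fun v chi (j, (z', w')).
  by move=> cc; apply: H; exact: euler_fun_invariant.
have c1 : continuous (fun _ : plane * plane => 1 : R) by exact: cts_cst.
have uw : sqnorm w = 1 by case: (i) pp => v /= [].
have uw' : sqnorm w' = 1 by case: (j) pq => v /= [].
case: i pp Hi Hd He H => v pp Hi Hd He H; last first.
  have := He v _ c1; rewrite /euler_fun eqxx.
  case: eqP => [jv _|_].
    subst j; rewrite (_ : (z', w') = (z, w)); first exact: CoRefl.
    by apply: coords_ext => chi /coords_cts/(He v); rewrite /euler_fun !eqxx.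
  case: eqP => [jv|_] h; last by exfalso; move: h; apply/eqP; rewrite oner_eq0.
  rewrite mulr1 in h; have [a ha za] := slot_polar (bump_eq1 (esym h)).
  subst j z'; have e : (z, w) = (a, cm w' (cpow a (euler v))).
    apply: coords_ext => chi /coords_cts/(He v); rewrite /euler_fun !eqxx /=.
    by rewrite bump1 // mul1r slot_coord.
  by case: e => -> ->; exact: CoEulerV.
have [D0|D0] := eqVneq (wall_prod v z) 0; last first.
  have := Hi v _ c1; rewrite /inner_fun /= eqxx mulr1.
  case: eqP => [jv|_] h; last by exfalso; move: D0; rewrite h eqxx.
  subst j; rewrite mulr1 in h; rewrite (_ : (z', w') = (z, w)); first exact: CoRefl.
  apply: coords_ext => chi /coords_cts/(Hi v); rewrite /inner_fun /= eqxx -h => k.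
  by rewrite (mulfI D0 k).
move/eqP: D0; rewrite mulf_eq0 => /orP[|].
  rewrite subr_eq0 eq_sym => /eqP uz.
  have g0 : (0 < genus v)%N \/ genus v = 0%N by case: (genus v) => [|n]; [right|left].
  have cp1 : continuous (fun _ : plane => 1 : R) by exact: cts_cst.
  have Ho chi : continuous chi -> outer_fun v (fun=> 1) chi (inl v, (z, w)) =
      outer_fun v (fun=> 1) chi (j, (z', w')).
    by move=> cc; apply: H; apply: outer_fun_invariant.
  have := Ho _ cp1; rewrite /outer_fun /= eqxx bout1 // !mulr1.
  case: eqP => [jv|_] h; last by exfalso; move: h; apply/eqP; rewrite oner_eq0.
  subst j; have uz' := bout_eq1 (esym h).
  have ww : w = w'.
    by apply: pair_ext; [have := Ho (fun y => y.1) ltac:(cts)|have := Ho (fun y => y.2) ltac:(cts)];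
      rewrite /outer_fun /= eqxx !bout1 // !mul1r.
  subst w'; case: g0 => [g0|g0]; last exact: CoSphere.
  have Hs k : (k < 4 * genus v)%N -> side_psi1 (genus v) k z = side_psi1 (genus v) k z' /\
     side_psi2 (genus v) k z = side_psi2 (genus v) k z'.
    move=> kg; have [s1 s2] := side_psi_cts (genus v) k.
    have I1 : wall_invariant (outer_fun v (side_psi1 (genus v) k) (fun=> 1)).
      apply: outer_fun_invariant => // [gv|i b s s01]; first by rewrite gv in g0.
      by have [] := side_psi_invariant g0 i b kg s01.
    have I2 : wall_invariant (outer_fun v (side_psi2 (genus v) k) (fun=> 1)).
      apply: outer_fun_invariant => // [gv|i b s s01]; first by rewrite gv in g0.
      by have [] := side_psi_invariant g0 i b kg s01.
    by have := H _ I1; have := H _ I2; rewrite /outer_fun /= eqxx !bout1 // !mul1r !mulr1.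
  case: (side_separate g0 uz uz' Hs) => [->|[k [kg kz ->]]|[k [l [kg lg -> ->]]]].
  - exact: CoRefl.
  - exact: CoSide.
  - exact: CoVertex.
move=> /prodf_eq0[[[d|h]|] hp]; rewrite ?subr_eq0 => /eqP oz; last 1 first.
- have [a ha za] := slot_polar oz; subst z.
  have := He v _ c1; rewrite /euler_fun eqxx /= bump1 // !mulr1.
  case: eqP => [jv h|_].
    subst j; have e : (z', w') = (a, cm w (cpow a (euler v))).
      apply: coords_ext => chi /coords_cts/(He v); rewrite /euler_fun !eqxx /=.
      by rewrite bump1 // mul1r slot_coord.
    by case: e => -> ->; exact: CoEuler.
  case: eqP => [jv|_] h; last by exfalso; move: h; apply/eqP; rewrite oner_eq0.
  rewrite ?mulr1 in h; have [b hb zb] := slot_polar (bump_eq1 (esym h)).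
  subst j z'; have e : (a, cm w (cpow a (euler v))) = (b, cm w' (cpow b (euler v))).
    apply: coords_ext => chi /coords_cts/(He v); rewrite /euler_fun !eqxx /=.
    by rewrite !bump1 // !mul1r !slot_coord.
  have ab : a = b := f_equal fst e; have {e}/= := f_equal snd e; subst b => e.
  have -> : w = w' by rewrite -(cmK w (sqnorm_cpow (euler v) ha)) e cmK ?sqnorm_cpow.
  exact: CoRefl.
- have dv : d_start d = v by apply/eqP.
  subst v; have [a ha za] := slot_polar oz; subst z.
  have se : (inl (d_end d) == inl (d_start d) :> vertex G + vertex G) = false.
    by apply/negbTE; apply: contra (d_start_neq_end d) => /eqP[->].
  have := Hd d _ c1; rewrite /dart_fun eqxx /= bump1 // !mulr1.
  case: eqP => [jv h|_].
    subst j; rewrite ?mulr1 in h; have [b hb zb] := slot_polar (bump_eq1 (esym h)); subst z'.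
    have e : (a, w) = (b, w').
      apply: coords_ext => chi /coords_cts/(Hd d); rewrite /dart_fun !eqxx /=.
      by rewrite !bump1 // !mul1r !slot_coord.
    by case: e => -> ->; exact: CoRefl.
  case: eqP => [jv|_] h; last by exfalso; move: h; apply/eqP; rewrite oner_eq0.
  rewrite ?mulr1 in h; have [b hb zb] := slot_polar (bump_eq1 (esym h)); subst j z'.
  have e : (a, w) = (w', b).
    apply: coords_ext => chi /coords_cts/(Hd d); rewrite /dart_fun se !eqxx /=.
    by rewrite !bump1 // !mul1r !slot_coord.
  by case: e => -> ->; exact: CoEdge.
- by [].
Qed.

End Invariants.

(** * Points of the manifold *)

Section QuotientInterface.
Variables (R : realType) (G : plumbing_graph).
Local Notation plane := (R * R)%type.
Local Notation r := (slot_radius R G).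
Local Notation sc := (@sc R G).
Local Notation glue := (@Defs.glue R G).
Local Notation X := (link_complement R G).
Local Notation mfd := (graph_manifold R G).
Local Notation cell := (vertex G + vertex G)%type.
Implicit Types v : vertex G.

Definition zvalid (i : cell) (z : plane) : Prop :=
  match i with
  | inl v => perforated_disk v z /\ forall h, att h = v -> z <> slot_center R (Some (inr h))
  | inr _ => unit_disk z
  end.

Definition valid (p : place R G) : Prop := zvalid p.1 p.2.1 /\ sqnorm p.2.2 = 1.

Lemma valid_piece p : valid p -> piece p.1 p.2.
Proof. by case: p => -[v|v] [z w] [/= h hw]; split=> //; case: h. Qed.

Definition mk_piece (p : place R G) (h : piece p.1 p.2) : pieces R G :=
  existT _ p.1 (exist _ p.2 (mem_set h)).

Lemma pieceP (p : pieces R G) : exists q (h : piece q.1 q.2), p = mk_piece h.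
Proof.
case: p => i [q hq]; exists (i, q), (set_mem hq); rewrite /mk_piece; congr existT.
by congr exist; exact: bool_irrelevance.
Qed.

Lemma place_mk p (h : piece p.1 p.2) : place_of (mk_piece h) = p.
Proof. by case: p h => i q h. Qed.

Definition ipt (p : pieces R G) : mfd := \pi_{eq_quot (@glued R G)} p.

Lemma ipt_glued p q : ipt p = ipt q <->
  clos_refl_sym_trans _ (fun p q => glue (place_of p) (place_of q)) p q.
Proof. by split=> [/eqmodP/asboolP//|h]; apply/eqmodP/asboolP. Qed.

Lemma ipt_invariant f p q : wall_invariant f -> ipt p = ipt q ->
  f (place_of p) = f (place_of q).
Proof.
move=> [fg _] /ipt_glued; elim=> {p q} [p q /fg //| //|p q _ -> //|p q s _ -> _ -> //].
Qed.

Lemma ipt_glue p q (h : piece p.1 p.2) (h' : piece q.1 q.2) :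
  glue p q -> ipt (mk_piece h) = ipt (mk_piece h').
Proof. by case: p q h h' => [i p] [j q] h h' g; apply/ipt_glued; apply: rst_step. Qed.

Lemma in_side_point g k a : (0 < g)%N -> sqnorm a = 1 -> in_side g k a ->
  exists2 s : R, 0 < s < 1 & a = side_point g k s.
Proof.
move=> g0 ha hk; have [phi hphi ->] := in_sideP g0 ha hk.
have [p0 _] := andP (pang_bounds R g0).
exists ((phi / pang R g + 1) / 2).
  have : -1 < phi / pang R g < 1 by rewrite ltr_pdivrMr // ltr_pdivlMr // mulN1r mul1r.
  by lra.
rewrite side_pointE //; congr (cm _ (cis _)).
by have := lt0r_neq0 p0; move: (pang R g) => p np; field.
Qed.

(* Either letter of a mated pair can be read first in [GluePolygon]. *)
Lemma mate_letter g k : (k < 4 * g)%N -> exists (i : 'I_g) (b : bool),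
  (k = (4 * i + b)%N /\ mate k = (4 * i + b + 2)%N) \/
  (mate k = (4 * i + b)%N /\ k = (4 * i + b + 2)%N).
Proof.
move=> kg; have [i e] : exists i : 'I_g, k = (4 * i + k %% 4)%N.
  have hi : (k %/ 4 < g)%N by rewrite ltn_divLR // mulnC.
  by exists (Ordinal hi); rewrite mulnC -divn_eq.
have h4 : (k %% 4 < 4)%N by exact: ltn_pmod.
have [h2|h2] := ltnP (k %% 4) 2.
  exists i, (k %% 4 == 1)%N; left; rewrite /mate h2.
  by move: e h2; move: (k %% 4)%N => [|[|n]] // e _ /=; lia.
exists i, (k %% 4 == 3)%N; right; rewrite /mate ltnNge h2 /=.
by move: e h2 h4; move: (k %% 4)%N => [|[|[|[|n]]]] // e _ _ /=; lia.
Qed.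

Lemma mk_piece_irr p (h h' : piece p.1 p.2) : mk_piece h = mk_piece h'.
Proof. by rewrite (Prop_irrelevance h h'). Qed.

Lemma ipt_side v k (s : R) w
    (h : piece (inl v) (side_point (genus v) k s, w))
    (h' : piece (inl v) (side_point (genus v) (mate k) (1 - s), w)) :
  (k < 4 * genus v)%N -> 0 <= s <= 1 ->
  ipt (@mk_piece (inl v, _) h) = ipt (@mk_piece (inl v, _) h').
Proof.
move=> kg s01; have [i [b [[e1 e2]|[e1 e2]]]] := mate_letter kg.
  by apply: ipt_glue; rewrite e2 {1}e1; constructor.
apply/esym; apply: ipt_glue; rewrite e1 e2.
by rewrite -{2}[s](subKr 1); constructor; lra.
Qed.

Lemma outer_valid v z w : sqnorm z = 1 -> sqnorm w = 1 -> valid (inl v, (z, w)).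
Proof.
have [r0 r4] := andP (slot_radius_bounds R G).
move=> hz hw; have ho p : r ^+ 2 <= off (sc p) z.
  apply: le_trans (off_outer p (z := z) _); last by rewrite hz; nra.
  nra.
split=> //=; split; last first.
  move=> h _ e; have := ho (Some (inr h)).
  rewrite e slot_centerE /off /sqnorm /= subrr expr0n /= addr0; nra.
by split; [rewrite /unit_disk /= hz|split=> [|d _]; apply/outside_slotE].
Qed.

Lemma vertex_piece v k w : sqnorm w = 1 -> piece (inl v) (vvec R (genus v) k, w).
Proof. by move=> hw; apply: (@valid_piece (inl v, _)); apply: outer_valid => //; exact: sqnorm_cis. Qed.

(** Gluing a side to its mate identifies the first end of each with the last end of the other. In a
    block of four sides this already identifies all the vertices, including the first vertex of the
    next block. *)
Lemma ipt_vertex v k l w (hw : sqnorm w = 1) : (k < 4 * genus v)%N -> (l < 4 * genus v)%N ->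
  ipt (@mk_piece (inl v, _) (vertex_piece v k hw)) =
  ipt (@mk_piece (inl v, _) (vertex_piece v l hw)).
Proof.
pose E k := ipt (@mk_piece (inl v, _) (vertex_piece v k hw)).
move=> kg lg; have g0 : (0 < genus v)%N by case: (genus v) kg => //; rewrite muln0.
have S0 j : (j < 4 * genus v)%N -> E j = E (mate j).+1.
  move=> jg; have := @ipt_side v j 0 w; rewrite subr0 side_point0 // side_point1 // => h.
  by apply: h; rewrite // lexx ler01.
have S1 j : (j < 4 * genus v)%N -> E j.+1 = E (mate j).
  move=> jg; have := @ipt_side v j 1 w; rewrite subrr side_point0 // side_point1 // => h.
  by apply: h; rewrite // lexx ler01.
have B (i : 'I_(genus v)) : [/\ E (4 * i)%N = E (4 * i + 3)%N, E (4 * i)%N = E (4 * i + 2)%N,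
    E (4 * i)%N = E (4 * i + 1)%N & E (4 * i)%N = E (4 * i.+1)%N].
  have := S0 _ (side_lt g0 i false); have := S1 _ (side_lt g0 i false).
  have := S0 _ (side_lt g0 i true); have := S1 _ (side_lt g0 i true).
  rewrite !mate_side !(addn0, addn1, addn2, addn3) mulnSr addn4.
  by move=> e1 e2 e3 e4; split; congruence.
have A (i : nat) : (i <= genus v)%N -> E (4 * i)%N = E 0%N.
  elim: i => [|i IH] ig; first by rewrite muln0.
  by rewrite -IH ?(ltnW ig) //; have [_ _ _ ->] := B (Ordinal ig).
suff C j : (j < 4 * genus v)%N -> E j = E 0%N by rewrite -!/(E _) !C.
move=> jg; have ig : (j %/ 4 < genus v)%N by rewrite ltn_divLR // mulnC.
rewrite -(A _ (ltnW ig)); have := B (Ordinal ig); rewrite /= => -[b3 b2 b1 _].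
have h4 : (j %% 4 < 4)%N by exact: ltn_pmod.
rewrite {1}(divn_eq j 4) mulnC.
by case: (j %% 4)%N h4 => [|[|[|[|n]]]] // _; rewrite ?addn0.
Qed.

Lemma coincide_ipt p q (h : piece p.1 p.2) (h' : piece q.1 q.2) :
  coincide p q -> ipt (mk_piece h) = ipt (mk_piece h').
Proof.
move=> c; case: c h h' => {p q}.
- by move=> p h h'; rewrite (mk_piece_irr h h').
- move=> d a w ha hw h h'; apply: ipt_glue.
  rewrite -(cis_arg ha) -(cis_arg hw) -!slot_circleE; exact: GlueEdge.
- move=> v a w ha hw h h'; apply: ipt_glue.
  rewrite -(cis_arg ha) -(cis_arg hw) cpow_cis -cisD -!slot_circleE; exact: GlueEuler.
- move=> v a w ha hw h h'; apply/esym; apply: ipt_glue.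
  rewrite -(cis_arg ha) -(cis_arg hw) cpow_cis -cisD -!slot_circleE; exact: GlueEuler.
- by move=> v a b w gv ha hb hw h h'; apply: ipt_glue; exact: GlueSphere.
- move=> v k a w kg ha hw hk.
  have g0 : (0 < genus v)%N by case: (genus v) kg => //; rewrite muln0.
  have [s s01 ->] := in_side_point g0 ha hk; rewrite -side_point_mate // => h h'.
  by apply: ipt_side => //; lra.
- move=> v k l w kg lg hw h h'.
  by rewrite (mk_piece_irr h (vertex_piece v k hw)) (mk_piece_irr h' (vertex_piece v l hw)) (ipt_vertex _ kg lg).
Qed.

Lemma ipt_coincide p q (h : piece p.1 p.2) (h' : piece q.1 q.2) :
  ipt (mk_piece h) = ipt (mk_piece h') <-> coincide p q.
Proof.
split=> [e|]; last exact: coincide_ipt.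
apply: coincideP => // f fi; have := ipt_invariant fi e.
by rewrite !place_mk.
Qed.

Lemma coincide_sym (p q : place R G) : piece p.1 p.2 -> piece q.1 q.2 -> coincide p q -> coincide q p.
Proof. by move=> h h' /(coincide_ipt h h')/esym/ipt_coincide. Qed.

(** The fibres of the link lie on no wall, so they are glued to nothing else. *)
Lemma coincide_center (p : place R G) v h w : att h = v -> valid p ->
  ~ coincide p (inl v, (slot_center R (Some (inr h)), w)).
Proof.
have [r0 r4] := andP (slot_radius_bounds R G).
move=> hv vp cp; have := sc_bounds R (Some (inr h) : port G) => /andP[s1 s2].
have sl (q : port G) a : sqnorm a = 1 -> (forall h', q <> Some (inr h')) ->
    slot_center R (Some (inr h)) = pol (sc q) r a -> False.
  move=> ha hq e; have := off_pol (sc q) r ha; rewrite -e slot_centerE /off /sqnorm /=.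
  have ne : Some (inr h) != q by apply/eqP => /esym; exact: hq.
  have : (4 * r) ^+ 2 <= (sc (Some (inr h)) - sc q) ^+ 2.
    by rewrite -[leRHS]real_normK ?num_real // ler_pXn2r ?nnegrE ?sc_sep //; lra.
  rewrite /=; nra.
have un a : sqnorm a = 1 -> slot_center R (Some (inr h)) = a -> False.
  by move=> ha e; move: ha; rewrite -e slot_centerE /sqnorm /=; nra.
move e : (inl v, _) cp => c cp; case: cp e vp => {p c}.
- by move=> p <- [[_ /(_ _ hv)]].
- by move=> d a b ha hb /(f_equal (fun q => q.2.1)) /= e _; case: (sl _ _ hb _ e).
- by [].
- by move=> w' a b ha hb /(f_equal (fun q => q.2.1)) /= e _; case: (sl _ _ ha _ e).
- by move=> w' a b c gw ha hb hc /(f_equal (fun q => q.2.1)) /= e _; case: (un _ hb).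
- move=> w' k a b kg ha hb hk /(f_equal (fun q => q.2.1)) /= e _; case: (un _ _ e).
  by rewrite /fold_side !sqnormM sqnorm_cj ha !sqnorm_cis !mul1r.
- move=> w' k l b kg lg hb /(f_equal (fun q => q.2.1)) /= e _; case: (un _ _ e).
  exact: sqnorm_cis.
Qed.

Lemma coincide_valid (p q : place R G) : piece p.1 p.2 -> valid q -> coincide p q -> valid p.
Proof.
move=> pp vq /(coincide_sym pp (valid_piece vq)).
case: p pp => -[v|v] [z w] [/= hz hw] c; split=> //=; split=> // h hv e.
by rewrite e in c; exact: (coincide_center hv vq c).
Qed.

Lemma valid_not_link p (h : valid p) : (~` @link R G) (ipt (mk_piece (valid_piece h))).
Proof.
move=> [q [k [t [e1 e2]]]]; have [q' [h' qe]] := pieceP q.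
rewrite qe place_mk in e1 e2.
by move: e2 => /ipt_coincide; rewrite e1; exact: coincide_center.
Qed.

Variable x0 : X.

(** Total on places, with the default [x0] off the link complement, so that paths can be written in
    coordinates. *)
Definition pt (p : place R G) : X :=
  if pselect (valid p) is left h then
    exist (fun x => x \in ~` @link R G) (ipt (mk_piece (valid_piece h)))
      (mem_set (@valid_not_link p h))
  else x0.

Lemma val_pt p (h : valid p) : val (pt p) = ipt (mk_piece (valid_piece h)).
Proof. by rewrite /pt; case: pselect => // h'; rewrite (Prop_irrelevance h h'). Qed.

Lemma pt_coincide p q : valid p -> valid q -> pt p = pt q <-> coincide p q.
Proof.
move=> vp vq; split=> [e|c].
  by apply/(ipt_coincide (valid_piece vp) (valid_piece vq)); rewrite -!val_pt e.
by apply: val_inj; rewrite (val_pt vp) (val_pt vq); apply: coincide_ipt.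
Qed.

Lemma pt_surj x : exists2 p, valid p & pt p = x.
Proof.
have [p [h pe]] := pieceP (repr (val x)).
have vx : val x = ipt (mk_piece h) by rewrite -pe /ipt reprK.
have vp : valid p.
  case: p h pe vx => -[v|v] [z w] h pe vx; have [h1 h2] := h; split=> //=; split=> // k hk e.
  apply: (set_mem (valP x)); rewrite vx; exists (mk_piece h), k, (arg w).
  by split; rewrite ?place_mk ?cis_arg // -e hk.
exists p => //; apply: val_inj; rewrite (val_pt vp) vx; congr ipt; exact: mk_piece_irr.
Qed.

Lemma pt_near i q (U : set X) : valid (i, q) -> nbhs (pt (i, q)) U ->
  \forall q' \near q, valid (i, q') -> U (pt (i, q')).
Proof.
move=> vq; rewrite nbhsE => -[V [[W oW We] Vq] VU].
have [W' oW' We'] : exists2 W' : set (plane * plane), open W' &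
    forall q' (h : piece i q'), W (ipt (@mk_piece (i, q') h)) <-> W' q'.
  have oP : open (ipt @^-1` W) by exact: oW.
  have /sigT_openP/(_ i)[W' oW' We'] := oP.
  exists W' => // q' h; rewrite -[W' q']/((set_val @^-1` W') (exist _ q' (mem_set h))).
  by rewrite We'.
have : W' q.
  by apply/(We' _ (valid_piece vq)); rewrite -(val_pt vq) -[W _]/((val @^-1` W) (pt (i, q))) We.
move=> hW; apply: filterS (open_nbhs_nbhs (conj oW' hW)) => q' hq' vq'; apply: VU.
by rewrite -We; have := (We' q' (valid_piece vq')).2 hq'; rewrite -(val_pt vq').
Qed.

Definition pt_fun (f : place R G -> R) (x : X) : R := f (place_of (repr (val x))).

Lemma pt_fun_pt f p : wall_invariant f -> valid p -> pt_fun f (pt p) = f p.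
Proof.
move=> fi vp; rewrite /pt_fun (val_pt vp) -[RHS](f_equal f (place_mk (valid_piece vp))).
by apply: ipt_invariant; rewrite // /ipt reprK.
Qed.

Lemma pt_fun_cts f : wall_invariant f -> continuous (pt_fun f).
Proof.
move=> fi x; have [_ fc] := fi.
have cf : continuous (fun p : pieces R G => f (place_of p)).
  move=> p; apply: (@sigT_continuous _ _ _ (fun i (q : piece i) => f (i, \val q))).
  by move=> i q; apply: (cts_comp (f := set_val : piece i -> _) _ (fc i)); exact: initial_continuous.
apply: (cts_comp (f := set_val : X -> mfd) (g := fun y => f (place_of (repr y)))).
  exact: initial_continuous.
apply: (@repr_comp_continuous _ _ _ (fun p => f (place_of p)) cf) => p q /eqP e.
by apply/eqP; exact: ipt_invariant.
Qed.

Lemma unit_compact (A : set plane) : closed A -> A `<=` [set z | sqnorm z <= 1] -> compact A.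
Proof.
move=> cA sA; apply: (@subclosed_compact _ A (`[-1, 1]%classic `*` `[-1, 1]%classic)) => //.
  by apply: compact_setX; exact: segment_compact.
move=> z /sA /=; rewrite /sqnorm => hz; split; rewrite /= in_itv /=; nra.
Qed.

Lemma piece_compact (i : cell) : compact (@piece R G i).
Proof.
have cl (f : plane -> R) (b : R) : continuous f -> closed [set z | f z <= b].
  by move=> cf; apply: (closed_comp _ (@closed_le _ b)) => z _; exact: cf.
have cg (f : plane -> R) (b : R) : continuous f -> closed [set z | b <= f z].
  by move=> cf; apply: (closed_comp _ (@closed_ge _ b)) => z _; exact: cf.
have cc : compact (@unit_circle R).
  apply: unit_compact => [|z /= ->//].
  rewrite (_ : @unit_circle R = [set z | sqnorm z <= 1] `&` [set z | 1 <= sqnorm z]).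
    by apply: closedI; [apply: cl|apply: cg]; exact: sqnorm_cts.
  by apply/seteqP; split=> z /=; rewrite /unit_circle /=; [move=> ->|lra].
have co p : closed (@outside_slot R G p).
  rewrite (_ : @outside_slot R G p = [set z | r ^+ 2 <= off (sc p) z]).
    exact: (cg _ (r ^+ 2) (@off_cts R (sc p))).
  by apply/seteqP; split=> z /outside_slotE.
case: i => v; apply: compact_setX => //; apply: unit_compact => //; last by apply: cl; exact: sqnorm_cts.
  rewrite (_ : @perforated_disk R G v = [set z | sqnorm z <= 1] `&` (@outside_slot R G None `&`
    \bigcap_(d in [set d | d_start d = v]) @outside_slot R G (Some (inl d)))) //.
  apply: closedI; first by apply: cl; exact: sqnorm_cts.
  by apply: closedI => //; apply: closed_bigI => d _.
by move=> z [].
Qed.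

(* Compactness of the pieces turns a condition near each place over [y0] into
   a condition on all places over the points near [y0]. *)
Lemma fibre_near (J : Type) (F : set_system J) (y0 : X)
    (P : place R G -> J -> Prop) : Filter F ->
  (forall i q, valid (i, q) -> pt (i, q) = y0 ->
     \forall q' \near q & j \near F, valid (i, q') -> P (i, q') j) ->
  \forall y \near y0 & j \near F, forall p, valid p -> pt p = y -> P p j.
Proof.
move=> FF H; have [p0 vp0 e0] := pt_surj y0.
have A i : \forall yj \near filter_prod (nbhs y0) F, forall q, piece i q ->
    valid (i, q) -> pt (i, q) = yj.1 -> P (i, q) yj.2.
  have /compact_near_coveringP := @piece_compact i.
  apply => q pq; have [eq0|ne0] := pselect (valid (i, q) /\ pt (i, q) = y0).
    have [vq /(H i q vq)] := eq0.
    move=> [[U V] /= [nU nV] UV]; exists (U, [set: X] `*` V); first split=> //=.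
      by exists ([set: X], V) => //; split=> //; exact: filterT.
    by move=> [q' [y j]] /= [Uq' [_ Vj]] vq' _; apply: (UV (q', j)).
  (* A place that is not over [y0] is separated from it by an invariant, so the places near it
     represent no point near [y0]. *)
  have [f fi fne] : exists2 f, wall_invariant f & f (i, q) <> f p0.
    apply: contrapT => nf; have cq : coincide (i, q) p0.
      apply: coincideP => //; first exact: valid_piece.
      by move=> f fi; apply: contrapT => fne; apply: nf; exists f.
    have vq : valid (i, q) by exact: (coincide_valid (p := (i, q)) pq vp0).
    by apply: ne0; split=> //; rewrite -e0; apply/pt_coincide.
  pose d := `|f (i, q) - f p0| / 2.
  have d0 : 0 < d by rewrite divr_gt0 // normr_gt0 subr_eq0; apply/eqP.
  have [_ fc] := fi; have n1 : \forall q' \near q, `|f (i, q) - f (i, q')| < d.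
    by have /cvgrPdist_lt := fc i q; apply.
  have n2 : \forall y \near y0, `|f p0 - pt_fun f y| < d.
    have /cvgrPdist_lt := pt_fun_cts fi (x := y0).
    by rewrite (_ : f p0 = pt_fun f y0) -?e0 ?pt_fun_pt //; apply.
  exists ([set q' | `|f (i, q) - f (i, q')| < d], [set y | `|f p0 - pt_fun f y| < d] `*` [set: J]).
    split=> //=; exists ([set y | `|f p0 - pt_fun f y| < d], [set: J]) => //.
    by split=> //; exact: filterT.
  move=> [q' [y j]] /= [h1 [h2 _]] vq' e; exfalso.
  move: h2; rewrite -e pt_fun_pt // distrC => h2.
  have := ler_distD (f (i, q')) (f (i, q)) (f p0); rewrite /d in h1 h2; lra.
have {A} A : \forall yj \near filter_prod (nbhs y0) F, forall i q, piece i q ->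
    valid (i, q) -> pt (i, q) = yj.1 -> P (i, q) yj.2.
  by apply: filter_forall.
apply: filterS A => -[y j] h [i q] vq; apply: h => //; exact: (valid_piece vq).
Qed.

End QuotientInterface.

(** * Polar coordinates around a point of the real axis *)

Section Polar.
Variable R : realType.
Local Notation plane := (R * R)%type.
Implicit Types (c : R) (z a : plane).

Definition rad c z : R := Num.sqrt (off c z).
Definition dir c z : plane := ((z.1 - c) / rad c z, z.2 / rad c z).

Lemma off_ge0 c z : 0 <= off c z.
Proof. by rewrite /off /sqnorm /= addr_ge0 // sqr_ge0. Qed.

Lemma rad_gt0 c z : (0 < rad c z) = (0 < off c z).
Proof. by rewrite sqrtr_gt0. Qed.

Lemma sqr_rad c z : rad c z ^+ 2 = off c z.
Proof. by rewrite sqr_sqrtr // off_ge0. Qed.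

Lemma sqnorm_dir c z : 0 < off c z -> sqnorm (dir c z) = 1.
Proof.
move=> h; have r0 : rad c z != 0 by rewrite gt_eqF // rad_gt0.
by rewrite /sqnorm /= !expr_div_n -mulrDl sqr_rad divff // gt_eqF.
Qed.

Lemma pol_dir c z : 0 < off c z -> pol c (rad c z) (dir c z) = z.
Proof.
move=> h; have r0 : rad c z != 0 by rewrite gt_eqF // rad_gt0.
by apply: pair_ext; rewrite /pol /=; field.
Qed.

Lemma rad_pol c rho a : 0 <= rho -> sqnorm a = 1 -> rad c (pol c rho a) = rho.
Proof. by move=> h ha; rewrite /rad off_pol // sqrtr_sqr ger0_norm. Qed.

Lemma dir_pol c rho a : 0 < rho -> sqnorm a = 1 -> dir c (pol c rho a) = a.
Proof.
move=> h ha; have h0 := lt0r_neq0 h.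
by apply: pair_ext; rewrite /dir rad_pol ?ltW // /pol /=; field.
Qed.

Lemma off0 z : off 0 z = sqnorm z.
Proof. by rewrite /off subr0; case: z. Qed.

Lemma rad0_unit z : sqnorm z = 1 -> rad 0 z = 1.
Proof. by move=> h; rewrite /rad off0 h sqrtr1. Qed.

Lemma dir0_unit z : sqnorm z = 1 -> dir 0 z = z.
Proof.
by move=> h; rewrite /dir rad0_unit // subr0 !divr1; case: z h.
Qed.

Lemma pol2 c rho a : (pol c rho a).2 = rho * a.2. Proof. by []. Qed.

Lemma rad_cts c : continuous (rad c).
Proof. by apply: (cts_comp (@off_cts R c)); exact: sqrt_continuous. Qed.

Lemma dir_cts_at c z : 0 < off c z -> {for z, continuous (dir c)}.
Proof.
move=> h; have r0 : rad c z != 0 by rewrite gt_eqF // rad_gt0.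
have cv : {for z, continuous (fun y => (rad c y)^-1)}.
  by apply: (@continuousV R plane (rad c)) => //; exact: rad_cts.
have f1 : {for z, continuous (fun y : plane => y.1 - c)}.
  by have h1 : continuous (fun y : plane => y.1 - c) by [cts]; exact: h1.
have f2 : {for z, continuous (fun y : plane => y.2)} by exact: cvg_snd.
have c1 := continuousM f1 cv; have c2 := continuousM f2 cv.
exact: (cvg_pair c1 c2).
Qed.

Lemma cts_near (Y : topologicalType) (f : plane -> Y) z (P : set Y) :
  {for z, continuous f} -> (\forall y \near f z, P y) -> \forall z' \near z, P (f z').
Proof. by move=> cf nP; exact: cf. Qed.

Lemma lt_near (f g : plane -> R) z : continuous f -> continuous g -> f z < g z ->
  \forall z' \near z, f z' < g z'.
Proof.
move=> cf cg h; have ch : continuous (fun y => g y - f y) by exact: ctsB.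
have h0 : 0 < g z - f z by rewrite subr_gt0.
by apply: filterS (cvgr_gt _ (ch z) _ h0) => y; rewrite subr_gt0.
Qed.

Lemma ctsat_pair (T Y Z : topologicalType) (f : T -> Y) (g : T -> Z) t :
  {for t, continuous f} -> {for t, continuous g} ->
  {for t, continuous (fun x => (f x, g x))}.
Proof. by move=> cf cg; exact: cvg_pair. Qed.

Lemma ctsat_comp (T Y Z : topologicalType) (f : T -> Y) (g : Y -> Z) t :
  {for t, continuous f} -> continuous g -> {for t, continuous (fun x => g (f x))}.
Proof. by move=> cf cg; apply: (@continuous_comp _ _ _ f g) => //; exact: cg. Qed.

(** From [z] to [z'], linearly in the distance to the pole and along the short arc of directions.
    When [radial] holds, the direction is that of [z'] throughout, and the path starts at another
    point of the circle of [z]. *)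
Definition contract c (radial : bool) z z' (l : R) : plane :=
  pol c (rad c z + l * (rad c z' - rad c z))
    (lerp (if radial then dir c z' else dir c z) (dir c z') l).

Lemma contract0 c b z : 0 < off c z -> contract c b z z = fun=> z.
Proof.
move=> h; apply/funext => l; rewrite /contract if_same lerpp ?sqnorm_dir //.
by rewrite subrr mulr0 addr0 pol_dir.
Qed.

Lemma contract_at0 c z z' : 0 < off c z -> contract c false z z' 0 = z.
Proof. by move=> h; rewrite /contract mul0r addr0 lerp0 pol_dir. Qed.

Lemma contract_at1 c b z z' : 0 < off c z -> 0 < off c z' ->
  2^-1 < (rel_dir (dir c z) (dir c z')).1 -> contract c b z z' 1 = z'.
Proof.
move=> h h' hr; rewrite /contract mul1r addrC subrK.
by case: b; rewrite ?lerpp ?lerp1 ?sqnorm_dir ?pol_dir.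
Qed.

Lemma off_contract c b z z' l : 0 < off c z -> 0 < off c z' ->
  off c (contract c b z z' l) = (rad c z + l * (rad c z' - rad c z)) ^+ 2.
Proof. by move=> h h'; rewrite off_pol // sqnorm_lerp // fun_if !sqnorm_dir ?if_same. Qed.

Lemma lerp_cts : continuous (fun p : plane * (plane * R) => lerp p.1 p.2.1 p.2.2).
Proof.
apply: cm_cts; first by move=> ?; exact: cvg_fst.
apply: (cts_comp _ (@cis_cts R)); apply: ctsM.
  by apply: (snd_comp_cts (f := snd)); cts.
apply: (cts_comp (g := @ang R)); last exact: ang_cts.
apply: cm_cts; first by apply: (snd_comp_cts (f := fst)); cts.
by apply: (cts_comp (f := fst)); [cts|exact: cj_cts].
Qed.

Lemma pol_cts c : continuous (fun p : R * plane => pol c p.1 p.2).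
Proof.
by apply: cts_pair; apply: ctsD || apply: ctsM;
  [cts|apply: ctsM; [cts|apply: (snd_comp_cts (f := fst)); cts]
  |cts|apply: (snd_comp_cts (f := snd)); cts].
Qed.

Lemma contract_cts_at c b z z' l : 0 < off c z' ->
  {for (z', l), continuous (fun p => contract c b z p.1 p.2)}.
Proof.
move=> h; have cd : {for (z', l), continuous (fun p : plane * R => dir c p.1)}.
  apply: (@continuous_comp _ _ _ fst (dir c)); first exact: cvg_fst.
  exact: dir_cts_at.
apply: (@continuous_comp _ _ _ (fun p : plane * R => (rad c z + p.2 * (rad c p.1 - rad c z),
   lerp (if b then dir c p.1 else dir c z) (dir c p.1) p.2)) (fun y => pol c y.1 y.2)); last exact: pol_cts.
have c1 : continuous (fun p : plane * R => rad c z + p.2 * (rad c p.1 - rad c z)).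
  by apply: ctsD; [cts|apply: ctsM; [cts|apply: ctsB; [apply: fst_comp_cts; exact: rad_cts|cts]]].
have c2 : {for (z', l), continuous (fun p : plane * R => if b then dir c p.1 else dir c z)}.
  by case: (b) => //; exact: cvg_cst.
have c3 : {for (z', l), continuous (fun p : plane * R => p.2)} by exact: cvg_snd.
have c5 := ctsat_comp (ctsat_pair c2 (ctsat_pair cd c3)) (@lerp_cts).
exact: (ctsat_pair (c1 (z', l)) c5).
Qed.

Lemma tube (T Y : topologicalType) (K : T * R -> Y) (t : T) (O : set Y) :
  (forall l, {for (t, l), continuous K}) ->
  (forall l, 0 <= l <= 1 -> nbhs (K (t, l)) O) ->
  \forall t' \near t, forall l, 0 <= l <= 1 -> O (K (t', l)).
Proof.
move=> cK nO; have /compact_near_coveringP H := @segment_compact R 0 1.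
have A (l : R) : `[(0 : R), 1]%classic l -> \forall l' \near l & t' \near t, O (K (t', l')).
  rewrite /= in_itv /= => /nO/(cK l) [[U V] /= [nU nV] UV].
  by exists (V, U) => // -[l' t'] /= [Vl Ut]; exact: (UV (t', l')).
apply: filterS (H T (nbhs t) (fun t' l => O (K (t', l))) _ A) => t' h l l01; apply: h.
by rewrite /= in_itv.
Qed.

End Polar.

(** * Close places *)

Section Close.
Variables (R : realType) (G : plumbing_graph).
Local Notation plane := (R * R)%type.
Local Notation r := (slot_radius R G).
Local Notation sc := (@sc R G).
Local Notation cell := (vertex G + vertex G)%type.
Implicit Types (v : vertex G) (i : cell) (z : plane) (q : plane * plane) (p : port G).

(** The pole around which nearby points are joined to [z]: the centre of the wall through [z], so
    that the path stays on the right side of this wall. Off the walls, -2 is outside of the disk and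
    still on the real axis, so that directions and ordinates have the same sign. *)
Definition center i z : R :=
  if sqnorm z == 1 then 0 else
  if i is inl v then
    if [pick p | hole v p && (off (sc p) z == r ^+ 2)] is Some p then sc p else -2
  else -2.

(** On a collapsed outer circle the direction of [z] has no meaning in the manifold, so the path
    takes that of its end. *)
Definition radial i z : bool := if i is inl v then (genus v == 0%N) && (sqnorm z == 1) else false.

Definition cone i z z' (l : R) : plane := contract (center i z) (radial i z) z z' l.

Lemma slot_not_unit p z : off (sc p) z = r ^+ 2 -> (sqnorm z == 1) = false.
Proof.
have [r0 _] := andP (slot_radius_bounds R G).
by move=> h; apply/negbTE; rewrite lt_eqF // (@off_unit R G p) // h; nra.
Qed.

Lemma slot_inj p p' z : off (sc p) z = r ^+ 2 -> off (sc p') z = r ^+ 2 -> p = p'.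
Proof.
have [r0 _] := andP (slot_radius_bounds R G).
move=> h h'; apply/eqP; apply: contraT => ne.
by have := off_other (z := z) ne; rewrite h h'; nra.
Qed.

Lemma center_outer i z : sqnorm z = 1 -> center i z = 0.
Proof. by rewrite /center => ->; rewrite eqxx. Qed.

Lemma center_slot v p z : hole v p -> off (sc p) z = r ^+ 2 -> center (inl v) z = sc p.
Proof.
move=> hp hz; rewrite /center (slot_not_unit hz).
case: pickP => [p' /andP[_ /eqP hp']|/(_ p)]; last by rewrite hp hz eqxx.
by rewrite (slot_inj hz hp').
Qed.

Lemma center_off i z : zvalid i z -> 0 < off (center i z) z.
Proof.
have [r0 _] := andP (slot_radius_bounds R G).
move=> hz; have un : sqnorm z <= 1 by case: i hz => v; [case=> -[]|].
have h2 : 0 < off (-2) z by move: un; rewrite /off /sqnorm /=; nra.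
rewrite /center; case: eqP => [u1|_]; first by rewrite off0 u1.
case: i hz => v // _; case: pickP => // p /andP[_ /eqP ->]; nra.
Qed.

Lemma zvalid_sqnorm i z : zvalid i z -> sqnorm z <= 1.
Proof. by case: i => v; [case=> -[]|]. Qed.

Lemma zvalid_hole v p z : zvalid (inl v) z -> hole v p -> r ^+ 2 <= off (sc p) z.
Proof.
case=> -[_ [h1 h2] _]; case: p => [[d|h]|] //= hp; apply/outside_slotE => //.
by apply: h2; apply/eqP.
Qed.

Lemma zvalid_arrow v h z : zvalid (inl v) z -> att h = v -> 0 < off (sc (Some (inr h))) z.
Proof.
move=> [_ hz] hv; rewrite lt_neqAle off_ge0 andbT eq_sym; apply/eqP => e.
apply: (hz h hv); rewrite slot_centerE; move: e; rewrite /off /sqnorm /= => /eqP.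
rewrite paddr_eq0 ?sqr_ge0 // !expf_eq0 /= subr_eq0 => /andP[/eqP e1 /eqP e2].
exact: pair_ext.
Qed.

Lemma zvalidI v z : sqnorm z <= 1 -> (forall p, hole v p -> r ^+ 2 <= off (sc p) z) ->
  (forall h, att h = v -> 0 < off (sc (Some (inr h))) z) -> zvalid (inl v) z.
Proof.
move=> h1 h2 h3; split; last first.
  move=> h /h3 h0 e; move: h0; rewrite e slot_centerE /off /sqnorm /= subrr expr0n addr0 ltxx.
  by [].
split=> //; split; first by apply/outside_slotE; exact: h2.
by move=> d hd; apply/outside_slotE; apply: h2; rewrite /hole hd.
Qed.

Lemma cone_cts_at i z z' l : 0 < off (center i z) z' ->
  {for (z', l), continuous (fun u : plane * R => cone i z u.1 u.2)}.
Proof. exact: contract_cts_at. Qed.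

Lemma center_near i z : zvalid i z -> \forall z' \near z, 0 < off (center i z) z'.
Proof.
move=> vz; apply: (@lt_near R (fun=> 0)); [exact: cts_cst|exact: off_cts|exact: center_off].
Qed.

Lemma near_forall (I : finType) (T : topologicalType) (t : T) (P : I -> T -> Prop) :
  (forall k, \forall t' \near t, P k t') -> \forall t' \near t, forall k, P k t'.
Proof. by move=> h; apply: filter_forall. Qed.

Lemma near_impl (T : topologicalType) (t : T) (A : Prop) (P : T -> Prop) :
  (A -> \forall t' \near t, P t') -> \forall t' \near t, A -> P t'.
Proof.
move=> h; have [a|na] := pselect A; first by apply: filterS (h a).
by apply: nearW => t' /na.
Qed.

Definition inside z : set plane :=
  [set y | [/\ sqnorm z < 1 -> sqnorm y < 1, forall p, r ^+ 2 < off (sc p) z -> r ^+ 2 < off (sc p) y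
    & forall p, 0 < off (sc p) z -> 0 < off (sc p) y]].

Lemma inside_near z : nbhs z (inside z).
Proof.
have n1 : \forall y \near z, sqnorm z < 1 -> sqnorm y < 1.
  by apply: near_impl => h; apply: lt_near => //; [exact: sqnorm_cts|exact: cts_cst].
have n2 : \forall y \near z, forall p, r ^+ 2 < off (sc p) z -> r ^+ 2 < off (sc p) y.
  by apply: near_forall => p; apply: near_impl => h; apply: (@lt_near R (fun=> r ^+ 2));
    [exact: cts_cst|exact: off_cts|].
have n3 : \forall y \near z, forall p, 0 < off (sc p) z -> 0 < off (sc p) y.
  by apply: near_forall => p; apply: near_impl => h; apply: (@lt_near R (fun=> 0));
    [exact: cts_cst|exact: off_cts|].
rewrite -nearE; near=> y; split; near: y; assumption.
Unshelve. all: by end_near. Qed.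

Lemma cone_near i z (O : set plane) : zvalid i z -> nbhs z O ->
  \forall z' \near z, forall l, 0 <= l <= 1 -> O (cone i z z' l).
Proof.
move=> vz nO; have c0 := center_off vz.
apply: (@tube R _ _ (fun u : plane * R => cone i z u.1 u.2)) => l; first exact: cone_cts_at.
by move=> _; rewrite /= /cone contract0.
Qed.

(** Strict inequalities at [z] persist along the whole path. An equality can only come from the wall
    through [z], and the distance to the centre of this wall varies linearly between two admissible
    values. *)
Lemma cone_valid i z : zvalid i z -> \forall z' \near z, zvalid i z' ->
  forall l, 0 <= l <= 1 -> zvalid i (cone i z z' l).
Proof.
have [r0 r4] := andP (slot_radius_bounds R G).
move=> vz; have c0 := center_off vz.
apply: filterS2 (center_near vz) (cone_near vz (inside_near z)) => z' c0' nz vz' l l01.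
have [n1 n2 n3] := nz l l01; have := off_contract (radial i z) l c0 c0'.
rewrite -/(cone i z z' l) => ho.
have un : sqnorm (cone i z z' l) <= 1.
  have [/n1/ltW //|] := ltP (sqnorm z) 1.
  have := zvalid_sqnorm vz => h1 h2; have u : sqnorm z = 1 by lra.
  move: ho; rewrite center_outer // !off0 rad0_unit // => ->.
  have r1 : 0 <= rad 0 z' by exact: sqrtr_ge0.
  have r2 : rad 0 z' ^+ 2 <= 1 by rewrite sqr_rad off0; exact: zvalid_sqnorm vz'.
  have r3 : rad 0 z' <= 1 by nra.
  have : 0 <= 1 + l * (rad 0 z' - 1) <= 1 by nra.
  by move: (1 + _) => x; nra.
case: i vz vz' c0 c0' nz ho un n1 n2 n3 => v // vz vz' c0 c0' nz ho un n1 n2 n3.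
apply: zvalidI => // [p hp|h hv]; last by apply: n3; exact: zvalid_arrow vz hv.
have [/n2/ltW //|h1] := ltP (r ^+ 2) (off (sc p) z).
have h2 := zvalid_hole vz hp; have e : off (sc p) z = r ^+ 2 by lra.
move: ho; rewrite (center_slot hp e) => ->.
have -> : rad (sc p) z = r by rewrite /rad e sqrtr_sqr ger0_norm ?ltW.
have r1 : 0 <= rad (sc p) z' by exact: sqrtr_ge0.
have r2 : r ^+ 2 <= rad (sc p) z' ^+ 2 by rewrite sqr_rad; exact: zvalid_hole vz' hp.
have r3 : r <= rad (sc p) z' by nra.
have : r <= r + l * (rad (sc p) z' - r) by nra.
by move: (r + _) => x; nra.
Qed.

(** The pole is on the real axis, so the ordinate has the sign of that of the direction, which
    [lerp_level] controls. *)
Lemma cone_half i z : zvalid i z -> \forall z' \near z,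
  (forall l, 0 <= l <= 1 -> 0 <= (cone i z z' l).2) \/
  (forall l, 0 <= l <= 1 -> (cone i z z' l).2 <= 0).
Proof.
move=> vz; have c0 := center_off vz.
have nl := dir_cts_at c0 (lerp_level (sqnorm_dir c0)); rewrite nbhs_filterE in nl.
apply: filterS2 (center_near vz) nl => z' c0' /(_ (sqnorm_dir c0')) hl.
have rp l : 0 <= l <= 1 -> 0 < rad (center i z) z + l * (rad (center i z) z' - rad (center i z) z).
  have : 0 < rad (center i z) z by rewrite rad_gt0.
  have : 0 < rad (center i z) z' by rewrite rad_gt0.
  by move: (rad _ _) (rad _ _) => x y; nra.
have [h|h] := leP 0 (dir (center i z) z').2; [left|right]; move=> l l01; rewrite /cone /contract pol2.
  rewrite pmulr_rge0 ?rp //; case: ifP => _; first by rewrite lerpp // sqnorm_dir.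
  by apply: (hl l l01).1.
rewrite pmulr_rle0 ?rp //; case: ifP => _; first by rewrite lerpp ?sqnorm_dir // ltW.
by apply: (hl l l01).2; exact: ltW.
Qed.

Definition small_angle : R := s2val (cid2 (@cos_near0 R)).

Lemma small_angleP : [/\ 0 < small_angle, small_angle < pi / 2 &
  forall t, `|t| < small_angle -> 2^-1 < cos t].
Proof. by rewrite /small_angle; case: (cid2 _) => e /= e0 [e1 e2]. Qed.

Definition cell_vertex i : vertex G := match i with inl v | inr v => v end.

(** The bound on the angles [s] and [t] under which [s + e * t], with [e] the Euler number, is still
    a small angle in the solid torus. *)
Definition eta i : R := small_angle / (2 * (1 + `|(euler (cell_vertex i))%:~R : R|)).

Lemma eta_gt0 i : 0 < eta i.
Proof.
by have [s0 _ _] := small_angleP; rewrite divr_gt0 // mulr_gt0.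
Qed.

Lemma eta_small i (s t : R) : `|s| < eta i -> `|t| < eta i ->
  `|s + (euler (cell_vertex i))%:~R * t| < small_angle.
Proof.
have [s0 _ _] := small_angleP.
rewrite /eta; set e := (euler _)%:~R : R => hs ht; have n0 := normr_ge0 e.
apply: (le_lt_trans (ler_normD _ _)); rewrite normrM.
have d0 : 0 < 2 * (1 + `|e|) by lra.
move: hs ht; rewrite !ltr_pdivlMr // => hs ht.
have := normr_ge0 s; have := normr_ge0 t; nra.
Qed.

(** The open arc between the middles of the two sides that meet at the vertex [k]. *)
Definition in_sector g k (a : plane) : Prop := in_side g k (cm a (cis (pang R g))).

(** What the comparison of [q] with a valid place near it relies on. In particular [q'] may leave
    the wall through [q], but it cannot lie on a wall that does not contain [q]. *)
Record close i q q' : Prop := Close {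
  cl_valid : valid (i, q');
  cl_fib : 2^-1 < (rel_dir q.2 q'.2).1 /\ `|ang (rel_dir q.2 q'.2)| < eta i;
  cl_off : 0 < off (center i q.1) q'.1;
  cl_ang : 2^-1 < (rel_dir (dir (center i q.1) q.1) (dir (center i q.1) q'.1)).1 /\
    `|ang (rel_dir (dir (center i q.1) q.1) (dir (center i q.1) q'.1))| < eta i;
  cl_cross : let a := dir (center i q.1) q.1 in let a' := dir (center i q.1) q'.1 in
    ncross a a' = if (0 < a.1) && (a.2 == 0) && (a'.2 < 0) then -1 else 0;
  cl_slot : forall v p, i = inl v -> hole v p -> off (sc p) q'.1 = r ^+ 2 -> off (sc p) q.1 = r ^+ 2;
  cl_outer : sqnorm q'.1 = 1 -> sqnorm q.1 = 1;
  cl_side : forall v k, i = inl v -> (k < 4 * genus v)%N -> sqnorm q.1 = 1 ->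
    (in_side (genus v) k q.1 -> in_side (genus v) k (dir 0 q'.1)) /\
    (in_sector (genus v) k q.1 -> in_sector (genus v) k (dir 0 q'.1));
  cl_low : q.1.2 < 0 -> q'.1.2 < 0;
  cl_up : 0 < q.1.2 -> 0 < q'.1.2;
  cl_axis : forall v p, i = inl v -> hole v p \/ (exists2 h, att h = v & p = Some (inr h)) ->
    q.1.2 = 0 -> (sc p < q'.1.1) = (sc p < q.1.1);
  cl_cone : forall l, 0 <= l <= 1 -> zvalid i (cone i q.1 q'.1 l);
  cl_half : (forall l, 0 <= l <= 1 -> 0 <= (cone i q.1 q'.1 l).2) \/
    (forall l, 0 <= l <= 1 -> (cone i q.1 q'.1 l).2 <= 0) }.

Lemma near_fst q (P : plane -> Prop) : (\forall z \near q.1, P z) -> \forall q' \near q, P q'.1.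
Proof. by move=> h; have : {for q, continuous (fst : plane * plane -> _)} by [exact: cvg_fst]; apply. Qed.
Lemma near_snd q (P : plane -> Prop) : (\forall z \near q.2, P z) -> \forall q' \near q, P q'.2.
Proof. by move=> h; have : {for q, continuous (snd : plane * plane -> _)} by [exact: cvg_snd]; apply. Qed.

Lemma near_close i q : valid (i, q) -> \forall q' \near q, valid (i, q') -> close i q q'.
Proof.
have [r0 r4] := andP (slot_radius_bounds R G).
case: q => z w [/= vz hw]; set c := center i z; have c0 : 0 < off c z := center_off vz.
have ha := sqnorm_dir c0; have cd := dir_cts_at c0.
have cdn (P : plane -> Prop) : (\forall a \near dir c z, P a) -> \forall z' \near z, P (dir c z').
  exact: cts_near.
have nc : \forall z' \near z, 0 < off c z' := center_near vz.
have n1 : \forall q' \near (z, w), 2^-1 < (rel_dir w q'.2).1 /\ `|ang (rel_dir w q'.2)| < eta i.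
  apply: (near_snd (q := (z, w)) (P := fun w' => 2^-1 < (rel_dir w w').1 /\ `|ang (rel_dir w w')| < eta i)).
  by apply: filterS2 (rel_dir_near hw) (ang_rel_near hw (eta_gt0 i)).
have n3 : \forall z' \near z, 2^-1 < (rel_dir (dir c z) (dir c z')).1 /\
    `|ang (rel_dir (dir c z) (dir c z'))| < eta i.
  by apply: filterS2 (cdn _ (rel_dir_near ha)) (cdn _ (ang_rel_near ha (eta_gt0 i))).
have n4 : \forall z' \near z, ncross (dir c z) (dir c z') =
   if (0 < (dir c z).1) && ((dir c z).2 == 0) && ((dir c z').2 < 0) then -1 else 0.
  by apply: filterS2 nc (cdn _ (ncross_level ha)) => z' h; apply; exact: sqnorm_dir.
have n5 := inside_near z.
have n6 : \forall z' \near z, forall p : port G, z.2 = 0 -> z.1 != sc p -> (sc p < z'.1) = (sc p < z.1).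
  apply: near_forall => p; apply: near_impl => _; apply: near_impl; rewrite neq_lt => /orP[h|h].
    have : \forall z' \near z, z'.1 < sc p by apply: (@lt_near R fst (fun=> sc p)); [cts|cts|].
    by apply: filterS => z' h'; rewrite !ltNge (ltW h) (ltW h').
  have : \forall z' \near z, sc p < z'.1 by apply: (@lt_near R (fun=> sc p) fst); [cts|cts|].
  by apply: filterS => z' h'; rewrite h h'.
have n7 : \forall z' \near z, z.2 < 0 -> z'.2 < 0.
  by apply: near_impl => h; apply: (@lt_near R snd (fun=> 0)); [cts|cts|].
have n8 : \forall z' \near z, 0 < z.2 -> 0 < z'.2.
  by apply: near_impl => h; apply: (@lt_near R (fun=> 0) snd); [cts|cts|].
have n9 : \forall z' \near z, forall k : 'I_(4 * genus (cell_vertex i)), sqnorm z = 1 ->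
    (in_side (genus (cell_vertex i)) k z -> in_side (genus (cell_vertex i)) k (dir 0 z')) /\
    (in_sector (genus (cell_vertex i)) k z -> in_sector (genus (cell_vertex i)) k (dir 0 z')).
  apply: near_forall => k; apply: near_impl => u1; set g := genus _.
  have z0 : 0 < off 0 z by rewrite off0 u1.
  have od (f : plane -> R) : continuous f -> \forall z' \near z,
      cos (pang R g) < f z -> cos (pang R g) < f (dir 0 z').
    move=> cf; apply: near_impl => h.
    apply: (cts_near (P := fun y => cos (pang R g) < f y) (dir_cts_at z0)).
    rewrite dir0_unit //; apply: lt_near => //; exact: cts_cst.
  have s1 := od (fun y => (rel_dir (nvec R g k) y).1).
  have s2 := od (fun y => (rel_dir (nvec R g k) (cm y (cis (pang R g)))).1).
  have {}s1 := s1 ltac:(rewrite /rel_dir /cm /=; cts).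
  have {}s2 := s2 ltac:(rewrite /rel_dir /cm /=; cts).
  by apply: filterS2 s1 s2.
have m : \forall z' \near z, zvalid i z' -> forall w', (2^-1 < (rel_dir w w').1 /\ `|ang (rel_dir w w')| < eta i) ->
   sqnorm w' = 1 -> close i (z, w) (z', w').
  near=> z' => vz' w' hw' uw'.
  have [b1 b2 b3] : inside z z' by near: z'; exact: n5.
  have b6 : forall p : port G, z.2 = 0 -> z.1 != sc p -> (sc p < z'.1) = (sc p < z.1).
    by near: z'; exact: n6.
  have b9 : forall k : 'I_(4 * genus (cell_vertex i)), sqnorm z = 1 ->
      (in_side (genus (cell_vertex i)) k z -> in_side (genus (cell_vertex i)) k (dir 0 z')) /\
      (in_sector (genus (cell_vertex i)) k z -> in_sector (genus (cell_vertex i)) k (dir 0 z')).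
    by near: z'; exact: n9.
  split => /=.
  - by split.
  - by [].
  - by near: z'; exact: nc.
  - by near: z'; exact: n3.
  - by near: z'; exact: n4.
  - move=> v p ei hp h; subst i; apply/eqP; rewrite eq_le (zvalid_hole vz hp) andbT leNgt.
    by apply/negP => /b2; rewrite h ltxx.
  - move=> u1; apply/eqP; rewrite eq_le (zvalid_sqnorm vz) /= leNgt.
    by apply/negP => /b1; rewrite u1 ltxx.
  - move=> v k ei kg u1; subst i.
    exact: (b9 (Ordinal kg) u1).
  - by near: z'; exact: n7.
  - by near: z'; exact: n8.
  - move=> v p ei hp z2; subst i.
    apply: b6 => //; apply/eqP => e.
    have : off (sc p) z = 0 by rewrite /off /sqnorm /= e z2 subrr expr0n addr0.
    case: hp => [/(zvalid_hole vz) h1|[h /(zvalid_arrow vz) h' ->]] h0; first by rewrite h0 in h1; nra.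
    by rewrite h0 ltxx in h'.
  - by move: vz'; near: z'; exact: cone_valid.
  - by near: z'; exact: cone_half.
apply: filterS2 n1 (near_fst (q := (z, w)) m) => -[z' w'] /= h1 h2 [/= vz' hw'].
exact: h2.
Unshelve. all: by end_near. Qed.

Section Corners.
Variable g : nat.
Hypothesis g0 : (0 < g)%N.
Local Notation nvec := (nvec R g).
Local Notation vvec := (vvec R g).
Local Notation pang := (pang R g).

Lemma vvec_turn k : cm (vvec k) (cis pang) = nvec k.
Proof. by rewrite -cisD; congr cis; ring. Qed.

Lemma nvec_turn k : cm (nvec k) (cis pang) = vvec k.+1.
Proof. by rewrite -cisD -natr1; congr cis; ring. Qed.

Lemma sector_vertex k : in_sector g k (vvec k).
Proof.
have [p0 _] := andP (pang_bounds R g0).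
rewrite /in_sector vvec_turn -[nvec k]cm1 -cis0; apply: in_side_cis => //.
by rewrite oppr_lt0 p0.
Qed.

Lemma vertex_sector k m : (k < 4 * g)%N -> (m < 4 * g)%N -> in_sector g m (vvec k) -> m = k.
Proof.
move=> kg mg h; have := sector_vertex k; rewrite /in_sector => h'.
by apply: (in_side_inj g0 mg kg _ h h'); rewrite sqnormM !sqnorm_cis mul1r.
Qed.

Lemma next_side k : (k < 4 * g)%N -> exists k1, [/\ (k1 < 4 * g)%N, vvec k1 = vvec k.+1 & nvec k1 = nvec k.+1].
Proof.
move=> kg; have [h|h] := ltnP k.+1 (4 * g); first by exists k.+1.
have -> : k.+1 = (4 * g)%N by apply/eqP; rewrite eqn_leq kg h.
by exists 0%N; rewrite -!vvec_turn vvec_total // muln_gt0.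
Qed.

(** A point of an open side, off its middle, is in the sector of one end only, and the sign of [phi]
    tells which. The last end is given by its position, as the index [k.+1] may be out of range. *)
Lemma side_sector k m (a : plane) : (k < 4 * g)%N -> (m < 4 * g)%N -> sqnorm a = 1 ->
  in_side g k a -> in_sector g m a -> exists phi, a = cm (nvec k) (cis phi) /\
    ((- pang < phi < 0 /\ m = k) \/ (0 < phi < pang /\ vvec m = vvec k.+1)).
Proof.
move=> kg mg ha hk hm; have [p0 _] := andP (pang_bounds R g0).
have [phi /andP[f1 f2] ae] := in_sideP g0 ha hk; exists phi; split=> //.
have hs : sqnorm (cm a (cis pang)) = 1 by rewrite sqnormM ha sqnorm_cis mul1r.
have [k1 [k1g e1 e2]] := next_side kg.
have at_ : cm a (cis pang) = cm (nvec k) (cis (phi + pang)) by rewrite ae -cmA -cisD.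
case: (ltgtP phi 0) => h0.
- left; split; first by rewrite f1.
  by apply: (in_side_inj g0 mg kg hs hm); rewrite at_; apply: in_side_cis => //; lra.
- right; split; first by rewrite f2.
  rewrite -e1; congr vvec; apply: (in_side_inj g0 mg k1g hs hm).
  have -> : cm a (cis pang) = cm (nvec k1) (cis (phi - pang)).
    by rewrite e2 at_ -!cisD -natr1; congr cis; ring.
  by apply: in_side_cis => //; lra.
- exfalso; apply: (@vvec_not_side R _ g0 _ _ k1g mg); rewrite e1 -nvec_turn.
  by move: hm; rewrite /in_sector ae h0 cis0 cm1.
Qed.

Lemma fold_side_in k (a : plane) : (k < 4 * g)%N -> sqnorm a = 1 -> in_side g k a ->
  in_side g (mate k) (fold_side g k a).
Proof.
move=> kg ha hk; have [phi /andP[f1 f2] ->] := in_sideP g0 ha hk.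
by rewrite fold_cis; apply: in_side_cis => //; lra.
Qed.

Lemma sqnorm_fold k (a : plane) : sqnorm a = 1 -> sqnorm (fold_side g k a) = 1.
Proof. by move=> ha; rewrite /fold_side !sqnormM sqnorm_cj ha !sqnorm_cis !mul1r. Qed.

End Corners.

Lemma coincide_outer v j z1 w1 z2 w2 : sqnorm z1 = 1 -> coincide (inl v, (z1, w1)) (j, (z2, w2)) ->
  [/\ j = inl v, w2 = w1 & [\/ z2 = z1, genus v = 0%N /\ sqnorm z2 = 1,
    exists k, [/\ (k < 4 * genus v)%N, in_side (genus v) k z1 & z2 = fold_side (genus v) k z1]
    | exists k l, [/\ (k < 4 * genus v)%N, (l < 4 * genus v)%N,
        z1 = vvec R (genus v) k & z2 = vvec R (genus v) l]]].
Proof.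
move=> u1; move e1 : (inl v, _) => p1; move e2 : (j, _) => p2 c.
case: c e1 e2 => {p1 p2}.
- by move=> p <- [-> -> ->]; split=> //; apply: Or41.
- move=> d a w ha hw [_ e _]; have := slot_not_unit (off_pol (sc (Some (inl d))) r ha).
  by rewrite -e u1 eqxx.
- move=> v' a w ha hw [_ e _]; have := slot_not_unit (off_pol (sc None) r ha).
  by rewrite -e u1 eqxx.
- by [].
- by move=> v' a b w gv ha hb hw [-> -> ->] [-> -> ->]; split=> //; apply: Or42.
- by move=> v' k a w kg ha hw hk [-> -> ->] [-> -> ->]; split=> //; apply: Or43; exists k.
- by move=> v' k l w kg lg hw [-> -> ->] [-> -> ->]; split=> //; apply: Or44; exists k, l.
Qed.

Lemma coincide_invariant f (p q : place R G) : valid p -> valid q -> wall_invariant f ->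
  coincide p q -> f p = f q.
Proof.
move=> vp vq fi /(ipt_coincide (valid_piece vp) (valid_piece vq)) e.
by have := ipt_invariant fi e; rewrite !place_mk.
Qed.

Lemma slot_near v p i q q' a : i = inl v -> hole v p -> sqnorm a = 1 -> close i q q' ->
  q'.1 = pol (sc p) r a -> exists2 a0, sqnorm a0 = 1 & q.1 = pol (sc p) r a0.
Proof. by move=> ei hp ha cl e; apply: slot_polar; apply: (cl_slot cl ei hp); rewrite e off_pol. Qed.

(** Closeness makes the two members of a pair change representative together: both on a slot circle,
    both on a collapsed circle or only the first, both on a side, a vertex followed by a point of a
    side, or both at vertices. An [F] compatible with these changes depends on the points only. *)
Lemma close_descends (T : Type) (F : cell -> plane * plane -> plane * plane -> T) :
  (forall d a0 w0 a w, sqnorm a0 = 1 -> sqnorm w0 = 1 -> sqnorm a = 1 -> sqnorm w = 1 ->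
     let z x := pol (sc (Some (inl d))) r x in let z' x := pol (sc (Some (inl (d_rev d)))) r x in
     close (inl (d_start d)) (z a0, w0) (z a, w) -> close (inl (d_end d)) (z' w0, a0) (z' w, a) ->
     F (inl (d_start d)) (z a0, w0) (z a, w) = F (inl (d_end d)) (z' w0, a0) (z' w, a)) ->
  (forall v a0 w0 a w, sqnorm a0 = 1 -> sqnorm w0 = 1 -> sqnorm a = 1 -> sqnorm w = 1 ->
     let z x := pol (sc None) r x in let u w x := cm w (cpow x (euler v)) in
     close (inl v) (z a0, w0) (z a, w) -> close (inr v) (a0, u w0 a0) (a, u w a) ->
     F (inl v) (z a0, w0) (z a, w) = F (inr v) (a0, u w0 a0) (a, u w a)) ->
  (forall v a0 b0 w0 q1 q2, genus v = 0%N -> sqnorm a0 = 1 -> sqnorm b0 = 1 -> sqnorm w0 = 1 ->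
     close (inl v) (a0, w0) q1 -> close (inl v) (b0, w0) q2 ->
     q1 = q2 \/ [/\ sqnorm q1.1 = 1, sqnorm q2.1 = 1 & q1.2 = q2.2] ->
     F (inl v) (a0, w0) q1 = F (inl v) (b0, w0) q2) ->
  (forall v k a0 w0 a w, let g := genus v in (k < 4 * g)%N -> sqnorm a0 = 1 -> sqnorm a = 1 ->
     sqnorm w0 = 1 -> sqnorm w = 1 -> in_side g k a0 -> in_side g k a ->
     close (inl v) (a0, w0) (a, w) -> close (inl v) (fold_side g k a0, w0) (fold_side g k a, w) ->
     F (inl v) (a0, w0) (a, w) = F (inl v) (fold_side g k a0, w0) (fold_side g k a, w)) ->
  (forall v k phi w0 w, let g := genus v in (k < 4 * g)%N -> - pang R g < phi < 0 ->
     sqnorm w0 = 1 -> sqnorm w = 1 -> let a := cm (nvec R g k) (cis phi) in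
     let b := cm (nvec R g (mate k)) (cis (- phi)) in
     close (inl v) (vvec R g k, w0) (a, w) -> close (inl v) (vvec R g (mate k).+1, w0) (b, w) ->
     F (inl v) (vvec R g k, w0) (a, w) = F (inl v) (vvec R g (mate k).+1, w0) (b, w)) ->
  (forall v k l w0 w, let g := genus v in (k < 4 * g)%N -> (l < 4 * g)%N ->
     sqnorm w0 = 1 -> sqnorm w = 1 ->
     close (inl v) (vvec R g k, w0) (vvec R g k, w) -> close (inl v) (vvec R g l, w0) (vvec R g l, w) ->
     F (inl v) (vvec R g k, w0) (vvec R g k, w) = F (inl v) (vvec R g l, w0) (vvec R g l, w)) ->
  forall i1 i2 q1 q2 q1' q2', valid (i1, q1) -> valid (i2, q2) ->
    close i1 q1 q1' -> close i2 q2 q2' ->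
    coincide (i1, q1) (i2, q2) -> coincide (i1, q1') (i2, q2') -> F i1 q1 q1' = F i2 q2 q2'.
Proof.
move=> Hedge Heuler Hsph Hside Hcorner Hvert.
have [r0 _] := andP (slot_radius_bounds R G).
have Heul v q1 q2 a w : sqnorm a = 1 -> sqnorm w = 1 -> valid (inl v, q1) -> valid (inr v, q2) ->
    close (inl v) q1 (pol (sc None) r a, w) -> close (inr v) q2 (a, cm w (cpow a (euler v))) ->
    coincide (inl v, q1) (inr v, q2) ->
    F (inl v) q1 (pol (sc None) r a, w) = F (inr v) q2 (a, cm w (cpow a (euler v))).
  move=> ha hw vq1 vq2 c1 c2 cc.
  have [a0 ha0 z1e] := slot_near erefl (erefl : hole v None) ha c1 erefl.
  have e (chi : plane * plane -> R) : continuous chi -> chi (a0, cm q1.2 (cpow a0 (euler v))) = chi q2.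
    move=> /(euler_fun_invariant v) ci; have := coincide_invariant vq1 vq2 ci cc.
    rewrite /euler_fun !eqxx /=; case: (q1) z1e => z1 w1 /= ->.
    by rewrite bump1 // mul1r slot_coord; case: (q2).
  have q2e : q2 = (a0, cm q1.2 (cpow a0 (euler v))).
    by apply: coords_ext => chi /coords_cts/e.
  subst q2; case: q1 z1e vq1 c1 {cc e} vq2 c2 => z1 w1 /= -> [_ /= hw1] c1 _ c2.
  exact: Heuler.
have dirq v q q' : close (inl v) q q' -> sqnorm q.1 = 1 -> sqnorm (dir 0 q'.1) = 1.
  by move=> c u; apply: sqnorm_dir; have := cl_off c; rewrite center_outer.
have g0k v k : (k < 4 * genus v)%N -> (0 < genus v)%N by case: (genus v) => //; rewrite muln0.
move=> i1 i2 q1 q2 q1' q2' vq1 vq2; move e1 : (i1, q1') => p1; move e2 : (i2, q2') => p2.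
move=> c1 c2 cc cc'; case: cc' e1 e2 => {p1 p2}.
- move=> p e1 e2; have ei : i2 = i1 by move: e1 e2 => <- [->].
  have eq : q2' = q1' by move: e1 e2 => <- [_ ->].
  subst i2 q2'; clear e1 e2 p.
  move e1 : (i1, q1) cc => p1; move e2 : (i1, q2) => p2 cc.
  case: cc e1 e2 => {p1 p2}.
  + by move=> p <- [->].
  + move=> d a w ha hw [e1 _] [e2 _]; exfalso; move/eqP: (d_start_neq_end d); apply.
    by move: e2; rewrite e1 => -[].
  + by move=> v a w _ _ [-> _] [].
  + by move=> v a w _ _ [-> _] [].
  + move=> v a b w gv ha hb hw [ei eq1] [_ eq2]; subst i1 q1 q2.
    by apply: Hsph => //; left.
  (* The common second member would have its direction in two different sides. *)
  + move=> v k a w kg ha hw hk [ei eq1] [_ eq2]; subst i1 q1 q2; exfalso.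
    have g0 := g0k _ _ kg; have mg := @mate_lt _ g0 _ kg.
    have hf := sqnorm_fold (genus v) k ha.
    have [s1 _] := cl_side c1 erefl kg ha; have [s2 _] := cl_side c2 erefl mg hf.
    have := in_side_inj g0 kg mg (dirq _ _ _ c1 ha) (s1 hk) (s2 (fold_side_in g0 kg ha hk)).
    by move/eqP; rewrite eq_sym (negbTE (mate_neq g0 k)).
  + move=> v k l w kg lg hw [ei eq1] [_ eq2]; subst i1 q1 q2.
    have g0 := g0k _ _ kg.
    have [_ s1] := cl_side c1 erefl kg (sqnorm_cis _); have [_ s2] := cl_side c2 erefl lg (sqnorm_cis _).
    have u := dirq _ _ _ c1 (sqnorm_cis _).
    rewrite (in_side_inj g0 kg lg _ (s1 (sector_vertex g0 k)) (s2 (sector_vertex g0 l))) //.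
    by rewrite sqnormM u sqnorm_cis mul1r.
- move=> d a w ha hw [ei eq] [ei' eq']; subst i1 i2 q1' q2'.
  have h1 : hole (d_start d) (Some (inl d)) by rewrite /hole.
  have h2 : hole (d_end d) (Some (inl (d_rev d))) by rewrite /hole d_start_rev.
  have [a0 ha0 z1e] := slot_near erefl h1 ha c1 erefl.
  have [w0 hw0 z2e] := slot_near erefl h2 hw c2 erefl.
  have se : (inl (d_end d) == inl (d_start d) :> cell) = false.
    by apply/negbTE; apply: contra (d_start_neq_end d) => /eqP[->].
  have e : (a0, q1.2) = (q2.2, w0).
    apply: coords_ext => chi /coords_cts/(dart_fun_invariant d) ci.
    have := coincide_invariant vq1 vq2 ci cc.
    rewrite /dart_fun se !eqxx; case: (q1) z1e => z1 w1 /= ->; case: (q2) z2e => z2 w2 /= ->.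
    by rewrite !bump1 // !mul1r !slot_coord.
  case: q1 z1e vq1 c1 e {cc} => z1 w1 /= -> vq1 c1 e; case: q2 z2e vq2 c2 e => z2 w2 /= -> vq2 c2 e.
  have ea : a0 = w2 := f_equal fst e; have ew : w1 = w0 := f_equal snd e; subst w2 w1.
  exact: Hedge.
- move=> v a w ha hw [ei eq] [ei' eq']; subst i1 i2 q1' q2'; exact: Heul.
- move=> v a w ha hw [ei eq] [ei' eq']; subst i1 i2 q1' q2'; apply/esym; apply: Heul => //.
  exact: (coincide_sym (valid_piece vq1) (valid_piece vq2)).
- move=> v a b w gv ha hb hw [ei eq] [ei' eq']; subst i1 i2 q1' q2'.
  have u1 := cl_outer c1 ha; have u2 := cl_outer c2 hb.
  case: q1 q2 vq1 vq2 c1 c2 cc u1 u2 => z1 w1 [z2 w2] [_ /= hw1] _ c1 c2 cc /= u1 u2.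
  have [_ ww _] := coincide_outer u1 cc; subst w2.
  by apply: Hsph => //; right.
- move=> v k a w kg ha hw hk [ei eq] [ei' eq']; subst i1 i2 q1' q2'.
  have g0 := g0k _ _ kg; have mg := @mate_lt _ g0 _ kg.
  have hf := sqnorm_fold (genus v) k ha; have hkf := fold_side_in g0 kg ha hk.
  have u1 := cl_outer c1 ha; have u2 := cl_outer c2 hf.
  case: q1 q2 vq1 vq2 c1 c2 cc u1 u2 => z1 w1 [z2 w2] [_ /= hw1] _ c1 c2 cc /= u1 u2.
  have [_ ww cs] := coincide_outer u1 cc; subst w2.
  have side1 m : (m < 4 * genus v)%N -> in_side (genus v) m z1 -> m = k.
    move=> mg' hm; have [s1 _] := cl_side c1 erefl mg' u1.
    by move: (s1 hm); rewrite /= dir0_unit // => h; exact: (in_side_inj g0 mg' kg ha h hk).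
  have side2 m : (m < 4 * genus v)%N -> in_side (genus v) m z2 -> m = mate k.
    move=> mg' hm; have [s1 _] := cl_side c2 erefl mg' u2.
    by move: (s1 hm); rewrite /= dir0_unit // => h; exact: (in_side_inj g0 mg' mg hf h hkf).
  have vert1 m : (m < 4 * genus v)%N -> z1 = vvec R (genus v) m -> in_sector (genus v) m a.
    move=> mg' hm; have [_ s1] := cl_side c1 erefl mg' u1; rewrite -[a]dir0_unit //.
    by apply: s1; rewrite /= hm; exact: sector_vertex.
  have vert2 m : (m < 4 * genus v)%N -> z2 = vvec R (genus v) m -> in_sector (genus v) m (fold_side (genus v) k a).
    move=> mg' hm; have [_ s1] := cl_side c2 erefl mg' u2; rewrite -[fold_side _ _ _]dir0_unit //.
    by apply: s1; rewrite /= hm; exact: sector_vertex.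
  (* Both first members are vertices. The position of [a] before or after the middle of its side
     tells which end [z1] is, and folding exchanges the two possibilities. *)
  have corner m l : (m < 4 * genus v)%N -> (l < 4 * genus v)%N -> z1 = vvec R (genus v) m ->
      z2 = vvec R (genus v) l ->
      F (inl v) (z1, w1) (a, w) = F (inl v) (z2, w1) (fold_side (genus v) k a, w).
    move=> mg' lg' e1 e2.
    have [phi [ae h]] := side_sector g0 kg mg' ha hk (vert1 m mg' e1).
    have [psi [be h']] := side_sector g0 mg lg' hf hkf (vert2 l lg' e2).
    have fe : psi = - phi.
      have [p0 _] := andP (pang_bounds R g0); have pp := @pi_pos R.
      have pg := pang_bounds R g0.
      move: be; rewrite ae fold_cis => be; apply: cis_inj.
        by rewrite ltr_norml; case: h => -[/andP[? ?] _]; case: h' => -[/andP[? ?] _]; lra.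
      have := f_equal (fun x => cm x (cj (nvec R (genus v) (mate k)))) be.
      by rewrite !(cmC (nvec _ _ _)) !cmK ?sqnorm_cis // => ->.
    subst psi; rewrite be ae; case: h => [[hphi hm]|[hphi hm]]; case: h' => [[hpsi hl]|[hpsi hl]].
    + by exfalso; move: hphi hpsi => /andP[? ?] /andP[? ?]; lra.
    + rewrite e2 hl e1 hm; apply: Hcorner => //; first by rewrite -ae -hm -e1.
      by rewrite -be -hl -e2.
    + have := Hcorner v (mate k) (- phi) w1 w mg hpsi hw1 hw.
      rewrite (mateK g0 kg) opprK -be -ae -hm -e1 => /(_ _ c1) h.
      by rewrite -h ?e2 ?hl // -hl -e2.
    + by exfalso; move: hphi hpsi => /andP[? ?] /andP[? ?]; lra.
  case: cs => [ez|[gv _]|[m [mg' hm ez]]|[m [l [mg' lg' ez1 ez2]]]].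
  + subst z2; have [[m mg' hm]|[m mg' hm]] := circle_sides g0 u1; last exact: (corner m m).
    exfalso; have := side2 m mg' hm; rewrite (side1 m mg' hm).
    by apply/eqP; rewrite eq_sym (mate_neq g0 k).
  + by rewrite gv in g0.
  + have em := side1 m mg' hm; subst m z2; exact: Hside.
  + exact: (corner m l).
- move=> v k l w kg lg hw [ei eq] [ei' eq']; subst i1 i2 q1' q2'.
  have g0 := g0k _ _ kg.
  have u1 := cl_outer c1 (sqnorm_cis _); have u2 := cl_outer c2 (sqnorm_cis _).
  case: q1 q2 vq1 vq2 c1 c2 cc u1 u2 => z1 w1 [z2 w2] [_ /= hw1] _ c1 c2 cc /= u1 u2.
  have [_ ww _] := coincide_outer u1 cc; subst w2.
  have vert m z : (m < 4 * genus v)%N -> sqnorm z = 1 ->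
      close (inl v) (z, w1) (vvec R (genus v) m, w) -> z = vvec R (genus v) m.
    move=> mg uz cz; have [[j jg hj]|[j jg hj]] := circle_sides g0 uz.
      have [s1 _] := cl_side cz erefl jg uz; exfalso; move: (s1 hj).
      by rewrite /= dir0_unit ?sqnorm_cis //; exact: vvec_not_side.
    have [_ s1] := cl_side cz erefl jg uz; rewrite hj; congr vvec.
    apply: (vertex_sector g0 mg jg); rewrite -[vvec _ _ m]dir0_unit ?sqnorm_cis //.
    by apply: s1; rewrite /= hj; exact: sector_vertex.
  have e1 := vert k z1 kg u1 c1; have e2 := vert l z2 lg u2 c2; subst z1 z2.
  exact: Hvert.
Qed.

End Close.

(** * Short paths between close places *)

Section Spokes.
Variables (R : realType) (G : plumbing_graph).
Local Notation plane := (R * R)%type.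
Local Notation r := (slot_radius R G).
Local Notation sc := (@sc R G).
Local Notation cell := (vertex G + vertex G)%type.
Local Notation X := (link_complement R G).
Local Notation close := (@close R G).
Implicit Types (v : vertex G) (i : cell) (z : plane) (q : plane * plane) (l : R).

Lemma lerp_cis (s t l : R) : - (pi / 2) < t - s < pi / 2 -> 2^-1 < cos (t - s) ->
  lerp (cis s) (cis t) l = cis (s + l * (t - s)).
Proof. by move=> h1 h2; rewrite /lerp rel_dir_cis ang_cis // -cisD. Qed.


Lemma lerp_turn (n : plane) (s t l : R) : - (pi / 2) < t - s < pi / 2 -> 2^-1 < cos (t - s) ->
  sqnorm n = 1 -> lerp (cm n (cis s)) (cm n (cis t)) l = cm n (cis (s + l * (t - s))).
Proof.
move=> h1 h2 /cis_arg <-; set u := arg n; have e : u + t - (u + s) = t - s by ring.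
by rewrite -!cisD lerp_cis e //; congr cis; ring.
Qed.

Definition spoke_place i q q' l : plane * plane := (cone i q.1 q'.1 l, lerp q.2 q'.2 l).

Lemma spoke_valid i q q' l : sqnorm q.2 = 1 -> close i q q' -> 0 <= l <= 1 ->
  valid (i, spoke_place i q q' l).
Proof. by move=> hw c l01; split; [exact: (cl_cone c)|rewrite /= sqnorm_lerp]. Qed.

Lemma cone_slot v (p : port G) a0 a l : hole v p -> sqnorm a0 = 1 -> sqnorm a = 1 ->
  cone (inl v) (pol (sc p) r a0) (pol (sc p) r a) l = pol (sc p) r (lerp a0 a l).
Proof.
have [r0 _] := andP (slot_radius_bounds R G).
move=> hp h0 h; rewrite /cone (center_slot hp) ?off_pol // /contract !rad_pol ?ltW // !dir_pol //.
by rewrite /radial (slot_not_unit (off_pol _ _ h0)) andbF subrr mulr0 addr0.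
Qed.

Lemma pol01 a : pol 0 1 a = a :> plane.
Proof. by case: a => x y; rewrite /pol /= add0r !mul1r. Qed.

Lemma cone_outer i a0 a l : radial i a0 = false -> sqnorm a0 = 1 -> sqnorm a = 1 ->
  cone i a0 a l = lerp a0 a l.
Proof.
move=> ri h0 h; rewrite /cone center_outer // /contract ri !rad0_unit // !dir0_unit //.
by rewrite subrr mulr0 addr0 pol01.
Qed.

Lemma cone_radial v a0 z l : genus v = 0%N -> sqnorm a0 = 1 -> 0 < off 0 z ->
  cone (inl v) a0 z l = pol 0 (1 + l * (rad 0 z - 1)) (dir 0 z).
Proof.
move=> gv h0 hz; rewrite /cone center_outer // /contract /radial gv h0 !eqxx /=.
by rewrite rad0_unit // lerpp // sqnorm_dir.
Qed.

Lemma radial_genus v z : (0 < genus v)%N -> radial (inl v) z = false.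
Proof. by rewrite /radial lt0n => /negbTE ->. Qed.

(** On a collapsed circle the spoke starts at another place, which represents the same point. *)
Lemma spoke0 (x0 : X) i q q' : valid (i, q) -> close i q q' ->
  pt x0 (i, spoke_place i q q' 0) = pt x0 (i, q).
Proof.
move=> vq c; case ri : (radial i q.1); last first.
  rewrite /spoke_place /cone ri contract_at0 ?lerp0 -?surjective_pairing //.
  by apply: center_off; case: vq.
case: i ri vq c => v //= /andP[/eqP gv /eqP u1] vq c; have [_ hw] := vq.
have o0 : 0 < off 0 q'.1 by have := cl_off c; rewrite center_outer.
rewrite /spoke_place lerp0 cone_radial // mul0r addr0 pol01.
apply/pt_coincide => //; first by apply: outer_valid => //; exact: sqnorm_dir.
by case: (q) u1 hw => z w /= u1 hw; apply: CoSphere => //; exact: sqnorm_dir.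
Qed.

Lemma spoke1 i q q' : valid (i, q) -> close i q q' -> spoke_place i q q' 1 = q'.
Proof.
move=> [/= vz vw] c; have [_ vw'] := cl_valid c; have [h1 _] := cl_ang c; have [h2 _] := cl_fib c.
rewrite /spoke_place /cone contract_at1 ?(cl_off c) // ?lerp1 -?surjective_pairing //.
exact: center_off.
Qed.

Lemma unit_lift (a0 a : plane) : sqnorm a0 = 1 -> sqnorm a = 1 -> 2^-1 < (rel_dir a0 a).1 ->
  exists s t, [/\ a0 = cis s, a = cis (s + t), t = ang (rel_dir a0 a), - (pi / 2) < t < pi / 2 & 2^-1 < cos t].
Proof.
move=> h0 h h1; exists (arg a0), (ang (rel_dir a0 a)); split=> //; rewrite ?cis_arg //.
- exact: lift_near (cis_arg h0) h h1.
- exact: ang_bound.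
- by have := cis_ang (sqnorm_rel h0 h) h1 => /(f_equal fst) /= ->.
Qed.

(** The gluing map of the solid torus is linear in the angles, and carries short arcs to short arcs
    as long as the resulting angle is small. *)
Lemma lerp_euler (a0 w0 a w : plane) (n : int) l :
  sqnorm a0 = 1 -> sqnorm w0 = 1 -> sqnorm a = 1 -> sqnorm w = 1 ->
  2^-1 < (rel_dir a0 a).1 -> 2^-1 < (rel_dir w0 w).1 ->
  `|ang (rel_dir w0 w) + n%:~R * ang (rel_dir a0 a)| < small_angle R ->
  lerp (cm w0 (cpow a0 n)) (cm w (cpow a n)) l = cm (lerp w0 w l) (cpow (lerp a0 a l) n).
Proof.
move=> ha0 hw0 ha hw /(unit_lift ha0 ha) [s [t [e1 e2 <- bt ct]]].
move=> /(unit_lift hw0 hw) [s' [t' [e1' e2' <- bt' ct']]] hs.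
have [_ s1 s2] := small_angleP R.
rewrite e1 e2 e1' e2' !cpow_cis -!cisD.
have d (x y : R) : x + y - x = y by ring.
have dd : s' + t' + n%:~R * (s + t) - (s' + n%:~R * s) = t' + n%:~R * t by ring.
have h3 := s2 _ hs.
have h4 : - (pi / 2) < t' + n%:~R * t < pi / 2 by rewrite -ltr_norml (lt_trans hs).
rewrite !lerp_cis ?d ?dd //.
by rewrite cpow_cis -cisD; congr cis; ring.
Qed.

Lemma between_conv (a b x y l : R) : a < x < b -> a < y < b -> 0 <= l <= 1 ->
  a < x + l * (y - x) < b.
Proof.
move=> /andP[h1 h2] /andP[h3 h4] /andP[l0 l1].
apply/andP; split; have [h|h] := leP l 2^-1; nra.
Qed.

Lemma outer_ang i z w z' w' : sqnorm z = 1 -> sqnorm z' = 1 -> close i (z, w) (z', w') ->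
  2^-1 < (rel_dir z z').1 /\ `|ang (rel_dir z z')| < eta R i.
Proof. by move=> u u' c; have := cl_ang c; rewrite center_outer // !dir0_unit. Qed.

(* The spokes of coinciding places agree, so they are paths of the manifold. *)
Lemma spoke_descends (x0 : X) l i1 i2 q1 q2 q1' q2' : 0 <= l <= 1 ->
  valid (i1, q1) -> valid (i2, q2) -> close i1 q1 q1' -> close i2 q2 q2' ->
  coincide (i1, q1) (i2, q2) -> coincide (i1, q1') (i2, q2') ->
  pt x0 (i1, spoke_place i1 q1 q1' l) = pt x0 (i2, spoke_place i2 q2 q2' l).
Proof.
move=> l01; apply: (close_descends (F := fun i q q' => pt x0 (i, spoke_place i q q' l))).
- move=> d a0 w0 a w ha0 hw0 ha hw z z' c1 c2.
  have h1 : hole (d_start d) (Some (inl d)) by rewrite /hole.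
  have h2 : hole (d_end d) (Some (inl (d_rev d))) by rewrite /hole d_start_rev.
  apply/pt_coincide; try exact: spoke_valid.
  by rewrite /spoke_place !cone_slot //; apply: CoEdge; exact: sqnorm_lerp.
- move=> v a0 w0 a w ha0 hw0 ha hw z u c1 c2; apply/pt_coincide; try exact: spoke_valid.
    by apply: spoke_valid => //=; rewrite /u sqnormM sqnorm_cpow // hw0 mul1r.
  have [k1 k2] := cl_fib c1; have [k3 k4] := outer_ang ha0 ha c2.
  rewrite /spoke_place cone_slot // cone_outer //= lerp_euler //; last exact: (eta_small k2 k4).
  by apply: CoEuler; exact: sqnorm_lerp.
- move=> v a0 b0 w0 qa qb gv ha0 hb0 hw0 c1 c2 h; apply/pt_coincide; try exact: spoke_valid.
  have o1 : 0 < off 0 qa.1 by have := cl_off c1; rewrite center_outer.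
  have o2 : 0 < off 0 qb.1 by have := cl_off c2; rewrite center_outer.
  rewrite /spoke_place !cone_radial //; case: h => [->|[u1 u2 ->]]; first exact: CoRefl.
  rewrite !rad0_unit // subrr mulr0 addr0 !pol01; apply: CoSphere => //; rewrite ?dir0_unit //.
  by apply: sqnorm_lerp.
- move=> v k a0 w0 a w g kg ha0 ha hw0 hw k0 k1 c1 c2; apply/pt_coincide; try exact: spoke_valid.
  have g0 : (0 < g)%N by case: (g) kg => //; rewrite muln0.
  have [f0 hf0 a0e] := in_sideP g0 ha0 k0; have [f hf ae] := in_sideP g0 ha k1.
  have [b1 _] := outer_ang ha0 ha c1.
  have [p0 p4] := andP (pang_bounds R g0); have pp := @pi_pos R.
  have cf : 2^-1 < cos (f - f0).
    by move: b1; rewrite a0e ae -!cisD rel_dir_cis /=; congr (_ < cos _); ring.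
  have bf : - (pi / 2) < f - f0 < pi / 2 by lra.
  rewrite /spoke_place !cone_outer ?radial_genus ?sqnorm_fold //=.
  have hl : lerp a0 a l = cm (nvec R g k) (cis (f0 + l * (f - f0))).
    by rewrite a0e ae; apply: lerp_turn => //; exact: sqnorm_cis.
  have -> : lerp (fold_side g k a0) (fold_side g k a) l = fold_side g k (lerp a0 a l).
    rewrite hl a0e ae !fold_cis lerp_turn ?sqnorm_cis //; first by congr (cm _ (cis _)); ring.
      by lra.
    by rewrite (_ : - f - - f0 = - (f - f0)) ?cosN //; ring.
  apply: CoSide => //; rewrite ?sqnorm_lerp //.
  by rewrite hl; apply: in_side_cis => //; exact: between_conv.
- move=> v k f w0 w g kg hf hw0 hw a b c1 c2; apply/pt_coincide; try exact: spoke_valid.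
  have g0 : (0 < g)%N by case: (g) kg => //; rewrite muln0.
  have mg := @mate_lt _ g0 _ kg.
  have [p0 p4] := andP (pang_bounds R g0); have pp := @pi_pos R; set p := pang R g in hf p0 p4 *.
  have vk : vvec R g k = cm (nvec R g k) (cis (- p)).
    by rewrite -vvec_turn -cmA -cisD subrr cis0 cm1.
  have vm : vvec R g (mate k).+1 = cm (nvec R g (mate k)) (cis p) by rewrite nvec_turn.
  have ua : sqnorm a = 1 by rewrite sqnormM !sqnorm_cis mulr1.
  have [b1 _] := outer_ang (sqnorm_cis (2 * k%:R * pang R g)) ua c1.
  have cf : 2^-1 < cos (f + p).
    by move: b1; rewrite -/(vvec R g k) vk /a -!cisD rel_dir_cis /=; congr (_ < cos _); rewrite -/p; ring.
  have ub : sqnorm b = 1 by rewrite sqnormM !sqnorm_cis mulr1.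
  rewrite /spoke_place !cone_outer ?radial_genus ?sqnorm_cis //= vk vm.
  have bl : - (pi / 2) < f - - p < pi / 2 by lra.
  have bl2 : - (pi / 2) < - f - p < pi / 2 by lra.
  have cf1 : 2^-1 < cos (f - - p) by rewrite opprK.
  have cf2 : 2^-1 < cos (- f - p) by rewrite -opprD cosN.
  rewrite !lerp_turn ?sqnorm_cis // opprK.
  (* The origin of the spoke is a vertex and its other points lie on an open side, so two different
     coincidences are used. *)
  have [l0|l0] := eqVneq l 0.
    rewrite l0 !mul0r !addr0 -vk -vm; have [k1 [k1g <- _]] := next_side R g0 mg.
    by apply: CoVertex => //; rewrite lerp0.
  have -> : cm (nvec R g (mate k)) (cis (p + l * (- f - p))) =
     fold_side g k (cm (nvec R g k) (cis (- p + l * (f + p)))).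
    by rewrite fold_cis; congr (cm _ (cis _)); ring.
  have lp : 0 < l by rewrite lt_neqAle eq_sym l0; case/andP: l01.
  apply: CoSide => //; rewrite ?sqnorm_lerp ?sqnormM ?sqnorm_cis ?mulr1 //.
  by apply: in_side_cis => //; rewrite -/p; case/andP: l01 => _ l1; case/andP: hf => f1 f2; nra.
- move=> v k m w0 w g kg mg hw0 hw c1 c2; apply/pt_coincide; try exact: spoke_valid.
  have g0 : (0 < g)%N by case: (g) kg => //; rewrite muln0.
  rewrite /spoke_place !cone_outer ?radial_genus ?sqnorm_cis //= !lerpp ?sqnorm_cis //.
  by apply: CoVertex => //; exact: sqnorm_lerp.
Qed.

Lemma spoke_place_cts_at i q q' l : 0 < off (center i q.1) q'.1 ->
  {for (q', l), continuous (fun u : (plane * plane) * R => spoke_place i q u.1 u.2)}.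
Proof.
move=> h; apply: ctsat_pair.
  have c : {for (q', l), continuous (fun u : (plane * plane) * R => (u.1.1, u.2))}.
    apply: ctsat_pair; last exact: cvg_snd.
    have c1 : continuous (fun u : (plane * plane) * R => u.1.1) by apply: (cts_comp (f := fst)); cts.
    exact: c1.
  exact: (@continuous_comp _ _ _ (fun u : (plane * plane) * R => (u.1.1, u.2))
    (fun u => cone i q.1 u.1 u.2) (q', l) c (cone_cts_at h)).
have c : continuous (fun u : (plane * plane) * R => (q.2, (u.1.2, u.2))).
  by apply: cts_pair; [cts|apply: cts_pair; [apply: (cts_comp (f := fst)); cts|cts]].
exact: (cts_comp c (@lerp_cts R)).
Qed.

Variable x0 : X.
Local Notation pt := (pt x0).

Definition linked x y i q q' : Prop :=
  [/\ valid (i, q), pt (i, q) = x, pt (i, q') = y & close i q q'].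

Definition descends (T : Type) (F : cell -> plane * plane -> plane * plane -> T) : Prop :=
  forall i1 i2 q1 q2 q1' q2', valid (i1, q1) -> valid (i2, q2) ->
    close i1 q1 q1' -> close i2 q2 q2' -> coincide (i1, q1) (i2, q2) ->
    coincide (i1, q1') (i2, q2') -> F i1 q1 q1' = F i2 q2 q2'.

(** The function on pairs of nearby points induced by an [F] that descends, with default [t0] for
    points that are not linked. *)
Definition germ_value (T : choiceType) (t0 : T) F (x y : X) : T :=
  xget t0 [set t | exists i q q', linked x y i q q' /\ F i q q' = t].

Lemma germ_valueE (T : choiceType) (t0 : T) F x y i q q' : descends F ->
  linked x y i q q' -> germ_value t0 F x y = F i q q'.
Proof.
move=> dF lk; rewrite /germ_value; case: xgetP => [t _ [j [p [p' [lk' <-]]]]|/(_ (F i q q'))].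
  case: lk lk' => v1 e1 e1' c1 [v2 e2 e2' c2]; apply: dF => //.
    by apply/(pt_coincide x0) => //; rewrite e1.
  by apply/(pt_coincide x0); rewrite ?e1' //; [exact: (cl_valid c2)|exact: (cl_valid c1)].
by case; exists i, q, q'.
Qed.

Lemma fibre_near1 (y0 : X) (P : place R G -> Prop) :
  (forall i q, valid (i, q) -> pt (i, q) = y0 -> \forall q' \near q, valid (i, q') -> P (i, q')) ->
  \forall y \near y0, forall p : place R G, valid p -> pt p = y -> P p.
Proof.
move=> h.
have H i q : valid (i, q) -> pt (i, q) = y0 ->
    \forall q' \near q & j \near nbhs x0, valid (i, q') -> P (i, q').
  move=> vq e; exists ([set q' | valid (i, q') -> P (i, q')], [set: X]).
    by split=> //=; [exact: h|exact: filterT].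
  by move=> [q' j] [].
have [[U V] /= [nU nV] UV] := @fibre_near R G x0 X (nbhs x0) y0 (fun p _ => P p) (nbhs_filter x0) H.
apply: filterS nU => y Uy; apply: (UV (y, x0)); split=> //=; exact: nbhs_singleton.
Qed.

(** The last clause allows [q'] to vary with the same origin [q], from which the continuity of
    [spoke x] follows. *)
Lemma near_linked x : \forall y \near x, forall i q', valid (i, q') -> pt (i, q') = y ->
  exists2 q, linked x y i q q' & \forall q'' \near q', valid (i, q'') -> close i q q''.
Proof.
have : \forall y \near x, forall p : place R G, valid p -> pt p = y -> exists2 q, linked x y p.1 q p.2 &
    \forall q'' \near p.2, valid (p.1, q'') -> close p.1 q q''.
  have H : \forall y \near x, forall p : place R G, valid p -> pt p = y -> exists q, [/\ valid (p.1, q), pt (p.1, q) = x,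
      close p.1 q p.2 & \forall q'' \near p.2, valid (p.1, q'') -> close p.1 q q''].
    apply: fibre_near1 => i q vq e; have := near_join (near_close vq).
    apply: filterS => q' h vq'; exists q; split=> //=.
    exact: (nbhs_singleton h vq').
  apply: filterS H => y h p vp e; have [q [vq eq c n]] := h p vp e.
  by exists q => //; split=> //; rewrite -e -surjective_pairing.
by apply: filterS => y h i q' vq e; exact: (h (i, q') vq e).
Qed.

Definition spoke x (l : R) (y : X) : X :=
  germ_value x0 (fun i q q' => pt (i, spoke_place i q q' (clamp l))) x y.

Lemma spokeE x y i q q' l : linked x y i q q' -> spoke x l y = pt (i, spoke_place i q q' (clamp l)).
Proof.
apply: germ_valueE => i1 i2 q1 q2 q1' q2' *.
by apply: spoke_descends => //; exact: clamp01.
Qed.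

Lemma spoke_cts x : \forall y \near x, forall l, {for (y, l), continuous (fun u => spoke x u.2 u.1)}.
Proof.
apply: filterS (near_linked x) => y h l O /= nO.
have H i q' : valid (i, q') -> pt (i, q') = y ->
    \forall q'' \near q' & l' \near nbhs l, valid (i, q'') -> O (spoke x l' (pt (i, q''))).
  move=> vq' e.
  have [q lk n] := h i q' vq' e; have [vq _ _ c] := lk.
  move: nO; rewrite (spokeE l lk) => nO.
  have vs : valid (i, spoke_place i q q' (clamp l)).
    by apply: spoke_valid => //; [case: vq|exact: clamp01].
  have cp := @spoke_place_cts_at i q q' (clamp l) (cl_off c).
  have cc : {for (q', l), continuous (fun u : (plane * plane) * R => (u.1, clamp u.2))}.
    apply: ctsat_pair; first exact: cvg_fst.
    exact: (ctsat_comp (f := snd) (t := (q', l)) cvg_snd (@clamp_cts R)).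
  have {cp} cp := @continuous_comp _ _ _ (fun u : (plane * plane) * R => (u.1, clamp u.2))
    (fun u => spoke_place i q u.1 u.2) (q', l) cc cp.
  have {cp} np : \forall u \near (q', l), valid (i, spoke_place i q u.1 (clamp u.2)) ->
      O (pt (i, spoke_place i q u.1 (clamp u.2))) := cp _ (pt_near vs nO).
  have n' : \forall u \near (q', l), valid (i, u.1) -> close i q u.1.
    have c1 : {for (q', l), continuous (fst : (plane * plane) * R -> _)} by exact: cvg_fst.
    exact: (c1 _ n).
  have : \forall u \near (q', l), valid (i, u.1) -> O (spoke x u.2 (pt (i, u.1))).
    apply: filterS2 np n' => -[q'' l'] /= h1 h2 vq''.
    have c'' := h2 vq''; rewrite (@spokeE _ _ i q q'') //; last first.
      by split=> //; case: lk.
    apply: h1; apply: spoke_valid => //; [by case: vq|exact: clamp01].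
  by case=> [[U V] /= [nU nV] UV]; exists (U, V) => // -[a b] [/= Ua Vb]; exact: (UV (a, b)).
have [[U V] /= [nU nV] UV] := @fibre_near R G x0 R (nbhs l) y
  (fun p l' => O (spoke x l' (pt p))) (nbhs_filter l) H.
exists (U, V) => // -[y' l'] [/= Uy Vl].
have [p vp e] := pt_surj x0 y'; rewrite /= -{1}e; exact: (UV (y', l') (conj Uy Vl) p vp e).
Qed.

(** Around each time, the spokes from a common origin [x] to the points of the path form a cone, so
    the path between two nearby times is equivalent to one spoke run backwards followed by
    another. *)
Lemma spoke_generation (M : groupType) (m : (R -> X) -> M) (S : X -> X -> set M) :
  path_functor m ->
  (forall x y y' a b, S x y a -> S y y' b -> S x y' (a * b)%g) ->
  (forall x y a, S x y a -> S y x a^-1%g) ->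
  (forall i q q', valid (i, q) -> close i q q' ->
     S (pt (i, q)) (pt (i, q')) (m (fun l => pt (i, spoke_place i q q' (clamp l))))) ->
  forall f : R -> X, continuous f -> S (f 0) (f 1) (m f).
Proof.
move=> mP SM SV Sspoke f cf.
pose P a b := S (f a) (f b) (m (fun t => f (a + t * (b - a)))).
suff : P 0 1.
  rewrite /P (pf_ext mP (g := f)) // => t _; by rewrite subr0 mulr1 add0r.
apply: interval_glue; last exact: ler01.
  by move=> a b c _ _ h1 h2; rewrite /P -(pf_between mP a b c cf); exact: (SM _ _ _ _ _ h1 h2).
move=> t0; set x := f t0.
have n1 : \forall s \near t0, (forall l, {for (f s, l), continuous (fun u => spoke x u.2 u.1)}) /\
    forall i q', valid (i, q') -> pt (i, q') = f s -> exists q, linked x (f s) i q q'.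
  have n0 : \forall y \near x, (forall l, {for (y, l), continuous (fun u => spoke x u.2 u.1)}) /\
      forall i q', valid (i, q') -> pt (i, q') = y -> exists q, linked x y i q q'.
    apply: filterS2 (spoke_cts x) (near_linked x) => y h1 h2; split=> // i q' vq e.
    by have [q lk _] := h2 i q' vq e; exists q.
  exact: (cf t0 _ n0).
have [e /= e0 he] := n1; exists e => // a b a1 a2 b1 b2.
have hab s : 0 <= s <= 1 -> ball t0 e (a + s * (b - a)).
  move=> /andP[s0 s1]; rewrite /ball /= ltr_norml; nra.
pose gs s := a + clamp s * (b - a).
have gin s : ball t0 e (gs s) by apply: hab; exact: clamp01.
have cg : continuous gs by rewrite /gs; apply: ctsD; [cts|apply: ctsM; [exact: clamp_cts|cts]].
pose K (u : R * R) := spoke x u.2 (f (gs u.1)).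
have cK : continuous K.
  move=> [s l]; apply: (@continuous_comp _ _ _ (fun u : R * R => (f (gs u.1), u.2))
     (fun u => spoke x u.2 u.1)); last by have [h _] := he _ (gin s); exact: h.
  have : continuous (fun u : R * R => (f (gs u.1), u.2)); last by apply.
  apply: cts_pair; last by cts.
  exact: (@fst_comp_cts R R X (fun s => f (gs s)) (cts_comp cg cf)).
have K0 s : K (s, 0) = x.
  have [_ h] := he _ (gin s); have [[i q'] vq' e'] := pt_surj x0 (f (gs s)).
  have [q lk] := h i q' vq' e'; rewrite /K (spokeE _ lk) clamp_id ?lexx ?ler01 //.
  by case: lk => vq <- _ c; exact: spoke0.
have K1 s : K (s, 1) = f (gs s).
  have [_ h] := he _ (gin s); have [[i q'] vq' e'] := pt_surj x0 (f (gs s)).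
  have [q lk] := h i q' vq' e'; rewrite /K (spokeE _ lk) clamp_id ?lexx ?ler01 //.
  by case: lk => vq _ <- c; rewrite spoke1.
have Sg s : S x (f (gs s)) (m (fun t => K (s, t))).
  have [_ h] := he _ (gin s); have [[i q'] vq' e'] := pt_surj x0 (f (gs s)).
  have [q lk] := h i q' vq' e'; have [vq eq eq' c] := lk.
  have := Sspoke i q q' vq c; rewrite eq eq'; congr (S _ _ _); apply: (pf_ext mP) => t _.
  by rewrite /K (spokeE _ lk).
have := pf_cone mP cK (fun s _ => etrans (K0 s) (esym (K0 0))) => /=.
rewrite (pf_ext mP (f := fun s => K (s, 1)) (g := fun t => f (a + t * (b - a)))); last first.
  by move=> t t01; rewrite K1 /gs clamp_id.
have g0 : gs 0 = a by rewrite /gs clamp_le0 // mul0r addr0.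
have g1 : gs 1 = b by rewrite /gs clamp_ge1 // mul1r addrC subrK.
move=> h; rewrite /P; have := SM _ _ _ _ _ (SV _ _ _ (Sg 0)) (Sg 1).
by rewrite -h mulKg g0 g1.
Qed.

End Spokes.

(** * Paths along the real axis *)

Section Halves.
Variables (R : realType) (G : plumbing_graph).
Local Notation plane := (R * R)%type.
Local Notation r := (slot_radius R G).
Local Notation sc := (@sc R G).
Local Notation X := (link_complement R G).
Implicit Types (v : vertex G) (z : plane) (u : bool).

Definition flip u z : plane := if u then z else cj z.
Definition in_half u z : Prop := 0 <= (flip u z).2.

Lemma flipK u : involutive (flip u).
Proof. by case: u => //; exact: cjK. Qed.

Lemma flip_cts u : continuous (flip u).
Proof. by case: u; [move=> ?; exact: cvg_id|exact: cj_cts]. Qed.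

Lemma zvalid_flip u v z : zvalid (inl v) (flip u z) <-> zvalid (inl v) z.
Proof.
case: u => //; have ho (c : R) y : off c (cj y) = off c y.
  by rewrite /off /sqnorm /cj /= sqrrN.
have H (y : plane) : zvalid (inl v) y -> zvalid (inl v) (cj y).
  move=> vy; apply: zvalidI => [|p hp|h hv].
  - by rewrite sqnorm_cj; exact: zvalid_sqnorm vy.
  - by rewrite ho; exact: zvalid_hole vy hp.
  - by rewrite ho; exact: zvalid_arrow vy hv.
by split=> /H //; rewrite /= cjK.
Qed.

(* The squared height of the holes of [v] above the abscissa [x]. *)
Definition hole_height2 v (x : R) : R :=
  \sum_(p | hole v p) Num.max 0 (r ^+ 2 - (x - sc p) ^+ 2).

Lemma hole_height2P v x : (hole_height2 v x = 0 /\ forall p, hole v p -> r ^+ 2 <= (x - sc p) ^+ 2) \/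
  exists2 p, hole v p & hole_height2 v x = r ^+ 2 - (x - sc p) ^+ 2 /\ 0 < hole_height2 v x.
Proof.
have [r0 _] := andP (slot_radius_bounds R G).
case: (pselect (exists2 p, hole v p & (x - sc p) ^+ 2 < r ^+ 2)) => [[p hp xp]|no]; [right|left].
  have e : hole_height2 v x = r ^+ 2 - (x - sc p) ^+ 2; last by exists p; rewrite // e subr_gt0.
  rewrite /hole_height2 (bigD1 p) //= big1 ?addr0 ?max_r ?subr_ge0 // 1?ltW // => q /andP[_ qp].
  rewrite max_l // subr_le0; apply: ltW; have := sc_sep R qp.
  have : - r < x - sc p < r by move: (x - sc p) xp => t xp; apply/andP; split; nra.
  rewrite ler_normr => /andP[h1 h2] /orP[h3|h3].
    have h4 : r < sc q - x by lra.
    by rewrite -[ltRHS]sqrrN opprB; move: (sc q - x) h4 => t h4; nra.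
  have h4 : r < x - sc q by lra.
  by move: (x - sc q) h4 => t h4; nra.
have h p : hole v p -> r ^+ 2 <= (x - sc p) ^+ 2.
  by move=> hp; rewrite leNgt; apply/negP => lt; apply: no; exists p.
by split=> //; rewrite /hole_height2 big1 // => p /h hp; rewrite max_l // subr_le0.
Qed.

Lemma hole_height2_ge v x p : hole v p -> r ^+ 2 - (x - sc p) ^+ 2 <= hole_height2 v x.
Proof.
move=> hp; rewrite /hole_height2 (bigD1 p) //=; apply: (le_trans (y := Num.max 0 (r ^+ 2 - (x - sc p) ^+ 2))).
  by rewrite le_max lexx orbT.
by rewrite lerDl; apply: sumr_ge0 => q _; rewrite le_max lexx.
Qed.

Lemma hole_height2_ge0 v x : 0 <= hole_height2 v x.
Proof. by apply: sumr_ge0 => q _; rewrite le_max lexx. Qed.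

Lemma hole_height2_cts v : continuous (hole_height2 v).
Proof.
rewrite /hole_height2; elim: (index_enum _) => [|p s IH].
  by under eq_fun do rewrite big_nil; exact: cts_cst.
under eq_fun do rewrite big_cons.
have c : continuous (fun x : R => Num.max 0 (r ^+ 2 - (x - sc p) * (x - sc p))) by cts.
by case: (hole v p) => //; exact: (ctsD c IH).
Qed.

Definition push v z : plane := (z.1, Num.max z.2 (Num.sqrt (hole_height2 v z.1))).

Lemma push_cts v : continuous (push v).
Proof.
apply: cts_pair; first by cts.
apply: cts_max; first by cts.
apply: (cts_comp _ (@sqrt_continuous R)).
by apply: (cts_comp (f := fst)); [cts|exact: hole_height2_cts].
Qed.

Lemma push_id v z : zvalid (inl v) z -> 0 <= z.2 -> push v z = z.
Proof.
move=> vz z0; apply: pair_ext => //=; apply: max_l.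
rewrite -[leRHS](ger0_norm z0) -sqrtr_sqr ler_wsqrtr //.
case: (hole_height2P v z.1) => [[-> _]|[p hp [-> _]]]; first exact: sqr_ge0.
by have := zvalid_hole vz hp; rewrite /off /sqnorm /=; lra.
Qed.

(** The segment from the top of the disk to [z], raised above the holes by [push]. It meets the real
    axis at its end only, hence it also avoids the centres of the arrowhead slots, which are not
    holes. *)
Definition toward v z (l : R) : plane := push v (l * z.1, (1 - l) + l * z.2).

Lemma toward1 v z : zvalid (inl v) z -> 0 <= z.2 -> toward v z 1 = z.
Proof. by move=> vz z0; rewrite /toward !mul1r subrr add0r -surjective_pairing push_id. Qed.

Lemma toward_valid v z l : zvalid (inl v) z -> 0 <= z.2 -> 0 <= l <= 1 ->
  zvalid (inl v) (toward v z l) /\ 0 <= (toward v z l).2.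
Proof.
have [r0 r4] := andP (slot_radius_bounds R G).
move=> vz z0 /andP[l0 l1]; rewrite /toward; set y := (l * z.1, 1 - l + l * z.2).
have hy1 : y.1 = l * z.1 by []. have hy2 : y.2 = 1 - l + l * z.2 by []. clearbody y.
have y0 : 0 <= y.2 by rewrite hy2; nra.
have uy : sqnorm y <= 1.
  have := zvalid_sqnorm vz; rewrite /sqnorm hy1 hy2 => h.
  have z1 : z.2 <= 1 by nra.
  have a1 : 0 <= l ^+ 2 * (1 - (z.1 ^+ 2 + z.2 ^+ 2)) by rewrite mulr_ge0 ?sqr_ge0 ?subr_ge0.
  have a2 : 0 <= l * (1 - l) * (1 - z.2) by rewrite !mulr_ge0 ?subr_ge0.
  lra.
have m0 : 0 <= (push v y).2 by rewrite /= le_max y0.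
have m2 : (push v y).2 ^+ 2 = y.2 ^+ 2 \/ (push v y).2 ^+ 2 = hole_height2 v y.1.
  rewrite /= /Num.max; case: ifP => _; [right|by left].
  by rewrite sqr_sqrtr // hole_height2_ge0.
have mh : hole_height2 v y.1 <= (push v y).2 ^+ 2.
  rewrite -[leLHS]sqr_sqrtr ?hole_height2_ge0 // ler_pXn2r ?nnegrE ?sqrtr_ge0 //.
  by rewrite /= le_max lexx orbT.
split=> //; apply: zvalidI.
- rewrite /sqnorm -[(push v y).1]/y.1; case: m2 => ->; first exact: uy.
  case: (hole_height2P v y.1) => [[-> _]|[p hp [e h0]]].
    by apply: le_trans uy; rewrite addr0 lerDl sqr_ge0.
  have := @off_unit R G p (y.1, Num.sqrt (hole_height2 v y.1)).
  rewrite /off /sqnorm /= !sqr_sqrtr ?(ltW h0) // => h.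
  by apply/ltW/h; rewrite e; nra.
- move=> p hp; have := hole_height2_ge y.1 hp; rewrite /off /sqnorm /= => h.
  by move: mh; rewrite /=; lra.
- move=> h hv; rewrite lt_neqAle off_ge0 andbT eq_sym; apply/eqP => e0.
  have [e1 e2] : y.1 - sc (Some (inr h)) = 0 /\ (push v y).2 = 0.
    move: e0; rewrite /off /sqnorm => /eqP; rewrite paddr_eq0 ?sqr_ge0 // !expf_eq0 /=.
    by case/andP => /eqP ? /eqP.
  have y20 : y.2 = 0.
    by apply/eqP; rewrite eq_le y0 andbT -e2 /= le_max lexx.
  (* The segment reaches the axis at its end only, where it is the valid point [z]. *)
  have l1' : l = 1 by rewrite hy2 in y20; nra.
  have := zvalid_arrow vz hv; rewrite /off /sqnorm /=.
  move: e1 y20; rewrite hy1 hy2 l1' !mul1r subrr add0r => -> ->.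
  by rewrite !expr0n /= addr0 ltxx.
Qed.

End Halves.

(** * Frames of the cells and the relations in the fundamental groupoid *)

Section Frames.
Variables (R : realType) (G : plumbing_graph) (x0 : link_complement R G).
Variables (M : groupType) (m : (R -> link_complement R G) -> M).
Hypothesis mP : path_functor m.
Local Notation plane := (R * R)%type.
Local Notation r := (slot_radius R G).
Local Notation sc := (@sc R G).
Local Notation cell := (vertex G + vertex G)%type.
Local Notation pt := (pt x0).
Implicit Types (v : vertex G) (i : cell) (z : plane) (u : bool) (s t : R) (n : int).

Lemma pt_cts (Z : topologicalType) i (phi : Z -> plane * plane) : continuous phi ->
  (forall y, valid (i, phi y)) -> continuous (fun y => pt (i, phi y)).
Proof.
move=> cp vp y O nO.
have h : \forall y' \near y, valid (i, phi y') -> O (pt (i, phi y')) := cp y _ (pt_near (vp y) nO).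
suff : \forall y' \near y, O (pt (i, phi y')) by [].
by apply: filterS h => y'; apply; exact: vp.
Qed.

(* [F z s] stands for the class of a path of the cell [i] from a base point to
   [(z, cis s)] that lifts to the universal cover of the fibre. *)
Definition cell_frame i (P : set plane) (F : plane -> R -> M) : Prop :=
  forall (zf : R -> plane) (sf : R -> R), continuous zf -> continuous sf ->
    (forall t, P (zf t)) ->
    (F (zf 0) (sf 0) * m (fun t => pt (i, (zf t, cis (sf t)))))%g = F (zf 1) (sf 1).

Lemma frame_left i P F a : cell_frame i P F -> cell_frame i P (fun z s => a * F z s)%g.
Proof. by move=> fF zf sf cz cs Pz; rewrite -mulgA fF. Qed.

(** Both frames compute the class of the same path of the manifold. *)
Lemma frame_transfer i P F i' P' F' (zf zf' : R -> plane) (sf sf' : R -> R) :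
  cell_frame i P F -> cell_frame i' P' F' ->
  continuous zf -> continuous sf -> continuous zf' -> continuous sf' ->
  (forall t, P (zf t)) -> (forall t, P' (zf' t)) ->
  (forall t, 0 <= t <= 1 -> pt (i, (zf t, cis (sf t))) = pt (i', (zf' t, cis (sf' t)))) ->
  ((F (zf 0) (sf 0))^-1 * F (zf 1%R) (sf 1%R) = (F' (zf' 0) (sf' 0))^-1 * F' (zf' 1%R) (sf' 1%R))%g.
Proof.
move=> fF fF' cz cs cz' cs' Pz Pz' e; rewrite -fF // -fF' // !mulKg.
exact: (pf_ext mP).
Qed.

(** The class of one turn of the fibre over [b]; by [frame_deck1] it translates the frame over every
    point joined to [b]. *)
Definition deck (F : plane -> R -> M) (b : plane) : M := (F b (2 * pi)%R * (F b 0%R)^-1)%g.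

Lemma frame_deck1 i P F b z s : cell_frame i P F ->
  (exists zf : R -> plane, [/\ continuous zf, zf 0 = b, zf 1 = z & forall t, P (zf t)]) ->
  (F z (s + 2 * pi)%R = deck F b * F z s)%g.
Proof.
move=> fF [zf [cz z0 z1 Pz]].
have c1 : continuous (fun t : R => t * s) by cts.
have c2 : continuous (fun t : R => 2 * pi + t * s) by cts.
have := frame_transfer fF fF cz c2 cz c1 Pz Pz => /= h.
rewrite z0 z1 !mul0r !mul1r addr0 in h.
rewrite /deck addrC -mulgA -h; first by rewrite mulVKg.
by move=> t _; rewrite addrC -(mul1r (2 * pi)) -[1]/(1%:~R) cis_int.
Qed.

Lemma frame_deck i P F b z s n : cell_frame i P F ->
  (exists zf : R -> plane, [/\ continuous zf, zf 0 = b, zf 1 = z & forall t, P (zf t)]) ->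
  (F z (s + n%:~R * (2 * pi))%R = expgz (deck F b) n * F z s)%g.
Proof.
move=> fF hz; have pos (k : nat) t : (F z (t + k%:R * (2 * pi))%R = deck F b ^+ k * F z t)%g.
  elim: k => [|k IH]; first by rewrite mul0r addr0 expg0 mul1g.
  by rewrite -natr1 mulrDl mul1r addrA (frame_deck1 _ fF hz) IH mulgA expgS.
case: n => k /=; first exact: pos.
apply: (mulgI (deck F b ^+ k.+1)%g); rewrite -pos mulVKg.
by congr (F z _); rewrite NegzE intrN mulNr addrNK.
Qed.

Definition half_dom u v : set plane := [set z | zvalid (inl v) z /\ in_half u z].
Definition half_path u v z (l : R) : plane := flip u (toward v (flip u z) l).
Definition half_base u v : plane := flip u (push v (0, 1)).
Definition raw u v z s : M :=
  m (fun l => pt (inl v, (half_path u v z (clamp l), cis (clamp l * s)))).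

Lemma half_path_dom u v z l : half_dom u v z -> 0 <= l <= 1 -> half_dom u v (half_path u v z l).
Proof.
move=> [/(zvalid_flip u) vz hz] l01; have [h1 h2] := toward_valid vz hz l01.
by split; [apply/zvalid_flip|rewrite /in_half /half_path flipK].
Qed.

Lemma half_path0 u v z : half_path u v z 0 = half_base u v.
Proof. by rewrite /half_path /toward !mul0r subr0 addr0. Qed.

Lemma half_path1 u v z : half_dom u v z -> half_path u v z 1 = z.
Proof. by move=> [/(zvalid_flip u) vz hz]; rewrite /half_path toward1 // flipK. Qed.

Lemma half_path_cts (Z : topologicalType) u v (zf : Z -> plane) (lf : Z -> R) :
  continuous zf -> continuous lf -> continuous (fun y => half_path u v (zf y) (lf y)).
Proof.
move=> cz cl; apply: (cts_comp _ (@flip_cts R u)); apply: (cts_comp _ (@push_cts R G v)).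
have c1 : continuous (fun y => (flip u (zf y)).1).
  by apply: (cts_comp (f := fun y => flip u (zf y))); [exact: (cts_comp cz (@flip_cts R u))|cts].
have c2 : continuous (fun y => (flip u (zf y)).2).
  by apply: (cts_comp (f := fun y => flip u (zf y))); [exact: (cts_comp cz (@flip_cts R u))|cts].
by apply: cts_pair; [exact: ctsM|apply: ctsD; [apply: ctsB => //; cts|exact: ctsM]].
Qed.

Lemma half_connected u v z : half_dom u v z ->
  exists zf : R -> plane, [/\ continuous zf, zf 0 = half_base u v, zf 1 = z & forall t, half_dom u v (zf t)].
Proof.
move=> hz; exists (fun l => half_path u v z (clamp l)); split.
- by apply: half_path_cts; [cts|exact: clamp_cts].
- by rewrite clamp_le0 // half_path0.
- by rewrite clamp_ge1 // half_path1.
- by move=> t; apply: half_path_dom => //; exact: clamp01.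
Qed.

Lemma raw_frame u v : cell_frame (inl v) (half_dom u v) (raw u v).
Proof.
move=> zf sf cz cs Pz.
pose K (y : R * R) := pt (inl v, (half_path u v (zf y.1) (clamp y.2), cis (clamp y.2 * sf y.1))).
have c2 : continuous (fun y : R * R => clamp y.2) by apply: (cts_comp (f := snd)); [cts|exact: clamp_cts].
have cK : continuous K.
  apply: pt_cts.
    apply: cts_pair; first by apply: half_path_cts => //; exact: (fst_comp_cts cz).
    apply: (cts_comp _ (@cis_cts R)); apply: ctsM => //; exact: (fst_comp_cts cs).
  move=> y; split; last exact: sqnorm_cis.
  by have [] := half_path_dom (Pz y.1) (clamp01 y.2).
have := pf_cone mP cK; rewrite /K /= => /(_ _).
rewrite (pf_ext mP (f := fun t => pt (inl v, (half_path u v (zf t) (clamp 1), cis (clamp 1 * sf t))))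
  (g := fun t => pt (inl v, (zf t, cis (sf t))))); last first.
  by move=> t _; rewrite clamp_ge1 // half_path1 // mul1r.
by apply=> t _; rewrite clamp_le0 // !half_path0 !mul0r.
Qed.

Definition solid v z s : M :=
  m (fun l => pt (inr v, ((clamp l * z.1, clamp l * z.2), cis (clamp l * s)))).

Lemma shrink_disk z l : unit_disk z -> 0 <= l <= 1 -> unit_disk (l * z.1, l * z.2).
Proof.
rewrite /unit_disk /sqnorm /= => h /andP[l0 l1].
have : 0 <= l ^+ 2 * (1 - (z.1 ^+ 2 + z.2 ^+ 2)) by rewrite mulr_ge0 ?sqr_ge0 ?subr_ge0.
nra.
Qed.

Lemma solid_connected v z : unit_disk z ->
  exists zf : R -> plane, [/\ continuous zf, zf 0 = (0, 0), zf 1 = z & forall t, unit_disk (zf t)].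
Proof.
move=> hz; exists (fun l => (clamp l * z.1, clamp l * z.2)); split.
- by apply: cts_pair; apply: ctsM; [exact: clamp_cts|cts|exact: clamp_cts|cts].
- by rewrite clamp_le0 // !mul0r.
- by rewrite clamp_ge1 // !mul1r -surjective_pairing.
- by move=> t; apply: shrink_disk => //; exact: clamp01.
Qed.

Lemma solid_frame v : cell_frame (inr v) (@unit_disk R) (solid v).
Proof.
move=> zf sf cz cs Pz.
pose K (y : R * R) := pt (inr v, ((clamp y.2 * (zf y.1).1, clamp y.2 * (zf y.1).2), cis (clamp y.2 * sf y.1))).
have c2 : continuous (fun y : R * R => clamp y.2) by apply: (cts_comp (f := snd)); [cts|exact: clamp_cts].
have c1 : continuous (fun y : R * R => (zf y.1).1) by apply: (cts_comp (f := fun y : R * R => zf y.1)); [exact: (fst_comp_cts cz)|cts].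
have c3 : continuous (fun y : R * R => (zf y.1).2) by apply: (cts_comp (f := fun y : R * R => zf y.1)); [exact: (fst_comp_cts cz)|cts].
have cK : continuous K.
  apply: pt_cts.
    apply: cts_pair; first by apply: cts_pair; exact: ctsM.
    apply: (cts_comp _ (@cis_cts R)); apply: ctsM => //; exact: (fst_comp_cts cs).
  by move=> y; split; [apply: shrink_disk; [exact: Pz|exact: clamp01]|exact: sqnorm_cis].
have := pf_cone mP cK; rewrite /K /= => /(_ _).
rewrite (pf_ext mP (f := fun t => pt (inr v, ((clamp 1 * (zf t).1, clamp 1 * (zf t).2), cis (clamp 1 * sf t))))
  (g := fun t => pt (inr v, (zf t, cis (sf t))))); last first.
  by move=> t _; rewrite clamp_ge1 // !mul1r -surjective_pairing.
by apply=> t _; rewrite clamp_le0 // !mul0r.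
Qed.

(** The lower frame is shifted so as to agree with the upper one at [(-1, 0)]; [height] then
    measures their difference elsewhere on the axis. *)
Definition frame u v : plane -> R -> M :=
  if u then raw true v
  else fun z s => (raw true v (-1, 0)%R 0%R * (raw false v (-1, 0)%R 0%R)^-1 * raw false v z s)%g.

Arguments frame : simpl never.

Lemma frame_law u v : cell_frame (inl v) (half_dom u v) (frame u v).
Proof. by case: u; [exact: raw_frame|apply: frame_left; exact: raw_frame]. Qed.

Definition fibre v : M := deck (frame true v) (half_base true v).
Definition axis v (x : R) : Prop := zvalid (inl v) (x, 0).
Definition height v (x : R) : M := (frame false v (x, 0)%R 0%R * (frame true v (x, 0)%R 0%R)^-1)%g.

Lemma axis_half u v (x : R) : axis v x -> half_dom u v (x, 0).
Proof. by move=> h; split=> //; case: u; rewrite /in_half //= oppr0. Qed.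

Lemma heightE v (x : R) s : axis v x -> (frame false v (x, 0)%R s = height v x * frame true v (x, 0)%R s)%g.
Proof.
move=> ax; have c0 : continuous (fun _ : R => (x, 0) : plane) by exact: cts_cst.
have c1 : continuous (fun t : R => t * s) by cts.
have := frame_transfer (frame_law (u := false) (v := v)) (frame_law (u := true) (v := v)) c0 c1 c0 c1
  (fun _ => axis_half false ax) (fun _ => axis_half true ax) (fun _ _ => erefl) => /= h.
rewrite !mul0r !mul1r in h.
by rewrite /height -mulgA -h mulVKg.
Qed.

Lemma axis_unit v (x : R) : x ^+ 2 = 1 -> axis v x.
Proof.
move=> h; have [] := @outer_valid R G v (x, 0) (1, 0) _ _ => //;
  by rewrite /sqnorm /= ?h expr0n ?expr1n addr0.
Qed.

Lemma height_left v : height v (-1) = 1%g.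
Proof. by rewrite /height /frame /= mulgVK mulgV. Qed.

(** At every valid abscissa [x] the fibre turn of the lower half is the conjugate by [height v x] of
    that of the upper half. At -1 the conjugator is 1, so both turns are equal, and then they
    commute with all the heights. *)
Lemma frame_fibre u v z s n : half_dom u v z ->
  (frame u v z (s + n%:~R * (2 * pi))%R = expgz (fibre v) n * frame u v z s)%g /\
  forall x, axis v x -> commute (fibre v) (height v x).
Proof.
have dk w y t k : half_dom w v y ->
    (frame w v y (t + k%:~R * (2 * pi))%R = expgz (deck (frame w v) (half_base w v)) k * frame w v y t)%g.
  by move=> hy; apply: frame_deck (@frame_law w v) (half_connected hy).
have cj x : axis v x -> (deck (frame false v) (half_base false v) = height v x * fibre v * (height v x)^-1)%g.
  move=> ax; have := dk false (x, 0) 0 1 (axis_half _ ax); rewrite !heightE // (dk true _ 0 1 (axis_half _ ax)).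
  have x1 (a : M) : expgz a 1 = a by exact: expg1.
  rewrite !x1 -/(fibre v) => /(f_equal (fun a => a * (height v x * frame true v (x, 0) 0)^-1)%g).
  by rewrite mulgK => <-; rewrite invgM !mulgA mulgK.
have e1 : deck (frame false v) (half_base false v) = fibre v.
  by rewrite (cj (-1)) ?height_left ?invg1 ?mulg1 ?mul1g //; apply: axis_unit; rewrite sqrrN expr1n.
move=> hz; split; first by rewrite dk //; case: (u); rewrite ?e1.
by move=> x /cj; rewrite e1 /commute => {1}->; rewrite mulgVK.
Qed.

Lemma height_const v (x y : R) : x <= y -> (forall t, x <= t <= y -> axis v t) ->
  height v x = height v y.
Proof.
move=> xy ax; have hz t : x <= x + clamp t * (y - x) <= y.
  by have := clamp01 t; nra.
have cz : continuous (fun t : R => (x + clamp t * (y - x), 0) : plane).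
  by apply: cts_pair; [apply: ctsD; [cts|apply: ctsM; [exact: clamp_cts|cts]]|cts].
have c0 : continuous (fun _ : R => 0 : R) by exact: cts_cst.
have := frame_transfer (@frame_law false v) (@frame_law true v) cz c0 cz c0
  (fun t => axis_half false (ax _ (hz t))) (fun t => axis_half true (ax _ (hz t))) (fun _ _ => erefl).
rewrite /= (@clamp_le0 R 0) // (@clamp_ge1 R 1) // mul0r addr0 mul1r addrC subrK /height => h.
by apply: (mulIg (frame true v (y, 0) 0)); rewrite mulgVK -mulgA -h mulVKg.
Qed.

Definition used v (p : port G) : bool :=
  match p with None => true | Some (inl d) => d_start d == v | Some (inr h) => att h == v end.

Lemma axisI v (x : R) : -1 <= x <= 1 -> (forall p, used v p -> r <= `|x - sc p|) -> axis v x.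
Proof.
have [r0 _] := andP (slot_radius_bounds R G).
move=> hx hp; have h2 p : used v p -> r ^+ 2 <= off (sc p) (x, 0).
  move=> /hp h; rewrite /off /sqnorm /= expr0n addr0 -[leRHS]real_normK ?num_real //.
  by rewrite ler_pXn2r ?nnegrE // ltW.
apply: zvalidI.
- by rewrite /sqnorm /= expr0n addr0; nra.
- by move=> [[d|h]|] //= hh; exact: h2.
- by move=> h hv; apply: lt_le_trans (h2 (Some (inr h)) _); [nra|rewrite /= hv].
Qed.

(** The abscissa halfway between the slots of ranks [k - 1] and [k], or in the margin of the disk
    for the extreme values of [k]. *)
Definition gap (k : nat) : R := -1 + 4 * r * k%:R + 2 * r.

Lemma height_slot_left v p : height v (gap (enum_rank p)) = height v (sc p - r).
Proof.
have [r0 r4] := andP (slot_radius_bounds R G); have [s1 s2] := andP (sc_bounds R p).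
have e : gap (enum_rank p) = sc p - 2 * r by rewrite /gap scE -natr1; ring.
rewrite e; apply: height_const => [|t tb]; first by lra.
apply: axisI => [|q _]; first by lra.
have [->|qp] := eqVneq q p; first by rewrite ler_normr; apply/orP; right; lra.
by have := sc_sep R qp; rewrite !ler_normr => /orP[h|h]; apply/orP; [right|left]; lra.
Qed.

Lemma height_slot_right v p : height v (sc p + r) = height v (gap (enum_rank p).+1).
Proof.
have [r0 r4] := andP (slot_radius_bounds R G); have [s1 s2] := andP (sc_bounds R p).
have e : gap (enum_rank p).+1 = sc p + 2 * r by rewrite /gap scE; ring.
rewrite e; apply: height_const => [|t tb]; first by lra.
apply: axisI => [|q _]; first by lra.
have [->|qp] := eqVneq q p; first by rewrite ler_normr; apply/orP; left; lra.
by have := sc_sep R qp; rewrite !ler_normr => /orP[h|h]; apply/orP; [right|left]; lra.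
Qed.

Lemma height_unused v p : ~~ used v p -> height v (sc p - r) = height v (sc p + r).
Proof.
have [r0 r4] := andP (slot_radius_bounds R G); have [s1 s2] := andP (sc_bounds R p).
move=> np; apply: height_const => [|t tb]; first by lra.
apply: axisI => [|q uq]; first by lra.
have qp : q != p by apply: contraNneq np => <-.
by have := sc_sep R qp; rewrite !ler_normr => /orP[h|h]; apply/orP; [right|left]; lra.
Qed.

Lemma height_gap0 v : height v (gap 0) = 1%g.
Proof.
have [r0 r4] := andP (slot_radius_bounds R G); rewrite -(height_left v); apply/esym.
apply: height_const => [|t tb]; first by rewrite /gap; lra.
rewrite /gap mulr0 addr0 in tb; apply: axisI => [|q uq]; first by lra.
by have [s1 s2] := andP (sc_bounds R q); rewrite ler_normr; apply/orP; right; lra.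
Qed.

Lemma height_gap_last v : height v (gap #|port G|) = height v 1.
Proof.
have [r0 r4] := andP (slot_radius_bounds R G); have st := slot_total R G; rewrite -natr1 in st.
have e : gap #|port G| = 1 - 2 * r by rewrite /gap; lra.
rewrite e; apply: height_const => [|t tb]; first by lra.
apply: axisI => [|q uq]; first by lra.
by have [s1 s2] := andP (sc_bounds R q); rewrite ler_normr; apply/orP; left; lra.
Qed.

Lemma prod_telescope (f : nat -> M) (a n : nat) :
  (\prod_(a <= k < a + n) ((f k)^-1 * f k.+1) = (f a)^-1 * f (a + n)%N)%g.
Proof.
elim: n => [|n IH]; first by rewrite addn0 big_geq // mulVg.
by rewrite addnS big_nat_recr ?leq_addr //= IH mulgA mulgK.
Qed.

Lemma height_prod v :
  (\prod_(p <- enum (port G)) ((height v (sc p - r)%R)^-1 * height v (sc p + r)%R) = height v 1%R)%g.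
Proof.
have := prod_telescope (fun k => height v (gap k)) 0 #|port G|.
rewrite height_gap0 invg1 mul1g add0n height_gap_last => <-; rewrite (big_nth None) -cardE.
apply: eq_big_nat => k /andP[_ kn].
have -> : nth None (enum (port G)) k = enum_val (Ordinal kn) by rewrite (enum_val_nth None).
by rewrite -height_slot_left height_slot_right enum_valK.
Qed.

Lemma slot_arc_dom v p u t : hole v p -> 0 <= t <= 1 ->
  half_dom u v (pol (sc p) r (cis ((if u then 0 else pi) + pi * t))).
Proof.
have [r0 r4] := andP (slot_radius_bounds R G); have pp := @pi_pos R.
move=> hp t01; set th := _ + pi * t.
have ho : off (sc p) (pol (sc p) r (cis th)) = r ^+ 2 by rewrite off_pol ?sqnorm_cis.
split; last first.
  have s0 : 0 <= sin (pi * t) by apply: sin_ge0_pi; rewrite ?in_itv /=; nra.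
  rewrite /in_half /flip /th; case: (u) => /=; first by rewrite add0r mulr_ge0 // ltW.
  by rewrite addrC sinDpi mulrN opprK mulr_ge0 // ltW.
apply: zvalidI => [|q hq|h hv].
- by apply/ltW/(@off_unit R G p); rewrite ho; nra.
- have [<-|qp] := eqVneq p q; first by rewrite ho.
  by apply: le_trans (off_other qp _); rewrite ?ho; nra.
- have qp : p != Some (inr h) by apply: contraTneq hp => ->.
  by apply: lt_le_trans (off_other qp _); rewrite ?ho; nra.
Qed.

(* Walking around the hole, above it in one half and below it in the other. *)
Lemma slot_loop v p i P F (zf : R -> plane) (sf : R -> R) : hole v p -> cell_frame i P F ->
  continuous zf -> continuous sf -> (forall t, P (zf t)) ->
  (forall t, pt (inl v, (pol (sc p) r (cis t), cis 0)) = pt (i, (zf t, cis (sf t)))) ->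
  let U := frame true v (sc p + r, 0) 0 in
  ((height v (sc p - r)%R)^-1 * height v (sc p + r)%R =
    U * ((F (zf 0%R) (sf 0%R))^-1 * F (zf (2 * pi)%R) (sf (2 * pi)%R)) * U^-1)%g.
Proof.
move=> hp fF cz cs Pz e U; have pp := @pi_pos R.
have c0 : continuous (fun _ : R => 0 : R) by exact: cts_cst.
have cl u : continuous (fun t : R => (if u then 0 else pi : R) + pi * clamp t).
  by apply: ctsD; [cts|apply: ctsM; [cts|exact: clamp_cts]].
have cp u : continuous (fun t : R => pol (sc p) r (cis ((if u then 0 else pi) + pi * clamp t))).
  have cpol : continuous (fun t : R => pol (sc p) r (cis t)).
    apply: (cts_comp (f := fun t : R => (r, cis t)) _ (@pol_cts R (sc p))).
    by apply: cts_pair; [cts|exact: cis_cts].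
  exact: (cts_comp (cl u) cpol).
(* One half turn for each [u]: from [sc p + r] to [sc p - r] in the upper half, and back in the
   lower half. *)
have h u := frame_transfer (@frame_law u v) fF (cp u) c0 (cts_comp (cl u) cz) (cts_comp (cl u) cs)
  (fun t => slot_arc_dom u hp (clamp01 t)) (fun t => Pz _) (fun t _ => e _).
have h1 := h true; have {h} h2 := h false.
have zr : pol (sc p) r (cis 0) = (sc p + r, 0) by rewrite cis0 /pol /= mulr1 mulr0.
have zl : pol (sc p) r (cis pi) = (sc p - r, 0) by rewrite cis_pi /pol /= mulrN1 mulr0.
have pipi : pi + pi = 2 * pi :> R by ring.
rewrite /= !(@clamp_le0 R 0) // !(@clamp_ge1 R 1) // mulr0 mulr1 !add0r !addr0 pipi in h1 h2.
have c2 : cis (2 * pi) = cis 0 :> plane by rewrite -[2 * pi]add0r -[2 * pi]mul1r -[1]/(1%:~R) cis_int.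
rewrite c2 zr zl in h1 h2.
have ax u : half_dom u v (sc p + r, 0) /\ half_dom u v (sc p - r, 0).
  have := slot_arc_dom u hp (t := 0); have := slot_arc_dom u hp (t := 1).
  rewrite mulr0 mulr1 !lexx !ler01 addr0 /=.
  by case: u; rewrite ?add0r ?pipi ?c2 ?zr ?zl => /(_ isT) k1 /(_ isT) k2.
have [[ar _] [al _]] := ax true.
rewrite !(heightE _ ar) !(heightE _ al) in h2.
have -> : ((F (zf 0) (sf 0))^-1 * F (zf (2 * pi)%R) (sf (2 * pi)%R) =
    ((F (zf 0) (sf 0))^-1 * F (zf pi) (sf pi)) * ((F (zf pi) (sf pi))^-1 * F (zf (2 * pi)%R) (sf (2 * pi)%R)))%g.
  by rewrite -mulgA mulVKg.
by rewrite -h1 -h2 -/U !gsimp.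
Qed.

Definition slot_base (d : dart G) : plane := (sc (Some (inl d)) + r, 0).
(** The base points of the two slots of the edge are glued together over the point [(1, 0)] of the
    fibres, so the two frames end at the same point. *)
Definition dart_class (d : dart G) : M :=
  (frame true (d_start d) (slot_base d) 0%R *
   (frame true (d_end d) (slot_base (d_rev d)) 0%R)^-1)%g.

Lemma pol_one p : pol (sc p) r (1, 0) = (sc p + r, 0).
Proof. by rewrite /pol /= mulr1 mulr0. Qed.

Lemma slot_valid v p (x y : plane) : hole v p -> sqnorm x = 1 -> sqnorm y = 1 ->
  valid (inl v, (pol (sc p) r x, y)).
Proof.
have [r0 r4] := andP (slot_radius_bounds R G).
move=> hp hx hy; split=> //=; have ho := off_pol (sc p) r hx.
apply: zvalidI => [|q hq|h hv].
- by apply/ltW/(@off_unit R G p); rewrite ho; nra.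
- have [<-|qp] := eqVneq p q; first by rewrite ho.
  by apply: le_trans (off_other qp _); rewrite ?ho; nra.
- have qp : p != Some (inr h) by apply: contraTneq hp => ->.
  by apply: lt_le_trans (off_other qp _); rewrite ?ho; nra.
Qed.

Lemma slot_base_dom v p u : hole v p -> half_dom u v (sc p + r, 0).
Proof.
move=> hp; apply: axis_half; have u1 : sqnorm ((1, 0) : plane) = 1 by rewrite -cis0 sqnorm_cis.
by have [] := slot_valid hp u1 u1; rewrite pol_one.
Qed.

Lemma rev_hole (d : dart G) : hole (d_end d) (Some (inl (d_rev d))).
Proof. by rewrite /hole d_start_rev. Qed.

Lemma fibre_full v z s : half_dom true v z ->
  (frame true v z (s + 2 * pi)%R = fibre v * frame true v z s)%g.
Proof.
move=> hz; have [h _] := frame_fibre s 1 hz.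
by rewrite -{1}(mul1r (2 * pi)) -[1]/(1%:~R) h; congr (_ * _)%g; exact: expg1.
Qed.

Lemma pt_edge (d : dart G) (a w : plane) : sqnorm a = 1 -> sqnorm w = 1 ->
  pt (inl (d_start d), (pol (sc (Some (inl d))) r a, w)) =
  pt (inl (d_end d), (pol (sc (Some (inl (d_rev d)))) r w, a)).
Proof.
move=> ha hw; apply/(pt_coincide x0); [by apply: slot_valid; rewrite // /hole| |exact: CoEdge].
by apply: slot_valid => //; exact: rev_hole.
Qed.

Lemma pt_euler v (a w : plane) : sqnorm a = 1 -> sqnorm w = 1 ->
  pt (inl v, (pol (sc None) r a, w)) = pt (inr v, (a, cm w (cpow a (euler v)))).
Proof.
move=> ha hw; apply/(pt_coincide x0); [exact: slot_valid| |exact: CoEuler].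
by split; rewrite /= ?sqnormM ?sqnorm_cpow ?hw ?mulr1 //= /unit_disk /= ha.
Qed.

Definition dart_height v p : M := ((height v (sc p - r)%R)^-1 * height v (sc p + r)%R)%g.

(** On the gluing torus, turning around the slot is turning in the fibre of the other end. *)
Lemma dart_height_dart (d : dart G) :
  dart_height (d_start d) (Some (inl d)) =
  (dart_class d * fibre (d_end d) * (dart_class d)^-1)%g.
Proof.
have hp : hole (d_start d) (Some (inl d)) by rewrite /hole.
have hr := slot_base_dom true (rev_hole d).
have c1 : continuous (fun t : R => t) by cts.
have c0 : continuous (fun _ : R => slot_base (d_rev d)) by exact: cts_cst.
have := slot_loop hp (@frame_law true (d_end d)) c0 c1 (fun _ => hr).
rewrite /dart_height => ->.
  by have := fibre_full 0 hr; rewrite add0r /dart_class => ->; move: (frame _ _ _ _) (frame _ _ _ _) (fibre _) => A B C; rewrite !gsimp.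
by move=> t; rewrite cis0 pt_edge ?sqnorm_cis ?pol_one // -cis0 sqnorm_cis.
Qed.

(** In the solid torus, the loop around the slot bounds in the base direction and makes [euler v]
    turns in the fibre. *)
Lemma dart_height_euler v : dart_height v None = expgz (fibre v) (euler v).
Proof.
set e := (euler v)%:~R : R.
have hp : hole v None by []. have hr := slot_base_dom true hp.
have u1 : sqnorm ((1, 0) : plane) = 1 by rewrite -cis0 sqnorm_cis.
have c1 : continuous (fun t : R => e * t) by cts.
have c0 : continuous (fun _ : R => 0 : R) by exact: cts_cst.
have ud t : unit_disk (cis t : plane) by rewrite /unit_disk /= sqnorm_cis.
have := slot_loop hp (@solid_frame v) (@cis_cts R) c1 ud.
rewrite /dart_height => ->; last first.
  move=> t; rewrite pt_euler ?sqnorm_cis // cpow_cis -cisD add0r //.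
have c2 : continuous (fun t : R => t * (2 * pi)) by cts.
have cz1 : continuous (fun _ : R => (sc None + r, 0) : plane) by exact: cts_cst.
have cz2 : continuous (fun _ : R => (1, 0) : plane) by exact: cts_cst.
have u1' : unit_disk ((1, 0) : plane) by rewrite -cis0; exact: ud.
have := frame_transfer (@frame_law true v) (@solid_frame v) cz1 c2 cz2 c2 (fun _ => hr) (fun _ => u1').
have ff := fibre_full 0 hr; rewrite add0r in ff; rewrite !mul0r !mul1r ff => h0.
(* Over the boundary of the slot, the fibre of [v] is also a fibre of the solid torus. *)
have h : (fibre v = frame true v (sc None + r, 0)%R 0%R * ((solid v (1, 0)%R 0%R)^-1 *
    (deck (solid v) (0, 0)%R * solid v (1, 0)%R 0%R)) * (frame true v (sc None + r, 0)%R 0%R)^-1)%g.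
  have := frame_deck1 0 (@solid_frame v) (solid_connected v u1'); rewrite add0r => <-; rewrite -h0.
    by rewrite !gsimp.
  by move=> t _; rewrite -pol_one pt_euler ?sqnorm_cis // (_ : cpow _ _ = (1, 0)) ?cm1 // -cis0 cpow_cis mulr0.
have c2p : cis (2 * pi) = cis 0 :> plane by rewrite -[2 * pi]add0r -[2 * pi]mul1r -[1]/(1%:~R) cis_int.
have fd := frame_deck 0 (euler v) (@solid_frame v) (solid_connected v u1'); rewrite add0r in fd.
rewrite c2p cis0 mulr0 fd h.
set U := frame true v _ _; set S := solid v _ _; set dS := deck _ _.
have -> : (U * (S^-1 * (dS * S)) * U^-1 = (U * S^-1) * dS * (U * S^-1)^-1)%g by rewrite !gsimp.
by rewrite conj_expgz !gsimp.
Qed.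

Lemma pt_side v k t w : (k < 4 * genus v)%N -> 0 <= t <= 1 -> sqnorm w = 1 ->
  pt (inl v, (side_point (genus v) k t, w)) =
  pt (inl v, (side_point (genus v) (mate k) (1 - t), w)).
Proof.
move=> kg t01 hw; have v1 j (s : R) : valid (inl v, (side_point (genus v) j s, w)).
  by apply: outer_valid => //; exact: sqnorm_cis.
by apply: val_inj; rewrite (val_pt x0 (v1 _ _)) (val_pt x0 (v1 (mate k) _)); exact: ipt_side.
Qed.

Section Handles.
Variable v : vertex G.
Local Notation g := (genus v).
Hypothesis g0 : (0 < g)%N.
Local Notation vert := (vvec R g).

Definition upper_side (k : nat) : bool := (k < 2 * g)%N.

Lemma circle_half u t : 0 <= t <= pi -> half_dom u v (cis ((if u then 0 else pi) + t)).
Proof.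
move=> t01; split; first by have [] := @outer_valid R G v (cis ((if u then 0 else pi) + t)) (cis 0) (sqnorm_cis _) (sqnorm_cis _).
have s0 : 0 <= sin t by apply: sin_ge0_pi; rewrite ?in_itv /=.
by rewrite /in_half /flip; case: u => /=; rewrite ?add0r // addrC sinDpi opprK.
Qed.

Lemma side_angle u k (s : R) : (if u then (k < 2 * g)%N else (2 * g <= k < 4 * g)%N) -> 0 <= s <= 1 ->
  exists2 t, 0 <= t <= pi & side_point g k s = cis ((if u then 0 else pi) + t).
Proof.
have pp := @pi_pos R; have c0 := g4_gt0 R g0.
move=> hk s01; exists (2 * pi * (k%:R + s) / (4 * g)%:R - (if u then 0 else pi)); last first.
  by rewrite addrC subrK.
have e4 : (4 * g)%:R = 2 * (2 * g)%:R :> R by rewrite -natrM mulnA.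
have hb : (if u then 0 <= (k%:R : R) + s <= (2 * g)%:R else (2 * g)%:R <= (k%:R : R) + s <= (4 * g)%:R).
  case: u hk => hk.
    have : (k.+1%:R : R) <= (2 * g)%:R by rewrite ler_nat.
    by have : (0 : R) <= k%:R by []; rewrite -natr1; lra.
  case/andP: hk => k1 k2; have : (k.+1%:R : R) <= (4 * g)%:R by rewrite ler_nat.
  have k3 : ((2 * g)%:R : R) <= k%:R by rewrite ler_nat.
  by rewrite -natr1; lra.
rewrite e4 in c0 *; move: hb; rewrite e4; move: (2 * g)%:R (k%:R + s) c0 => c x c0.
by case: u {hk} => hb; rewrite lerBrDr lerBlDr ler_pdivlMr // ler_pdivrMr //; nra.
Qed.

Lemma side_dom u k (s : R) : (if u then (k < 2 * g)%N else (2 * g <= k < 4 * g)%N) -> 0 <= s <= 1 ->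
  half_dom u v (side_point g k s).
Proof. by move=> hk /(side_angle hk) [t ht ->]; exact: circle_half. Qed.

Lemma upper_sideP k : (k < 4 * g)%N ->
  if upper_side k then (k < 2 * g)%N else (2 * g <= k < 4 * g)%N.
Proof. by move=> kg; rewrite /upper_side; case: ltnP. Qed.

(** The class of the path along the side [k], read in the half that contains this side; [letter]
    brings it to the vertex 0. *)
Definition side_class (k : nat) : M :=
  ((frame (upper_side k) v (vert k) 0%R)^-1 * frame (upper_side k) v (vert k.+1) 0%R)%g.
Definition letter (k : nat) : M :=
  (frame true v (vert 0) 0%R * side_class k * (frame true v (vert 0) 0%R)^-1)%g.

Lemma side_point_cts k : continuous (fun s : R => side_point g k (clamp s)).
Proof.
apply: (cts_comp _ (@cis_cts R)); apply: ctsM; last by cts.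
by apply: ctsM; [cts|apply: ctsD; [cts|exact: clamp_cts]].
Qed.

Lemma side_class_mate k : (k < 4 * g)%N -> side_class (mate k) = (side_class k)^-1%g.
Proof.
move=> kg; have mg := @mate_lt _ g0 _ kg.
have c0 : continuous (fun _ : R => 0 : R) by exact: cts_cst.
have cr : continuous (fun t : R => 1 - t) by cts.
have cm := cts_comp cr (side_point_cts (k := mate k)).
have := frame_transfer (@frame_law (upper_side k) v) (@frame_law (upper_side (mate k)) v)
  (side_point_cts (k := k)) c0 cm c0 (fun t => side_dom (upper_sideP kg) (clamp01 t))
  (fun t => side_dom (upper_sideP mg) (clamp01 _)).
rewrite /= subr0 subrr (@clamp_le0 R 0) // (@clamp_ge1 R 1) // !side_point0 // !side_point1 // => h.
rewrite [in RHS]/side_class h; first by rewrite /side_class invgM invgK.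
move=> t t01; have t01' : 0 <= 1 - t <= 1 by lra.
by rewrite (clamp_id t01) (clamp_id t01'); exact: (pt_side kg t01 (sqnorm_cis 0)).
Qed.

Lemma vert0 : vert 0 = (1, 0).
Proof. by rewrite /vvec mulr0 mul0r cis0. Qed.

Lemma vert_half : vert (2 * g) = (-1, 0).
Proof.
rewrite -cis_pi /vvec; congr cis; rewrite -[RHS](pang_total R g0) natrM [(4 * g)%:R]natrM.
by rewrite (_ : 4 = 2 * 2 :> R); [ring|rewrite -natrM].
Qed.

(** The sides telescope in each half, and the two frames agree at [(-1, 0)], where the halves
    meet. *)
Lemma side_prod : (\prod_(0 <= k < 4 * g) side_class k =
  (frame true v (vert 0) 0%R)^-1 * frame false v (vert 0) 0%R)%g.
Proof.
have e4 : (4 * g = 2 * g + 2 * g)%N by lia.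
rewrite e4 (big_cat_nat (n := 2 * g)) ?leq_addr //=.
have h1 : (\prod_(0 <= k < 2 * g) side_class k = (frame true v (vert 0) 0%R)^-1 * frame true v (vert (2 * g)) 0%R)%g.
  rewrite -[(2 * g)%N in RHS]add0n -(prod_telescope (fun k => frame true v (vert k) 0) 0) add0n.
  by apply: eq_big_nat => k /andP[_ kg]; rewrite /side_class /upper_side kg.
have h2 : (\prod_(2 * g <= k < 2 * g + 2 * g) side_class k =
    (frame false v (vert (2 * g)) 0%R)^-1 * frame false v (vert (2 * g + 2 * g)) 0%R)%g.
  rewrite -(prod_telescope (fun k => frame false v (vert k) 0)).
  by apply: eq_big_nat => k /andP[kg _]; rewrite /side_class /upper_side ltnNge kg.
have a1 : axis v (-1) by apply: axis_unit; rewrite sqrrN expr1n.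
rewrite h1 h2 -e4 vvec_total // vert_half (heightE _ a1) height_left mul1g.
by rewrite mulgA mulgK.
Qed.

Lemma letter_prod : (\prod_(0 <= k < 4 * g) letter k = height v 1%R)%g.
Proof.
have h (n : nat) : (\prod_(0 <= k < n) letter k = frame true v (vert 0) 0%R *
    (\prod_(0 <= k < n) side_class k) * (frame true v (vert 0) 0%R)^-1)%g.
  elim: n => [|n IH]; first by rewrite !big_geq // mulg1 mulgV.
  rewrite !big_nat_recr //= IH /letter; move: (frame _ _ _ _) (side_class _) => A B.
  by move: (\prod_(_ <= _ < _) _)%g => C; rewrite !gsimp.
rewrite h side_prod /height vert0; move: (frame _ _ _ _) (frame _ _ _ _) => A B.
by rewrite !gsimp.
Qed.

Lemma letter_mate k : (k < 4 * g)%N -> letter (mate k) = (letter k)^-1%g.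
Proof.
by move=> kg; rewrite /letter side_class_mate //; move: (frame _ _ _ _) (side_class _) => A B; rewrite !gsimp.
Qed.

(** The fibres over all the vertices are one and the same loop of the manifold. *)
Lemma vert_fibre u u' k l : (k < 4 * g)%N -> (l < 4 * g)%N -> half_dom u v (vert k) -> half_dom u' v (vert l) ->
  ((frame u v (vert k) 0%R)^-1 * fibre v * frame u v (vert k) 0%R =
   (frame u' v (vert l) 0%R)^-1 * fibre v * frame u' v (vert l) 0%R)%g.
Proof.
move=> kg lg hk hl; have c2 : continuous (fun t : R => t * (2 * pi)) by cts.
have ck j : continuous (fun _ : R => vert j) by exact: cts_cst.
have := frame_transfer (@frame_law u v) (@frame_law u' v) (ck k) c2 (ck l) c2 (fun _ => hk) (fun _ => hl).
have f1 w z : half_dom w v z -> frame w v z (2 * pi) = (fibre v * frame w v z 0)%g.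
  move=> hz; have [h _] := frame_fibre 0 1 hz.
  by have := h; rewrite add0r mul1r => ->; congr (_ * _)%g; exact: expg1.
rewrite /= mul0r mul1r !f1 // !mulgA; apply=> t _.
apply/(pt_coincide x0); try by apply: outer_valid; exact: sqnorm_cis.
by apply: CoVertex => //; exact: sqnorm_cis.
Qed.

Lemma commute_loop (a A B C : M) : (A^-1 * a * A = B^-1 * a * B ->
  B^-1 * a * B = C^-1 * a * C -> a * (A * (B^-1 * C) * A^-1) = A * (B^-1 * C) * A^-1 * a)%g.
Proof.
move fE : (A^-1 * a * A)%g => f h1 h3.
have e1 : (a * A = A * f)%g by rewrite -fE !mulgA mulgV mul1g.
have e2 : (f * B^-1 = B^-1 * a)%g by rewrite h1 -!mulgA mulgV mulg1.
have e3 : (a * C = C * f)%g by rewrite h1 h3 !mulgA mulgV mul1g.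
have e4 : (f * A^-1 = A^-1 * a)%g by rewrite -fE -!mulgA mulgV mulg1.
rewrite !mulgA e1 -(mulgA A f) e2 mulgA -(mulgA _ a C) e3 !mulgA -(mulgA _ f) e4.
by rewrite !mulgA.
Qed.

Lemma letter_fibre k : (k < 4 * g)%N -> commute (fibre v) (letter k).
Proof.
move=> kg; have z0 : (0 < 4 * g)%N by rewrite muln_gt0.
have [k1 [k1g e1 _]] := next_side R g0 kg.
have d0 : half_dom true v (vert 0) by rewrite vert0; apply/axis_half/axis_unit; rewrite expr1n.
have l01 : is_true (0 <= (0 : R) <= 1) by lra. have l11 : is_true (0 <= (1 : R) <= 1) by lra.
have dk : half_dom (upper_side k) v (vert k) by rewrite -side_point0 //; exact: (side_dom (upper_sideP kg) l01).
have dk1 : half_dom (upper_side k) v (vert k1) by rewrite e1 -side_point1 //; exact: (side_dom (upper_sideP kg) l11).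
have h1 := vert_fibre z0 kg d0 dk; have h2 := vert_fibre z0 k1g d0 dk1.
have := etrans (esym h1) h2; rewrite e1 /letter /side_class /commute.
move: h1; set A := frame true v _ _; set B := frame _ v (vert k) _; set C := frame _ v _ _ => h1 h3.
exact: commute_loop h1 h3.
Qed.

End Handles.

(** Both half circles are constant paths in the manifold, so in each half the frames at [(1, 0)] and
    [(-1, 0)] are equal. *)
Lemma height_sphere v : genus v = 0%N -> height v 1 = 1%g.
Proof.
move=> gv; have pp := @pi_pos R.
have a1 : axis v 1 by apply: axis_unit; rewrite expr1n.
have am : axis v (-1) by apply: axis_unit; rewrite sqrrN expr1n.
have cl u : continuous (fun t : R => cis ((if u then 0 else pi) + pi * clamp t)).
  by apply: (cts_comp _ (@cis_cts R)); apply: ctsD; [cts|apply: ctsM; [cts|exact: clamp_cts]].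
have c0 : continuous (fun _ : R => 0 : R) by exact: cts_cst.
have cz : continuous (fun _ : R => (1, 0) : plane) by exact: cts_cst.
have hc t : 0 <= pi * clamp t <= pi by have := clamp01 t; nra.
have h u := frame_transfer (@frame_law u v) (@frame_law u v) (cl u) c0 cz c0
  (fun t => circle_half v u (hc t)) (fun _ => axis_half u a1).
have e u t : pt (inl v, (cis ((if u then 0 else pi) + pi * clamp t), cis 0)) = pt (inl v, ((1, 0), cis 0)).
  apply/(pt_coincide x0); try by apply: outer_valid; rewrite ?sqnorm_cis // -cis0 sqnorm_cis.
  by apply: CoSphere => //; rewrite ?sqnorm_cis // -cis0 sqnorm_cis.
have h1 := h true (fun t _ => e true t); have h2 := h false (fun t _ => e false t).
have c2p : cis (pi + pi) = cis 0 :> plane.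
  by rewrite (_ : pi + pi = 0 + 1%:~R * (2 * pi)) ?cis_int //; rewrite add0r mul1r; ring.
rewrite /= !(@clamp_le0 R 0) // !(@clamp_ge1 R 1) // mulr0 mulr1 !add0r ?addr0 c2p cis0 cis_pi !mulVg in h1 h2.
rewrite (heightE _ am) (heightE _ a1) height_left mul1g in h2.
move: h1 h2; set A := frame true v (1, 0) 0; set B := frame true v (-1, 0) 0 => h1 h2.
have e1 : B = A by rewrite -(mulVKg A B) h1 mulg1.
by apply: (mulIg A); rewrite mul1g -[LHS](mulVKg B) h2 mulg1.
Qed.

(** The inverses come from the convention for [[~ x, y]]: a block of letters [x], [y], [x^-1],
    [y^-1] is the commutator of [x^-1] and [y^-1]. *)
Definition path_data : pdata G M := {|
  pd_v := fibre;
  pd_h := fun h => dart_height (att h) (Some (inr h));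
  pd_d := dart_class;
  pd_a := fun k : handle G => (letter (tag k) (4 * tagged k))^-1%g;
  pd_b := fun k : handle G => (letter (tag k) (4 * tagged k + 1))^-1%g |}.

Lemma path_port v p : port_val path_data v p = dart_height v p.
Proof.
case: p => [[d|h]|] /=; last by rewrite dart_height_euler.
  case: eqP => [<-|/eqP ne]; first by rewrite dart_height_dart.
  by rewrite /dart_height height_unused ?mulVg //= ne.
case: eqP => [<- //|/eqP ne].
by rewrite /dart_height height_unused ?mulVg //= ne.
Qed.

Lemma prod_by4 (f : nat -> M) (n : nat) : (\prod_(0 <= k < 4 * n) f k =
  \prod_(j < n) (f (4 * j)%N * f (4 * j + 1)%N * f (4 * j + 2)%N * f (4 * j + 3)%N))%g.
Proof.
elim: n => [|n IH]; first by rewrite muln0 big_ord0 big_geq.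
rewrite big_ord_recr /= -IH mulnS addnC !addnS addn0 !big_nat_recr //=.
by rewrite !mulgA.
Qed.

Lemma path_data_ok : pdata_ok path_data (fun=> enum (port G)).
Proof.
have hc v x : axis v x -> commute (fibre v) (height v x).
  by move=> ax; have [_] := frame_fibre 0 0 (axis_half true ax); apply.
have lg (k : handle G) : (0 < genus (tag k))%N by case: k => v [j /= hj]; apply: leq_ltn_trans hj.
have l1 (k : handle G) : (4 * tagged k < 4 * genus (tag k))%N by case: k => v [j /= hj]; rewrite ltn_pmul2l.
have l2 (k : handle G) : (4 * tagged k + 1 < 4 * genus (tag k))%N by case: k => v [j /= hj]; lia.
split.
- by move=> d; rewrite /= /dart_class d_start_rev d_end_rev d_revK; move: (frame _ _ _ _) (frame _ _ _ _) => A B; rewrite !gsimp.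
- move=> d; rewrite /dart_val /= -dart_height_dart /dart_height.
  have hp : hole (d_start d) (Some (inl d)) by rewrite /hole.
  have ar : axis (d_start d) (sc (Some (inl d)) + r) by have [] := slot_base_dom true hp.
  have al : axis (d_start d) (sc (Some (inl d)) - r).
    have u1 : sqnorm ((-1, 0) : plane) = 1 by rewrite -cis_pi sqnorm_cis.
    by have [] := slot_valid hp u1 u1; rewrite /pol /= mulrN1 mulr0.
  by apply: commuteM; [apply: commuteV|]; exact: hc.
- move=> h; rewrite /= /dart_height.
  have [r0 r4] := andP (slot_radius_bounds R G); have [s1 s2] := andP (sc_bounds R (Some (inr h) : port G)).
  have ax (e : R) : (e = 1 \/ e = -1) -> axis (att h) (sc (Some (inr h)) + e * r).
    move=> he; apply: axisI => [|q _]; first by case: he => ->; lra.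
    have [->|qp] := eqVneq q (Some (inr h)).
      by rewrite addrAC subrr add0r ler_normr; case: he => ->; apply/orP; [left|right]; lra.
    by have := sc_sep R qp; rewrite !ler_normr => /orP[h'|h']; apply/orP; [right|left]; case: he => ->; lra.
  have ar := ax 1 (or_introl erefl); have al := ax (-1) (or_intror erefl); rewrite mul1r in ar; rewrite mulN1r in al.
  by apply: commuteM; [apply: commuteV|]; exact: hc.
- by move=> k; apply: commuteV; apply: letter_fibre.
- by move=> k; apply: commuteV; apply: letter_fibre.
- move=> v; rewrite (eq_bigr (dart_height v)) => [|p _]; last exact: path_port.
  rewrite height_prod /handles_val; have [g0|g0] := posnP (genus v).
    by rewrite height_sphere // big1 // => -[j hj] _; exfalso; move: hj; rewrite g0.
  rewrite -letter_prod // prod_by4; apply: eq_bigr => j _ /=.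
  have e2 : letter v (4 * j + 2) = (letter v (4 * j))^-1%g.
    by have := mate_side j false; rewrite /= addn0 => <-; apply: letter_mate => //; rewrite ltn_pmul2l.
  have e3 : letter v (4 * j + 3) = (letter v (4 * j + 1))^-1%g.
    have := mate_side j true; rewrite /= -addnA => <-; apply: letter_mate => //.
    exact: (l2 (Tagged (fun v => 'I_(genus v)) j)).
  by rewrite e2 e3 /commg /conjg !gsimp.
Qed.

End Frames.

(** * Generation *)

Section Generation.
Variables (R : realType) (G : plumbing_graph) (x0 : link_complement R G).
Variables (M : groupType) (m : (R -> link_complement R G) -> M).
Hypothesis mP : path_functor m.
Local Notation plane := (R * R)%type.
Local Notation r := (slot_radius R G).
Local Notation sc := (@sc R G).
Local Notation cell := (vertex G + vertex G)%type.
Local Notation pt := (pt x0).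
Local Notation frame := (frame x0 m).
Local Notation height := (height x0 m).
Local Notation fibre := (fibre x0 m).
Local Notation solid := (solid x0 m).
Local Notation D := (path_data x0 m).
Variables (gg : vertex G -> M) (N : set M).
Hypotheses (hN : subgroup_set N) (DN : pdata_in (pgauge D gg) N).
Implicit Types (v : vertex G) (i : cell) (z : plane) (u : bool) (s t : R) (n : int).

Lemma N1 : N 1%g. Proof. by case: hN. Qed.
Lemma NM x y : N x -> N y -> N (x * y)%g. Proof. by case: hN => _ h _; exact: h. Qed.
Lemma NV x : N x -> N x^-1%g. Proof. by case: hN => _ _; apply. Qed.

Definition Nat v (x : M) : Prop := N (gg v * x * (gg v)^-1)%g.

Lemma Nat1 v : Nat v 1%g. Proof. by rewrite /Nat mulg1 mulgV; exact: N1. Qed.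
Lemma NatM v x y : Nat v x -> Nat v y -> Nat v (x * y)%g.
Proof. by move=> hx hy; have := NM hx hy; rewrite /Nat !gsimp. Qed.
Lemma NatV v x : Nat v x -> Nat v x^-1%g.
Proof. by move=> hx; have := NV hx; rewrite /Nat !gsimp. Qed.

Lemma Nat_fibre v n : Nat v (expgz (fibre v) n).
Proof.
rewrite /Nat -conj_expgz; have h : N (gg v * fibre v * (gg v)^-1)%g by case: DN => + _ _ _ _; apply.
have pos (k : nat) : N ((gg v * fibre v * (gg v)^-1) ^+ k)%g.
  by elim: k => [|k IH]; [exact: N1|rewrite expgS; exact: NM].
by case: n => k /=; [|apply: NV]; exact: pos.
Qed.

Lemma Nat_dart (d : dart G) : N (gg (d_start d) * dart_class x0 m d * (gg (d_end d))^-1)%g.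
Proof. by case: DN => _ _ + _ _; apply. Qed.

Lemma Nat_port v p : Nat v (dart_height x0 m v p).
Proof.
rewrite -path_port //; case: p => [[d|h]|] /=; last exact: Nat_fibre.
  case: eqP => [<-|_]; last exact: Nat1.
  have h1 := Nat_dart d; have h2 := Nat_fibre (d_end d) 1.
  have := NM (NM h1 h2) (NV h1); rewrite /Nat /dart_val /= expg1.
  by move: (dart_class _ _ _) (fibre _) => A B; rewrite !gsimp.
case: eqP => [<-|_]; last exact: Nat1.
by case: DN => _ + _ _ _; apply.
Qed.

Lemma Nat_gap v k : (k <= #|port G|)%N -> Nat v (height v (gap R G k)).
Proof.
elim: k => [|k IH] kn; first by rewrite height_gap0 //; exact: Nat1.
have hk : k = enum_rank (enum_val (Ordinal kn)) :> nat by rewrite enum_valK.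
have := NatM (IH (ltnW kn)) (Nat_port v (enum_val (Ordinal kn))).
rewrite /dart_height -height_slot_left // height_slot_right // -hk.
by rewrite mulVKg.
Qed.

(** Without passing the centre of the nearest slot, [x] slides along the axis to the middle of a
    gap, and meets neither a hole nor the link. *)
Lemma axis_gap v x : axis v x -> exists2 k, (k <= #|port G|)%N & height v x = height v (gap R G k).
Proof.
have [r0 r4] := andP (slot_radius_bounds R G); have st := slot_total R G.
move=> ax; have := zvalid_sqnorm ax; rewrite /sqnorm /= expr0n addr0 => xb.
have {xb} [x1 x2] : -1 <= x /\ x <= 1 by split; nra.
(* The integer part [k] of [y] is [(x + 1) / (4 * r)] rounded to the nearest integer, and the slot
   of rank [k - 1] is centred at [-1 + 4 * r * k]. The value 0 and those above [#|port G|]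
   correspond to the two margins. *)
pose y := (x + 1) / (4 * r) + 2^-1; have y0 : 0 <= y.
  by rewrite /y addr_ge0 ?invr_ge0 // divr_ge0 //; lra.
have /andP[k1 k2] := truncn_itv y0; set k := Num.truncn y in k1 k2.
have ry : (y - 2^-1) * (4 * r) = x + 1.
  by rewrite /y addrK divfK // gt_eqF // mulr_gt0.
rewrite -natr1 in k2.
have b1 : 4 * r * k%:R - 2 * r <= x + 1 by rewrite -ry; nra.
have b2 : x + 1 < 4 * r * k%:R + 2 * r by rewrite -ry; nra.
case: (posnP k) => [k0|kpos].
  exists 0%N => //; rewrite k0 mulr0 add0r in b2; apply: height_const => // [|t tb]; first by rewrite /gap; lra.
  rewrite /gap mulr0 addr0 in tb; apply: axisI => [|q _]; first by lra.
  by have [s1 s2] := andP (sc_bounds R q); rewrite ler_normr; apply/orP; right; lra.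
have [kn|kn] := ltnP #|port G| k.
  exists #|port G| => //; have kk : (#|port G|.+1%:R : R) <= k%:R by rewrite ler_nat.
  rewrite -natr1 in st kk; have e : gap R G #|port G| = 1 - 2 * r by rewrite /gap; lra.
  have hx : 1 - 2 * r <= x by nra.
  rewrite e; apply/esym; apply: height_const => // t tb.
  apply: axisI => [|q _]; first by lra.
  by have [s1 s2] := andP (sc_bounds R q); rewrite ler_normr; apply/orP; left; lra.
have kn' : (k.-1 < #|port G|)%N by rewrite prednK.
pose p : port G := enum_val (Ordinal kn').
have rk : enum_rank p = k.-1 :> nat by rewrite /p enum_valK.
have sp : sc p = -1 + 4 * r * k%:R by rewrite scE rk prednK.
have [s1 s2] := andP (sc_bounds R p).
have gl : gap R G (enum_rank p) = sc p - 2 * r by rewrite /gap scE -natr1; ring.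
have gr : gap R G (enum_rank p).+1 = sc p + 2 * r by rewrite /gap scE; ring.
have other t q : `|t - sc p| <= 2 * r -> q != p -> r ^+ 2 <= (t - sc q) ^+ 2.
  rewrite ler_norml => /andP[t1 t2] qp.
  have := sc_sep R qp; rewrite ler_normr => /orP[h|h].
    have h5 : r <= sc q - t by lra.
    by rewrite -[(t - _) ^+ 2]sqrrN opprB; move: (sc q - t) h5 => c h5; nra.
  have h5 : r <= t - sc q by lra.
  by move: (t - sc q) h5 => c h5; nra.
have tax t : `|t - sc p| <= 2 * r -> (hole v p -> r ^+ 2 <= (t - sc p) ^+ 2) ->
    ((exists2 h, att h = v & p = Some (inr h)) -> t != sc p) -> axis v t.
  move=> ht h1 h2; apply: zvalidI => [|q hq|h hv].
  - by move: ht; rewrite ler_norml /sqnorm /= expr0n addr0 => /andP[? ?]; nra.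
  - rewrite /off /sqnorm /= expr0n addr0; have [e|qp] := eqVneq q p; last exact: other.
    by rewrite e in hq *; exact: h1.
  - rewrite /off /sqnorm /= expr0n addr0; have [e|qp] := eqVneq (Some (inr h)) p.
      by rewrite e exprn_even_gt0 //= subr_eq0; apply: h2; exists h.
    by apply: lt_le_trans (other t _ ht qp); nra.
have xh : hole v p -> r ^+ 2 <= (x - sc p) ^+ 2.
  by move=> /(zvalid_hole ax); rewrite /off /sqnorm /= expr0n addr0.
have xa : (exists2 h, att h = v & p = Some (inr h)) -> x != sc p.
  move=> [h hv e]; have := zvalid_arrow ax hv; rewrite -e /off /sqnorm /= expr0n addr0.
  by rewrite exprn_even_gt0 //= subr_eq0.
have [xp|xp] := leP x (sc p).
  exists (enum_rank p); [by rewrite rk ltnW|rewrite gl; apply/esym; apply: height_const => // [|t tb]; first lra].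
  apply: tax => [|/xh h|/xa h]; first by rewrite ler_norml; lra.
    have h1 : x - sc p <= 0 by lra.
    have h2 : t - sc p <= x - sc p by lra.
    by move: (x - sc p) (t - sc p) h h1 h2 => a b; nra.
  by apply/eqP => e; move: h; rewrite -e => /eqP; apply; lra.
exists (enum_rank p).+1; [by rewrite rk prednK|rewrite gr; apply: height_const => // [|t tb]; first lra].
apply: tax => [|/xh h|/xa h]; first by rewrite ler_norml; lra.
  have h1 : 0 <= x - sc p by lra.
  have h2 : x - sc p <= t - sc p by lra.
  by move: (x - sc p) (t - sc p) h h1 h2 => a b; nra.
by apply/eqP => e; lra.
Qed.

Lemma Nat_height v x : axis v x -> Nat v (height v x).
Proof. by move=> /axis_gap[k kn ->]; exact: Nat_gap. Qed.

Definition solid_frame0 v z s : M :=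
  (frame true v (sc None + r, 0)%R 0%R * (solid v (1%R, 0%R) 0%R)^-1 * solid v z s)%g.

(** The half and the lift [arg w] of the fibre coordinate are arbitrary choices; by [place_frameE],
    other choices change the frame by an element of [N]. *)
Definition place_frame (p : place R G) : M :=
  match p with
  | (inl v, (z, w)) => (gg v * frame (0 <= z.2)%R v z (arg w))%g
  | (inr v, (z, w)) => (gg v * solid_frame0 v z (arg w))%g
  end.

Lemma place_frameE v u z s : half_dom u v z ->
  N (place_frame (inl v, (z, cis s)) * (gg v * frame u v z s)^-1)%g.
Proof.
move=> hz; have [vz hu] := hz; pose u' : bool := 0 <= z.2.
have hz' : half_dom u' v z.
  split=> //; rewrite /in_half /flip /u'; case: (leP 0 z.2) => h //.
  by rewrite /cj /= oppr_ge0 ltW.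
have e1 : (frame u' v z (arg (cis s)) = expgz (fibre v) (- fl s) * frame u' v z s)%g.
  rewrite arg_lift; have [h _] := frame_fibre x0 mP s (- fl s) hz'.
  by rewrite -h; congr (frame _ _ _ _); rewrite intrN mulNr.
have e2 : exists2 h, Nat v h & (frame u' v z s = h * frame u v z s)%g.
  case: (ltgtP z.2 0) => z2.
  - exists 1%g; [exact: Nat1|rewrite mul1g; congr (frame _ _ _ _)].
    by rewrite /u' leNgt z2; case: (u) hu => //; rewrite /in_half /= leNgt z2.
  - exists 1%g; [exact: Nat1|rewrite mul1g; congr (frame _ _ _ _)].
    by rewrite /u' ltW //; case: (u) hu => //; rewrite /in_half /= oppr_ge0 leNgt z2.
  - have ze : z = (z.1, 0) by rewrite -z2 -surjective_pairing.
    have ax : axis v z.1 by rewrite /axis -ze.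
    rewrite /u' z2 lexx; case: (u); first by exists 1%g; [exact: Nat1|rewrite mul1g].
    exists (height v z.1)^-1%g; first by apply/NatV/Nat_height.
    by rewrite ze (heightE x0 mP s ax) mulKg.
have [h hh e] := e2; rewrite /place_frame -/u' e1 e.
have := NatM (Nat_fibre v (- fl s)) hh; rewrite /Nat.
by move: (expgz _ _) (frame _ _ _ _) => A B; rewrite !gsimp.
Qed.

Lemma solid_frame0_law v : cell_frame x0 m (inr v) (@unit_disk R) (solid_frame0 v).
Proof. by apply: frame_left; exact: solid_frame. Qed.

(* The path of class [a] from [p0] to [p1] becomes a loop with class in [N] once
   completed by the frames of its ends. *)
Definition good (p0 p1 : place R G) (a : M) : Prop :=
  N (place_frame p0 * a * (place_frame p1)^-1)%g.

Lemma good_half v u (zf : R -> plane) (sf : R -> R) : continuous zf -> continuous sf ->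
  (forall t, half_dom u v (zf t)) ->
  good (inl v, (zf 0, cis (sf 0))) (inl v, (zf 1, cis (sf 1)))
    (m (fun t => pt (inl v, (zf t, cis (sf t))))).
Proof.
move=> cz cs hz; have h := frame_law x0 mP cz cs hz.
have := NM (place_frameE (sf 0) (hz 0)) (NV (place_frameE (sf 1) (hz 1))).
rewrite /good -h; move: (place_frame _) (place_frame _) (m _) (frame _ _ _ _) => A B C E.
by rewrite !gsimp.
Qed.

Lemma solid_placeE v z s : unit_disk z ->
  N (place_frame (inr v, (z, cis s)) * (gg v * solid_frame0 v z s)^-1)%g.
Proof.
move=> hz; rewrite /place_frame arg_lift -mulNr -intrN.
have fd := frame_deck mP s (- fl s) (solid_frame0_law v) (solid_connected v hz); rewrite fd.
have u1 : unit_disk ((1, 0) : plane) by rewrite /unit_disk /= -cis0 sqnorm_cis.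
have hp : hole v None by [].
have dR := slot_base_dom R true hp.
have c2 : continuous (fun t : R => t * (2 * pi)) by cts.
have cz1 : continuous (fun _ : R => (sc None + r, 0) : plane) by exact: cts_cst.
have cz2 : continuous (fun _ : R => (1, 0) : plane) by exact: cts_cst.
have := frame_transfer mP (@frame_law _ _ x0 _ _ mP true v) (solid_frame0_law v) cz1 c2 cz2 c2 (fun _ => dR) (fun _ => u1).
have ff := fibre_full x0 mP 0 dR; rewrite add0r in ff; rewrite !mul0r !mul1r ff.
have fs := frame_deck1 mP 0 (solid_frame0_law v) (solid_connected v u1); rewrite add0r in fs; rewrite fs.
have e0 : solid_frame0 v (1, 0) 0 = frame true v (sc None + r, 0) 0 by rewrite /solid_frame0 mulgVK.
rewrite e0 => h; have {h} dk : fibre v = deck (solid_frame0 v) (0, 0).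
  apply: (mulIg (frame true v (sc None + r, 0) 0)); apply: (mulgI (frame true v (sc None + r, 0) 0)^-1)%g; apply: h => t _.
  rewrite -pol_one pt_euler ?sqnorm_cis -?cis0 ?sqnorm_cis // cpow_cis mulr0.
  by rewrite cis0 cm1.
have := Nat_fibre v (- fl s); rewrite dk /Nat.
by move: (expgz _ _) (solid_frame0 _ _ _) => A B; rewrite !gsimp.
Qed.

Lemma good_solid v (zf : R -> plane) (sf : R -> R) : continuous zf -> continuous sf ->
  (forall t, unit_disk (zf t)) ->
  good (inr v, (zf 0, cis (sf 0))) (inr v, (zf 1, cis (sf 1)))
    (m (fun t => pt (inr v, (zf t, cis (sf t))))).
Proof.
move=> cz cs hz; have h := solid_frame0_law v cz cs hz.
have := NM (solid_placeE v (sf 0) (hz 0)) (NV (solid_placeE v (sf 1) (hz 1))).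
rewrite /good -h; move: (place_frame _) (place_frame _) (m _) (solid_frame0 _ _ _) => A B C E.
by rewrite !gsimp.
Qed.

Definition same (p q : place R G) : Prop := N (place_frame p * (place_frame q)^-1)%g.

(** A path that can be read from two families of places carries [same] from its origin to its
    end. *)
Lemma same_step p0 p1 q0 q1 a : good p0 p1 a -> good q0 q1 a -> same p0 q0 -> same p1 q1.
Proof.
rewrite /good /same => h1 h2 h3; have := NM (NM (NV h1) h3) h2.
by move: (place_frame p0) (place_frame p1) (place_frame q0) (place_frame q1) => A B C E; rewrite !gsimp.
Qed.

Lemma same_refl p : same p p. Proof. by rewrite /same mulgV; exact: N1. Qed.
Lemma same_sym p q : same p q -> same q p.
Proof. by rewrite /same => /NV; move: (place_frame p) (place_frame q) => A B; rewrite !gsimp. Qed.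
Lemma same_trans p q q2 : same p q -> same q q2 -> same p q2.
Proof. by rewrite /same => h1 h2; have := NM h1 h2; rewrite mulgA mulgVK. Qed.

(** From [(1, 0)], at most two arcs, each in a closed half plane, lead to any point of the
    circle. *)
Lemma circle_ind (Q : plane -> Prop) : Q (1, 0) ->
  (forall u t, 0 <= t <= pi -> let a x := cis ((if u then 0 else pi) + x) in Q (a 0) -> Q (a t)) ->
  forall a, sqnorm a = 1 -> Q a.
Proof.
have pp := @pi_pos R; move=> Q1 Qs a /argP[/andP[t0 t2] <-].
have h0 : Q (cis (0 + 0)) by rewrite addr0 cis0.
have [tp|tp] := leP (arg a) pi.
  by have := Qs true (arg a) _ h0; rewrite /= add0r; apply; rewrite t0.
have h1 : Q (cis (pi + 0)).
  by have := Qs true pi _ h0; rewrite /= add0r addr0; apply; rewrite lexx ltW.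
have := Qs false (arg a - pi) _ h1; rewrite /= addrCA subrr addr0; apply; lra.
Qed.

Lemma fibre_half v z : zvalid (inl v) z -> half_dom (0 <= z.2) v z.
Proof.
move=> vz; split=> //; rewrite /in_half /flip; case: (leP 0 z.2) => h //.
by rewrite /cj /= oppr_ge0 ltW.
Qed.

Lemma arc_cts (c t : R) : continuous (fun x : R => c + clamp x * t).
Proof. by apply: ctsD; [cts|apply: ctsM; [exact: clamp_cts|cts]]. Qed.

Definition good_arc (P : plane -> place R G) : Prop :=
  forall u t, 0 <= t <= pi -> let arc x := cis ((if u then 0 else pi) + x) in
    good (P (arc 0)) (P (arc t)) (m (fun x => pt (P (arc (clamp x * t))))).

Lemma same_arc (P Q : plane -> place R G) : good_arc P -> good_arc Q ->
  (forall a, sqnorm a = 1 -> pt (P a) = pt (Q a)) ->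
  same (P (1, 0)) (Q (1, 0)) -> forall a, sqnorm a = 1 -> same (P a) (Q a).
Proof.
move=> hP hQ e h0; apply: (circle_ind (Q := fun a => same (P a) (Q a))) => // u t ht arc h.
apply: (same_step (hP u t ht) _ h).
rewrite (pf_ext mP (g := fun x => pt (Q (arc (clamp x * t))))); first exact: hQ.
by move=> x _; rewrite e // sqnorm_cis.
Qed.

Lemma good_slot v p w : hole v p -> sqnorm w = 1 ->
  good_arc (fun a => (inl v, (pol (sc p) r a, w))).
Proof.
move=> hp hw u t ht arc; have pp := @pi_pos R.
have c0 : continuous (fun _ : R => arg w) by exact: cts_cst.
have cz : continuous (fun x : R => pol (sc p) r (arc (clamp x * t))).
  have cpol : continuous (fun y : R => pol (sc p) r (cis y)).
    apply: (cts_comp (f := fun y : R => (r, cis y)) _ (@pol_cts R (sc p))).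
    by apply: cts_pair; [cts|exact: cis_cts].
  exact: (cts_comp (@arc_cts _ t) cpol).
have hz x : half_dom u v (pol (sc p) r (arc (clamp x * t))).
  have := @slot_arc_dom R G v p u (clamp x * t / pi) hp.
  rewrite (_ : pi * (clamp x * t / pi) = clamp x * t); last by rewrite mulrC divfK // gt_eqF.
  apply; have /andP[c1 c2] := clamp01 x; case/andP: ht => t0 t1.
  apply/andP; split; first by apply: divr_ge0; [exact: mulr_ge0|exact: ltW].
  by rewrite ler_pdivrMr // mul1r; move: (clamp x) c1 c2 => c c1 c2; nra.
have := good_half cz c0 hz.
by rewrite !cis_arg // (@clamp_le0 R 0) // (@clamp_ge1 R 1) // mul0r mul1r.
Qed.

Lemma good_outer v w : sqnorm w = 1 -> good_arc (fun a => (inl v, (a, w))).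
Proof.
move=> hw u t ht arc; have c0 : continuous (fun _ : R => arg w) by exact: cts_cst.
have cz := cts_comp (@arc_cts (if u then 0 else pi) t) (@cis_cts R).
have hz x : half_dom u v (arc (clamp x * t)).
  apply: circle_half; have /andP[c1 c2] := clamp01 x; case/andP: ht => t0 t1.
  by move: (clamp x) c1 c2 => c c1 c2; apply/andP; split; nra.
have := good_half cz c0 hz.
by rewrite !cis_arg // (@clamp_le0 R 0) // (@clamp_ge1 R 1) // mul0r mul1r.
Qed.

Lemma good_fibre v z : zvalid (inl v) z -> good_arc (fun a => (inl v, (z, a))).
Proof.
move=> vz u t ht arc; have cz : continuous (fun _ : R => z) by exact: cts_cst.
have := good_half cz (@arc_cts (if u then 0 else pi) t) (fun _ => fibre_half vz).
by rewrite (@clamp_le0 R 0) // (@clamp_ge1 R 1) // mul0r mul1r.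
Qed.

Lemma good_solid_base v w n : sqnorm w = 1 -> good_arc (fun a => (inr v, (a, cm w (cpow a n)))).
Proof.
move=> hw u t ht arc.
have e y : cm w (cpow (cis y) n) = cis (arg w + n%:~R * y) by rewrite cpow_cis cisD cis_arg.
have cz := cts_comp (@arc_cts (if u then 0 else pi) t) (@cis_cts R).
have cs : continuous (fun x : R => arg w + n%:~R * ((if u then 0 else pi) + clamp x * t)).
  by apply: ctsD; [cts|apply: ctsM; [cts|exact: arc_cts]].
have hz x : unit_disk (arc (clamp x * t)) by rewrite /unit_disk /= sqnorm_cis.
have := good_solid v cz cs hz.
rewrite (@clamp_le0 R 0) // (@clamp_ge1 R 1) // mul0r mul1r /arc !e.
by rewrite (pf_ext mP (g := fun x => pt (inr v, (arc (clamp x * t), cm w (cpow (arc (clamp x * t)) n))))) // => x _; rewrite /arc e.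
Qed.

Lemma good_solid_fibre v z : unit_disk z -> good_arc (fun w => (inr v, (z, w))).
Proof.
move=> vz u t ht arc; have cz : continuous (fun _ : R => z) by exact: cts_cst.
have := good_solid v cz (@arc_cts (if u then 0 else pi) t) (fun _ => vz).
by rewrite (@clamp_le0 R 0) // (@clamp_ge1 R 1) // mul0r mul1r.
Qed.

Lemma good_const p : good_arc (fun _ => p).
Proof. by move=> u t ht arc; rewrite /good (pf_const mP) mulg1 mulgV; exact: N1. Qed.

Lemma arg_one : arg (1, 0) = 0 :> R.
Proof.
have pp := @pi_pos R; rewrite -cis0 arg_lift (_ : fl (0 : R) = 0) ?mul0r ?subr0 //.
by apply: flE; rewrite ?mul0r // add0r mul1r mulr_gt0.
Qed.

Lemma sqnorm_one : sqnorm ((1, 0) : plane) = 1. Proof. by rewrite -cis0 sqnorm_cis. Qed.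

(** An arc in each direction of the torus leads to the base points of the two slots, where the
    frames differ by the class of the edge. *)
Lemma same_edge d a w : sqnorm a = 1 -> sqnorm w = 1 ->
  same (inl (d_start d), (pol (sc (Some (inl d))) r a, w))
       (inl (d_end d), (pol (sc (Some (inl (d_rev d)))) r w, a)).
Proof.
move=> ha hw; have h1 : hole (d_start d) (Some (inl d)) by rewrite /hole.
have h2 := rev_hole d; have u1 := sqnorm_one.
have [v2 _] := slot_valid h2 hw u1.
apply: (same_arc (good_slot h1 hw) (good_fibre v2) _ _ ha) => [b hb|]; first exact: pt_edge.
have [v1 _] := slot_valid h1 u1 u1.
apply: (same_arc (good_fibre v1) (good_slot h2 u1) _ _ hw) => [b hb|]; first exact: pt_edge.
rewrite /same /place_frame arg_one !pol_one /= lexx.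
have := Nat_dart d; rewrite /dart_class /slot_base.
by move: (frame _ _ _ _) (frame _ _ _ _) => A B; rewrite !gsimp.
Qed.

Lemma same_euler v a w : sqnorm a = 1 -> sqnorm w = 1 ->
  same (inl v, (pol (sc None) r a, w)) (inr v, (a, cm w (cpow a (euler v)))).
Proof.
move=> ha hw; have hp : hole v None by []. have u1 := sqnorm_one.
apply: (same_arc (good_slot hp hw) (@good_solid_base v w (euler v) hw) _ _ ha) => [b hb|]; first exact: pt_euler.
have e1 : cpow (1, 0) (euler v) = (1, 0) :> plane by rewrite -cis0 cpow_cis mulr0.
have d1 : unit_disk ((1, 0) : plane) by rewrite /unit_disk /= u1.
have [v1 _] := slot_valid hp u1 u1; rewrite e1 cm1.
apply: (same_arc (good_fibre v1) (good_solid_fibre v d1) _ _ hw) => [b hb|].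
  by rewrite pt_euler // e1 cm1.
by rewrite /same /place_frame arg_one pol_one /= lexx /solid_frame0 mulgVK mulgV; exact: N1.
Qed.

Lemma same_sphere v a b w : genus v = 0%N -> sqnorm a = 1 -> sqnorm b = 1 -> sqnorm w = 1 ->
  same (inl v, (a, w)) (inl v, (b, w)).
Proof.
move=> gv ha hb hw; have u1 := sqnorm_one.
have H c : sqnorm c = 1 -> same (inl v, (c, w)) (inl v, ((1, 0), w)).
  move=> hc; apply: (same_arc (good_outer v hw) (good_const (inl v, ((1, 0), w))) _ _ hc); last exact: same_refl.
  move=> x hx; apply/(pt_coincide x0); [exact: outer_valid|exact: outer_valid|exact: CoSphere].
exact: same_trans (H a ha) (same_sym (H b hb)).
Qed.

Lemma Nat_letter v j : (j < 4 * genus v)%N -> Nat v (letter x0 m v j).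
Proof.
move=> jg; have g0 : (0 < genus v)%N by case: (genus v) jg.
have A (i : 'I_(genus v)) (b : bool) : Nat v (letter x0 m v (4 * i + b)).
  case: DN => _ _ _ Da Db.
  have h1 := Da (Tagged (fun v => 'I_(genus v)) i); have h2 := Db (Tagged (fun v => 'I_(genus v)) i).
  rewrite -[letter _ _ _ _]invgK; apply: NatV; case: b; [exact: h2|rewrite addn0; exact: h1].
have [i [b [[-> _]|[h _]]]] := mate_letter jg; first exact: A.
by rewrite -[letter _ _ _ _]invgK -letter_mate // h; apply/NatV/A.
Qed.

Lemma half_vertex v k : (k < 4 * genus v)%N ->
  half_dom (upper_side v k) v (vvec R (genus v) k) /\
  half_dom (upper_side v k) v (vvec R (genus v) k.+1).
Proof.
move=> kg; have l0 : is_true (0 <= (0 : R) <= 1) by lra.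
have l1 : is_true (0 <= (1 : R) <= 1) by lra.
have g0 : (0 < genus v)%N by case: (genus v) kg.
by rewrite -side_point0 // -side_point1 //; split; apply: side_dom => //; exact: upper_sideP.
Qed.

(** The frames of consecutive vertices differ by a letter, and the letters are the handle generators
    and their inverses. *)
Lemma same_vertex v k l w : (k < 4 * genus v)%N -> (l < 4 * genus v)%N -> sqnorm w = 1 ->
  same (inl v, (vvec R (genus v) k, w)) (inl v, (vvec R (genus v) l, w)).
Proof.
move=> kg lg hw; have u1 := sqnorm_one; set V := vvec R (genus v).
have g0 : (0 < genus v)%N by case: (genus v) kg.
have hv j : zvalid (inl v) (V j) by have [] := @outer_valid R G v (V j) (1, 0) (sqnorm_cis _) u1.
apply: (same_arc (good_fibre (hv k)) (good_fibre (hv l)) _ _ hw) => [b hb|].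
  by apply/(pt_coincide x0); [exact: outer_valid (sqnorm_cis _) hb|exact: outer_valid (sqnorm_cis _) hb|exact: CoVertex].
suff H j : (j < 4 * genus v)%N -> same (inl v, (V j, (1, 0))) (inl v, (V 0, (1, 0))).
  exact: same_trans (H _ kg) (same_sym (H _ lg)).
pose f0 := frame true v (V 0) 0.
have z0 : (0 < 4 * genus v)%N by rewrite muln_gt0.
have d0 : half_dom true v (V 0) by have [] := half_vertex z0; rewrite /upper_side muln_gt0 g0.
have b0 := place_frameE 0 d0; rewrite cis0 -/f0 in b0.
suff {}H : (j < 4 * genus v)%N -> N (place_frame (inl v, (V j, (1%R, 0%R))) * (gg v * f0)^-1)%g.
  by move=> /H h; have := NM h (NV b0); rewrite /same; move: (place_frame _) (place_frame _) => A B; rewrite !gsimp.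
elim: j => [_|j IH jg]; first exact: b0.
have jg' := ltnW jg; have [dj dj1] := half_vertex jg'.
have := Nat_letter jg'; rewrite /Nat /letter /side_class -/f0 -/V => h1.
have := IH jg' => h2.
have h3 := place_frameE 0 dj; have h4 := place_frameE 0 dj1; rewrite cis0 -/V in h3 h4.
have := NM h4 (NM (NM (NV h3) h2) h1).
clear; move: (place_frame _) (place_frame (inl v, (V j, _))) (frame _ v (V j) 0) (frame _ v (V j.+1) 0) f0 => A B C E F.
by rewrite !gsimp.
Qed.

(** Sliding along the two sides to their ends reduces the claim to vertices. *)
Lemma same_side v k a w : (k < 4 * genus v)%N -> sqnorm a = 1 -> sqnorm w = 1 ->
  in_side (genus v) k a -> same (inl v, (a, w)) (inl v, (fold_side (genus v) k a, w)).
Proof.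
move=> kg ha hw ia; have g0 : (0 < genus v)%N by case: (genus v) kg.
have [s s01 ae] := in_side_point g0 ha ia; have mg := @mate_lt _ g0 _ kg.
rewrite ae -side_point_mate //.
have c0 : continuous (fun _ : R => arg w) by exact: cts_cst.
have csp j (f : R -> R) : continuous f -> continuous (fun x => side_point (genus v) j (f x)).
  move=> cf; apply: (cts_comp _ (@cis_cts R)); apply: ctsM; last by cts.
  by apply: ctsM; [cts|apply: ctsD; [cts|exact: cf]].
have cc : continuous (fun x : R => clamp x * s) by apply: ctsM; [exact: clamp_cts|cts].
have cc' : continuous (fun x : R => 1 - clamp x * s) by apply: ctsB; [cts|exact: cc].
have b x : 0 <= clamp x * s <= 1.
  by have /andP[] := clamp01 x; case/andP: s01; move: (clamp x) => c *; apply/andP; split; nra.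
have b' x : 0 <= 1 - clamp x * s <= 1 by have := b x; lra.
have h1 := good_half (csp k _ cc) c0 (fun x => side_dom g0 (upper_sideP kg) (b x)).
have h2 := good_half (csp (mate k) _ cc') c0 (fun x => side_dom g0 (upper_sideP mg) (b' x)).
rewrite (@clamp_le0 R 0) // (@clamp_ge1 R 1) // mul0r mul1r ?subr0 cis_arg // in h1 h2.
apply: same_step h1 _ _.
  rewrite (pf_ext mP (g := fun x => pt (inl v, (side_point (genus v) (mate k) (1 - clamp x * s), w)))); first exact: h2.
  by move=> x _; exact: pt_side.
rewrite side_point0 // side_point1 //; have [k1 [k1g <- _]] := next_side R g0 mg.
exact: same_vertex.
Qed.

Lemma same_coincide p q : valid p -> valid q -> coincide p q -> same p q.
Proof.
move=> vp vq c; case: c vp vq => {p q}.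
- by move=> p _ _; exact: same_refl.
- by move=> d a w ha hw _ _; exact: same_edge.
- by move=> v a w ha hw _ _; exact: same_euler.
- by move=> v a w ha hw _ _; apply: same_sym; exact: same_euler.
- by move=> v a b w *; exact: same_sphere.
- by move=> v k a w *; exact: same_side.
- by move=> v k l w *; exact: same_vertex.
Qed.

(** By [cl_half], a spoke of a product cell stays in one half, where the frame law applies. *)
Lemma good_spoke i q q' : valid (i, q) -> close i q q' ->
  good (i, q) (i, q') (m (fun l => pt (i, spoke_place i q q' (clamp l)))).
Proof.
move=> vq c; have [vz hw] := vq; have vq' := cl_valid c; have [vz' hw'] := vq'.
have s0 : same (i, q) (i, spoke_place i q q' 0).
  apply: same_coincide => //; first by apply: spoke_valid => //; rewrite lexx ler01.
  apply/(pt_coincide x0) => //; last by rewrite spoke0.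
  by apply: spoke_valid => //; rewrite lexx ler01.
suff h : good (i, spoke_place i q q' 0) (i, q') (m (fun l => pt (i, spoke_place i q q' (clamp l)))).
  have := NM s0 h; rewrite /good; move: (place_frame _) (place_frame _) (place_frame _) (m _) => A B C E.
  by rewrite !gsimp.
pose sf (l : R) := arg q.2 + clamp l * ang (rel_dir q.2 q'.2).
pose zf (l : R) := cone i q.1 q'.1 (clamp l).
have csf : continuous sf by exact: arc_cts.
have czf : continuous zf.
  move=> l; have := cone_cts_at (l := clamp l) (cl_off c) => cc.
  have cp : continuous (fun l : R => (q'.1, clamp l)) by apply: cts_pair; [cts|exact: clamp_cts].
  exact: (@continuous_comp _ _ _ (fun l : R => (q'.1, clamp l)) (fun u : plane * R => cone i q.1 u.1 u.2) l (cp l) cc).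
have eq l : spoke_place i q q' (clamp l) = (zf l, cis (sf l)).
  by rewrite /spoke_place /lerp /sf cisD cis_arg.
have e0 : spoke_place i q q' 0 = (zf 0, cis (sf 0)) by rewrite -eq clamp_le0.
have e1 : q' = (zf 1, cis (sf 1)) by rewrite -eq clamp_ge1 // spoke1.
rewrite [X in good _ (i, X)]e1 e0.
rewrite (pf_ext mP (g := fun l => pt (i, (zf l, cis (sf l))))); last by move=> l _; rewrite eq.
have vzf l : zvalid i (zf l) by apply: (cl_cone c); exact: clamp01.
have hzf l : zf l = cone i q.1 q'.1 (clamp l) by [].
clear e0 e1 s0 eq vq vz hw vq' vz' hw'; clearbody zf sf.
case: i c zf czf vzf hzf => v c zf czf vzf hzf; last exact: good_solid.
have [h|h] := cl_half c.
  by apply: (@good_half v true) => // t; split=> //; rewrite /in_half /= hzf; apply: h; exact: clamp01.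
apply: (@good_half v false) => // t; split=> //; rewrite /in_half /= oppr_ge0 hzf; apply: h; exact: clamp01.
Qed.

Lemma good_path (f : R -> link_complement R G) p0 p1 : continuous f -> valid p0 -> valid p1 ->
  pt p0 = f 0 -> pt p1 = f 1 -> good p0 p1 (m f).
Proof.
move=> cf v0 v1 e0 e1.
pose S x y := [set a | forall p q, valid p -> valid q -> pt p = x -> pt q = y -> good p q a].
suff h : S (f 0) (f 1) (m f) by exact: h.
apply: (@spoke_generation R G x0 M m S mP _ _ _ f cf) => [x y y' a b h1 h2 p q vp vq ep eq|x y a h p q vp vq ep eq|i q q' vq c p p' vp vp' ep ep'].
- have [s vs es] := pt_surj x0 y; have := NM (h1 _ _ vp vs ep es) (h2 _ _ vs vq es eq); rewrite /good.
  by move: (place_frame _) (place_frame _) (place_frame _) => A B C; rewrite !gsimp.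
- have := NV (h _ _ vq vp eq ep); rewrite /good.
  by move: (place_frame _) (place_frame _) => A B; rewrite !gsimp.
- have s1 : same p (i, q) by apply: same_coincide => //; apply/(pt_coincide x0).
  have s2 : same (i, q') p'.
    by apply: same_coincide => //; [exact: cl_valid c|apply/(pt_coincide x0) => //; exact: cl_valid c].
  have := NM (NM s1 (good_spoke vq c)) s2; rewrite /good.
  move: (place_frame p) (place_frame p') (place_frame (i, q)) (place_frame (i, q')) (m _) => A B C E F.
  by rewrite !gsimp.
Qed.

End Generation.

Lemma path_data_generates (R : realType) (G : plumbing_graph) (x0 x1 : link_complement R G)
    (M : groupType) (m : (R -> link_complement R G) -> M) : path_functor m ->
  (forall y, exists f : R -> link_complement R G, [/\ continuous f, f 0 = x1, f 1 = x1 & m f = y]) ->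
  pgenerates (path_data x0 m).
Proof.
move=> mP sm gg N hN DN y; have [p vp e] := pt_surj x0 x1.
(* A loop is completed by the same frame at both ends; conjugating its class by [W] beforehand
   leaves [y] itself. *)
pose W := place_frame x0 m gg p.
have [f [cf f0 f1 fy]] := sm (W^-1 * y * W)%g.
have := good_path mP hN DN cf vp vp (etrans e (esym f0)) (etrans e (esym f1)).
by rewrite /good fy -/W !gsimp.
Qed.

(** * Universality *)

Section Expgz.
Variable M : groupType.
Local Open Scope group_scope.

Lemma expgzB (x : M) (a b : nat) : expgz x (a%:Z - b%:Z)%R = x ^+ a / x ^+ b.
Proof.
have [ba|ab] := leqP b a; first by rewrite subzn //= -{2}(subnK ba) expgnDr mulgK.
have [k kE] : exists k, (b - a = k.+1)%N by exists (b - a).-1; rewrite prednK // subn_gt0.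
rewrite -opprB subzn ?(ltnW ab) // kE -NegzE /= -(subnK (ltnW ab)) kE expgnDr invgM.
by rewrite mulgA mulgV mul1g.
Qed.

Lemma expgzD (x : M) (m n : int) : expgz x (m + n)%R = expgz x m * expgz x n.
Proof.
have e (k : int) : exists a b : nat, k = (a%:Z - b%:Z)%R.
  by case: k => k; [exists k, 0; rewrite subr0|exists 0, k.+1; rewrite sub0r NegzE].
have [a [b ->]] := e m; have [a' [b' ->]] := e n.
rewrite (_ : _ + _ = (a + a')%N%:Z - (b + b')%N%:Z)%R; last by rewrite !PoszD; ring.
have c : commute (x ^+ b)^-1 (x ^+ a') by apply: commute_sym; apply/commuteV/commuteX2/commute_refl.
rewrite !expgzB !expgnDr -(expgnDr x b b') addnC expgnDr invgM !mulgA; congr (_ * _).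
by rewrite -!mulgA c.
Qed.

Lemma expgz0 (x : M) : expgz x 0 = 1. Proof. by []. Qed.
Lemma expgzN (x : M) n : expgz x (- n)%R = (expgz x n)^-1.
Proof. by apply: (mulIg (expgz x n)); rewrite -expgzD addNr mulVg. Qed.
Lemma expgzN1 (x : M) : expgz x (-1)%R = x^-1. Proof. exact: (expgzN x 1). Qed.

End Expgz.

(** * The cocycle of a family and its holonomy *)

Section Universal.
Variables (R : realType) (G : plumbing_graph) (Q : groupType) (E : pdata G Q).
Hypothesis hE : pdata_ok E (fun=> enum (port G)).
Local Notation plane := (R * R)%type.
Local Notation r := (slot_radius R G).
Local Notation sc := (@sc R G).
Local Notation cell := (vertex G + vertex G)%type.
Local Notation gm := (pd_v E).
Local Notation vert v := (vvec R (genus v)).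
Implicit Types (v : vertex G) (i : cell) (z : plane) (u : bool) (s t : R) (q : plane * plane) (p : port G).

(** The counterpart in [Q], up to conjugation, of [height v x]. *)
Definition below v (x : R) : Q :=
  (\prod_(p <- enum (port G)) (if (sc p < x)%R then port_val E v p else 1))%g.

Lemma below_commute v x : commute (gm v) (below v x).
Proof.
apply: (big_ind (fun y => commute (gm v) y)) => [|y y'|p _]; [exact: commute1|exact: commuteM|].
by case: ifP => _; [exact: (port_val_commute _ _ hE)|exact: commute1].
Qed.

Lemma below_eq v x y : (forall p, used v p -> (sc p < x)%R = (sc p < y)%R) -> below v x = below v y.
Proof.
move=> h; apply: eq_bigr => p _; have [up|nu] := boolP (used v p); first by rewrite h.
suff -> : port_val E v p = 1%g by rewrite !if_same.
by case: p nu => [[d|a]|] //= /negbTE ->.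
Qed.

Lemma below_left v p : below v (sc p - r) = below v (sc p).
Proof.
have [r0 _] := andP (slot_radius_bounds R G); apply: below_eq => q _.
have [->|qp] := eqVneq q p; first by rewrite ltxx; apply/negbTE; rewrite -leNgt; lra.
by have := sc_sep R qp; rewrite ler_normr => /orP[h|h]; apply/idP/idP => h'; lra.
Qed.

Lemma below_slot v p : below v (sc p + r) = (below v (sc p) * port_val E v p)%g.
Proof.
have [r0 _] := andP (slot_radius_bounds R G).
pose n k := nth None (enum (port G)) k.
have bE (x : R) : below v x =
    (\prod_(0 <= k < #|port G|) (if (sc (n k) < x)%R then port_val E v (n k) else 1))%g.
  by rewrite /below (big_nth None) -cardE.
have rk k : (k < #|port G|)%N -> enum_rank (n k) = k :> nat.
  by move=> kn; rewrite (_ : n k = enum_val (Ordinal kn)) ?enum_valK // (enum_val_nth None).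
have pk : n (enum_rank p) = p by exact: nth_enum_rank.
have hp := ltn_ord (enum_rank p).
have tail x : x <= sc p + r -> (\prod_((enum_rank p).+1 <= k < #|port G|)
    (if (sc (n k) < x)%R then port_val E v (n k) else 1) = 1)%g.
  move=> hx; rewrite big_nat big1 // => k /andP[k1 k2]; rewrite ifF //; apply/negbTE; rewrite -leNgt.
  have h : (enum_rank p < enum_rank (n k))%N by rewrite rk.
  by have := sc_lt R h; lra.
have head x : sc p <= x -> (\prod_(0 <= k < enum_rank p)
    (if (sc (n k) < x)%R then port_val E v (n k) else 1) =
    \prod_(0 <= k < enum_rank p) port_val E v (n k))%g.
  move=> hx; apply: eq_big_nat => k /andP[_ k2]; rewrite ifT //.
  have h : (enum_rank (n k) < enum_rank p)%N by rewrite rk // (ltn_trans k2).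
  by have := sc_lt R h; lra.
have cut (F : nat -> Q) : (\prod_(0 <= k < #|port G|) F k = \prod_(0 <= k < enum_rank p) F k *
    (F (enum_rank p) * \prod_((enum_rank p).+1 <= k < #|port G|) F k))%g.
  by rewrite (big_cat_nat (n := enum_rank p)) ?(ltnW hp) //= (big_ltn hp).
rewrite !bE !cut pk ltxx ltrDl r0 (tail (sc p + r)) // (tail (sc p)) ?lerDl ?(ltW r0) //.
by rewrite (head (sc p + r)) ?lerDl ?(ltW r0) // (head (sc p)) // !mulg1.
Qed.

Lemma below_first v : below v (-1) = 1%g.
Proof.
have [r0 _] := andP (slot_radius_bounds R G); rewrite /below big1 // => p _; rewrite ifF //.
by apply/negbTE; rewrite -leNgt; have := sc_bounds R p; lra.
Qed.

Lemma below_last v : below v 1 = handles_val E v.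
Proof.
have [r0 _] := andP (slot_radius_bounds R G); rewrite -(ok_prod hE); apply: eq_bigr => p _; rewrite ifT //.
by have := sc_bounds R p; lra.
Qed.

(** The counterpart of [letter], with the same inverses as in [path_data]. *)
Definition lval v (k : nat) : Q :=
  if insub (k %/ 4)%N is Some j then
    let h := Tagged (fun v => 'I_(genus v)) (j : 'I_(genus v)) in
    nth 1%g [:: (pd_a E h)^-1; (pd_b E h)^-1; pd_a E h; pd_b E h]%g (k %% 4)
  else 1%g.
Definition lprod v (k : nat) : Q := (\prod_(0 <= i < k) lval v i)%g.

Lemma lvalE v (j : 'I_(genus v)) c : (c < 4)%N -> lval v (4 * j + c) =
  nth 1%g [:: (pd_a E (Tagged (fun v => 'I_(genus v)) j))^-1; (pd_b E (Tagged (fun v => 'I_(genus v)) j))^-1;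
   pd_a E (Tagged (fun v => 'I_(genus v)) j); pd_b E (Tagged (fun v => 'I_(genus v)) j)]%g c.
Proof.
move=> c4; rewrite /lval; have -> : ((4 * j + c) %/ 4 = j)%N by lia.
rewrite (valK j); have -> : ((4 * j + c) %% 4 = c)%N by lia.
by [].
Qed.

Lemma lval_commute v k : commute (gm v) (lval v k).
Proof.
rewrite /lval; case: insubP => [j _ _|_]; last exact: commute1.
have ca := ok_a hE (Tagged (fun v => 'I_(genus v)) j); have cb := ok_b hE (Tagged (fun v => 'I_(genus v)) j).
move: (k %% 4)%N => [|[|[|[|n]]]] //=; try exact: commuteV.
by rewrite nth_nil; exact: commute1.
Qed.

Lemma lprod_commute v k : commute (gm v) (lprod v k).
Proof. by apply: (big_ind (fun y => commute (gm v) y)) => [|y y'|j _]; [exact: commute1|exact: commuteM|exact: lval_commute]. Qed.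

Lemma lprodS v k : lprod v k.+1 = (lprod v k * lval v k)%g.
Proof. by rewrite /lprod big_nat_recr. Qed.

Lemma lval_mate v k : (k < 4 * genus v)%N -> lval v (mate k) = (lval v k)^-1%g.
Proof.
move=> /mate_letter [j [b [[kE ->]|[-> kE]]]].
  by rewrite {}kE -addnA; case: b; rewrite !lvalE //= invgK.
by rewrite {}kE -addnA; case: b; rewrite !lvalE //=.
Qed.

Lemma lprod_total v : lprod v (4 * genus v) = handles_val E v.
Proof.
rewrite /lprod prod_by4; apply: eq_bigr => j _.
have := @lvalE v j 0; rewrite addn0 => -> //; rewrite !lvalE //= /commg /conjg.
by rewrite !mulgA.
Qed.

(** One value for the whole open side, such that entering a side from its first end contributes as
    much as entering its mate from the last end, which is the same point. *)
Definition sideval v k : Q := if (k %% 4 < 2)%N then lprod v k else lprod v k.+1.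

Lemma sideval_commute v k : commute (gm v) (sideval v k).
Proof. by rewrite /sideval; case: ifP => _; exact: lprod_commute. Qed.

Definition kout v z : Q :=
  if [pick k : 'I_(4 * genus v) | `[< z = vert v k >]] is Some k then lprod v k else
  if [pick k : 'I_(4 * genus v) | `[< in_side (genus v) k z >]] is Some k then sideval v k else 1%g.

Lemma vvec_inj v k l : (k < 4 * genus v)%N -> (l < 4 * genus v)%N -> vert v k = vert v l -> k = l.
Proof.
move=> kg lg e; have g0 : (0 < genus v)%N by case: (genus v) kg.
by apply: (@vertex_sector R _ g0 l k) => //; rewrite -e; exact: sector_vertex.
Qed.

Lemma kout_vertex v k : (k < 4 * genus v)%N -> kout v (vert v k) = lprod v k.
Proof.
move=> kg; rewrite /kout; case: pickP => [l /asboolP e|/(_ (Ordinal kg)) /asboolP //].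
by rewrite (vvec_inj kg _ e).
Qed.

Lemma kout_side v k z : (k < 4 * genus v)%N -> sqnorm z = 1 -> in_side (genus v) k z -> kout v z = sideval v k.
Proof.
move=> kg hz iz; have g0 : (0 < genus v)%N by case: (genus v) kg.
rewrite /kout; case: pickP => [l /asboolP e|_].
  by exfalso; apply: (@vvec_not_side R _ g0 l k) => //; rewrite -e.
case: pickP => [l /asboolP e|/(_ (Ordinal kg)) /asboolP //].
by rewrite (@in_side_inj R _ g0 l k z).
Qed.

Lemma kout_sphere v z : genus v = 0%N -> kout v z = 1%g.
Proof.
move=> gv; rewrite /kout; case: pickP => [[k kg] _|_]; first by exfalso; move: kg; rewrite gv.
by case: pickP => [[k kg] _|_] //; exfalso; move: kg; rewrite gv.
Qed.

Lemma kout_commute v z : commute (gm v) (kout v z).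
Proof.
rewrite /kout; case: pickP => [k _|_]; first exact: lprod_commute.
by case: pickP => [k _|_]; [exact: sideval_commute|exact: commute1].
Qed.

(* The whole value of an edge is carried by one of its two darts. *)
Definition dart_half (d : dart G) : Q := if d.2 then 1%g else pd_d E d.

Lemma dart_half_rev d : dart_half d = (pd_d E d * dart_half (d_rev d))%g.
Proof.
by case: d => e []; rewrite /dart_half /= ?mulg1 // -/(d_rev (e, true)) (ok_rev hE) mulgV.
Qed.

(** For the twisted slot, the power counts the full turns in the angle [arg w + euler v * arg a], a
    lift of the fibre coordinate of the solid torus. *)
Definition slot_tail v p (a w : plane) : Q :=
  match p with
  | None => expgz (gm v) (fl (arg w + (euler v)%:~R * arg a)%R)
  | Some (inl d) => dart_half d
  | _ => 1%g
  end.
Definition slot_head v p (a : plane) : Q := if 0 <= a.2 then 1%g else below v (sc p).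

Definition kap i q : Q :=
  match i with
  | inr _ => 1%g
  | inl v => if sqnorm q.1 == 1 then kout v q.1 else
      if [pick p | hole v p && (off (sc p) q.1 == r ^+ 2)] is Some p
      then (slot_head v p (dir (sc p) q.1) * slot_tail v p (dir (sc p) q.1) q.2)%g else 1%g
  end.

Lemma kap_slot v p a w : hole v p -> sqnorm a = 1 ->
  kap (inl v) (pol (sc p) r a, w) = (slot_head v p a * slot_tail v p a w)%g.
Proof.
have [r0 _] := andP (slot_radius_bounds R G).
move=> hp ha; have ho : off (sc p) (pol (sc p) r a) = r ^+ 2 by exact: off_pol.
rewrite /kap (slot_not_unit ho); case: pickP => [p' /andP[_ /eqP h']|/(_ p)]; last by rewrite /= ho hp eqxx.
by rewrite -(slot_inj ho h') dir_pol.
Qed.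

Lemma kap_outer v z w : sqnorm z = 1 -> kap (inl v) (z, w) = kout v z.
Proof. by move=> /= ->; rewrite eqxx. Qed.

(* Going down through the real axis at the abscissa x contributes the inverse of
   the product of the ports to the left of x, a positive turn in the fibre
   contributes [gm v], and [kap] corrects the values on the walls so that the
   result only depends on the points and not on the places representing them. *)
Definition cross i z z' : Q :=
  if i is inl v then if (0 <= z.2) && (z'.2 < 0) then (below v z.1)^-1%g else 1%g else 1%g.
Definition cval i q q' : Q := (cross i q.1 q'.1 * expgz (gm (cell_vertex i)) (ncross q.2 q'.2))%g.
Definition gval i q q' : Q := ((kap i q)^-1 * cval i q q' * kap i q')%g.

Lemma unit_axis z : sqnorm z = 1 -> z.2 = 0 -> z = (1, 0) \/ z = (-1, 0).
Proof.
case: z => x y /= h y0; subst y; move: h; rewrite /sqnorm /= expr0n addr0 => /eqP.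
by rewrite sqrf_eq1 => /orP[] /eqP ->; [left|right].
Qed.

Lemma slot_rel v p a0 w0 a w : hole v p -> sqnorm a0 = 1 -> sqnorm a = 1 ->
  close (inl v) (pol (sc p) r a0, w0) (pol (sc p) r a, w) ->
  [/\ ncross a0 a = if (0 < a0.1) && (a0.2 == 0) && (a.2 < 0) then -1 else 0,
    2^-1 < (rel_dir a0 a).1 & `|ang (rel_dir a0 a)| < eta R (inl v)].
Proof.
have [r0 _] := andP (slot_radius_bounds R G).
move=> hp ha0 ha c; have ho : off (sc p) (pol (sc p) r a0) = r ^+ 2 by exact: off_pol.
have cs : center (inl v) (pol (sc p) r a0, w0).1 = sc p := center_slot hp ho.
have h1 := cl_cross c; have [h2 h3] := cl_ang c; cbv zeta in h1.
by rewrite cs !dir_pol // in h1 h2 h3.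
Qed.

Lemma gvalE v z w z' w' : gval (inl v) (z, w) (z', w') =
  ((kap (inl v) (z, w))^-1 * (cross (inl v) z z' * expgz (gm v) (ncross w w')) * kap (inl v) (z', w'))%g.
Proof. by []. Qed.

(** A slot circle crosses the axis on both sides of the slot, with the products of the ports to the
    left of each crossing. Corrected by [slot_head] on the lower half, the left crossing disappears
    and the right one leaves the value of the port alone. *)
Lemma slot_cross v p a0 w0 a w : hole v p -> sqnorm a0 = 1 -> sqnorm a = 1 ->
  close (inl v) (pol (sc p) r a0, w0) (pol (sc p) r a, w) ->
  ((slot_head v p a0)^-1 * cross (inl v) (pol (sc p) r a0) (pol (sc p) r a) * slot_head v p a =
   expgz (port_val E v p) (ncross a0 a))%g.
Proof.
have [r0 _] := andP (slot_radius_bounds R G).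
move=> hp ha0 ha c; have [-> _ _] := slot_rel hp ha0 ha c.
have low := cl_low c; have up := cl_up c; rewrite /= !pmulr_rlt0 // in low; rewrite /= !pmulr_rgt0 // in up.
rewrite /slot_head /cross !pol2 pmulr_rge0 // pmulr_rlt0 //.
case: (ltgtP a0.2 0) => a2.
- by have a3 := low a2; rewrite leNgt a3 /= ?andbF /= ?mulg1 mulVg.
- by have a3 := up a2; rewrite (ltNge a.2 0) (ltW a3) /= ?andbF /= !mulg1 invg1.
- case: (ltP a.2 0) => a3; last by rewrite ?andbF /= !mulg1 invg1.
  rewrite /= invg1 mul1g ?andbT.
  have [-> /=|-> /=] := unit_axis ha0 a2.
    by rewrite ltr01 expgzN1 mulr1 below_slot invgM mulgVK.
  by rewrite ltr0N1 mulrN1 below_left mulVg.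
Qed.

Lemma gval_slot v p a0 w0 a w : hole v p -> sqnorm a0 = 1 -> sqnorm a = 1 ->
  close (inl v) (pol (sc p) r a0, w0) (pol (sc p) r a, w) ->
  gval (inl v) (pol (sc p) r a0, w0) (pol (sc p) r a, w) =
  ((slot_tail v p a0 w0)^-1 * (expgz (port_val E v p) (ncross a0 a) * expgz (gm v) (ncross w0 w)) *
   slot_tail v p a w)%g.
Proof.
move=> hp ha0 ha c; rewrite -(slot_cross hp ha0 ha c) gvalE !kap_slot //.
have cy : commute (expgz (gm v) (ncross w0 w)) (slot_head v p a).
  apply/commute_sym/commute_expgz/commute_sym; rewrite /slot_head.
  by case: ifP => _; [exact: commute1|exact: below_commute].
move: cy; move: (slot_head v p a) => y; move: (slot_head v p a0) (slot_tail v p a w) => h0 t.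
move: (slot_tail v p a0 w0) (cross _ _ _) (expgz _ _) => t0 c1 h cy; rewrite invgM -!mulgA; do 3 congr (_ * _)%g.
by rewrite !mulgA cy.
Qed.

(** What the port contributes at one end is what the fibre contributes at the other. The order of
    the two contributions is reversed, which [ok_dart] permits. *)
Lemma gval_edge d a0 w0 a w : sqnorm a0 = 1 -> sqnorm w0 = 1 -> sqnorm a = 1 -> sqnorm w = 1 ->
  let z x := pol (sc (Some (inl d))) r x in let z' x := pol (sc (Some (inl (d_rev d)))) r x in
  close (inl (d_start d)) (z a0, w0) (z a, w) -> close (inl (d_end d)) (z' w0, a0) (z' w, a) ->
  gval (inl (d_start d)) (z a0, w0) (z a, w) = gval (inl (d_end d)) (z' w0, a0) (z' w, a).
Proof.
move=> ha0 hw0 ha hw z z' c1 c2; have h1 : hole (d_start d) (Some (inl d)) by rewrite /hole.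
have h2 := rev_hole d; rewrite !gval_slot // /slot_tail dart_half_rev.
rewrite /port_val d_start_rev !eqxx /dart_val d_end_rev (ok_rev hE) invgK.
have cd := ok_dart hE d; rewrite /dart_val in cd.
move: cd; move: (ncross a0 a) (ncross w0 w) (pd_d E d) (dart_half _) (gm (d_start d)) (gm (d_end d)).
move=> n k D X A B cd.
have e : (A * (D * B * D^-1) = (D * B * D^-1) * A)%g by exact: cd.
have {}e := commute_expgz n (cd : commute A (D * B / D)%g).
have {}e := commute_sym (commute_expgz k (commute_sym e)).
have e' : (expgz (D^-1 * A * D) k = D^-1 * expgz A k * D)%g.
  by have := conj_expgz D^-1%g A k; rewrite invgK.
rewrite e' conj_expgz in e *; move: e; rewrite /commute; move: (expgz A k) (expgz B n) => A' B' e.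
have {}e : (D * B' * D^-1 * A' = A' * (D * B' * D^-1))%g by rewrite e.
by rewrite e !gsimp.
Qed.

(** Both sides are powers of the fibre. The exponents agree because the angle of the solid torus is
    the sum of those of the product, up to the turns counted by [slot_tail]. *)
Lemma gval_euler v a0 w0 a w : sqnorm a0 = 1 -> sqnorm w0 = 1 -> sqnorm a = 1 -> sqnorm w = 1 ->
  let z x := pol (sc None) r x in let u w x := cm w (cpow x (euler v)) in
  close (inl v) (z a0, w0) (z a, w) -> close (inr v) (a0, u w0 a0) (a, u w a) ->
  gval (inl v) (z a0, w0) (z a, w) = gval (inr v) (a0, u w0 a0) (a, u w a).
Proof.
move=> ha0 hw0 ha hw z u c1 c2; have hp : hole v None by [].
rewrite gval_slot // /gval /cval /= invg1 !mul1g mulg1 -!expgzN.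
have [k1 k2] := cl_fib c1; have [nc k3 k4] := slot_rel hp ha0 ha c1.
have [_ s1 s2] := small_angleP R.
have hs : `|ang (rel_dir w0 w) + (euler v)%:~R * ang (rel_dir a0 a)| < small_angle R := eta_small k2 k4.
have [s [t [e1 e2 te bt ct]]] := unit_lift ha0 ha k3.
have [s' [t' [e1' e2' te' bt' ct']]] := unit_lift hw0 hw k1.
(* Only these two exponents occur, by [nc]. *)
have expm (x : Q) (e n : int) : (n = 0 \/ n = -1) -> expgz (expgz x e) n = expgz x (e * n).
  by case=> ->; [rewrite mulr0|rewrite expgzN1 mulrN1 expgzN].
rewrite expm; last by rewrite nc; case: ifP; [right|left].
rewrite -!expgzD; congr (expgz _ _); move: hs; rewrite -te -te' => hs.
rewrite /u e1 e2 e1' e2' !cpow_cis -!cisD !arg_lift.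
have dd (x y : R) : x + y - x = y by ring.
have d2 : s' + t' + (euler v)%:~R * (s + t) - (s' + (euler v)%:~R * s) = t' + (euler v)%:~R * t by ring.
rewrite !ncrossE ?dd ?d2 //; last by exact: s2.
  have fE (x y : R) : fl (x - (fl x)%:~R * (2 * pi) + (euler v)%:~R * (y - (fl y)%:~R * (2 * pi))) =
      fl (x + (euler v)%:~R * y) - fl x - euler v * fl y.
    have -> : fl (x + (euler v)%:~R * y) - fl x - euler v * fl y =
      fl (x + (euler v)%:~R * y) + (- fl x - euler v * fl y) by rewrite addrA.
    rewrite -flD; congr fl; rewrite intrD !intrN intrM; ring.
  by rewrite !fE; ring.
by rewrite -ltr_norml (lt_trans hs).
Qed.

(** The outer circle meets the axis at [(-1, 0)], with no port on the left, and at [(1, 0)], where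
    the product of all the ports is that of the handles by the vertex relation. *)
Lemma cross_outer v z w z' w' : close (inl v) (z, w) (z', w') -> sqnorm z = 1 ->
  cross (inl v) z z' = if (z == (1, 0)) && (z'.2 < 0) then (handles_val E v)^-1%g else 1%g.
Proof.
move=> c hz; rewrite /cross; case: (ltgtP z.2 0) => z2.
- by rewrite (_ : (z == _) = false) //=; apply/negbTE/eqP => e; move: z2; rewrite e ltxx.
- have := cl_up c z2 => /= z2'.
  by rewrite ltNge (ltW z2') /= ?andbF.
- have [->|->] := unit_axis hz z2; first by rewrite eqxx below_last.
  rewrite below_first invg1 if_same (_ : (_ == _) = false) //.
  by apply/negbTE/eqP => -[] e; lra.
Qed.

Lemma gval_sphere v a0 b0 w0 q1 q2 : genus v = 0%N -> sqnorm a0 = 1 -> sqnorm b0 = 1 -> sqnorm w0 = 1 ->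
  close (inl v) (a0, w0) q1 -> close (inl v) (b0, w0) q2 ->
  q1 = q2 \/ [/\ sqnorm q1.1 = 1, sqnorm q2.1 = 1 & q1.2 = q2.2] ->
  gval (inl v) (a0, w0) q1 = gval (inl v) (b0, w0) q2.
Proof.
move=> gv ha0 hb0 hw0 c1 c2 h.
have hv1 : handles_val E v = 1%g by rewrite /handles_val big1 // => -[j hj]; exfalso; move: hj; rewrite gv.
have H a q : sqnorm a = 1 -> close (inl v) (a, w0) q -> gval (inl v) (a, w0) q = expgz (gm v) (ncross w0 q.2).
  case: q => z w ha c; rewrite gvalE kap_outer // kout_sphere // (cross_outer c ha) hv1 invg1 if_same.
  rewrite ?invg1 !mul1g /kap /=; case: eqP => [|_]; first by rewrite kout_sphere // mulg1.
  case: pickP => [p /andP[hp /eqP ho]|_]; last by rewrite mulg1.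
  by have := cl_slot c erefl hp ho => /= /slot_not_unit; rewrite ha eqxx.
by rewrite !H //; case: h => [->|[_ _ ->]].
Qed.

Lemma side_sign v k z : (k < 4 * genus v)%N -> sqnorm z = 1 -> in_side (genus v) k z ->
  if upper_side v k then 0 < z.2 else z.2 < 0.
Proof.
move=> kg hz iz; have g0 : (0 < genus v)%N by case: (genus v) kg.
have [s /andP[s0 s1] e] := in_side_point g0 hz iz.
have s01 : is_true (0 <= s <= 1) by rewrite !ltW.
have [_] := side_dom g0 (upper_sideP kg) s01; rewrite -e /in_half.
have n0 : z.2 != 0.
  apply/eqP => z0; have [ze|ze] := unit_axis hz z0.
    by apply: (@vvec_not_side R _ g0 0 k) => //; rewrite ?muln_gt0 ?vert0 // -ze.
  apply: (@vvec_not_side R _ g0 (2 * genus v) k) => //; first by rewrite ltn_pmul2r.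
  by rewrite vert_half // -ze.
by case: (upper_side v k) => /=; rewrite ?oppr_ge0 => h; rewrite lt_neqAle h ?n0 // eq_sym n0.
Qed.

Lemma gval_side_start v m z w0 w : (m < 4 * genus v)%N -> sqnorm z = 1 -> in_side (genus v) m z ->
  close (inl v) (vert v m, w0) (z, w) ->
  gval (inl v) (vert v m, w0) (z, w) = ((lprod v m)^-1 * expgz (gm v) (ncross w0 w) * sideval v m)%g.
Proof.
move=> mg hz iz c; have g0 : (0 < genus v)%N by case: (genus v) mg.
rewrite gvalE !kap_outer ?sqnorm_cis // (cross_outer c) ?sqnorm_cis // kout_vertex // (kout_side mg) //.
rewrite ifF ?mul1g //; apply/negbTE/andP => -[/eqP e].
have m0 : m = 0%N by apply: (@vvec_inj v) => //; rewrite ?muln_gt0 // e vert0.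
by have := side_sign mg hz iz; rewrite m0 /upper_side muln_gt0 g0 /= => h; rewrite ltNge ltW.
Qed.

Lemma gval_side_end v m z w0 w : (m < 4 * genus v)%N -> sqnorm z = 1 -> in_side (genus v) m z ->
  close (inl v) (vert v m.+1, w0) (z, w) ->
  gval (inl v) (vert v m.+1, w0) (z, w) = ((lprod v m.+1)^-1 * expgz (gm v) (ncross w0 w) * sideval v m)%g.
Proof.
move=> mg hz iz c; have g0 : (0 < genus v)%N by case: (genus v) mg.
rewrite gvalE !kap_outer ?sqnorm_cis // (cross_outer c) ?sqnorm_cis // (kout_side mg hz iz).
have z0 : (0 < 4 * genus v)%N by rewrite muln_gt0.
move: mg; rewrite leq_eqVlt => /orP[/eqP e|mg].
  have mg : (m < 4 * genus v)%N by rewrite -e.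
  have := side_sign mg hz iz; rewrite /upper_side ifF => [h|]; last by apply/negbTE; rewrite -leqNgt; lia.
  rewrite e vvec_total // kout_vertex // vert0 eqxx h /= -lprod_total /lprod big_geq // invg1.
  by rewrite mul1g.
rewrite kout_vertex // ifF ?mul1g //; apply/negbTE/andP => -[/eqP e _].
by have := @vvec_inj v _ _ mg z0; rewrite e vert0 => /(_ erefl).
Qed.

Lemma gval_corner v k phi w0 w : let g := genus v in (k < 4 * g)%N -> - pang R g < phi < 0 ->
  sqnorm w0 = 1 -> sqnorm w = 1 -> let a := cm (nvec R g k) (cis phi) in
  let b := cm (nvec R g (mate k)) (cis (- phi)) in
  close (inl v) (vvec R g k, w0) (a, w) -> close (inl v) (vvec R g (mate k).+1, w0) (b, w) ->
  gval (inl v) (vvec R g k, w0) (a, w) = gval (inl v) (vvec R g (mate k).+1, w0) (b, w).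
Proof.
move=> g kg hf hw0 hw a b c1 c2; have g0 : (0 < genus v)%N by move: kg; rewrite /g; case: (genus v).
have mg := @mate_lt _ g0 _ kg.
have ua : sqnorm a = 1 by rewrite sqnormM !sqnorm_cis mulr1.
have ub : sqnorm b = 1 by rewrite sqnormM !sqnorm_cis mulr1.
have [p0 _] := andP (pang_bounds R g0).
have ia : in_side g k a by apply: in_side_cis => //; rewrite -/g in p0 *; lra.
have ib : in_side g (mate k) b by apply: in_side_cis => //; rewrite -/g in p0 *; lra.
rewrite gval_side_start // gval_side_end //.
have cn (y : Q) : commute (gm v) y -> (expgz (gm v) (ncross w0 w) * y = y * expgz (gm v) (ncross w0 w))%g.
  by move=> h; exact: commute_sym (commute_expgz (ncross w0 w) (commute_sym h)).
rewrite -!mulgA (cn _ (sideval_commute v k)) (cn _ (sideval_commute v (mate k))) !mulgA; congr (_ * _)%g.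
have lm := lval_mate kg; rewrite !lprodS.
rewrite /sideval; case: ifP => k4.
  rewrite ifF; last by rewrite /mate k4; lia.
  by rewrite lprodS !mulVg.
have -> : (mate k %% 4 < 2)%N by rewrite /mate k4; lia.
by rewrite lprodS lm; move: (lprod _ _) (lprod _ _) (lval _ _) => A B C; rewrite !gsimp.
Qed.

Lemma gval_side v k a0 w0 a w : let g := genus v in (k < 4 * g)%N -> sqnorm a0 = 1 -> sqnorm a = 1 ->
  sqnorm w0 = 1 -> sqnorm w = 1 -> in_side g k a0 -> in_side g k a ->
  close (inl v) (a0, w0) (a, w) -> close (inl v) (fold_side g k a0, w0) (fold_side g k a, w) ->
  gval (inl v) (a0, w0) (a, w) = gval (inl v) (fold_side g k a0, w0) (fold_side g k a, w).
Proof.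
move=> g kg ha0 ha hw0 hw i0 i1 c1 c2; have g0 : (0 < genus v)%N by move: kg; rewrite /g; case: (genus v).
have H j x y : (j < 4 * genus v)%N -> sqnorm x = 1 -> sqnorm y = 1 -> in_side (genus v) j x ->
    in_side (genus v) j y -> close (inl v) (x, w0) (y, w) ->
    gval (inl v) (x, w0) (y, w) = expgz (gm v) (ncross w0 w).
  move=> jg hx hy ix iy c; rewrite gvalE !kap_outer // !(kout_side jg) // (cross_outer c hx).
  rewrite ifF; last first.
    apply/negbTE/andP => -[/eqP e _]; apply: (@vvec_not_side R _ g0 0 j) => //; first by rewrite muln_gt0.
    by rewrite vert0 -e.
  have := commute_sym (commute_expgz (ncross w0 w) (commute_sym (sideval_commute v j))).
  by rewrite /= mul1g /commute -mulgA => ->; rewrite mulKg.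
rewrite (H k) // (H (mate k)) //; [exact: mate_lt|exact: sqnorm_fold|exact: sqnorm_fold|exact: fold_side_in|exact: fold_side_in].
Qed.

Lemma gval_vertex v k l w0 w : let g := genus v in (k < 4 * g)%N -> (l < 4 * g)%N ->
  sqnorm w0 = 1 -> sqnorm w = 1 ->
  close (inl v) (vvec R g k, w0) (vvec R g k, w) -> close (inl v) (vvec R g l, w0) (vvec R g l, w) ->
  gval (inl v) (vvec R g k, w0) (vvec R g k, w) = gval (inl v) (vvec R g l, w0) (vvec R g l, w).
Proof.
move=> g kg lg hw0 hw _ _.
have H z : sqnorm z = 1 -> gval (inl v) (z, w0) (z, w) = expgz (gm v) (ncross w0 w).
  move=> hz; rewrite gvalE !kap_outer // /cross ifF; last by case: (leP 0 z.2) => //=; rewrite ?andbF // ltNge => ->.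
  have := commute_sym (commute_expgz (ncross w0 w) (commute_sym (kout_commute v z))).
  by rewrite /= mul1g /commute -mulgA => ->; rewrite mulKg.
by rewrite !H ?sqnorm_cis.
Qed.

Lemma gval_descends : descends gval.
Proof.
exact: close_descends gval_edge gval_euler gval_sphere gval_side gval_corner gval_vertex.
Qed.

Lemma below_axis v q q' : close (inl v) q q' -> q.1.2 = 0 -> below v q.1.1 = below v q'.1.1.
Proof.
move=> c z0; apply: below_eq => p up; apply/esym; apply: (cl_axis c erefl) => //.
by case: p up => [[d|h]|] /= => [/eqP e|/eqP e|_]; [left; rewrite /hole e|right; exists h|left].
Qed.

(** A crossing is counted when the axis is left downwards. Moving along the axis before that passes
    no port, so [below] does not change. *)
Lemma cross_add i q q' q'' : close i q q' -> close i q' q'' ->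
  cross i q.1 q''.1 = (cross i q.1 q'.1 * cross i q'.1 q''.1)%g.
Proof.
case: i => v c c'; rewrite /cross; last by rewrite mulg1.
case: (ltgtP q.1.2 0) => z2.
- by have z2' := cl_low c z2; rewrite leNgt z2' /= mulg1.
- by have z2' := cl_up c z2; have z3 := cl_up c' z2'; rewrite !ltNge !ltW //= mulg1.
case: (ltgtP q'.1.2 0) => z2'.
- by have z3 := cl_low c' z2'; rewrite z3 /= mulg1.
- by have z3 := cl_up c' z2'; rewrite !ltNge !ltW //= mulg1.
by rewrite /= mul1g (below_axis c).
Qed.

Lemma gval_add i q q' : sqnorm q.2 = 1 -> close i q q' -> \forall q'' \near q', sqnorm q''.2 = 1 ->
  close i q' q'' -> gval i q q'' = (gval i q q' * gval i q' q'')%g.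
Proof.
move=> hw c; have [_ hw'] := cl_valid c; have [c1 _] := cl_fib c.
have n : \forall q'' \near q', sqnorm q''.2 = 1 -> ncross q.2 q''.2 = ncross q.2 q'.2 + ncross q'.2 q''.2.
  exact: (near_snd (P := fun w => sqnorm w = 1 -> ncross q.2 w = ncross q.2 q'.2 + ncross q'.2 w) (ncross_add hw hw' c1)).
apply: filterS n => q'' h hw'' c'; rewrite /gval /cval h // (cross_add c c') expgzD.
have cc : commute (expgz (gm (cell_vertex i)) (ncross q.2 q'.2)) (cross i q'.1 q''.1).
  apply/commute_sym/commute_expgz/commute_sym; rewrite /cross; case: (i) => v /=; last exact: commute1.
  by case: ifP => _; [apply/commuteV/below_commute|exact: commute1].
move: cc; rewrite /commute.
move: (kap i q) (kap i q') (kap i q'') (cross _ _ _) (cross _ _ _) (expgz _ _) (expgz _ _) => A B C c3 c4 n1 n2 e.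
by rewrite !mulgA mulgK -(mulgA _ n2 c4) e !mulgA.
Qed.

Variable x0 : link_complement R G.
Local Notation X := (link_complement R G).
Local Notation pt := (pt x0).
Local Notation germ := (germ_value x0 (1%g : Q) gval).
Local Notation tr := (transport germ).

(** By [near_linked], every place over [y] can be given an origin over [x] in its own cell; three
    successive places of one cell then satisfy [gval_add]. *)
Lemma gval_cocycle : germ_cocycle germ.
Proof.
move=> x; apply: filterS (near_linked x0 x) => y hy.
have H : \forall z \near y, forall p : place R G, valid p -> pt p = z ->
    germ x (pt p) = (germ x y * germ y (pt p))%g.
  apply: fibre_near1 => i q' vq' e; have [q lk n] := hy i q' vq' e; have [vq ex ey c] := lk.
  have [_ hw] := vq; have n2 := near_close vq'; have n3 := gval_add hw c.
  apply: filterS3 n n2 n3 => q'' h1 h2 h3 vq''.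
  have c1 := h1 vq''; have c2 := h2 vq''; have [_ hw''] := vq''.
  have l1 : linked x0 x (pt (i, q'')) i q q'' by split.
  have l2 : linked x0 y (pt (i, q'')) i q' q'' by split.
  rewrite (germ_valueE 1%g gval_descends l1) (germ_valueE 1%g gval_descends l2).
  by rewrite (germ_valueE 1%g gval_descends lk); exact: h3.
by apply: filterS H => z h; have [p vp e] := pt_surj x0 z; rewrite -e; exact: h.
Qed.

(** On [P] the crossings are the variation of [B], so the horizontal lift has a closed form: turns
    of the fibre, [B], and the correction on the walls. *)
Lemma lift_frame i (P : set plane) (B : plane -> Q) :
  (forall z, P z -> zvalid i z) -> (forall z, commute (gm (cell_vertex i)) (B z)) ->
  (forall z z' w w', P z -> P z' -> close i (z, w) (z', w') -> B z' = (B z * cross i z z')%g) ->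
  cell_frame x0 tr i P (fun z s => expgz (gm (cell_vertex i)) (fl s) * B z * kap i (z, cis s))%g.
Proof.
move=> Pv cB hB zf sf cz cs Pz; pose qf t : plane * plane := (zf t, cis (sf t)).
have cq : continuous qf by apply: cts_pair => //; exact: (cts_comp cs (@cis_cts R)).
have vq t : valid (i, qf t) by split; [exact: (Pv _ (Pz t))|exact: sqnorm_cis].
pose g t := (expgz (gm (cell_vertex i)) (fl (sf t)) * B (zf t) * kap i (qf t))%g.
suff key : lift_on germ (@unit_itv R) (fun t => pt (i, qf t)) g by have h := transportE key; exact: esym h.
move=> t _.
have [e0 e1 e2] := small_angleP R.
have n1 : \forall s \near t, valid (i, qf s) -> close i (qf t) (qf s) := cq t _ (near_close (vq t)).
have n2 : \forall s \near t, sf s < sf t + small_angle R by apply: (cvgr_lt _ (cs t)); rewrite ltrDl.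
have n3 : \forall s \near t, sf t - small_angle R < sf s by apply: (cvgr_gt _ (cs t)); rewrite ltrBlDr ltrDl.
apply: filterS3 n1 n2 n3 => s h1 h2 h3 _; have c := h1 (vq s).
have lk : linked x0 (pt (i, qf t)) (pt (i, qf s)) i (qf t) (qf s) by split.
rewrite (germ_valueE 1%g gval_descends lk) /gval /cval /g (hB _ _ _ _ (Pz t) (Pz s) c).
have sm : `|sf s - sf t| < small_angle R by rewrite ltr_norml; lra.
have -> : ncross (qf t).2 (qf s).2 = fl (sf s) - fl (sf t).
  by apply: ncrossE; [rewrite -ltr_norml (lt_trans sm)|exact: e2].
have cc : commute (expgz (gm (cell_vertex i)) (fl (sf s) - fl (sf t))) (B (zf t) * cross i (zf t) (zf s))%g.
  apply/commute_sym/commute_expgz/commute_sym; rewrite -(hB _ _ _ _ (Pz t) (Pz s) c); exact: cB.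
have -> : expgz (gm (cell_vertex i)) (fl (sf s)) = (expgz (gm (cell_vertex i)) (fl (sf t)) *
    expgz (gm (cell_vertex i)) (fl (sf s) - fl (sf t)))%g by rewrite -expgzD addrC subrK.
move: cc; rewrite /commute -/(qf t) -/(qf s); move: (kap i (qf t)) (kap i (qf s)) (cross _ _ _) (B _) => k k' c4 b.
move: (expgz _ (fl (sf s) - fl (sf t))) => A; move: (expgz _ _) => D e.
by rewrite -(mulgA D A) e !mulgA mulgK.
Qed.

(** No crossing is counted inside the upper half. In the lower half one is counted on leaving the
    axis, hence a value on the axis that drops to 1 below it. *)
Definition half_lift u v z : Q := if u then 1%g else if z.2 == 0 then below v z.1 else 1%g.
Definition lift u v z s : Q := (expgz (gm v) (fl s) * half_lift u v z * kap (inl v) (z, cis s))%g.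

Lemma lift_law u v : cell_frame x0 tr (inl v) (half_dom u v) (lift u v).
Proof.
apply: (@lift_frame (inl v) (half_dom u v) (half_lift u v)) => [z []//|z|z z' w w' [_ hz] [_ hz'] c].
  by rewrite /half_lift; case: (u); [exact: commute1|case: ifP => _; [exact: below_commute|exact: commute1]].
rewrite /half_lift /cross; case: (u) hz hz'; rewrite /in_half /= ?oppr_ge0 => hz hz'.
  by rewrite (ltNge z'.2) hz' andbF mulg1.
case: (ltgtP z.2 0) hz => // z2 _.
  by have := cl_low c z2 => /= z2'; rewrite lt_eqF // mulg1.
case: (ltgtP z'.2 0) hz' => // z2' _; first by rewrite /= mulgV.
by rewrite /= mulg1 (below_axis c).
Qed.

Variables (M : groupType) (m : (R -> X) -> M) (f : M -> Q) (Gf : X -> Q).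
Hypotheses (mP : path_functor m) (fM : {morph f : x y / (x * y)%g}).
Hypothesis fm : forall phi : R -> X, continuous phi ->
  f (m phi) = (Gf (phi 0%R) * tr phi * (Gf (phi 1%R))^-1)%g.

(** The images of [F] under [f] and the lift [FT] obey the same law along paths up to the values of
    [Gf] at the ends, so a single constant relates them. *)
Lemma frame_compare i (P : set plane) F FT b : cell_frame x0 m i P F -> cell_frame x0 tr i P FT ->
  (forall z, P z -> zvalid i z) ->
  (forall z, P z -> exists zf : R -> plane, [/\ continuous zf, zf 0 = b, zf 1 = z & forall t, P (zf t)]) ->
  exists C, forall z s, P z -> f (F z s) = (C * FT z s * (Gf (pt (i, (z, cis s))))^-1)%g.
Proof.
move=> fF fFT Pv conn; exists (f (F b 0%R) * Gf (pt (i, (b, cis 0))) * (FT b 0%R)^-1)%g => z s Pz.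
have [zf [cz z0 z1 Pzf]] := conn z Pz.
have cs : continuous (fun t : R => t * s) by cts.
have h1 := fF _ _ cz cs Pzf; have h2 := fFT _ _ cz cs Pzf.
rewrite z0 z1 mul0r mul1r in h1 h2; rewrite -h1 -h2 fM fm; last first.
  apply: pt_cts; first by apply: cts_pair => //; exact: (cts_comp cs (@cis_cts R)).
  by move=> y; split; [exact: (Pv _ (Pzf y))|exact: sqnorm_cis].
rewrite z0 z1 mul0r mul1r; move: (f _) (Gf _) (Gf _) (FT b _) (tr _) => A B C D T.
by rewrite !gsimp.
Qed.

Lemma lift_compare : exists g : vertex G -> Q, forall u v z s, half_dom u v z ->
  f (frame x0 m u v z s) = (g v * lift u v z s * (Gf (pt (inl v, (z, cis s))))^-1)%g.
Proof.
suff H v : exists C, forall u z s, half_dom u v z ->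
    f (frame x0 m u v z s) = (C * lift u v z s * (Gf (pt (inl v, (z, cis s))))^-1)%g.
  by have [g hg] := choice H; exists g => u v z s; exact: hg.
have hu u := frame_compare (@frame_law _ _ x0 _ _ mP u v) (@lift_law u v) (fun z h => proj1 h)
  (fun z h => half_connected h).
have [C hC] := hu true; have [C' hC'] := hu false; exists C.
suff e : C' = C by move=> [] z s hz; [exact: hC|rewrite -e; exact: hC'].
(* The constants of the two halves are compared at [(-1, 0)], where [height] and [below] are both
   1. *)
have am : axis v (-1 : R) by apply: axis_unit; rewrite sqrrN expr1n.
have e1 := hC _ 0 (axis_half true am); have e2 := hC' _ 0 (axis_half false am).
rewrite (heightE x0 mP _ am) (height_left x0 m) mul1g e1 in e2.
move: e2; rewrite /lift /half_lift eqxx below_first.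
move: (expgz _ _) (kap _ _) (Gf _) => A B D /mulIg e2; rewrite !mulgA in e2.
by move: e2 => /mulIg /mulIg /mulIg.
Qed.

(** In the lower half the point [(1, 0)] is the vertex of index [4 * genus v] and not 0: its value
    on the axis supplies the product of all the letters. *)
Lemma half_lift_vertex v j : (0 < genus v)%N -> (0 < j)%N -> (j <= 4 * genus v)%N ->
  (half_lift false v (vert v j) * kap (inl v) (vert v j, (1, 0)%R) = lprod v j)%g.
Proof.
move=> g0 j0; have z0 : (0 < 4 * genus v)%N by rewrite muln_gt0.
rewrite kap_outer ?sqnorm_cis // /half_lift leq_eqVlt => /orP[/eqP ->|jg].
  rewrite vvec_total // kout_vertex // {1}/lprod big_geq // mulg1 vert0 eqxx below_last.
  by rewrite lprod_total.
rewrite kout_vertex //; case: eqP => [e|_]; last by rewrite mul1g.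
have hz : sqnorm (vert v j) = 1 by exact: sqnorm_cis.
have [e'|->] := unit_axis hz e; last by rewrite below_first mul1g.
have := @vvec_inj v _ _ jg z0; rewrite vert0 => /(_ e') jz; by move: j0; rewrite jz.
Qed.

Lemma arrow_axis h (e : R) : e = 1 \/ e = -1 -> axis (att h) (sc (Some (inr h)) + e * r).
Proof.
have [r0 r4] := andP (slot_radius_bounds R G); have [s1 s2] := andP (sc_bounds R (Some (inr h) : port G)).
move=> he; apply: axisI => [|q _]; first by case: he => ->; lra.
have [->|qp] := eqVneq q (Some (inr h)).
  by rewrite addrAC subrr add0r ler_normr; case: he => ->; apply/orP; [left|right]; lra.
by have := sc_sep R qp; rewrite !ler_normr => /orP[h'|h']; apply/orP; [right|left]; case: he => ->; lra.
Qed.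

Lemma path_data_map : exists g, pdata_map f (path_data x0 m) (pgauge E g).
Proof.
have [g hg] := lift_compare; exists g; have pp := @pi_pos R; have fV := morphV fM.
have fl0 : fl (0 : R) = 0 by apply: flE; rewrite ?mul0r // add0r mul1r mulr_gt0.
have fl2 : fl (2 * pi : R) = 1 by have := flD (0 : R) 1; rewrite fl0 !add0r -[1%:~R]/(1 : R) mul1r.
have c2p : cis (2 * pi) = (1, 0) :> plane by rewrite -cis0 -[2 * pi]add0r -[2 * pi]mul1r -[1]/(1%:~R) cis_int.
have u1 : sqnorm ((1, 0) : plane) = 1 by rewrite -cis0 sqnorm_cis.
pose K v z := kap (inl v) (z, (1, 0)).
have F0 u v z : half_dom u v z -> f (frame x0 m u v z 0) =
    (g v * (half_lift u v z * K v z) * (Gf (pt (inl v, (z, (1%R, 0%R)))))^-1)%g.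
  by move=> hz; rewrite hg // /lift fl0 cis0 expgz0 mul1g.
have H v x : axis v x -> f (height x0 m v x) = (g v * below v x * (g v)^-1)%g.
  move=> ax; rewrite /height fM fV (F0 _ _ _ (axis_half false ax)) (F0 _ _ _ (axis_half true ax)).
  by rewrite /half_lift eqxx; move: (K _ _) (Gf _) (below _ _) => A B C; rewrite !gsimp.
have L v j : (j < 4 * genus v)%N -> f (letter x0 m v j) = (g v * lval v j * (g v)^-1)%g.
  move=> jg; have g0 : (0 < genus v)%N by case: (genus v) jg.
  have z0 : (0 < 4 * genus v)%N by rewrite muln_gt0.
  have [dj dj1] := half_vertex R jg; have [d0 _] := half_vertex R z0.
  rewrite {1}/upper_side muln_gt0 g0 /= in d0.
  have P k : (k <= 4 * genus v)%N -> pt (inl v, (vert v k, (1, 0))) = pt (inl v, (vert v 0, (1, 0))).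
    rewrite leq_eqVlt => /orP[/eqP ->|kg]; first by rewrite vvec_total.
    by apply/(pt_coincide x0); [exact: outer_valid (sqnorm_cis _) u1|exact: outer_valid (sqnorm_cis _) u1|exact: CoVertex].
  have V k : (k < 4 * genus v)%N -> K v (vert v k) = lprod v k.
    by move=> kg; rewrite /K kap_outer ?sqnorm_cis // kout_vertex.
  have [Vj Vj1] : (half_lift (upper_side v j) v (vert v j) * K v (vert v j) = lprod v j)%g /\
      (half_lift (upper_side v j) v (vert v j.+1) * K v (vert v j.+1) = lprod v j.+1)%g.
    case uj : (upper_side v j); first by rewrite /half_lift !mul1g !V //; move: uj; rewrite /upper_side; lia.
    have jp : (0 < j)%N by move: uj; rewrite /upper_side; lia.
    by split; apply: half_lift_vertex => //; exact: ltnW.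
  have W : (half_lift true v (vert v 0) * K v (vert v 0) = 1)%g by rewrite /half_lift mul1g V // /lprod big_geq.
  rewrite /letter /side_class !fM !fV (F0 _ _ _ dj) (F0 _ _ _ dj1) (F0 _ _ _ d0) Vj Vj1 W !P // ?(ltnW jg) //.
  by rewrite lprodS; move: (lprod _ _) (lval _ _) (Gf _) => A B C; rewrite !gsimp.
have lg v (j : 'I_(genus v)) (b : bool) : (4 * j + b < 4 * genus v)%N by have := ltn_ord j; case: b; lia.
split.
- move=> v; have hb : half_dom true v (half_base R true v).
    have a1 : axis v (1 : R) by apply: axis_unit; rewrite expr1n.
    by have [zf [_ <- _ h]] := half_connected (axis_half true a1); exact: h.
  rewrite /= /fibre /deck fM fV !hg // /lift fl0 fl2 c2p cis0 (_ : expgz _ 1 = gm v); last exact: expg1.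
  by rewrite expgz0; move: (half_lift _ _ _) (kap _ _) (Gf _) => A B C; rewrite !gsimp.
- move=> h; rewrite /= /dart_height fM fV.
  have ar := arrow_axis h (or_introl erefl : (1 : R) = 1 \/ (1 : R) = -1).
  have al := arrow_axis h (or_intror erefl : (-1 : R) = 1 \/ (-1 : R) = -1).
  rewrite mul1r in ar; rewrite mulN1r in al.
  rewrite !H // below_left below_slot /= eqxx.
  by move: (below _ _) (pd_h E h) => A B; rewrite !gsimp.
- move=> d; rewrite /= /dart_class fM fV /slot_base.
  have h1 : hole (d_start d) (Some (inl d)) by rewrite /hole.
  have h2 := rev_hole d.
  rewrite (F0 _ _ _ (slot_base_dom R true h1)) (F0 _ _ _ (slot_base_dom R true h2)) /half_lift !mul1g.
  have KE v p : hole v p -> K v (sc p + r, 0) = slot_tail v p (1, 0) (1, 0).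
    by move=> hp; rewrite /K -pol_one kap_slot // /slot_head lexx mul1g.
  have pe := pt_edge x0 d u1 u1; rewrite !pol_one in pe.
  rewrite !KE // pe /= dart_half_rev; move: (dart_half _) (Gf _) (pd_d E d) => A B C.
  by rewrite !gsimp.
- move=> [v j] /=; have h := lg v j false; rewrite addn0 in h.
  have := @lvalE v j 0; rewrite addn0 => e; rewrite fV L // e //=.
  by rewrite !gsimp.
- move=> [v j] /=; have h := lg v j true.
  by rewrite fV L // lvalE //= !gsimp.
Qed.

End Universal.

(** * Connectedness of the link complement *)

Section Connectedness.
Variables (R : realType) (G : plumbing_graph) (x0 : link_complement R G).
Local Notation plane := (R * R)%type.
Local Notation X := (link_complement R G).
Local Notation pt := (pt x0).
Local Notation sc := (@sc R G).
Local Notation r := (slot_radius R G).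
Implicit Types (v : vertex G) (z w : plane) (u : bool).

Definition joined (x y : X) : Prop := exists f : R -> X, [/\ continuous f, f 0 = x & f 1 = y].

Lemma joined_sym x y : joined x y -> joined y x.
Proof.
move=> [f [cf f0 f1]]; exists (fun t => f (1 - t)); split; rewrite ?subr0 ?subrr //.
by apply: (cts_comp _ cf); cts.
Qed.

Lemma joined_trans (y x x' : X) : joined x y -> joined y x' -> joined x x'.
Proof.
move=> [f [cf f0 f1]] [g [cg g0 g1]]; exists (cat_path f g); split.
- by apply: cat_path_cts => //; rewrite f1 g0.
- by rewrite /cat_path invr_ge0 ler0n mulr0 clamp_le0.
- rewrite /cat_path ifF; last by lra.
  by rewrite clamp_ge1 ?g1 //; lra.
Qed.

Lemma joined_half u v z w : half_dom u v z -> sqnorm w = 1 ->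
  joined (pt (inl v, (half_base R u v, (1, 0)))) (pt (inl v, (z, w))).
Proof.
move=> hz hw; exists (fun l => pt (inl v, (half_path u v z (clamp l), cis (clamp l * arg w)))); split.
- apply: pt_cts.
    apply: cts_pair; first by apply: half_path_cts; [cts|exact: clamp_cts].
    by apply: (cts_comp _ (@cis_cts R)); apply: ctsM; [exact: clamp_cts|cts].
  move=> l; split; last exact: sqnorm_cis.
  by have [] := half_path_dom hz (clamp01 l).
- by rewrite clamp_le0 // half_path0 mul0r cis0.
- by rewrite clamp_ge1 // half_path1 // mul1r cis_arg.
Qed.

Definition vertex_point v : X := pt (inl v, ((-1, 0), (1, 0))).

Lemma joined_cell v z w : zvalid (inl v) z -> sqnorm w = 1 -> joined (vertex_point v) (pt (inl v, (z, w))).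
Proof.
move=> hz hw; have hd := fibre_half hz.
have am : axis v (-1 : R) by apply: axis_unit; rewrite sqrrN expr1n.
have u1 : sqnorm ((1, 0) : plane) = 1 by rewrite -cis0 sqnorm_cis.
exact: joined_trans (joined_sym (joined_half (axis_half (0 <= z.2) am) u1)) (joined_half hd hw).
Qed.

Lemma joined_disk v z w : unit_disk z -> sqnorm w = 1 ->
  joined (pt (inr v, ((0, 0), (1, 0)))) (pt (inr v, (z, w))).
Proof.
move=> hz hw; exists (fun l => pt (inr v, ((clamp l * z.1, clamp l * z.2), cis (clamp l * arg w)))); split.
- apply: pt_cts.
    apply: cts_pair; first by apply: cts_pair; apply: ctsM; [exact: clamp_cts|cts|exact: clamp_cts|cts].
    by apply: (cts_comp _ (@cis_cts R)); apply: ctsM; [exact: clamp_cts|cts].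
  by move=> l; split; [apply: shrink_disk => //; exact: clamp01|exact: sqnorm_cis].
- by rewrite clamp_le0 // !mul0r cis0.
- by rewrite clamp_ge1 // !mul1r cis_arg // -surjective_pairing.
Qed.

Lemma joined_torus v z w : unit_disk z -> sqnorm w = 1 -> joined (vertex_point v) (pt (inr v, (z, w))).
Proof.
move=> hz hw; have u1 : sqnorm ((1, 0) : plane) = 1 by rewrite -cis0 sqnorm_cis.
have hp : hole v None by []. have [v1 _] := slot_valid hp u1 u1.
have uc : sqnorm (cm (1, 0) (cpow (1, 0) (euler v)) : plane) = 1 by rewrite sqnormM u1 sqnorm_cpow // mulr1.
have d1 : unit_disk ((1, 0) : plane) by rewrite /unit_disk /= u1.
apply: joined_trans (joined_cell v1 u1) _; rewrite pt_euler //.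
exact: joined_trans (joined_sym (joined_disk v d1 uc)) (joined_disk v hz hw).
Qed.

Lemma joined_vertices (v w : vertex G) : joined (vertex_point v) (vertex_point w).
Proof.
have u1 : sqnorm ((1, 0) : plane) = 1 by rewrite -cis0 sqnorm_cis.
have Hd (d : dart G) : joined (vertex_point (d_start d)) (vertex_point (d_end d)).
  have h1 : hole (d_start d) (Some (inl d)) by rewrite /hole.
  have [v1 _] := slot_valid h1 u1 u1; have [v2 _] := slot_valid (rev_hole d) u1 u1.
  apply: joined_trans (joined_cell v1 u1) _; rewrite (pt_edge x0 d u1 u1).
  exact: joined_sym (joined_cell v2 u1).
have /connectP[p pp ->] := graph_connected v w.
elim: p v pp => [|a p IH] v /=.
  by move=> _; exists (fun=> vertex_point v); split=> //; exact: cts_cst.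
move=> /andP[/existsP[e he] pp]; apply: joined_trans (IH a pp).
by case/orP: he => /andP[/eqP <- /eqP <-]; [exact: (Hd (e, true))|exact: (Hd (e, false))].
Qed.

Lemma joined_all (x y : X) : joined x y.
Proof.
have H (x' : X) : exists v, joined (vertex_point v) x'.
  have [[[v|v] [z1 w]] [hz hw] <-] := pt_surj x0 x'; exists v; [exact: joined_cell|exact: joined_torus].
have [v hv] := H x; have [w hw] := H y.
exact: joined_trans (joined_sym hv) (joined_trans (joined_vertices v w) hw).
Qed.

(** The base path of [x0] itself is constant, as [pi1_class_loop] requires. *)
Lemma base_paths : exists om : X -> R -> X, [/\ forall x, continuous (om x),
  forall x, om x 0 = x0, forall x, om x 1 = x & forall t, om x0 t = x0].
Proof.
have H x : exists f : R -> X, [/\ continuous f, f 0 = x0, f 1 = x & x = x0 -> f = fun=> x0].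
  have [->|ne] := pselect (x = x0); first by exists (fun=> x0); split=> //; exact: cts_cst.
  by have [f [cf f0 f1]] := joined_all x0 x; exists f; split.
have [om hom] := choice H; exists om; split=> x; try by have [] := hom x.
by have [_ _ _ ->] := hom x0.
Qed.

End Connectedness.

(** * The family of the fundamental group *)

Section GroupoidPresentation.
Variables (R : realType) (G : plumbing_graph) (x0 : link_complement R G).
Local Notation X := (link_complement R G).

Lemma pi1_groupoid_presentation : groupoid_presentation (fun=> enum (port G)) (pi1 R x0).
Proof.
have [om [oc o0 o1 ox]] := base_paths x0.
pose m := pi1_class oc o0 o1.
have mP : path_functor m := pi1_class_functor oc o0 o1.
have mE (y : pi1 R x0) : m (ext (repr y)) = y.
  by rewrite -[RHS]reprK; exact: (pi1_class_loop oc o0 o1 (repr y) ox).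
exists (path_data x0 m); split.
- exact: path_data_ok mP.
- apply: (path_data_generates (x1 := x0) mP) => y; exists (ext (repr y)); split=> //.
  + exact: ext_cts.
  + by rewrite ext_le0.
  + by rewrite ext_ge1.
move=> Q E hE; have tP := @transport_functor R X Q _ (gval_cocycle hE x0); set tr := transport _ in tP.
have hom (l l' : loop R x0) : homotopic l l' -> tr (ext l) = tr (ext l').
  move=> /homotopicP[H [cH H0 H1 Hx]].
  have h0 s : H (s, 0) = x0 by apply: Hx; left.
  have h1 s : H (s, 1) = x0 by apply: Hx; right.
  have := pf_homotopy tP cH (fun s _ => etrans (h0 s) (esym (h0 0))) (fun s _ => etrans (h1 s) (esym (h1 0))).
  rewrite (pf_ext tP (f := fun t => H (0, t)) (g := ext l)); last by move=> t t01; rewrite ext_id // H0.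
  by rewrite (pf_ext tP (f := fun t => H (1, t)) (g := ext l')) // => t t01; rewrite ext_id // H1.
(* The holonomy along a representative; by [hom] any other loop of the class gives the same
   value. *)
pose f (y : pi1 R x0) : Q := tr (ext (repr y)).
(* For a path that is not a loop, the base paths of its ends contribute their holonomies, which are
   the [Gf] of [path_data_map]. *)
have fm (phi : R -> X) : continuous phi ->
    f (m phi) = (tr (om (phi 0)) * tr phi * (tr (om (phi 1%R)))^-1)%g.
  move=> cp; rewrite /m pi1_classE // (path_classE oc o0 o1 cp) /f.
  rewrite (hom _ (based_loop oc o0 o1 cp)); last by apply/pi1_eqP; rewrite reprK.
  have cB := based_fun_cts oc o1 cp; set B := based_fun om phi in cB.
  have e1 := pf_between tP 0 1 2 cB; have e2 := pf_between tP 0 2 3 cB.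
  rewrite (pf_ext tP (g := fun t => B (0 + t * (3 - 0)))); last first.
    by move=> t t01; rewrite ext_id //= -/B subr0 add0r mulrC.
  rewrite -e2 -e1.
  rewrite (pf_ext tP (f := fun t => B (0 + t * (1 - 0))) (g := om (phi 0))); last first.
    move=> t t01; rewrite subr0 mulr1 add0r /B /based_fun ifT ?clamp_id //; lra.
  rewrite (pf_ext tP (f := fun t => B (1 + t * (2 - 1))) (g := phi)); last first.
    move=> t t01; rewrite (_ : 1 + t * (2 - 1) = 1 + t); last by ring.
    rewrite /B /based_fun; case: leP => h1.
      have -> : t = 0 by lra.
      by rewrite addr0 clamp_ge1 // o1.
    rewrite ifT; last by lra.
    by rewrite addrAC subrr add0r clamp_id.
  rewrite (pf_ext tP (f := fun t => B (2 + t * (3 - 2))) (g := fun t => om (phi 1) (1 - t))); last first.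
    move=> t t01; rewrite (_ : 2 + t * (3 - 2) = 2 + t); last by ring.
    rewrite /B /based_fun ifF; last by lra.
    case: leP => h1.
      have -> : t = 0 by lra.
      rewrite addr0 subr0 o1 clamp_ge1 //; lra.
    rewrite (_ : 3 - (2 + t) = 1 - t); last by ring.
    by rewrite clamp_id //; lra.
  by rewrite (pf_rev tP (oc (phi 1))).
have g1 : tr (om x0) = 1%g.
  by rewrite (_ : om x0 = fun=> x0) ?(pf_const tP) //; exact/funext.
have fM : {morph f : x y / (x * y)%g}.
  move=> x y; pose lx := ext (repr x); pose ly := ext (repr y).
  have cx : continuous lx by exact: ext_cts. have cy : continuous ly by exact: ext_cts.
  have xy : lx 1 = ly 0 by rewrite /lx /ly ext_ge1 // ext_le0.
  rewrite -{1}(mE x) -{1}(mE y) -(pf_cat mP cx cy xy) fm; last exact: cat_path_cts.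
  rewrite /cat_path invr_ge0 ler0n ifF; last by lra.
  rewrite mulr0 (@clamp_le0 R 0) // clamp_ge1; last by lra.
  have -> : lx 0 = x0 by rewrite /lx ext_le0.
  have -> : ly 1 = x0 by rewrite /ly ext_ge1.
  rewrite g1 mul1g invg1 mulg1.
  exact: (pf_cat tP cx cy xy).
have [g hg] := @path_data_map R G Q E hE x0 _ m f (fun x => tr (om x)) mP fM fm.
by exists f, g; split.
Qed.

End GroupoidPresentation.

Theorem theorem2p2 (R : realType) (G : plumbing_graph)
    (c : plumbing_choices G) (x0 : link_complement R G) :
  [/\ has_presentation (@pi1 R (link_complement R G) x0) (@plumbing_rel G c),
      exists (X I : finType) (rel : I -> relation_of X),
        #|X| = #|I| /\
        has_presentation (@pi1 R (link_complement R G) x0) rel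
    & (0 < #|arrowhead G|)%N ->
      exists h : arrowhead G,
        has_presentation (@pi1 R (link_complement R G) x0)
          (fun i : {i : prel_index c | i <> RelArrowhead c h} =>
             plumbing_rel (proj1_sig i))].
Proof. exact: (plumbing_presentations c (pi1_groupoid_presentation x0)). Qed.
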